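(* Fix any phase $\alpha\in\mathbb S^1$ and select a Stokes sector $V\subset\mathbb C_\tau$. Let $U\subset\mathbb C_t$ be its projection to the $t$-plane, and let $\hat q(t,\hbar)$ be the distinguished branch on $U$ of the multivalued formal solution of the deformed Painlevé I equation. Then $\hat q(t,\hbar)$ is stably Borel summable in the direction $\alpha$, locally uniformly for all $t\in U$. Thus, the Borel resummation $q_\alpha(t,\hbar)=s_\alpha[\hat q](t,\hbar)$ defines a holomorphic function on a domain $\mathbb U\subset U\times\mathbb C_\hbar$ with the following property: every $t_0\in U$ has a neighbourhood $U_0\subset U$ such that there is a sectorial neighbourhood $S_0\subset\mathbb C_\hbar$ of the origin with opening $\mathrm{Arc}_\pi(\alpha)$ satisfying $U_0\times S_0\subset\mathbb U$. Furthermore, $q_\alpha$ is locally uniformly asymptotic to $\hat q$ of uniform factorial type: $$q_\alpha(t,\hbar)\simeq\hat q(t,\hbar)\quad\text{as }\hbar\to0\text{ uniformly along }\mathrm{Arc}_\pi(\alpha),$$ locally uniformly for all $t\in U$. In fact, $q_\alpha$ is the unique holomorphic function on $\mathbb U$ with this property. Moreover, $U$ is a maximal domain of Borel summability of $\hat q$ in the direction $\alpha$; i.e., there does not exist another domain $U'$ properly containing $U$ such that $\hat q(t,\hbar)$ is stably Borel summable in the direction $\alpha$, locally uniformly for all $t\in U'$.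
   Context: Formal solution. $\hat q(t,\hbar)=\sum_{n\ge0}q_n(t)\hbar^n$ is the formal solution of the deformed Painlevé I equation $\hbar^2\partial_t^2q=6q^2+t$ with locally holomorphic coefficients on $\mathbb C_t^*$; a branch is determined by a root $q_0(t)$ of $6q_0^2+t=0$, and then $q_{2n-1}=0$, $q_{2n}=\frac1{12q_0}(\ddot q_{2n-2}-6\sum_{i+j=n,\,i,j\ne0}q_{2i}q_{2j})$ for $n\geq 1$. Let $\mathbb C_\tau\to\mathbb C_t$ be the double cover $\tau^2=-t/6$, on which $q_0=\tau$. Stokes lines and sectors. For a phase $\alpha\in\mathbb S^1=\mathbb R/2\pi\mathbb Z$, a Stokes line in the $\tau$-plane is any infinite straight ray $e^{i\theta}\mathbb R_+\subset\mathbb C_\tau$ with phase $\theta$ satisfying $5\theta+2\alpha\equiv0\pmod{2\pi}$. There are five of them, with phases $\theta_k=\frac25(k\pi-\alpha)$, $k=0,\dots,4$. The Stokes graph is the union of all Stokes lines; a Stokes sector is a connected component $V\subset\mathbb C_\tau$ of its complement, i.e. one of the five infinite sectors $\{\theta_k<\arg\tau<\theta_{k+1}\}$ of opening angle $2\pi/5$. Its projection $U\subset\mathbb C_t$ is its image under $\tau\mapsto t=-6\tau^2$, which is injective on $V$; the distinguished branch of $\hat q$ on $U$ is the one with $q_0(t)=\tau$ for $\tau\in V$. Borel summation. The Borel transform is $\hat\omega(t,\xi)=\sum_{n\ge0}\frac1{n!}q_{n+1}(t)\xi^n$. $\hat q(t,\hbar)$ is Borel summable in the direction $\alpha$ if $\hat\omega(t,\cdot)$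 converges near $0$, continues analytically to $\omega(t,\xi)$ on a neighbourhood of the ray $e^{i\alpha}\mathbb R_+$, and is bounded there by $Ce^{K|\xi|}$; then $s_\alpha[\hat q](t,\hbar)=q_0(t)+\int_{e^{i\alpha}\mathbb R_+}e^{-\xi/\hbar}\omega(t,\xi)\,d\xi$. ''Stably'' means summable in all directions in an open arc containing $\alpha$. ''Locally uniformly in $t$'' means each point has a neighbourhood on which the arc, the neighbourhood of the ray and the constants $C,K$ can be chosen independent of $t$. Sectors and asymptotics. $\mathrm{Arc}_\pi(\alpha)=(\alpha-\frac\pi2,\alpha+\frac\pi2)$. A sectorial neighbourhood of the origin with opening $A$ is a simply connected domain $S\subset\mathbb C_\hbar^*$ such that some simply connected open subset of the real-oriented blowup $\mathbb C_\hbar^*\sqcup\mathbb S^1$ meets $\mathbb C_\hbar^*$ in $S$ and the boundary circle in $A$. ''$q_\alpha\simeq\hat q$ as $\hbar\to0$ uniformly along $\mathrm{Arc}_\pi(\alpha)$, locally uniformly for $t\in U$, of uniform factorial type'' means that each $t_0\in U$ has a neighbourhood $U_0$, a sectorial neighbourhood $S_0$ with opening $\mathrm{Arc}_\pi(\alpha)$ with $U_0\times S_0\subset\mathbb U$, and constants $C,M>0$ with $|q_\alpha(t,\hbar)-\sum_{k<n}q_k(t)\hbar^k|\le CM^nn!|\hbar|^n$ for all $n\ge0$, $t\in U_0$, $\hbar\in S_0$.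
   Formalization: Stokes lines are given by 5θ−2α≡0 (mod 2π) instead of 5θ+2α≡0, with which the claim fails unless α∈(π/2)ℤ; uniqueness of q_α is among holomorphic functions on 𝕌 with the factorial bounds on the same sectorial neighbourhoods S_0 attached to the points of U. *)

(* Defs.v *)
From Stdlib Require Export Reals ZArith.
From Coquelicot Require Export Coquelicot.
Open Scope R_scope.

(* Complex functions are total; holomorphy is imposed at each point of an open set. *)

Definition cis (theta : R) : C := (cos theta, sin theta).

Definition Cexp (z : C) : C := Cmult (RtoC (exp (Re z))) (cis (Im z)).

Definition ray (theta : R) (z : C) : Prop :=
  exists r : R, 0 <= r /\ z = Cmult (RtoC r) (cis theta).

Definition holomorphic_on (D : C -> Prop) (f : C -> C) : Prop :=
  forall z : C, D z -> ex_derive (K := C_AbsRing) (V := C_NormedModule) f z.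

(* Joint complex Frechet differentiability. *)
Definition holomorphic2_on (D : C * C -> Prop) (f : C -> C -> C) : Prop :=
  forall p : C * C, D p ->
    ex_filterdiff (K := C_AbsRing)
      (U := prod_NormedModule C_AbsRing C_NormedModule C_NormedModule)
      (V := C_NormedModule)
      (fun x => f (fst x) (snd x)) (locally p).

(* Sum of the first [n] terms; Coquelicot's [sum_n a n] has [n + 1] terms. *)
Definition partial_sum (a : nat -> C) (n : nat) : C :=
  match n with
  | O => RtoC 0
  | S m => sum_n a m
  end.

(** * Topology *)

Definition connected {T : UniformSpace} (X : T -> Prop) : Prop :=
  forall A B : T -> Prop,
    open A -> open B ->
    (forall x, X x -> A x \/ B x) ->
    (exists x, X x /\ A x) -> (exists x, X x /\ B x) ->
    exists x, X x /\ A x /\ B x.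

Definition connected_component {T : UniformSpace} (X V : T -> Prop) : Prop :=
  (exists x, V x) /\ connected V /\ (forall x, V x -> X x) /\
  (forall W : T -> Prop, connected W -> (forall x, W x -> X x) ->
     (forall x, V x -> W x) -> forall x, W x -> V x).

Definition domain {T : UniformSpace} (D : T -> Prop) : Prop :=
  open D /\ (exists x, D x) /\ connected D.

(* A path on [0,1] extends continuously to R by constants, and a homotopy on
   [0,1]^2 extends to R^2 by retraction, so asking for continuity everywhere
   is no restriction. *)
Definition path_in {T : UniformSpace} (X : T -> Prop) (g : R -> T) : Prop :=
  (forall s, continuous g s) /\ (forall s, 0 <= s <= 1 -> X (g s)).

Definition null_homotopic_in {T : UniformSpace} (X : T -> Prop) (g : R -> T) : Prop :=
  exists H : R * R -> T,
    (forall p, continuous H p) /\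
    (forall s u, 0 <= s <= 1 -> 0 <= u <= 1 -> X (H (s, u))) /\
    (forall s, 0 <= s <= 1 -> H (s, 0) = g s /\ H (s, 1) = g 0) /\
    (forall u, 0 <= u <= 1 -> H (0, u) = g 0 /\ H (1, u) = g 0).

Definition simply_connected {T : UniformSpace} (X : T -> Prop) : Prop :=
  (exists x, X x) /\
  (forall x y, X x -> X y -> exists g, path_in X g /\ g 0 = x /\ g 1 = y) /\
  (forall g, path_in X g -> g 0 = g 1 -> null_homotopic_in X g).

Definition open_in {T : UniformSpace} (B X : T -> Prop) : Prop :=
  forall x, X x -> locally x (fun y => B y -> X y).

(** * Sectorial neighbourhoods *)

(* The real-oriented blowup of C at 0 in polar coordinates: (r, u) with r > 0
   is the point r u of C^*, and (0, u) is the point u of the boundary circle. *)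
Definition blowup (p : R * C) : Prop := 0 <= fst p /\ Cmod (snd p) = 1.

Definition sectorial_neighbourhood (A S : C -> Prop) : Prop :=
  open S /\ simply_connected S /\ ~ S (RtoC 0) /\
  exists X : R * C -> Prop,
    (forall p, X p -> blowup p) /\ open_in blowup X /\ simply_connected X /\
    (forall r u, 0 < r -> Cmod u = 1 -> (X (r, u) <-> S (Cmult (RtoC r) u))) /\
    (forall u, Cmod u = 1 -> (X (0, u) <-> A u)).

Definition Arc_pi (alpha : R) (u : C) : Prop :=
  exists phi : R, alpha - PI / 2 < phi < alpha + PI / 2 /\ u = cis phi.

(** * Stokes geometry *)

(* A phase is represented by a real number; everything below depends on it only
   modulo 2 PI.  On the sign of alpha: the Borel transform of the branch
   q_0 = tau is singular at xi^2 = (6912/25) tau^5, since linearising at q_0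
   gives exponents +- int sqrt(12 q_0) dt.  Hence exp(i alpha) R_+ meets a
   singularity exactly when 5 theta = 2 alpha mod 2 PI. *)
Definition stokes_phase (alpha theta : R) : Prop :=
  exists k : Z, 5 * theta - 2 * alpha = 2 * PI * IZR k.

Definition stokes_graph (alpha : R) (tau : C) : Prop :=
  exists theta : R, stokes_phase alpha theta /\ ray theta tau.

Definition stokes_sector (alpha : R) (V : C -> Prop) : Prop :=
  connected_component (fun tau => ~ stokes_graph alpha tau) V.

Definition tau_to_t (tau : C) : C := Cmult (RtoC (-6)) (Cmult tau tau).

Definition t_projection (V : C -> Prop) (t : C) : Prop :=
  exists tau : C, V tau /\ t = tau_to_t tau.

(** * Formal solutions *)

(* Coefficient of hbar^n in hbar^2 (d/dt)^2 q. *)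
Definition lhs_coeff (q : nat -> C -> C) (n : nat) (t : C) : C :=
  match n with
  | S (S m) => C_derive (C_derive (q m)) t
  | _ => RtoC 0
  end.

(* Coefficient of hbar^n in 6 q^2 + t. *)
Definition rhs_coeff (q : nat -> C -> C) (n : nat) (t : C) : C :=
  Cplus
    (Cmult (RtoC 6) (sum_n (fun i => Cmult (q i t) (q (n - i)%nat t)) n))
    (match n with O => t | _ => RtoC 0 end).

Definition formal_solution (W : C -> Prop) (q : nat -> C -> C) : Prop :=
  (forall n, holomorphic_on W (q n)) /\
  (forall n t, W t -> lhs_coeff q n t = rhs_coeff q n t).

(* [V] being a Stokes sector, [tau_to_t] is injective on it. *)
Definition distinguished_branch (V : C -> Prop) (q : nat -> C -> C) : Prop :=
  formal_solution (t_projection V) q /\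
  (forall tau, V tau -> q O (tau_to_t tau) = tau).

(** * Borel summation *)

Definition borel_coeff (q : nat -> C -> C) (t : C) (n : nat) : C :=
  Cdiv (q (S n) t) (RtoC (INR (fact n))).

(* [omega] continues the Borel transform at [t] to the neighbourhood [D] of the
   ray of phase [beta], where it is bounded by K0 exp (K1 |xi|). *)
Definition borel_continuation (q : nat -> C -> C) (t : C) (beta : R)
    (D : C -> Prop) (K0 K1 : R) (omega : C -> C) : Prop :=
  open D /\ (forall xi, ray beta xi -> D xi) /\
  holomorphic_on D omega /\
  (exists rho : R, 0 < rho /\ forall xi : C, Cmod xi < rho ->
     is_pseries (K := C_AbsRing) (V := C_NormedModule)
       (borel_coeff q t) xi (omega xi)) /\
  (forall xi, D xi -> Cmod (omega xi) <= K0 * exp (K1 * Cmod xi)).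

Definition stably_borel_summable_locally_uniformly
    (q : nat -> C -> C) (alpha : R) (W : C -> Prop) : Prop :=
  forall t0 : C, W t0 ->
    exists N : C -> Prop,
      open N /\ N t0 /\ (forall t, N t -> W t) /\
      exists delta : R, 0 < delta /\
        forall beta : R, Rabs (beta - alpha) < delta ->
          exists (D : C -> Prop) (K0 K1 : R),
            forall t : C, N t ->
              exists omega : C -> C, borel_continuation q t beta D K0 K1 omega.

(* [s] is the Borel resummation at (t, hbar) in the direction alpha, with
   xi = r exp(i alpha) in the Laplace integral. *)
Definition is_borel_sum (q : nat -> C -> C) (alpha : R) (t hbar s : C) : Prop :=
  hbar <> RtoC 0 /\
  exists (D : C -> Prop) (K0 K1 : R) (omega : C -> C) (I : C),
    borel_continuation q t alpha D K0 K1 omega /\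
    is_RInt_gen (V := C_R_NormedModule)
      (fun r : R =>
         let xi := Cmult (RtoC r) (cis alpha) in
         Cmult (Cmult (Cexp (Copp (Cdiv xi hbar))) (omega xi)) (cis alpha))
      (at_point 0) (Rbar_locally p_infty) I /\
    s = Cplus (q O t) I.

(** * Asymptotics of uniform factorial type *)

Definition factorial_bounds (q : nat -> C -> C) (f : C -> C -> C)
    (U0 S0 : C -> Prop) : Prop :=
  exists K M : R, 0 < K /\ 0 < M /\
    forall (n : nat) (t hbar : C), U0 t -> S0 hbar ->
      Cmod (Cminus (f t hbar)
                   (partial_sum (fun k => Cmult (q k t) (Cpow hbar k)) n))
      <= K * M ^ n * INR (fact n) * Cmod hbar ^ n.

(* [S t0] is the sectorial neighbourhood attached to the point [t0] of [U];
   the neighbourhood of [t0] and the constants are those of [f]. *)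
Definition locally_uniformly_asymptotic (q : nat -> C -> C)
    (U : C -> Prop) (UU : C * C -> Prop) (S : C -> C -> Prop)
    (f : C -> C -> C) : Prop :=
  forall t0 : C, U t0 ->
    exists U0 : C -> Prop,
      open U0 /\ U0 t0 /\ (forall t, U0 t -> U t) /\
      (forall t hbar, U0 t -> S t0 hbar -> UU (t, hbar)) /\
      factorial_bounds q f U0 (S t0).

(* Main.v *)
Require Import Defs.
From Stdlib Require Import Lra Lia ClassicalEpsilon FunctionalExtensionality.
Open Scope R_scope.

(** Both sides of the recursion are homogeneous, so q_n = d_n tau Y^n with universal real numbers d_n and
    Y^2 tau^5 = 25/6912.  Hence the Borel transform is, for every t, the rescaling of one function b of
    one variable, which solves a quadratic convolution equation with denominator 1 + z^2.  Picard iteration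
    on convex domains that avoid i and -i and exhaust the right half-plane continues b there with
    exponential bounds; over a Stokes sector the rays near the phase alpha are mapped into that half-plane.
    The Laplace integral then converges on tangent discs Re (exp (i alpha) / hbar) > c, where splitting off the
    Taylor polynomial of b gives the factorial bounds.  Two functions with the same bounds on a tangent disc
    differ by an exponentially small function, which vanishes by Watson's lemma.

    A connected open set larger than U contains a nonzero point on the boundary of U.  There the ray passes
    through the singularity, and along it the Taylor coefficients of the Borel transform, divided by -tau Y,
    are nonnegative because d_n <= 0 for n >= 1; a continuation along the ray would dominate every term of the
    series, but the terms are unbounded at a point far enough out. *)

(** * Complex derivatives and integrals of curves *)

(** The branch enters only through a function v with v^2 (tau e^(-i th))^5 = 25/6912 and Re v > 0,
    where th is the middle phase of the Stokes sector. The opening 2 PI / 5 is exactly what makes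
    the fifth power sweep the phases (-PI, PI), so that the root of its inverse fills the open right
    half-plane, with i and -i on the boundary. Estimates that are locally uniform in t therefore
    reduce to estimates for b that are uniform on closed sectors m |Im v| <= Re v with |v| bounded.
    On an edge of the Stokes sector v would be imaginary: this is where maximality comes from. The
    delicate point of uniqueness is that the opening is exactly PI. A bound exp (- c / |h|) is then
    the borderline case: it forces vanishing only after comparison with an auxiliary function of
    logarithmically divergent size, applied on discs tangent at 0 to the edge of the half-plane. *)

(** Derivative without a quotient, so that w = z needs no exception; [is_derive_cder] identifies it
    with the library notion. *)
Definition cder (f : C -> C) (z l : C) : Prop :=
  forall eps : R, 0 < eps -> exists delta : R, 0 < delta /\
    forall w : C, Cmod (w - z) < delta ->
      Cmod (f w - f z - l * (w - z)) <= eps * Cmod (w - z).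

(** The balls of the product uniformity on C are squares, whence the factor sqrt 2. *)
Lemma locally_C_disc (P : C -> Prop) (z : C) :
  locally (T := C_UniformSpace) z P <->
  exists r : R, 0 < r /\ forall w : C, Cmod (w - z) < r -> P w.
Proof.
  split.
  - intros [e He]. exists e. split; [apply cond_pos|].
    intros w Hw. apply He. apply C_NormedModule_mixin_compat1. exact Hw.
  - intros [r [Hr H]].
    assert (Hr2 : 0 < r / sqrt 2) by (apply Rdiv_lt_0_compat; [lra|apply sqrt_lt_R0; lra]).
    exists (mkposreal _ Hr2). intros w Hw. apply H.
    apply C_NormedModule_mixin_compat2 in Hw. simpl in Hw.
    replace (sqrt 2 * (r / sqrt 2)) with r in Hw. exact Hw.
    field. apply Rgt_not_eq, sqrt_lt_R0; lra.
Qed.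

Lemma open_C_disc (D : C -> Prop) :
  open (T := C_UniformSpace) D <->
  forall z, D z -> exists r : R, 0 < r /\ forall w : C, Cmod (w - z) < r -> D w.
Proof.
  split; intros H z Hz; apply locally_C_disc; auto.
Qed.

(** The source of a complex derivative carries the uniformity of the absolute value, a different
    instance whose balls are discs. *)
Lemma locally_CA_disc (P : C -> Prop) (z : C) :
  locally (T := AbsRing_UniformSpace C_AbsRing) z P <->
  exists r : R, 0 < r /\ forall w : C, Cmod (w - z) < r -> P w.
Proof.
  split.
  - intros [e He]. exists e. split; [apply cond_pos|].
    intros w Hw. apply He. exact Hw.
  - intros [r [Hr H]]. exists (mkposreal _ Hr). intros w Hw. apply H. exact Hw.
Qed.

Lemma is_filter_lim_CA_unique (x y : C) :
  is_filter_lim (T := AbsRing_UniformSpace C_AbsRing)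
    (locally (T := AbsRing_UniformSpace C_AbsRing) x) y -> x = y.
Proof.
  intros H. symmetry. apply (is_filter_lim_unique (K := C_AbsRing) (V := AbsRing_NormedModule C_AbsRing) (F := locally (T := AbsRing_UniformSpace C_AbsRing) x)); [exact H|].
  intros P HP; exact HP.
Qed.

Lemma is_derive_cder (f : C -> C) (z l : C) :
  is_derive (K := C_AbsRing) (V := C_NormedModule) f z l <-> cder f z l.
Proof.
  split.
  - intros [_ H] eps Heps.
    specialize (H z (fun P HP => HP) (mkposreal _ Heps)).
    apply locally_CA_disc in H. destruct H as [r [Hr H]].
    exists r. split; [exact Hr|]. intros w Hw. specialize (H w Hw).
    simpl in H. rewrite (Cmult_comm l). exact H.
  - intros H. split.
    + apply (is_linear_scal_l (K := C_AbsRing) (V := C_NormedModule)).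
    + intros x Hx eps. apply is_filter_lim_CA_unique in Hx. subst x.
      apply locally_CA_disc.
      destruct (H eps (cond_pos eps)) as [d [Hd H']].
      exists d. split; [exact Hd|]. intros w Hw. specialize (H' w Hw).
      rewrite (Cmult_comm l) in H'. exact H'.
Qed.

Lemma ex_derive_cder (f : C -> C) (z : C) :
  ex_derive (K := C_AbsRing) (V := C_NormedModule) f z <-> exists l, cder f z l.
Proof.
  split; intros [l H]; exists l; apply is_derive_cder; exact H.
Qed.

Lemma cder_C_derive (f : C -> C) (z l : C) : cder f z l -> C_derive f z = l.
Proof. intros H. apply is_C_derive_unique, is_derive_cder, H. Qed.

Lemma cder_unique (f : C -> C) (z l l' : C) : cder f z l -> cder f z l' -> l = l'.
Proof. intros H H'. rewrite <- (cder_C_derive _ _ _ H). apply cder_C_derive, H'. Qed.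

Lemma Cmod_sub_sym (x y : C) : Cmod (x - y) = Cmod (y - x).
Proof. rewrite <- (Cmod_opp (x - y)). f_equal. ring. Qed.

Lemma Cmod_triangle_sub (x y : C) : Cmod (x - y) <= Cmod x + Cmod y.
Proof. unfold Cminus. rewrite <- (Cmod_opp y). apply Cmod_triangle. Qed.

Lemma Cmod_triangle_rev (x y : C) : Cmod x - Cmod y <= Cmod (x - y).
Proof.
  pose proof (Cmod_triangle (x - y) y) as H.
  replace (x - y + y)%C with x in H by ring. lra.
Qed.

Lemma cder_cont (f : C -> C) (z l : C) : cder f z l ->
  forall eps, 0 < eps -> exists delta, 0 < delta /\
    forall w, Cmod (w - z) < delta -> Cmod (f w - f z) < eps.
Proof.
  intros H eps Heps.
  destruct (H 1 Rlt_0_1) as [d [Hd Hf]].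
  pose proof (Cmod_ge_0 l) as Hl.
  exists (Rmin d (eps / (Cmod l + 2))). split.
  - apply Rmin_pos; [exact Hd|]. apply Rdiv_lt_0_compat; lra.
  - intros w Hw.
    assert (H1 : Cmod (w - z) < d) by (eapply Rlt_le_trans; [exact Hw|apply Rmin_l]).
    assert (H2 : Cmod (w - z) < eps / (Cmod l + 2)) by (eapply Rlt_le_trans; [exact Hw|apply Rmin_r]).
    specialize (Hf w H1).
    replace (f w - f z)%C with ((f w - f z - l * (w - z)) + l * (w - z))%C by ring.
    eapply Rle_lt_trans; [apply Cmod_triangle|]. rewrite Cmod_mult.
    apply (Rmult_lt_compat_l (Cmod l + 2)) in H2; [|lra].
    replace ((Cmod l + 2) * (eps / (Cmod l + 2))) with eps in H2 by (field; lra).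
    pose proof (Cmod_ge_0 (w - z)). nra.
Qed.

Lemma cder_const (c z : C) : cder (fun _ => c) z 0.
Proof.
  intros e He. exists 1. split; [lra|]. intros w _.
  replace (c - c - 0 * (w - z))%C with (RtoC 0) by ring. rewrite Cmod_0.
  apply Rmult_le_pos; [lra|apply Cmod_ge_0].
Qed.

Lemma cder_id (z : C) : cder (fun w => w) z 1.
Proof.
  intros e He. exists 1. split; [lra|]. intros w _.
  replace (w - z - 1 * (w - z))%C with (RtoC 0) by ring. rewrite Cmod_0.
  apply Rmult_le_pos; [lra|apply Cmod_ge_0].
Qed.

Lemma cder_ext_loc (f g : C -> C) (z l : C) (r : R) : 0 < r ->
  (forall w, Cmod (w - z) < r -> f w = g w) -> cder f z l -> cder g z l.
Proof.
  intros Hr Hfg H e He. destruct (H e He) as [d [Hd Hf]].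
  exists (Rmin d r). split; [apply Rmin_pos; assumption|].
  intros w Hw.
  rewrite <- !Hfg.
  - apply Hf. eapply Rlt_le_trans; [exact Hw|apply Rmin_l].
  - replace (z - z)%C with (RtoC 0) by ring. rewrite Cmod_0. exact Hr.
  - eapply Rlt_le_trans; [exact Hw|apply Rmin_r].
Qed.

Lemma cder_ext (f g : C -> C) (z l : C) :
  (forall w, f w = g w) -> cder f z l -> cder g z l.
Proof. intros H. apply (cder_ext_loc f g z l 1); [lra|auto]. Qed.

Lemma cder_plus (f g : C -> C) (z l m : C) :
  cder f z l -> cder g z m -> cder (fun w => f w + g w)%C z (l + m)%C.
Proof.
  intros Hf Hg e He.
  destruct (Hf (e / 2) ltac:(lra)) as [d1 [Hd1 H1]].
  destruct (Hg (e / 2) ltac:(lra)) as [d2 [Hd2 H2]].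
  exists (Rmin d1 d2). split; [apply Rmin_pos; assumption|]. intros w Hw.
  specialize (H1 w ltac:(eapply Rlt_le_trans; [exact Hw|apply Rmin_l])).
  specialize (H2 w ltac:(eapply Rlt_le_trans; [exact Hw|apply Rmin_r])).
  replace (f w + g w - (f z + g z) - (l + m) * (w - z))%C
    with ((f w - f z - l * (w - z)) + (g w - g z - m * (w - z)))%C by ring.
  eapply Rle_trans; [apply Cmod_triangle|]. lra.
Qed.

Lemma cder_mult (f g : C -> C) (z l m : C) :
  cder f z l -> cder g z m -> cder (fun w => f w * g w)%C z (l * g z + f z * m)%C.
Proof.
  intros Hf Hg e He.
  pose proof (Cmod_ge_0 l) as Hl0. pose proof (Cmod_ge_0 (f z)) as Hf0.
  pose proof (Cmod_ge_0 (g z)) as Hg0.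
  set (e1 := e / (3 * (Cmod (g z) + 1))).
  set (e2 := e / (3 * (Cmod (f z) + 1))).
  assert (He1 : 0 < e1) by (apply Rdiv_lt_0_compat; lra).
  assert (He2 : 0 < e2) by (apply Rdiv_lt_0_compat; lra).
  destruct (Hf _ He1) as [d1 [Hd1 H1]].
  destruct (Hg _ He2) as [d2 [Hd2 H2]].
  destruct (Hf 1 Rlt_0_1) as [d4 [Hd4 H4]].
  assert (He3 : 0 < e / (3 * (Cmod l + 1))) by (apply Rdiv_lt_0_compat; lra).
  destruct (cder_cont _ _ _ Hg _ He3) as [d3 [Hd3 H3]].
  exists (Rmin (Rmin d1 d2) (Rmin d3 d4)).
  split; [repeat apply Rmin_pos; assumption|]. intros w Hw.
  assert (Hw1 : Cmod (w - z) < Rmin d1 d2) by (eapply Rlt_le_trans; [exact Hw|apply Rmin_l]).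
  assert (Hw2 : Cmod (w - z) < Rmin d3 d4) by (eapply Rlt_le_trans; [exact Hw|apply Rmin_r]).
  specialize (H1 w ltac:(eapply Rlt_le_trans; [exact Hw1|apply Rmin_l])).
  specialize (H2 w ltac:(eapply Rlt_le_trans; [exact Hw1|apply Rmin_r])).
  specialize (H3 w ltac:(eapply Rlt_le_trans; [exact Hw2|apply Rmin_l])).
  specialize (H4 w ltac:(eapply Rlt_le_trans; [exact Hw2|apply Rmin_r])).
  replace (f w * g w - f z * g z - (l * g z + f z * m) * (w - z))%C
    with ((f w - f z - l * (w - z)) * g z + f z * (g w - g z - m * (w - z))
          + (f w - f z) * (g w - g z))%C by ring.
  assert (H5 : Cmod (f w - f z) <= (Cmod l + 1) * Cmod (w - z)).
  { replace (f w - f z)%C with ((f w - f z - l * (w - z)) + l * (w - z))%C by ring.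
    eapply Rle_trans; [apply Cmod_triangle|]. rewrite Cmod_mult. lra. }
  eapply Rle_trans; [apply Cmod_triangle|].
  eapply Rle_trans; [apply Rplus_le_compat_r, Cmod_triangle|].
  rewrite !Cmod_mult.
  pose proof (Cmod_ge_0 (w - z)) as Hx.
  set (x := Cmod (w - z)) in *.
  pose proof (Cmod_ge_0 (g w - g z)) as Hgg.
  assert (A1 : Cmod (f w - f z - l * (w - z)) * Cmod (g z) <= e / 3 * x).
  { apply Rle_trans with (e1 * x * (Cmod (g z) + 1)).
    - apply Rmult_le_compat; try lra. apply Cmod_ge_0.
    - unfold e1. right. field. lra. }
  assert (A2 : Cmod (f z) * Cmod (g w - g z - m * (w - z)) <= e / 3 * x).
  { apply Rle_trans with ((Cmod (f z) + 1) * (e2 * x)).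
    - apply Rmult_le_compat; try lra. apply Cmod_ge_0.
    - unfold e2. right. field. lra. }
  assert (A3 : Cmod (f w - f z) * Cmod (g w - g z) <= e / 3 * x).
  { apply Rle_trans with ((Cmod l + 1) * x * (e / (3 * (Cmod l + 1)))).
    - apply Rmult_le_compat; try lra. apply Cmod_ge_0.
    - right. field. lra. }
  lra.
Qed.

Lemma cder_comp (f g : C -> C) (z l m : C) :
  cder f (g z) l -> cder g z m -> cder (fun w => f (g w)) z (l * m)%C.
Proof.
  intros Hf Hg e He.
  pose proof (Cmod_ge_0 l) as Hl0. pose proof (Cmod_ge_0 m) as Hm0.
  destruct (Hf (e / (2 * (Cmod m + 1)))) as [d1 [Hd1 H1]]; [apply Rdiv_lt_0_compat; lra|].
  destruct (Hg (e / (2 * (Cmod l + 1)))) as [d2 [Hd2 H2]]; [apply Rdiv_lt_0_compat; lra|].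
  destruct (Hg 1 Rlt_0_1) as [d3 [Hd3 H3]].
  destruct (cder_cont _ _ _ Hg _ Hd1) as [d4 [Hd4 H4]].
  exists (Rmin d2 (Rmin d3 d4)). split; [repeat apply Rmin_pos; assumption|].
  intros w Hw.
  assert (Hw1 : Cmod (w - z) < Rmin d3 d4) by (eapply Rlt_le_trans; [exact Hw|apply Rmin_r]).
  specialize (H2 w ltac:(eapply Rlt_le_trans; [exact Hw|apply Rmin_l])).
  specialize (H3 w ltac:(eapply Rlt_le_trans; [exact Hw1|apply Rmin_l])).
  specialize (H4 w ltac:(eapply Rlt_le_trans; [exact Hw1|apply Rmin_r])).
  specialize (H1 (g w) H4).
  replace (f (g w) - f (g z) - l * m * (w - z))%C
    with ((f (g w) - f (g z) - l * (g w - g z)) + l * (g w - g z - m * (w - z)))%C by ring.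
  eapply Rle_trans; [apply Cmod_triangle|]. rewrite Cmod_mult.
  pose proof (Cmod_ge_0 (w - z)) as Hx. set (x := Cmod (w - z)) in *.
  assert (H5 : Cmod (g w - g z) <= (Cmod m + 1) * x).
  { replace (g w - g z)%C with ((g w - g z - m * (w - z)) + m * (w - z))%C by ring.
    eapply Rle_trans; [apply Cmod_triangle|]. rewrite Cmod_mult. fold x. lra. }
  assert (A1 : e / (2 * (Cmod m + 1)) * Cmod (g w - g z) <= e / 2 * x).
  { apply Rle_trans with (e / (2 * (Cmod m + 1)) * ((Cmod m + 1) * x)).
    - apply Rmult_le_compat_l; [|exact H5]. apply Rlt_le, Rdiv_lt_0_compat; lra.
    - right. field. lra. }
  assert (A2 : Cmod l * Cmod (g w - g z - m * (w - z)) <= e / 2 * x).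
  { apply Rle_trans with ((Cmod l + 1) * (e / (2 * (Cmod l + 1)) * x)).
    - apply Rmult_le_compat; try lra. apply Cmod_ge_0.
    - right. field. lra. }
  lra.
Qed.

Lemma cder_eq (f : C -> C) (z l l' : C) : l = l' -> cder f z l -> cder f z l'.
Proof. intros ->; auto. Qed.

Lemma cder_opp (f : C -> C) (z l : C) : cder f z l -> cder (fun w => - f w)%C z (- l)%C.
Proof.
  intros H. apply (cder_ext (fun w => (-(1)) * f w)%C); [intros; ring|].
  eapply cder_eq; [|apply (cder_mult _ _ _ _ _ (cder_const (-(1)) z) H)]. ring.
Qed.

Lemma cder_minus (f g : C -> C) (z l m : C) :
  cder f z l -> cder g z m -> cder (fun w => f w - g w)%C z (l - m)%C.
Proof. intros Hf Hg. apply (cder_plus f (fun w => - g w)%C); [|apply cder_opp]; assumption. Qed.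

Lemma cder_scal (c : C) (f : C -> C) (z l : C) :
  cder f z l -> cder (fun w => c * f w)%C z (c * l)%C.
Proof.
  intros H. eapply cder_eq; [|apply (cder_mult _ _ _ _ _ (cder_const c z) H)]. ring.
Qed.

Lemma cder_inv_at (z : C) : z <> 0 -> cder Cinv z (- / (z * z))%C.
Proof.
  intros Hz e He.
  assert (Hm : 0 < Cmod z) by (apply Cmod_gt_0; exact Hz).
  set (M := Cmod z) in *.
  exists (Rmin (M / 2) (e * M ^ 3 / 2)). split.
  { apply Rmin_pos; [lra|]. apply Rdiv_lt_0_compat; [|lra]. apply Rmult_lt_0_compat; [lra|]. apply pow_lt; lra. }
  intros w Hw.
  assert (H1 : Cmod (w - z) < M / 2) by (eapply Rlt_le_trans; [exact Hw|apply Rmin_l]).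
  assert (H2 : Cmod (w - z) < e * M ^ 3 / 2) by (eapply Rlt_le_trans; [exact Hw|apply Rmin_r]).
  assert (Hw0 : M / 2 < Cmod w).
  { pose proof (Cmod_triangle_rev z (z - w)) as H.
    replace (z - (z - w))%C with w in H by ring.
    rewrite Cmod_sub_sym in H1. fold M in H. lra. }
  assert (Hwn : w <> 0) by (apply Cmod_gt_0; lra).
  replace (/ w - / z - - / (z * z) * (w - z))%C
    with ((w - z) * (w - z) * (/ w * (/ z * / z)))%C by (field; split; assumption).
  rewrite !Cmod_mult, !Cmod_inv by assumption. fold M.
  pose proof (Cmod_ge_0 (w - z)) as Hx. set (x := Cmod (w - z)) in *.
  assert (H3 : / Cmod w <= 2 / M).
  { replace (2 / M) with (/ (M / 2)) by (field; lra). apply Rinv_le_contravar; lra. }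
  rewrite (Rmult_comm e), Rmult_assoc. apply Rmult_le_compat_l; [exact Hx|].
  apply Rle_trans with (x * (2 / M * (/ M * / M))).
  { apply Rmult_le_compat_l; [exact Hx|]. apply Rmult_le_compat_r; [|exact H3].
    apply Rmult_le_pos; apply Rlt_le, Rinv_0_lt_compat; lra. }
  apply Rle_trans with (e * M ^ 3 / 2 * (2 / M * (/ M * / M))).
  { apply Rmult_le_compat_r; [|lra]. apply Rmult_le_pos.
    - apply Rlt_le, Rdiv_lt_0_compat; lra.
    - apply Rmult_le_pos; apply Rlt_le, Rinv_0_lt_compat; lra. }
  right. field. lra.
Qed.

Lemma cder_inv (f : C -> C) (z l : C) : f z <> 0 ->
  cder f z l -> cder (fun w => / f w)%C z (- l / (f z * f z))%C.
Proof.
  intros Hz H. eapply cder_eq; [|apply (cder_comp Cinv f _ _ _ (cder_inv_at _ Hz) H)].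
  field. exact Hz.
Qed.

Lemma cder_pow (f : C -> C) (z l : C) (n : nat) :
  cder f z l -> cder (fun w => f w ^ n)%C z (INR n * f z ^ (pred n) * l)%C.
Proof.
  intros H. induction n as [|n IH].
  - simpl. eapply cder_eq; [|apply cder_const]. ring.
  - change (cder (fun w => f w * f w ^ n)%C z (INR (S n) * f z ^ n * l)%C).
    eapply cder_eq; [|apply (cder_mult _ _ _ _ _ H IH)].
    rewrite S_INR, RtoC_plus. destruct n; [simpl; ring|]. simpl pred. rewrite (Cpow_S _ n). ring.
Qed.

(** * Integrals of complex-valued functions of a real variable *)

Notation is_CInt := (is_RInt (V := C_R_NormedModule)).
Notation ccont := (continuous (U := C_UniformSpace)).

Lemma ccont_eps (f : R -> C) (t : R) :
  ccont f t <-> forall eps, 0 < eps -> exists delta, 0 < delta /\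
    forall s, Rabs (s - t) < delta -> Cmod (f s - f t) < eps.
Proof.
  split.
  - intros H eps Heps.
    assert (HP : locally (T := C_UniformSpace) (f t) (fun w => Cmod (w - f t) < eps)).
    { apply locally_C_disc. exists eps. split; auto. }
    destruct (H _ HP) as [d Hd]. exists d. split; [apply cond_pos|]. exact Hd.
  - intros H P HP. apply locally_C_disc in HP. destruct HP as [r [Hr HP]].
    destruct (H r Hr) as [d [Hd Hf]]. exists (mkposreal _ Hd). intros s Hs. apply HP, Hf, Hs.
Qed.

Lemma ccont_comp_cder (f : C -> C) (g : R -> C) (t : R) (l : C) :
  cder f (g t) l -> ccont g t -> ccont (fun s => f (g s)) t.
Proof.
  intros Hf Hg. apply ccont_eps. intros e He.
  destruct (cder_cont _ _ _ Hf e He) as [d [Hd H]].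
  destruct (proj1 (ccont_eps g t) Hg d Hd) as [d' [Hd' H']].
  exists d'. split; auto.
Qed.

Lemma ccont_pair (f : R -> C) (t : R) :
  continuous (fun s => fst (f s)) t -> continuous (fun s => snd (f s)) t -> ccont f t.
Proof.
  intros H1 H2 P HP. destruct HP as [e He].
  destruct (H1 (ball (fst (f t)) e) (locally_ball _ e)) as [d1 Hd1].
  destruct (H2 (ball (snd (f t)) e) (locally_ball _ e)) as [d2 Hd2].
  exists (mkposreal _ (Rmin_pos _ _ (cond_pos d1) (cond_pos d2))).
  intros s Hs. apply He. split.
  - apply Hd1. eapply Rlt_le_trans; [exact Hs|apply Rmin_l].
  - apply Hd2. eapply Rlt_le_trans; [exact Hs|apply Rmin_r].
Qed.

Lemma ccont_fst (f : R -> C) (t : R) : ccont f t -> continuous (fun s => fst (f s)) t.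
Proof. intros H. apply (continuous_comp f fst t H). apply continuous_fst. Qed.

Lemma ccont_snd (f : R -> C) (t : R) : ccont f t -> continuous (fun s => snd (f s)) t.
Proof. intros H. apply (continuous_comp f snd t H). apply continuous_snd. Qed.

Lemma ccont_plus (f g : R -> C) (t : R) :
  ccont f t -> ccont g t -> ccont (fun s => f s + g s)%C t.
Proof.
  intros Hf Hg. apply ccont_pair; simpl;
  apply (continuous_plus (V := R_NormedModule)); auto using ccont_fst, ccont_snd.
Qed.

Lemma ccont_opp (f : R -> C) (t : R) : ccont f t -> ccont (fun s => - f s)%C t.
Proof.
  intros Hf. apply ccont_pair; simpl;
  apply (continuous_opp (V := R_NormedModule)); auto using ccont_fst, ccont_snd.
Qed.

Lemma ccont_minus (f g : R -> C) (t : R) :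
  ccont f t -> ccont g t -> ccont (fun s => f s - g s)%C t.
Proof. intros Hf Hg. apply ccont_plus; [|apply ccont_opp]; assumption. Qed.

Lemma ccont_mult (f g : R -> C) (t : R) :
  ccont f t -> ccont g t -> ccont (fun s => f s * g s)%C t.
Proof.
  intros Hf Hg. apply ccont_pair; simpl.
  - apply (continuous_minus (V := R_NormedModule));
    apply (continuous_mult (K := R_AbsRing)); auto using ccont_fst, ccont_snd.
  - apply (continuous_plus (V := R_NormedModule));
    apply (continuous_mult (K := R_AbsRing)); auto using ccont_fst, ccont_snd.
Qed.

Lemma ccont_const (c : C) (t : R) : ccont (fun _ => c) t.
Proof. apply continuous_const. Qed.

Lemma ccont_RtoC (f : R -> R) (t : R) : continuous f t -> ccont (fun s => RtoC (f s)) t.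
Proof. intros H. apply ccont_pair; simpl; [exact H|apply continuous_const]. Qed.

Lemma ccont_Rid (t : R) : ccont (fun s => RtoC s) t.
Proof. apply ccont_RtoC, continuous_id. Qed.

Lemma ccont_cis (f : R -> R) (t : R) : continuous f t -> ccont (fun s => cis (f s)) t.
Proof.
  intros H. apply ccont_pair; simpl.
  - apply (continuous_comp f cos); [exact H|apply continuous_cos].
  - apply (continuous_comp f sin); [exact H|apply continuous_sin].
Qed.

Lemma ex_CInt_cont (f : R -> C) (a b : R) : a <= b ->
  (forall t, a <= t <= b -> ccont f t) -> exists I, is_CInt f a b I.
Proof.
  intros Hab H.
  destruct (ex_RInt_continuous (V := C_R_CompleteNormedModule) f a b) as [I HI].
  - intros z. rewrite Rmin_left, Rmax_right by lra. apply H.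
  - exists I. exact HI.
Qed.

Definition CInt (f : R -> C) (a b : R) : C := RInt (V := C_R_CompleteNormedModule) f a b.

Lemma is_CInt_unique (f : R -> C) (a b : R) (I : C) : is_CInt f a b I -> CInt f a b = I.
Proof. intros H. apply (is_RInt_unique (V := C_R_CompleteNormedModule)). exact H. Qed.

Lemma is_CInt_inj (f : R -> C) (a b : R) (I J : C) : is_CInt f a b I -> is_CInt f a b J -> I = J.
Proof. intros H H'. rewrite <- (is_CInt_unique _ _ _ _ H). apply is_CInt_unique, H'. Qed.

Lemma CInt_correct (f : R -> C) (a b : R) : a <= b ->
  (forall t, a <= t <= b -> ccont f t) -> is_CInt f a b (CInt f a b).
Proof.
  intros Hab H. destruct (ex_CInt_cont f a b Hab H) as [I HI].
  rewrite (is_CInt_unique _ _ _ _ HI). exact HI.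
Qed.

Lemma is_CInt_plus (f g : R -> C) (a b : R) (I J : C) :
  is_CInt f a b I -> is_CInt g a b J -> is_CInt (fun t => f t + g t)%C a b (I + J)%C.
Proof. apply (is_RInt_plus (V := C_R_NormedModule)). Qed.

Lemma is_CInt_minus (f g : R -> C) (a b : R) (I J : C) :
  is_CInt f a b I -> is_CInt g a b J -> is_CInt (fun t => f t - g t)%C a b (I - J)%C.
Proof. apply (is_RInt_minus (V := C_R_NormedModule)). Qed.

(** The integral is linear over R by construction; a complex factor mixes the components and is
    handled through them. *)
Lemma is_CInt_scal (c : C) (f : R -> C) (a b : R) (I : C) :
  is_CInt f a b I -> is_CInt (fun t => c * f t)%C a b (c * I)%C.
Proof.
  intros H.
  pose proof (is_RInt_fct_extend_fst (U := R_NormedModule) (V := R_NormedModule) f a b I H) as H1.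
  pose proof (is_RInt_fct_extend_snd (U := R_NormedModule) (V := R_NormedModule) f a b I H) as H2.
  apply (is_RInt_fct_extend_pair (U := R_NormedModule) (V := R_NormedModule)
    (fun t => c * f t)%C a b (fst (c * I)%C) (snd (c * I)%C)); simpl.
  - apply (is_RInt_minus (V := R_NormedModule));
      apply (is_RInt_scal (V := R_NormedModule)); assumption.
  - apply (is_RInt_plus (V := R_NormedModule));
      apply (is_RInt_scal (V := R_NormedModule)); assumption.
Qed.

Lemma is_CInt_const (c : C) (a b : R) : is_CInt (fun _ => c) a b (RtoC (b - a) * c)%C.
Proof.
  replace (RtoC (b - a) * c)%C with (scal (V := C_R_NormedModule) (b - a) c).
  - apply (is_RInt_const (V := C_R_NormedModule)).
  - unfold scal; simpl. unfold prod_scal, scal; simpl. unfold mult; simpl.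
    unfold Cmult, RtoC; simpl. f_equal; ring.
Qed.

Lemma is_CInt_ext (f g : R -> C) (a b : R) (I : C) : a <= b ->
  (forall t, a <= t <= b -> f t = g t) -> is_CInt f a b I -> is_CInt g a b I.
Proof.
  intros Hab H. apply (is_RInt_ext (V := C_R_NormedModule)).
  intros x. rewrite Rmin_left, Rmax_right by lra. intros Hx. apply H; lra.
Qed.

Lemma CInt_bound (f : R -> C) (a b M : R) (I : C) : a <= b ->
  (forall t, a <= t <= b -> Cmod (f t) <= M) -> is_CInt f a b I -> Cmod I <= M * (b - a).
Proof.
  intros Hab H HI. rewrite Cmod_norm.
  apply (norm_RInt_le (V := C_R_NormedModule) f (fun _ => M) a b I (M * (b - a)) Hab).
  - intros x Hx. rewrite <- Cmod_norm. apply H, Hx.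
  - exact HI.
  - replace (M * (b - a)) with (scal (V := R_NormedModule) (b - a) M).
    + apply (is_RInt_const (V := R_NormedModule)).
    + unfold scal; simpl. unfold mult; simpl. ring.
Qed.

Lemma CInt_bound_fun (f : R -> C) (g : R -> R) (a b J : R) (I : C) : a <= b ->
  (forall t, a <= t <= b -> Cmod (f t) <= g t) ->
  is_CInt f a b I -> is_RInt g a b J -> Cmod I <= J.
Proof.
  intros Hab H HI HJ. rewrite Cmod_norm.
  apply (norm_RInt_le (V := C_R_NormedModule) f g a b I J Hab); [|exact HI|exact HJ].
  intros x Hx. rewrite <- Cmod_norm. apply H, Hx.
Qed.

Definition curve_der (g : R -> C) (t : R) (l : C) : Prop :=
  is_derive (K := R_AbsRing) (V := C_R_NormedModule) g t l.

Lemma curve_der_eps (g : R -> C) (t : R) (l : C) :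
  curve_der g t l <-> forall eps, 0 < eps -> exists delta, 0 < delta /\
    forall s, Rabs (s - t) < delta ->
      Cmod (g s - g t - l * RtoC (s - t)) <= eps * Rabs (s - t).
Proof.
  assert (E : forall s, minus (minus (g s) (g t)) (scal (V := C_R_NormedModule) (minus s t) l)
     = (g s - g t - l * RtoC (s - t))%C).
  { intros s. unfold scal; simpl. unfold prod_scal, scal; simpl. unfold mult; simpl.
    apply injective_projections; simpl; unfold minus, plus, opp; simpl; ring. }
  split.
  - intros [_ H] e He. specialize (H t (fun P HP => HP) (mkposreal _ He)).
    destruct H as [d Hd]. exists d. split; [apply cond_pos|].
    intros s Hs. specialize (Hd s Hs). simpl in Hd. rewrite Cmod_norm, <- E. exact Hd.
  - intros H. split; [apply (is_linear_scal_l (K := R_AbsRing) (V := C_R_NormedModule))|].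
    intros x Hx eps.
    assert (Ex : t = x).
    { symmetry. apply (is_filter_lim_unique (K := R_AbsRing) (V := R_NormedModule) (F := locally t)); [exact Hx|].
      intros P HP; exact HP. }
    subst x. destruct (H eps (cond_pos eps)) as [d [Hd Hg]].
    exists (mkposreal _ Hd). intros s Hs. specialize (Hg s Hs).
    rewrite Cmod_norm, <- E in Hg. exact Hg.
Qed.

(** A holomorphic function after a real curve: this turns complex primitives into primitives along
    curves, to which [CInt_derive] applies. *)
Lemma curve_der_comp (f : C -> C) (g : R -> C) (t : R) (l m : C) :
  cder f (g t) l -> curve_der g t m -> curve_der (fun s => f (g s)) t (l * m)%C.
Proof.
  intros Hf Hg. apply curve_der_eps. intros e He.
  pose proof (proj1 (curve_der_eps _ _ _) Hg) as Hg'. clear Hg.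
  pose proof (Cmod_ge_0 l) as Hl0. pose proof (Cmod_ge_0 m) as Hm0.
  destruct (Hf (e / (2 * (Cmod m + 1)))) as [d1 [Hd1 H1]]; [apply Rdiv_lt_0_compat; lra|].
  destruct (Hg' (e / (2 * (Cmod l + 1)))) as [d2 [Hd2 H2]]; [apply Rdiv_lt_0_compat; lra|].
  destruct (Hg' 1 Rlt_0_1) as [d3 [Hd3 H3]].
  assert (Hd4 : 0 < d1 / (Cmod m + 1)) by (apply Rdiv_lt_0_compat; lra).
  exists (Rmin d2 (Rmin d3 (d1 / (Cmod m + 1)))). split; [repeat apply Rmin_pos; assumption|].
  intros s Hs.
  assert (Hs1 : Rabs (s - t) < Rmin d3 (d1 / (Cmod m + 1))) by (eapply Rlt_le_trans; [exact Hs|apply Rmin_r]).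
  specialize (H2 s ltac:(eapply Rlt_le_trans; [exact Hs|apply Rmin_l])).
  specialize (H3 s ltac:(eapply Rlt_le_trans; [exact Hs1|apply Rmin_l])).
  assert (Hs2 : Rabs (s - t) < d1 / (Cmod m + 1)) by (eapply Rlt_le_trans; [exact Hs1|apply Rmin_r]).
  pose proof (Rabs_pos (s - t)) as Hx. set (x := Rabs (s - t)) in *.
  assert (Hx' : Cmod (RtoC (s - t)) = x) by apply Cmod_R.
  assert (H5 : Cmod (g s - g t) <= (Cmod m + 1) * x).
  { replace (g s - g t)%C with ((g s - g t - m * RtoC (s - t)) + m * RtoC (s - t))%C by ring.
    eapply Rle_trans; [apply Cmod_triangle|]. rewrite Cmod_mult, Hx'. lra. }
  assert (H6 : Cmod (g s - g t) < d1).
  { eapply Rle_lt_trans; [exact H5|].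
    apply (Rmult_lt_compat_l (Cmod m + 1)) in Hs2; [|lra].
    replace ((Cmod m + 1) * (d1 / (Cmod m + 1))) with d1 in Hs2 by (field; lra). exact Hs2. }
  specialize (H1 _ H6).
  replace (f (g s) - f (g t) - l * m * RtoC (s - t))%C
    with ((f (g s) - f (g t) - l * (g s - g t)) + l * (g s - g t - m * RtoC (s - t)))%C by ring.
  eapply Rle_trans; [apply Cmod_triangle|]. rewrite Cmod_mult.
  assert (A1 : e / (2 * (Cmod m + 1)) * Cmod (g s - g t) <= e / 2 * x).
  { apply Rle_trans with (e / (2 * (Cmod m + 1)) * ((Cmod m + 1) * x)).
    - apply Rmult_le_compat_l; [|exact H5]. apply Rlt_le, Rdiv_lt_0_compat; lra.
    - right. field. lra. }
  assert (A2 : Cmod l * Cmod (g s - g t - m * RtoC (s - t)) <= e / 2 * x).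
  { apply Rle_trans with ((Cmod l + 1) * (e / (2 * (Cmod l + 1)) * x)).
    - apply Rmult_le_compat; try lra. apply Cmod_ge_0.
    - right. field. lra. }
  lra.
Qed.

Lemma curve_der_cont (g : R -> C) (t : R) (l : C) : curve_der g t l -> ccont g t.
Proof.
  intros H. apply (ex_derive_continuous (K := R_AbsRing) (V := C_R_NormedModule) g t).
  exists l. exact H.
Qed.

Lemma curve_der_affine (p u : C) (t : R) : curve_der (fun s => p + RtoC s * u)%C t u.
Proof.
  apply curve_der_eps. intros e He. exists 1. split; [lra|]. intros s _.
  replace (p + RtoC s * u - (p + RtoC t * u) - u * RtoC (s - t))%C with (RtoC 0).
  - rewrite Cmod_0. apply Rmult_le_pos; [lra|apply Rabs_pos].
  - rewrite RtoC_minus. ring.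
Qed.

Lemma CInt_derive (g dg : R -> C) (a b : R) : a <= b ->
  (forall t, a <= t <= b -> curve_der g t (dg t)) ->
  (forall t, a <= t <= b -> ccont dg t) -> is_CInt dg a b (g b - g a)%C.
Proof.
  intros Hab H H'.
  apply (is_RInt_derive (V := C_R_CompleteNormedModule) g dg a b).
  - intros x. rewrite Rmin_left, Rmax_right by lra. apply H.
  - intros x. rewrite Rmin_left, Rmax_right by lra. apply H'.
Qed.

(** * Goursat's theorem on parallelograms *)

Definition seg (f : C -> C) (p u : C) : C := CInt (fun t => u * f (p + RtoC t * u))%C 0 1.

(** The contour integral around the parallelogram p, p + u, p + u + v, p + v; the last two sides are
    run backwards. *)
Definition loop (f : C -> C) (p u v : C) : C :=
  (seg f p u + seg f (p + u) v - seg f (p + v) u - seg f p v)%C.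

Definition holo_at (f : C -> C) (z : C) : Prop := exists l, cder f z l.

Lemma holo_at_ccont (f : C -> C) (g : R -> C) (t : R) :
  holo_at f (g t) -> ccont g t -> ccont (fun s => f (g s)) t.
Proof. intros [l Hl]. apply (ccont_comp_cder f g t l Hl). Qed.

Lemma ccont_affine (p u : C) (t : R) : ccont (fun s => p + RtoC s * u)%C t.
Proof. eapply curve_der_cont, curve_der_affine. Qed.

Lemma seg_correct (f : C -> C) (p u : C) :
  (forall t, 0 <= t <= 1 -> holo_at f (p + RtoC t * u)%C) ->
  is_CInt (fun t => u * f (p + RtoC t * u))%C 0 1 (seg f p u).
Proof.
  intros H. apply CInt_correct; [lra|]. intros t Ht.
  apply ccont_mult; [apply ccont_const|].
  apply (holo_at_ccont f (fun s => p + RtoC s * u)%C); [apply H, Ht|apply ccont_affine].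
Qed.

Lemma RtoC_half (t : R) (u : C) : (RtoC t * (u / 2) = RtoC (t / 2) * u)%C.
Proof. unfold Rdiv. rewrite RtoC_mult, RtoC_inv by lra. unfold Cdiv. ring. Qed.

Lemma seg_split (f : C -> C) (p u : C) :
  (forall t, 0 <= t <= 1 -> holo_at f (p + RtoC t * u)%C) ->
  seg f p u = (seg f p (u / 2) + seg f (p + u / 2) (u / 2))%C.
Proof.
  intros H.
  set (G := fun t => (u * f (p + RtoC t * u))%C).
  assert (HG : forall t, 0 <= t <= 1 -> ccont G t).
  { intros t Ht. apply ccont_mult; [apply ccont_const|].
    apply (holo_at_ccont f (fun s => p + RtoC s * u)%C); [apply H, Ht|apply ccont_affine]. }
  pose proof (CInt_correct G 0 (1/2) ltac:(lra) ltac:(intros; apply HG; lra)) as I1.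
  pose proof (CInt_correct G (1/2) 1 ltac:(lra) ltac:(intros; apply HG; lra)) as I2.
  assert (E : seg f p u = (CInt G 0 (1/2) + CInt G (1/2) 1)%C).
  { apply is_CInt_unique. apply (is_RInt_Chasles (V := C_R_NormedModule) G 0 (1/2) 1); assumption. }
  assert (E1 : seg f p (u / 2) = CInt G 0 (1/2)).
  { apply is_CInt_unique.
    pose proof (is_RInt_comp_lin (V := C_R_NormedModule) G (1/2) 0 0 1 (CInt G 0 (1/2))) as L.
    replace (1/2*0+0) with 0 in L by lra. replace (1/2*1+0) with (1/2) in L by lra.
    specialize (L I1). eapply is_CInt_ext; [lra| |exact L]. intros t Ht. unfold G.
    rewrite RtoC_half. replace (1/2*t+0) with (t/2) by lra.
    unfold scal; simpl. unfold prod_scal, scal; simpl. unfold mult; simpl.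
    generalize (f (p + RtoC (t / 2) * u)%C). intros w.
    apply injective_projections; simpl; field; lra. }
  assert (E2 : seg f (p + u / 2) (u / 2) = CInt G (1/2) 1).
  { apply is_CInt_unique.
    pose proof (is_RInt_comp_lin (V := C_R_NormedModule) G (1/2) (1/2) 0 1 (CInt G (1/2) 1)) as L.
    replace (1/2*0+1/2) with (1/2) in L by lra. replace (1/2*1+1/2) with 1 in L by lra.
    specialize (L I2). eapply is_CInt_ext; [lra| |exact L]. intros t Ht. unfold G.
    replace (p + u / 2 + RtoC t * (u / 2))%C with (p + RtoC (1/2*t+1/2) * u)%C.
    2:{ rewrite RtoC_half. replace (1/2*t+1/2) with (t/2 + /2) by lra.
        rewrite RtoC_plus, RtoC_inv by lra. unfold Cdiv. ring. }
    unfold scal; simpl. unfold prod_scal, scal; simpl. unfold mult; simpl.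
    generalize (f (p + RtoC (1/2*t+1/2) * u)%C). intros w.
    apply injective_projections; simpl; field; lra. }
  rewrite E, E1, E2. reflexivity.
Qed.

Definition holo_on_par (f : C -> C) (p u v : C) : Prop :=
  forall s t, 0 <= s <= 1 -> 0 <= t <= 1 -> holo_at f (p + RtoC s * u + RtoC t * v)%C.

(** Each inner half-side occurs twice with opposite signs, so after halving the outer sides only a
    ring identity remains. *)
Lemma loop_quarter (f : C -> C) (p u v : C) : holo_on_par f p u v ->
  loop f p u v =
  (loop f p (u/2) (v/2) + loop f (p + u/2) (u/2) (v/2)
   + loop f (p + v/2) (u/2) (v/2) + loop f (p + u/2 + v/2) (u/2) (v/2))%C.
Proof.
  intros H. unfold loop at 1.
  rewrite (seg_split f p u), (seg_split f (p + u) v), (seg_split f (p + v) u), (seg_split f p v).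
  - unfold loop.
    replace (p + u/2 + u/2)%C with (p + u)%C by (unfold Cdiv; field).
    replace (p + v/2 + v/2)%C with (p + v)%C by (unfold Cdiv; field).
    replace (p + v/2 + u/2)%C with (p + u/2 + v/2)%C by ring.
    replace (p + u/2 + v/2 + u/2)%C with (p + u + v/2)%C by (unfold Cdiv; field).
    replace (p + u/2 + v/2 + v/2)%C with (p + v + u/2)%C by (unfold Cdiv; field).
    ring.
  - intros t Ht. replace (p + RtoC t * v)%C with (p + RtoC 0 * u + RtoC t * v)%C by ring. apply H; lra.
  - intros t Ht. replace (p + v + RtoC t * u)%C with (p + RtoC t * u + RtoC 1 * v)%C by ring. apply H; lra.
  - intros t Ht. replace (p + u + RtoC t * v)%C with (p + RtoC 1 * u + RtoC t * v)%C by ring. apply H; lra.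
  - intros t Ht. replace (p + RtoC t * u)%C with (p + RtoC t * u + RtoC 0 * v)%C by ring. apply H; lra.
Qed.

Lemma seg_affine (A B p u : C) :
  is_CInt (fun t => u * (A + B * (p + RtoC t * u)))%C 0 1 (u * (A + B * p + B * u / 2))%C.
Proof.
  pose proof (CInt_derive
    (fun t => RtoC t * (u * (A + B * p)) + RtoC t * RtoC t * (u * u * B / 2))%C
    (fun t => u * (A + B * (p + RtoC t * u)))%C 0 1 ltac:(lra)) as H.
  match type of H with ?a -> ?b -> is_CInt ?f ?x ?y ?I =>
    replace (u * (A + B * p + B * u / 2))%C with I by (simpl; unfold Cdiv; ring) end.
  apply H.
  - intros t _.
    assert (D : cder (fun z => z * (u * (A + B * p)) + z * z * (u * u * B / 2))%C (RtoC t)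
      (u * (A + B * (p + RtoC t * u)))%C).
    { eapply cder_eq; [|apply cder_plus; apply cder_mult; [apply cder_id|apply cder_const|apply cder_mult; apply cder_id|apply cder_const]].
      unfold Cdiv. field. }
    assert (E : curve_der (fun s => RtoC s) t 1).
    { apply curve_der_eps. intros e He. exists 1. split; [lra|]. intros s _.
      replace (RtoC s - RtoC t - 1 * RtoC (s - t))%C with (RtoC 0) by (rewrite RtoC_minus; ring).
      rewrite Cmod_0. apply Rmult_le_pos; [lra|apply Rabs_pos]. }
    pose proof (curve_der_comp _ _ _ _ _ D E) as F.
    rewrite Cmult_1_r in F. exact F.
  - intros t _. apply ccont_mult; [apply ccont_const|]. apply ccont_plus; [apply ccont_const|].
    apply ccont_mult; [apply ccont_const|]. apply ccont_affine.
Qed.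

Lemma seg_affine_approx (f : C -> C) (A B p u : C) (M : R) :
  (forall t, 0 <= t <= 1 -> holo_at f (p + RtoC t * u)%C) ->
  (forall t, 0 <= t <= 1 -> Cmod (f (p + RtoC t * u) - (A + B * (p + RtoC t * u)))%C <= M) ->
  Cmod (seg f p u - u * (A + B * p + B * u / 2))%C <= Cmod u * M.
Proof.
  intros H HM.
  pose proof (is_CInt_minus _ _ _ _ _ _ (seg_correct f p u H) (seg_affine A B p u)) as I.
  eapply Rle_trans; [eapply (CInt_bound _ 0 1 (Cmod u * M)); [lra| |exact I]|lra].
  intros t Ht. cbv beta.
  replace (u * f (p + RtoC t * u) - u * (A + B * (p + RtoC t * u)))%C
    with (u * (f (p + RtoC t * u) - (A + B * (p + RtoC t * u))))%C by ring.
  rewrite Cmod_mult. apply Rmult_le_compat_l; [apply Cmod_ge_0|]. apply HM, Ht.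
Qed.

(** An affine function has a primitive and hence loop integral 0; only the deviation from it counts,
    at most the perimeter times its supremum. *)
Lemma loop_affine_approx (f : C -> C) (A B p u v : C) (M : R) :
  holo_on_par f p u v ->
  (forall s t, 0 <= s <= 1 -> 0 <= t <= 1 ->
     Cmod (f (p + RtoC s * u + RtoC t * v) - (A + B * (p + RtoC s * u + RtoC t * v)))%C <= M) ->
  Cmod (loop f p u v) <= 2 * (Cmod u + Cmod v) * M.
Proof.
  intros H HM. unfold loop.
  assert (E1 : Cmod (seg f p u - u * (A + B * p + B * u / 2))%C <= Cmod u * M).
  { apply seg_affine_approx; intros t Ht;
    replace (p + RtoC t * u)%C with (p + RtoC t * u + RtoC 0 * v)%C by ring; [apply H|apply HM]; lra. }
  assert (E2 : Cmod (seg f (p + u) v - v * (A + B * (p + u) + B * v / 2))%C <= Cmod v * M).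
  { apply seg_affine_approx; intros t Ht;
    replace (p + u + RtoC t * v)%C with (p + RtoC 1 * u + RtoC t * v)%C by ring; [apply H|apply HM]; lra. }
  assert (E3 : Cmod (seg f (p + v) u - u * (A + B * (p + v) + B * u / 2))%C <= Cmod u * M).
  { apply seg_affine_approx; intros t Ht;
    replace (p + v + RtoC t * u)%C with (p + RtoC t * u + RtoC 1 * v)%C by ring; [apply H|apply HM]; lra. }
  assert (E4 : Cmod (seg f p v - v * (A + B * p + B * v / 2))%C <= Cmod v * M).
  { apply seg_affine_approx; intros t Ht;
    replace (p + RtoC t * v)%C with (p + RtoC 0 * u + RtoC t * v)%C by ring; [apply H|apply HM]; lra. }
  replace (seg f p u + seg f (p + u) v - seg f (p + v) u - seg f p v)%C with
   ((seg f p u - u * (A + B * p + B * u / 2)) + (seg f (p + u) v - v * (A + B * (p + u) + B * v / 2))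
    - (seg f (p + v) u - u * (A + B * (p + v) + B * u / 2)) - (seg f p v - v * (A + B * p + B * v / 2)))%C
   by (unfold Cdiv; ring).
  eapply Rle_trans; [apply Cmod_triangle_sub|].
  eapply Rle_trans; [apply Rplus_le_compat_r, Cmod_triangle_sub|].
  eapply Rle_trans; [apply Rplus_le_compat_r, Rplus_le_compat_r, Cmod_triangle|].
  lra.
Qed.

Lemma pow_half_pos (n : nat) : 0 < (/ 2) ^ n.
Proof. apply pow_lt; lra. Qed.

Section Bisection.
Variables (f : C -> C) (p u v : C).
Hypothesis Hf : holo_on_par f p u v.

(** A piece of level n is coded by the relative coordinates of its corner, so that the common point
    of nested pieces comes from two nested sequences of real intervals. *)
Let sq (st : R * R) (n : nat) : C :=
  loop f (p + RtoC (fst st) * u + RtoC (snd st) * v)%C (RtoC ((/2)^n) * u)%C (RtoC ((/2)^n) * v)%C.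

Let good (st : R * R) (n : nat) : Prop :=
  0 <= fst st <= 1 - (/2)^n /\ 0 <= snd st <= 1 - (/2)^n.

Lemma holo_on_sub (st : R * R) (n : nat) : good st n ->
  holo_on_par f (p + RtoC (fst st) * u + RtoC (snd st) * v)%C (RtoC ((/2)^n) * u)%C (RtoC ((/2)^n) * v)%C.
Proof.
  intros [H1 H2] a b Ha Hb. pose proof (pow_half_pos n) as Hn.
  replace (p + RtoC (fst st) * u + RtoC (snd st) * v + RtoC a * (RtoC ((/2)^n) * u) + RtoC b * (RtoC ((/2)^n) * v))%C
   with (p + RtoC (fst st + a * (/2)^n) * u + RtoC (snd st + b * (/2)^n) * v)%C
   by (rewrite !RtoC_plus, !RtoC_mult; ring).
  apply Hf; nra.
Qed.

(** One of the four quarters carries at least a quarter of the integral. The condition [good] stands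
    below the existential so that choice yields a total step function. *)
Lemma bisect_step (st : R * R) (n : nat) : exists st' : R * R, good st n ->
  good st' (S n) /\ fst st <= fst st' <= fst st + (/2)^(S n) /\ snd st <= snd st' <= snd st + (/2)^(S n) /\
  Cmod (sq st n) <= 4 * Cmod (sq st' (S n)).
Proof.
  destruct (classic (good st n)) as [G|G]; [|exists st; tauto].
  pose proof (loop_quarter _ _ _ _ (holo_on_sub st n G)) as Q.
  pose proof (pow_half_pos (S n)) as Hp.
  assert (Hp2 : (/2)^n = 2 * (/2)^(S n)) by (simpl; field).
  assert (Hu : (RtoC ((/2)^n) * u / 2 = RtoC ((/2)^(S n)) * u)%C).
  { rewrite Hp2, RtoC_mult. unfold Cdiv. field. }
  assert (Hv : (RtoC ((/2)^n) * v / 2 = RtoC ((/2)^(S n)) * v)%C).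
  { rewrite Hp2, RtoC_mult. unfold Cdiv. field. }
  rewrite Hu, Hv in Q.
  set (h := (/2)^(S n)) in *.
  assert (E : sq st n = (sq st (S n) + sq ((fst st + h)%R, snd st) (S n) + sq (fst st, (snd st + h)%R) (S n)
     + sq ((fst st + h)%R, (snd st + h)%R) (S n))%C).
  { unfold sq. rewrite Q. simpl fst; simpl snd. fold h.
    f_equal; [f_equal; [f_equal|]|]; f_equal; rewrite !RtoC_plus; ring. }
  destruct G as [G1 G2].
  assert (GG : good st (S n) /\ good (fst st + h, snd st) (S n) /\ good (fst st, snd st + h) (S n)
     /\ good (fst st + h, snd st + h) (S n)).
  { unfold good; fold h; simpl fst; simpl snd. repeat split; lra. }
  destruct GG as [GA [GB [GC GD]]].
  assert (T : Cmod (sq st n) <= Cmod (sq st (S n)) + Cmod (sq (fst st + h, snd st) (S n))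
     + Cmod (sq (fst st, snd st + h) (S n)) + Cmod (sq (fst st + h, snd st + h) (S n))).
  { rewrite E. eapply Rle_trans; [apply Cmod_triangle|]. apply Rplus_le_compat_r.
    eapply Rle_trans; [apply Cmod_triangle|]. apply Rplus_le_compat_r. apply Cmod_triangle. }
  destruct (Rle_lt_dec (Cmod (sq st n)) (4 * Cmod (sq st (S n)))) as [L|L1].
  { exists st. intros _. repeat split; try apply GA; try lra. }
  destruct (Rle_lt_dec (Cmod (sq st n)) (4 * Cmod (sq (fst st + h, snd st) (S n)))) as [L|L2].
  { eexists. intros _. split; [exact GB|]. simpl fst; simpl snd. repeat split; lra. }
  destruct (Rle_lt_dec (Cmod (sq st n)) (4 * Cmod (sq (fst st, snd st + h) (S n)))) as [L|L3].
  { eexists. intros _. split; [exact GC|]. simpl fst; simpl snd. repeat split; lra. }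
  eexists. intros _. split; [exact GD|]. simpl fst; simpl snd. repeat split; lra.
Qed.

Lemma nested_limit (x : nat -> R) :
  (forall n, x n <= x (S n) <= x n + (/2)^(S n)) -> exists l, forall n, x n <= l <= x n + (/2)^n.
Proof.
  intros H.
  assert (Hm : forall n k, x n <= x (n + k)%nat <= x n + (/2)^n - (/2)^(n + k)).
  { intros n k. induction k as [|k IH].
    - rewrite Nat.add_0_r. lra.
    - rewrite Nat.add_succ_r. specialize (H (n + k)%nat). simpl in H |- *. lra. }
  assert (Hb : forall n m, x m <= x n + (/2)^n).
  { intros n m. destruct (le_lt_dec n m) as [L|L].
    - replace m with (n + (m - n))%nat by lia. specialize (Hm n (m - n)%nat).
      pose proof (pow_half_pos (n + (m - n))). lra.
    - specialize (Hm m (n - m)%nat). replace (m + (n - m))%nat with n in Hm by lia.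
      pose proof (pow_half_pos n). lra. }
  destruct (completeness (fun y => exists n, y = x n)) as [l [Hl1 Hl2]].
  - exists (x 0%nat + (/2)^0). intros y [n ->]. apply Hb.
  - exists (x 0%nat), 0%nat. reflexivity.
  - exists l. intros n. split.
    + apply Hl1. exists n. reflexivity.
    + apply Hl2. intros y [m ->]. apply Hb.
Qed.

(** The chosen pieces keep at least 4^-n of the integral, whereas at their common point the affine
    approximation makes the integral of a piece smaller than any given multiple of 4^-n. *)
Theorem goursat : loop f p u v = 0.
Proof.
  apply Cmod_eq_0. apply Rle_antisym; [|apply Cmod_ge_0].
  apply Rnot_lt_le. intros Hpos.
  set (step := fun st n => proj1_sig (constructive_indefinite_description _ (bisect_step st n))).
  set (seqn := nat_rect (fun _ => (R * R)%type) (0, 0) (fun n st => step st n)).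
  assert (Hinv : forall n, good (seqn n) n /\ Cmod (loop f p u v) <= 4 ^ n * Cmod (sq (seqn n) n)).
  { induction n as [|n [IH1 IH2]].
    - split; [unfold good; simpl; lra|]. simpl. unfold sq; simpl fst; simpl snd. right.
      rewrite Rmult_1_l. do 2 f_equal; simpl pow; ring.
    - simpl seqn. unfold step. destruct (constructive_indefinite_description _ _) as [st' Hst]. simpl.
      destruct (Hst IH1) as [A [_ [_ D]]]. split; [exact A|].
      eapply Rle_trans; [exact IH2|]. fold seqn. simpl pow.
      rewrite (Rmult_comm 4), Rmult_assoc. apply Rmult_le_compat_l; [apply pow_le; lra|exact D]. }
  assert (Hst : forall n, fst (seqn n) <= fst (seqn (S n)) <= fst (seqn n) + (/2)^(S n) /\
     snd (seqn n) <= snd (seqn (S n)) <= snd (seqn n) + (/2)^(S n)).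
  { intros n. destruct (Hinv n) as [G _]. simpl seqn. unfold step.
    destruct (constructive_indefinite_description _ _) as [st' Hst]. simpl proj1_sig.
    destruct (Hst G) as [_ [B1 [B2 _]]]. split; assumption. }
  destruct (nested_limit (fun n => fst (seqn n))) as [a Ha]; [intros n; apply Hst|].
  destruct (nested_limit (fun n => snd (seqn n))) as [b Hb]; [intros n; apply Hst|].
  assert (Ha1 : 0 <= a <= 1).
  { pose proof (Ha 0%nat) as H. simpl in H. lra. }
  assert (Hb1 : 0 <= b <= 1).
  { pose proof (Hb 0%nat) as H. simpl in H. lra. }
  set (z := (p + RtoC a * u + RtoC b * v)%C).
  destruct (Hf a b Ha1 Hb1) as [l Hl]. fold z in Hl.
  set (D := Cmod u + Cmod v).
  pose proof (Cmod_ge_0 u) as Hu0. pose proof (Cmod_ge_0 v) as Hv0.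
  assert (HD : 0 <= D) by (unfold D; lra).
  set (m := Cmod (loop f p u v)) in *.
  (* Chosen so that the final bound 2 D^2 eps is strictly below m. *)
  set (eps := m / (4 * (D * D + 1))).
  assert (Heps : 0 < eps) by (apply Rdiv_lt_0_compat; nra).
  destruct (Hl eps Heps) as [d [Hd Hd']].
  assert (Hn : exists n, D * (/2)^n < d).
  { destruct (pow_lt_1_zero (/2) ltac:(rewrite Rabs_right; lra) (d / (D + 1)) ltac:(apply Rdiv_lt_0_compat; lra)) as [n Hn].
    exists n. specialize (Hn n (le_n n)). rewrite Rabs_right in Hn by (apply Rle_ge, pow_le; lra).
    apply (Rmult_lt_compat_l (D + 1)) in Hn; [|lra].
    replace ((D + 1) * (d / (D + 1))) with d in Hn by (field; lra).
    pose proof (pow_half_pos n). nra. }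
  destruct Hn as [n Hn]. destruct (Hinv n) as [G Hm]. pose proof (pow_half_pos n) as Hp.
  set (h := (/2)^n) in *.
  assert (Hsq : Cmod (sq (seqn n) n) <= 2 * (Cmod (RtoC h * u) + Cmod (RtoC h * v)) * (eps * (D * h))).
  { unfold sq. apply (loop_affine_approx f (f z - l * z) l); [apply holo_on_sub, G|].
    fold h. intros s t Hs Ht.
    set (w := (p + RtoC (fst (seqn n)) * u + RtoC (snd (seqn n)) * v + RtoC s * (RtoC h * u) + RtoC t * (RtoC h * v))%C).
    replace (f w - (f z - l * z + l * w))%C with (f w - f z - l * (w - z))%C by ring.
    assert (Hwz : Cmod (w - z) <= D * h).
    { replace (w - z)%C with (RtoC (fst (seqn n) + s * h - a) * u + RtoC (snd (seqn n) + t * h - b) * v)%C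
        by (unfold w, z; rewrite !RtoC_minus, !RtoC_plus, !RtoC_mult; ring).
      eapply Rle_trans; [apply Cmod_triangle|]. rewrite !Cmod_mult, !Cmod_R.
      pose proof (Ha n) as Han. pose proof (Hb n) as Hbn. fold h in Han, Hbn.
      assert (R1 : Rabs (fst (seqn n) + s * h - a) <= h) by (apply Rabs_le; nra).
      assert (R2 : Rabs (snd (seqn n) + t * h - b) <= h) by (apply Rabs_le; nra).
      unfold D. nra. }
    eapply Rle_trans; [apply Hd'; lra|]. apply Rmult_le_compat_l; lra. }
  rewrite !Cmod_mult, !Cmod_R, !(Rabs_right h) in Hsq by lra.
  assert (H4 : 4 ^ n * (h * h) = 1).
  { unfold h. rewrite <- !Rpow_mult_distr. replace (4 * (/2 * /2)) with 1 by field. apply pow1. }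
  assert (Hfin : m <= 2 * (D * D) * eps).
  { eapply Rle_trans; [exact Hm|].
    apply Rle_trans with (4 ^ n * (2 * (h * Cmod u + h * Cmod v) * (eps * (D * h)))).
    - apply Rmult_le_compat_l; [apply pow_le; lra|exact Hsq].
    - right. replace (4 ^ n * (2 * (h * Cmod u + h * Cmod v) * (eps * (D * h))))
        with ((4 ^ n * (h * h)) * (2 * (D * D) * eps)) by (unfold D; ring). rewrite H4. ring. }
  assert (Hc : 2 * (D * D) * eps < m).
  { unfold eps. apply Rlt_le_trans with (4 * (D * D + 1) * (m / (4 * (D * D + 1)))).
    - apply Rmult_lt_compat_r; [exact Heps|nra].
    - right. field. nra. }
  lra.
Qed.
End Bisection.

(** * The complex exponential *)

Lemma cis_plus (a b : R) : cis (a + b) = (cis a * cis b)%C.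
Proof. unfold cis, Cmult; simpl. rewrite cos_plus, sin_plus. f_equal; ring. Qed.

Lemma cis_0 : cis 0 = 1.
Proof. unfold cis. rewrite cos_0, sin_0. reflexivity. Qed.

Lemma Cmod_cis (a : R) : Cmod (cis a) = 1.
Proof.
  pose proof (sin2_cos2 a) as H. unfold Rsqr in H. unfold Cmod, cis; simpl.
  replace (cos a * (cos a * 1) + sin a * (sin a * 1)) with 1 by lra. apply sqrt_1.
Qed.

Lemma cis_neq_0 (a : R) : cis a <> 0.
Proof. apply Cmod_gt_0. rewrite Cmod_cis. lra. Qed.

Lemma cis_2PI : cis (2 * PI) = 1.
Proof. unfold cis. rewrite cos_2PI, sin_2PI. reflexivity. Qed.

Lemma cis_opp (a : R) : cis (- a) = (/ cis a)%C.
Proof.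
  assert (H : (cis (- a) * cis a)%C = 1) by (rewrite <- cis_plus; replace (- a + a) with 0 by ring; apply cis_0).
  rewrite <- (Cmult_1_l (/ cis a)), <- H. field. apply cis_neq_0.
Qed.

Lemma cis_pow (a : R) (n : nat) : (cis a ^ n)%C = cis (INR n * a).
Proof.
  induction n as [|n IH]; [simpl; rewrite Rmult_0_l, cis_0; reflexivity|].
  rewrite Cpow_S, IH, <- cis_plus, S_INR. f_equal. ring.
Qed.

Lemma Cexp_plus (z w : C) : Cexp (z + w) = (Cexp z * Cexp w)%C.
Proof.
  unfold Cexp. change (Re (z + w)%C) with (Re z + Re w)%R. change (Im (z + w)%C) with (Im z + Im w)%R.
  rewrite exp_plus, cis_plus, RtoC_mult. ring.
Qed.

Lemma Cexp_0 : Cexp 0 = 1.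
Proof. unfold Cexp; simpl. rewrite exp_0, cis_0. ring. Qed.

Lemma Cmod_Cexp (z : C) : Cmod (Cexp z) = exp (Re z).
Proof.
  unfold Cexp. rewrite Cmod_mult, Cmod_cis, Cmod_R, Rabs_right; [ring|].
  apply Rle_ge, Rlt_le, exp_pos.
Qed.

Lemma exp_le (x y : R) : x <= y -> exp x <= exp y.
Proof. intros [H|H]; [apply Rlt_le, exp_increasing, H|rewrite H; apply Rle_refl]. Qed.

Lemma exp_ge_1 (x : R) : 0 <= x -> 1 <= exp x.
Proof. intros H. rewrite <- exp_0. apply exp_le, H. Qed.

Lemma Re_le_Cmod (z : C) : Re z <= Cmod z.
Proof. eapply Rle_trans; [apply Rle_abs|apply re_le_Cmod]. Qed.

Lemma im_le_Cmod (z : C) : Rabs (Im z) <= Cmod z.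
Proof. eapply Rle_trans; [|apply Rmax_Cmod]. apply Rmax_r. Qed.

(** Only this derivative along a line through 0 is computed in components. Integrating it twice
    gives the quadratic estimate at 0, and the addition law carries that estimate to every point in
    [cder_Cexp]. *)
Lemma Cexp_curve_der (w : C) (t : R) :
  curve_der (fun s => Cexp (RtoC s * w)) t (w * Cexp (RtoC t * w))%C.
Proof.
  destruct w as [x y].
  pose (g := fun s => (exp (s * x) * cos (s * y), exp (s * x) * sin (s * y))).
  assert (E : forall s, Cexp (RtoC s * (x, y)) = g s).
  { intros s. unfold g, Cexp, cis, Cmult, RtoC; simpl.
    replace (s * x - 0 * y) with (s * x) by ring. replace (s * y + 0 * x) with (s * y) by ring.
    f_equal; ring. }
  apply (is_derive_ext (K := R_AbsRing) (V := C_R_NormedModule) g); [intros; symmetry; apply E|].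
  rewrite E. unfold g.
  set (cc := exp (t * x) * cos (t * y)). set (ss := exp (t * x) * sin (t * y)).
  change ((x, y) * (cc, ss))%C with ((x * cc - y * ss, x * ss + y * cc) : C).
  apply curve_der_eps. intros e He.
  assert (D1 : is_derive (fun s => exp (s * x) * cos (s * y)) t (x * cc - y * ss)).
  { unfold cc, ss. auto_derive; [trivial|ring]. }
  assert (D2 : is_derive (fun s => exp (s * x) * sin (s * y)) t (x * ss + y * cc)).
  { unfold cc, ss. auto_derive; [trivial|ring]. }
  destruct D1 as [_ D1]. destruct D2 as [_ D2].
  assert (He2 : 0 < e / sqrt 2) by (apply Rdiv_lt_0_compat; [lra|apply sqrt_lt_R0; lra]).
  destruct (D1 t (fun P HP => HP) (mkposreal _ He2)) as [d1 H1].
  destruct (D2 t (fun P HP => HP) (mkposreal _ He2)) as [d2 H2].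
  exists (Rmin d1 d2). split; [apply Rmin_pos; apply cond_pos|]. intros s Hs.
  specialize (H1 s ltac:(eapply Rlt_le_trans; [exact Hs|apply Rmin_l])).
  specialize (H2 s ltac:(eapply Rlt_le_trans; [exact Hs|apply Rmin_r])).
  eapply Rle_trans; [apply Cmod_2Rmax|].
  apply Rle_trans with (sqrt 2 * (e / sqrt 2 * Rabs (s - t))).
  - apply Rmult_le_compat_l; [apply sqrt_pos|]. apply Rmax_lub.
    + eapply Rle_trans; [|exact H1]. right. unfold norm; simpl. unfold abs; simpl.
      f_equal. unfold minus, plus, opp, scal; simpl. unfold mult; simpl. ring.
    + eapply Rle_trans; [|exact H2]. right. unfold norm; simpl. unfold abs; simpl.
      f_equal. unfold minus, plus, opp, scal; simpl. unfold mult; simpl. ring.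
  - right. field. apply Rgt_not_eq, sqrt_lt_R0; lra.
Qed.

Lemma ccont_Cexp (w : C) (t : R) : ccont (fun s => Cexp (RtoC s * w)) t.
Proof. eapply curve_der_cont, Cexp_curve_der. Qed.

Lemma Cmod_Cexp_scal_le (w : C) (t : R) : 0 <= t <= 1 -> Cmod (Cexp (RtoC t * w)) <= exp (Cmod w).
Proof.
  intros Ht. rewrite Cmod_Cexp. apply exp_le. eapply Rle_trans; [apply Re_le_Cmod|].
  rewrite Cmod_mult, Cmod_R, Rabs_right by lra. pose proof (Cmod_ge_0 w). nra.
Qed.

Lemma Cexp_int (w : C) : is_CInt (fun t => w * Cexp (RtoC t * w))%C 0 1 (Cexp w - 1)%C.
Proof.
  replace (Cexp w - 1)%C with (Cexp (RtoC 1 * w) - Cexp (RtoC 0 * w))%C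
    by (rewrite Cmult_1_l, Cmult_0_l, Cexp_0; reflexivity).
  apply (CInt_derive (fun s => Cexp (RtoC s * w))); [lra| |]; intros t _.
  - apply Cexp_curve_der.
  - apply ccont_mult; [apply ccont_const|apply ccont_Cexp].
Qed.

Lemma Cexp_minus_1_bound (w : C) : Cmod (Cexp w - 1) <= Cmod w * exp (Cmod w).
Proof.
  eapply Rle_trans; [eapply (CInt_bound _ 0 1 (Cmod w * exp (Cmod w))); [lra| |apply Cexp_int]|lra].
  intros t Ht. cbv beta. rewrite Cmod_mult. apply Rmult_le_compat_l; [apply Cmod_ge_0|].
  apply Cmod_Cexp_scal_le, Ht.
Qed.

Lemma Cexp_quad_bound (w : C) : Cmod (Cexp w - 1 - w) <= Cmod w * Cmod w * exp (Cmod w).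
Proof.
  pose proof (Cexp_int w) as I.
  pose proof (is_CInt_minus _ _ _ _ _ _ I (is_CInt_const w 0 1)) as J.
  replace (RtoC (1 - 0) * w)%C with w in J by (rewrite Rminus_0_r; ring).
  eapply Rle_trans; [eapply (CInt_bound _ 0 1 (Cmod w * Cmod w * exp (Cmod w))); [lra| |exact J]|lra].
  intros t Ht. cbv beta.
  replace (w * Cexp (RtoC t * w) - w)%C with (w * (Cexp (RtoC t * w) - 1))%C by ring.
  rewrite Cmod_mult, Rmult_assoc. apply Rmult_le_compat_l; [apply Cmod_ge_0|].
  eapply Rle_trans; [apply Cexp_minus_1_bound|].
  assert (L : Cmod (RtoC t * w) <= Cmod w).
  { rewrite Cmod_mult, Cmod_R, Rabs_right by lra. pose proof (Cmod_ge_0 w). nra. }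
  apply Rmult_le_compat; [apply Cmod_ge_0|apply Rlt_le, exp_pos|exact L|apply exp_le, L].
Qed.

Lemma cder_Cexp (z : C) : cder Cexp z (Cexp z).
Proof.
  intros e He.
  pose proof (exp_pos (Re z)) as Hp. pose proof (exp_pos 1) as Hp1.
  assert (Hd : 0 < e / (exp (Re z) * exp 1)) by (apply Rdiv_lt_0_compat; [lra|apply Rmult_lt_0_compat; lra]).
  exists (Rmin 1 (e / (exp (Re z) * exp 1))).
  split; [apply Rmin_pos; lra|]. intros w Hw.
  assert (H1 : Cmod (w - z) < 1) by (eapply Rlt_le_trans; [exact Hw|apply Rmin_l]).
  assert (H2 : Cmod (w - z) < e / (exp (Re z) * exp 1)) by (eapply Rlt_le_trans; [exact Hw|apply Rmin_r]).
  replace (Cexp w) with (Cexp z * Cexp (w - z))%C by (rewrite <- Cexp_plus; f_equal; ring).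
  replace (Cexp z * Cexp (w - z) - Cexp z - Cexp z * (w - z))%C
    with (Cexp z * (Cexp (w - z) - 1 - (w - z)))%C by ring.
  rewrite Cmod_mult, Cmod_Cexp.
  pose proof (Cexp_quad_bound (w - z)) as Q.
  pose proof (Cmod_ge_0 (w - z)) as Hx. set (x := Cmod (w - z)) in *.
  assert (E : exp x <= exp 1) by (apply exp_le; lra).
  apply Rle_trans with (exp (Re z) * (x * x * exp 1)).
  { apply Rmult_le_compat_l; [lra|]. eapply Rle_trans; [exact Q|]. apply Rmult_le_compat_l; [nra|exact E]. }
  apply Rle_trans with (exp (Re z) * exp 1 * x * (e / (exp (Re z) * exp 1))).
  { replace (exp (Re z) * (x * x * exp 1)) with (exp (Re z) * exp 1 * x * x) by ring.
    apply Rmult_le_compat_l; [|lra]. repeat apply Rmult_le_pos; lra. }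
  right. field. lra.
Qed.

(** * Cauchy's formula and Taylor expansion on discs *)

(** The circle average, that is, the contour integral of f(w) / (w - a) divided by 2 PI i. *)
Definition mean (f : C -> C) (a : C) (r : R) : C :=
  CInt (fun t => f (a + RtoC r * cis (2 * PI * t)))%C 0 1.

Lemma ccont_circle (a : C) (r t : R) : ccont (fun t => a + RtoC r * cis (2 * PI * t))%C t.
Proof.
  apply ccont_plus; [apply ccont_const|]. apply ccont_mult; [apply ccont_const|].
  apply ccont_cis. apply (continuous_mult (K := R_AbsRing)); [apply continuous_const|apply continuous_id].
Qed.

Lemma circle_dist (a : C) (r t : R) : 0 <= r -> Cmod (a + RtoC r * cis (2 * PI * t) - a) = r.
Proof.
  intros Hr. replace (a + RtoC r * cis (2 * PI * t) - a)%C with (RtoC r * cis (2 * PI * t))%C by ring.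
  rewrite Cmod_mult, Cmod_cis, Cmod_R, Rabs_right by lra. ring.
Qed.

Lemma mean_correct (f : C -> C) (a : C) (r : R) : 0 <= r ->
  (forall z, Cmod (z - a) = r -> holo_at f z) ->
  is_CInt (fun t => f (a + RtoC r * cis (2 * PI * t)))%C 0 1 (mean f a r).
Proof.
  intros Hr H. apply CInt_correct; [lra|]. intros t _.
  apply (holo_at_ccont f (fun t => a + RtoC r * cis (2 * PI * t))%C); [|apply ccont_circle].
  apply H, circle_dist, Hr.
Qed.

Lemma Cexp_ln (r t : R) : 0 < r -> Cexp (ln r, t) = (RtoC r * cis t)%C.
Proof. intros Hr. unfold Cexp; simpl. rewrite exp_ln by exact Hr. reflexivity. Qed.

(** In the coordinate w = log (z - a) the annulus is a rectangle of height 2 PI. Its horizontal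
    sides cancel by periodicity, and [goursat] equates the vertical ones, which are the two
    means. *)
Lemma mean_annulus (f : C -> C) (a : C) (R1 R2 r1 r2 : R) :
  (forall z, R1 < Cmod (z - a) < R2 -> holo_at f z) ->
  0 < r1 -> R1 < r1 -> r1 <= r2 -> r2 < R2 -> mean f a r1 = mean f a r2.
Proof.
  intros H Hr1 HR1 H12 HR2.
  set (h := fun w => f (a + Cexp w)%C).
  set (p := (ln r1, 0) : C). set (u := (ln r2 - ln r1, 0) : C). set (v := (0, 2 * PI) : C).
  assert (Hr2 : 0 < r2) by lra.
  assert (HL : ln r1 <= ln r2) by (destruct H12 as [H12|H12]; [left; apply ln_increasing; lra|rewrite H12; lra]).
  assert (Hpar : holo_on_par h p u v).
  { intros s t Hs Ht. unfold h.
    set (w := (p + RtoC s * u + RtoC t * v)%C).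
    assert (Hw : Re w = ln r1 + s * (ln r2 - ln r1)) by (unfold w, p, u, v; simpl; ring).
    assert (B : r1 <= exp (Re w) <= r2).
    { rewrite Hw. split.
      - rewrite <- (exp_ln r1) at 1 by exact Hr1. apply exp_le. nra.
      - rewrite <- (exp_ln r2) at 2 by exact Hr2. apply exp_le. nra. }
    destruct (H (a + Cexp w)%C) as [l Hl].
    { replace (a + Cexp w - a)%C with (Cexp w) by ring. rewrite Cmod_Cexp. lra. }
    exists (l * (0 + Cexp w))%C. apply (cder_comp f (fun w => a + Cexp w)%C); [exact Hl|].
    apply cder_plus; [apply cder_const|apply cder_Cexp]. }
  pose proof (goursat h p u v Hpar) as G. unfold loop in G.
  assert (E1 : seg h (p + v) u = seg h p u).
  { unfold seg. f_equal. apply functional_extensionality. intros t. f_equal. unfold h. do 2 f_equal.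
    replace (p + v + RtoC t * u)%C with ((p + RtoC t * u) + v)%C by ring. rewrite Cexp_plus.
    replace (Cexp v) with (RtoC 1); [ring|]. unfold Cexp, v; simpl. rewrite exp_0, cis_2PI. ring. }
  assert (E2 : forall r, 0 < r -> R1 < r < R2 -> seg h (ln r, 0) v = (v * mean f a r)%C).
  { intros r Hr HRr. unfold seg. apply is_CInt_unique.
    pose proof (is_CInt_scal v _ 0 1 _ (mean_correct f a r ltac:(lra) ltac:(intros z Hz; apply H; lra))) as I.
    eapply is_CInt_ext; [lra| |exact I]. intros t _. cbv beta. unfold h. do 3 f_equal.
    rewrite <- Cexp_ln by exact Hr. f_equal. unfold v. apply injective_projections; simpl; ring. }
  rewrite E1 in G.
  replace (p + u)%C with ((ln r2, 0) : C) in G by (unfold p, u; apply injective_projections; simpl; ring).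
  unfold p in G. rewrite (E2 r1), (E2 r2) in G by lra.
  assert (Hv : v <> 0).
  { unfold v. intros E. injection E. intros E'. pose proof PI_RGT_0. lra. }
  assert (G2 : (v * (mean f a r2 - mean f a r1))%C = 0).
  { rewrite <- G. ring. }
  destruct (Ceq_dec (mean f a r2 - mean f a r1)%C 0) as [Z|Z].
  - replace (mean f a r1) with (mean f a r2 - (mean f a r2 - mean f a r1))%C by ring. rewrite Z. ring.
  - exfalso. exact (Cmult_neq_0 _ _ Hv Z G2).
Qed.

Lemma Ceq_of_small (x y : C) : (forall e, 0 < e -> Cmod (x - y) <= e) -> x = y.
Proof.
  intros H. assert (E : Cmod (x - y) = 0).
  { apply Rle_antisym; [|apply Cmod_ge_0]. apply Rnot_lt_le. intros P.
    specialize (H (Cmod (x - y) / 2) ltac:(lra)). lra. }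
  apply Cmod_eq_0 in E. replace x with ((x - y) + y)%C by ring. rewrite E. ring.
Qed.

(** The mean does not depend on the radius and tends to f a as the radius shrinks. Continuity at the
    centre is what a filled-in difference quotient offers there. *)
Lemma mean_center (f : C -> C) (a : C) (R0 r : R) : 0 < r < R0 ->
  (forall z, 0 < Cmod (z - a) < R0 -> holo_at f z) ->
  (forall e, 0 < e -> exists d, 0 < d /\ forall z, Cmod (z - a) < d -> Cmod (f z - f a) < e) ->
  mean f a r = f a.
Proof.
  intros Hr H Hc. apply Ceq_of_small. intros e He.
  destruct (Hc e He) as [d [Hd Hd']].
  set (r' := Rmin (d / 2) r).
  assert (Hr' : 0 < r' <= r /\ r' < d).
  { unfold r'. repeat split.
    - apply Rmin_pos; lra.
    - apply Rmin_r.
    - eapply Rle_lt_trans; [apply Rmin_l|lra]. }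
  rewrite <- (mean_annulus f a 0 R0 r' r); try lra; [|exact H].
  assert (I : is_CInt (fun t => f (a + RtoC r' * cis (2 * PI * t)) - f a)%C 0 1 (mean f a r' - RtoC (1 - 0) * f a)%C).
  { apply is_CInt_minus; [apply mean_correct; [lra|intros z Hz; apply H; lra]|apply is_CInt_const]. }
  replace (mean f a r' - RtoC (1 - 0) * f a)%C with (mean f a r' - f a)%C in I by (rewrite Rminus_0_r; ring).
  eapply Rle_trans; [eapply (CInt_bound _ 0 1 e); [lra| |exact I]|lra].
  intros t _. apply Rlt_le, Hd'. rewrite circle_dist; lra.
Qed.

(** Compactness of [0,1] makes continuity in the parameter uniform along the circle; this gives
    continuity of the mean in the radius. *)
Lemma param_unif_cont (F : R -> R -> C) (r0 : R) :
  (forall t, 0 <= t <= 1 -> forall e, 0 < e -> exists d, 0 < d /\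
     forall r s, Rabs (r - r0) < d -> Rabs (s - t) < d -> Cmod (F r s - F r0 t) < e) ->
  forall e, 0 < e -> exists d, 0 < d /\
     forall r s, Rabs (r - r0) < d -> 0 <= s <= 1 -> Cmod (F r s - F r0 s) < e.
Proof.
  intros H e He.
  assert (Hd : forall t, exists d : posreal, 0 <= t <= 1 ->
     forall r s, Rabs (r - r0) < d -> Rabs (s - t) < d -> Cmod (F r s - F r0 t) < e / 2).
  { intros t. destruct (classic (0 <= t <= 1)) as [Ht|Ht].
    - destruct (H t Ht (e/2) ltac:(lra)) as [d [Hd Hd']]. exists (mkposreal d Hd). intros _. exact Hd'.
    - exists (mkposreal 1 Rlt_0_1). tauto. }
  set (delta := fun t => proj1_sig (constructive_indefinite_description _ (Hd t))).
  destruct (compactness_value_1d 0 1 delta) as [d Hc].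
  exists d. split; [apply cond_pos|]. intros r s Hr Hs.
  (* [compactness_value_1d] yields its covering point under a double negation. *)
  apply NNPP. intros N. apply (Hc s Hs). intros [t [Ht [Hst Hdt]]]. apply N.
  unfold delta in Hst, Hdt. destruct (constructive_indefinite_description _ (Hd t)) as [dt Hdt']. simpl in Hst, Hdt.
  specialize (Hdt' Ht).
  pose proof (Hdt' r s ltac:(lra) Hst) as A1.
  pose proof (Hdt' r0 s ltac:(rewrite Rminus_diag, Rabs_R0; apply cond_pos) Hst) as A2.
  replace (F r s - F r0 s)%C with ((F r s - F r0 t) - (F r0 s - F r0 t))%C by ring.
  eapply Rle_lt_trans; [apply Cmod_triangle_sub|]. lra.
Qed.

Definition cont_at (f : C -> C) (z : C) : Prop :=
  forall e, 0 < e -> exists d, 0 < d /\ forall w, Cmod (w - z) < d -> Cmod (f w - f z) < e.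

Lemma holo_cont_at (f : C -> C) (z : C) : holo_at f z -> cont_at f z.
Proof. intros [l Hl]. exact (cder_cont f z l Hl). Qed.

Lemma cont_at_ccont (f : C -> C) (g : R -> C) (t : R) :
  cont_at f (g t) -> ccont g t -> ccont (fun s => f (g s)) t.
Proof.
  intros Hf Hg. apply ccont_eps. intros e He. destruct (Hf e He) as [d [Hd H]].
  destruct (proj1 (ccont_eps g t) Hg d Hd) as [d' [Hd' H']]. exists d'. split; auto.
Qed.

Lemma mean_correct_cont (f : C -> C) (a : C) (r : R) : 0 <= r ->
  (forall z, Cmod (z - a) = r -> cont_at f z) ->
  is_CInt (fun t => f (a + RtoC r * cis (2 * PI * t)))%C 0 1 (mean f a r).
Proof.
  intros Hr H. apply CInt_correct; [lra|]. intros t _.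
  apply (cont_at_ccont f (fun t => a + RtoC r * cis (2 * PI * t))%C); [|apply ccont_circle].
  apply H, circle_dist, Hr.
Qed.

Lemma mean_cont (f : C -> C) (a : C) (R0 r0 : R) : 0 < r0 < R0 ->
  (forall z, Cmod (z - a) < R0 -> cont_at f z) ->
  forall e, 0 < e -> exists d, 0 < d /\
    forall r, 0 <= r -> Rabs (r - r0) < d -> Cmod (mean f a r - mean f a r0) <= e.
Proof.
  intros Hr0 H e He.
  destruct (param_unif_cont (fun r t => f (a + RtoC r * cis (2 * PI * t))%C) r0) with (e := e) as [d [Hd Hd']]; [|exact He|].
  - intros t Ht e' He'.
    destruct (H (a + RtoC r0 * cis (2 * PI * t))%C ltac:(rewrite circle_dist; lra) e' He') as [d [Hd Hf]].
    destruct (proj1 (ccont_eps _ _) (ccont_circle a r0 t) (d / 2) ltac:(lra)) as [d2 [Hd2 Hc]].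
    exists (Rmin (d / 2) d2). split; [apply Rmin_pos; lra|]. intros r s Hr Hs. apply Hf.
    assert (Hr1 : Rabs (r - r0) < d / 2) by (eapply Rlt_le_trans; [exact Hr|apply Rmin_l]).
    assert (Hs1 : Rabs (s - t) < d2) by (eapply Rlt_le_trans; [exact Hs|apply Rmin_r]).
    replace (a + RtoC r * cis (2 * PI * s) - (a + RtoC r0 * cis (2 * PI * t)))%C
      with (RtoC (r - r0) * cis (2 * PI * s) + (a + RtoC r0 * cis (2 * PI * s) - (a + RtoC r0 * cis (2 * PI * t))))%C
      by (rewrite RtoC_minus; ring).
    eapply Rle_lt_trans; [apply Cmod_triangle|].
    rewrite Cmod_mult, Cmod_cis, Cmod_R. specialize (Hc s Hs1). lra.
  - exists (Rmin d (R0 - r0)). split; [apply Rmin_pos; lra|]. intros r Hr Hrd.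
    assert (H1 : Rabs (r - r0) < d) by (eapply Rlt_le_trans; [exact Hrd|apply Rmin_l]).
    assert (H2 : Rabs (r - r0) < R0 - r0) by (eapply Rlt_le_trans; [exact Hrd|apply Rmin_r]).
    apply Rabs_def2 in H2.
    assert (I : is_CInt (fun t => f (a + RtoC r * cis (2 * PI * t)) - f (a + RtoC r0 * cis (2 * PI * t)))%C 0 1 (mean f a r - mean f a r0)%C).
    { apply is_CInt_minus; apply mean_correct_cont; try lra; intros z Hz; apply H; lra. }
    eapply Rle_trans; [eapply (CInt_bound _ 0 1 e); [lra| |exact I]|lra].
    intros t Ht. apply Rlt_le, Hd'; assumption.
Qed.

Lemma Cmod_sub_pos (z w : C) : z <> w -> 0 < Cmod (z - w).
Proof.
  intros H. apply Cmod_gt_0. intros E. apply H. replace z with ((z - w) + w)%C by ring. rewrite E. ring.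
Qed.

(* The difference quotient has a removable singularity at z.  Its circular mean is constant below and above
   the radius |z - a| and continuous across it, so it equals the value at the centre. *)
Lemma cauchy_quotient (f : C -> C) (a z : C) (R0 r : R) :
  (forall w, Cmod (w - a) < R0 -> holo_at f w) -> Cmod (z - a) < r -> r < R0 ->
  is_CInt (fun t => (f (a + RtoC r * cis (2 * PI * t)) - f z) / (a + RtoC r * cis (2 * PI * t) - z)
       * (RtoC r * cis (2 * PI * t)))%C 0 1 (RtoC 0).
Proof.
  intros H Hz HrR. pose proof (Cmod_ge_0 (z - a)) as Hz0.
  destruct (H z ltac:(lra)) as [l Hl].
  set (G := fun w : C => if Ceq_dec w z then l else ((f w - f z) / (w - z))%C).
  (* The factor w - a makes the value at the centre 0 and turns the mean into the contour integral
     of the difference quotient. *)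
  set (Hh := fun w : C => (G w * (w - a))%C).
  assert (Gh : forall w, w <> z -> Cmod (w - a) < R0 -> holo_at Hh w).
  { intros w Hwz HwR. pose proof (Cmod_sub_pos w z Hwz) as Hp.
    destruct (H w HwR) as [m Hm].
    assert (Dg : holo_at (fun w => (f w - f z) * / (w - z))%C w).
    { eexists. apply cder_mult.
      - apply cder_minus; [exact Hm|apply cder_const].
      - apply cder_inv; [apply Cmod_gt_0; exact Hp|]. apply cder_minus; [apply cder_id|apply cder_const]. }
    destruct Dg as [m' Hm']. eexists. unfold Hh. apply cder_mult.
    - apply (cder_ext_loc (fun w => (f w - f z) * / (w - z))%C G w m' _ Hp); [|exact Hm'].
      intros w' Hw'. unfold G. destruct (Ceq_dec w' z) as [E|E]; [|reflexivity].
      exfalso. subst w'. rewrite Cmod_sub_sym in Hw'. lra.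
    - apply cder_minus; [apply cder_id|apply cder_const]. }
  assert (Gc : cont_at Hh z).
  { intros e He.
    destruct (Hl (e / (2 * (R0 + 1))) ltac:(apply Rdiv_lt_0_compat; lra)) as [d [Hd Hd']].
    pose proof (Cmod_ge_0 l) as Hl0.
    exists (Rmin (Rmin d (R0 - Cmod (z - a))) (e / (2 * (Cmod l + 1)))).
    split; [repeat apply Rmin_pos; try lra; apply Rdiv_lt_0_compat; lra|].
    intros w Hw.
    assert (Hw1 : Cmod (w - z) < Rmin d (R0 - Cmod (z - a))) by (eapply Rlt_le_trans; [exact Hw|apply Rmin_l]).
    assert (Hw2 : Cmod (w - z) < e / (2 * (Cmod l + 1))) by (eapply Rlt_le_trans; [exact Hw|apply Rmin_r]).
    assert (Hw3 : Cmod (w - z) < d) by (eapply Rlt_le_trans; [exact Hw1|apply Rmin_l]).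
    assert (Hw4 : Cmod (w - z) < R0 - Cmod (z - a)) by (eapply Rlt_le_trans; [exact Hw1|apply Rmin_r]).
    assert (Hwa : Cmod (w - a) < R0).
    { replace (w - a)%C with ((w - z) + (z - a))%C by ring. eapply Rle_lt_trans; [apply Cmod_triangle|]. lra. }
    assert (Gz : G z = l) by (unfold G; destruct (Ceq_dec z z); congruence).
    unfold Hh. rewrite Gz.
    assert (Q : Cmod (G w - l) <= e / (2 * (R0 + 1))).
    { unfold G. destruct (Ceq_dec w z) as [E|E].
      - replace (l - l)%C with (RtoC 0) by ring. rewrite Cmod_0. apply Rlt_le, Rdiv_lt_0_compat; lra.
      - pose proof (Cmod_sub_pos w z E) as Hp. specialize (Hd' w Hw3).
        replace ((f w - f z) / (w - z) - l)%C with ((f w - f z - l * (w - z)) / (w - z))%C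
          by (field; apply Cmod_gt_0; exact Hp).
        rewrite Cmod_div by (apply Cmod_gt_0; exact Hp).
        apply Rmult_le_reg_r with (Cmod (w - z)); [exact Hp|].
        unfold Rdiv at 1. rewrite Rmult_assoc, Rinv_l by lra. lra. }
    replace (G w * (w - a) - l * (z - a))%C with ((G w - l) * (w - a) + l * (w - z))%C by ring.
    eapply Rle_lt_trans; [apply Cmod_triangle|]. rewrite !Cmod_mult.
    assert (A1 : Cmod (G w - l) * Cmod (w - a) <= e / 2).
    { apply Rle_trans with (e / (2 * (R0 + 1)) * (R0 + 1)).
      - apply Rmult_le_compat; try apply Cmod_ge_0; lra.
      - right. field. lra. }
    assert (A2 : Cmod l * Cmod (w - z) < e / 2).
    { apply Rle_lt_trans with ((Cmod l + 1) * Cmod (w - z)).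
      - pose proof (Cmod_ge_0 (w - z)). nra.
      - apply (Rmult_lt_compat_l (Cmod l + 1)) in Hw2; [|lra].
        replace ((Cmod l + 1) * (e / (2 * (Cmod l + 1)))) with (e / 2) in Hw2 by (field; lra). exact Hw2. }
    lra. }
  assert (Gcont : forall w, Cmod (w - a) < R0 -> cont_at Hh w).
  { intros w Hw. destruct (Ceq_dec w z) as [->|E]; [exact Gc|]. apply holo_cont_at, Gh; assumption. }
  assert (Hha : Hh a = 0) by (unfold Hh; ring).
  assert (M0 : mean Hh a r = 0).
  { rewrite <- Hha. destruct (Ceq_dec z a) as [E|E].
    - subst z. apply (mean_center Hh a R0 r).
      + pose proof (Cmod_ge_0 (a - a)). lra.
      + intros w Hw. apply Gh; [|lra]. intros ->. destruct Hw as [Hw _].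
        replace (a - a)%C with (RtoC 0) in Hw by ring. rewrite Cmod_0 in Hw. lra.
      + exact Gc.
    - pose proof (Cmod_sub_pos z a E) as Hp. set (r0 := Cmod (z - a)) in *.
      apply Ceq_of_small. intros e He.
      destruct (mean_cont Hh a R0 r0 ltac:(lra) Gcont (e / 2) ltac:(lra)) as [d [Hd Hm]].
      set (d' := Rmin (d / 2) (Rmin (r0 / 2) (r - r0))).
      assert (Hd' : 0 < d' /\ d' <= d / 2 /\ d' <= r0 / 2 /\ d' <= r - r0).
      { unfold d'. repeat split.
        - repeat apply Rmin_pos; lra.
        - apply Rmin_l.
        - eapply Rle_trans; [apply Rmin_r|apply Rmin_l].
        - eapply Rle_trans; [apply Rmin_r|apply Rmin_r]. }
      assert (L : mean Hh a (r0 - d') = Hh a).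
      { apply (mean_center Hh a r0); [lra| |].
        - intros w Hw. apply Gh; [|lra]. intros ->. unfold r0 in Hw. lra.
        - apply Gcont. replace (a - a)%C with (RtoC 0) by ring. rewrite Cmod_0. lra. }
      assert (U : mean Hh a (r0 + d') = mean Hh a r).
      { apply (mean_annulus Hh a r0 R0); try lra. intros w Hw. apply Gh; [|lra].
        intros ->. unfold r0 in Hw. lra. }
      rewrite <- U, <- L.
      pose proof (Hm (r0 - d') ltac:(lra) ltac:(rewrite Rabs_left; lra)) as A1.
      pose proof (Hm (r0 + d') ltac:(lra) ltac:(rewrite Rabs_right; lra)) as A2.
      replace (mean Hh a (r0 + d') - mean Hh a (r0 - d'))%C
        with ((mean Hh a (r0 + d') - mean Hh a r0) - (mean Hh a (r0 - d') - mean Hh a r0))%C by ring.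
      eapply Rle_trans; [apply Cmod_triangle_sub|]. lra. }
  rewrite <- M0.
  eapply is_CInt_ext; [lra| |apply mean_correct_cont; [lra|intros w Hw; apply Gcont; lra]].
  intros t _. cbv beta. unfold Hh, G.
  destruct (Ceq_dec (a + RtoC r * cis (2 * PI * t)) z) as [E|E].
  - exfalso. assert (0 <= r) by lra. rewrite <- E, circle_dist in Hz by assumption. lra.
  - f_equal. ring.
Qed.

Lemma circle_bounded (f : C -> C) (a : C) (r : R) : 0 <= r ->
  (forall z, Cmod (z - a) = r -> cont_at f z) ->
  exists B, 0 < B /\ forall t, 0 <= t <= 1 -> Cmod (f (a + RtoC r * cis (2 * PI * t))%C) <= B.
Proof.
  intros Hr H.
  destruct (continuity_ab_maj (fun t => Cmod (f (a + RtoC r * cis (2 * PI * t))%C)) 0 1 ltac:(lra)) as [m [Hm _]].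
  - intros t Ht. apply continuity_pt_filterlim.
    assert (Cf : ccont (fun s => f (a + RtoC r * cis (2 * PI * s))%C) t).
    { apply (cont_at_ccont f (fun t => a + RtoC r * cis (2 * PI * t))%C); [apply H, circle_dist, Hr|apply ccont_circle]. }
    apply (continuous_ext (fun s => norm (V := C_R_NormedModule) (f (a + RtoC r * cis (2 * PI * s))%C))).
    { intros s. symmetry. apply Cmod_norm. }
    apply (continuous_comp (fun s => f (a + RtoC r * cis (2 * PI * s))%C) (norm (V := C_R_NormedModule)) t Cf).
    apply (filterlim_norm (V := C_R_NormedModule)).
  - exists (Rabs (Cmod (f (a + RtoC r * cis (2 * PI * m))%C)) + 1). split.
    + pose proof (Rabs_pos (Cmod (f (a + RtoC r * cis (2 * PI * m))%C))). lra.
    + intros t Ht. specialize (Hm t Ht). eapply Rle_trans; [exact Hm|].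
      pose proof (Rle_abs (Cmod (f (a + RtoC r * cis (2 * PI * m))%C))). lra.
Qed.

Definition taylor_coeff (f : C -> C) (a : C) (r : R) (k : nat) : C :=
  mean (fun w => f w / (w - a) ^ k)%C a r.

Lemma mean_ext (f g : C -> C) (a : C) (r : R) : 0 <= r ->
  (forall w, Cmod (w - a) = r -> f w = g w) -> mean f a r = mean g a r.
Proof.
  intros Hr H. unfold mean, CInt. apply (RInt_ext (V := C_R_CompleteNormedModule)).
  intros t _. apply H, circle_dist, Hr.
Qed.

Lemma holo_at_inv_pow (a w : C) (k : nat) : w <> a -> holo_at (fun w => / (w - a) ^ k)%C w.
Proof.
  intros H. pose proof (Cmod_sub_pos w a H) as Hp.
  eexists. apply (cder_inv (fun w => (w - a) ^ k)%C).
  - apply Cpow_nz. apply Cmod_gt_0, Hp.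
  - apply (cder_pow (fun w => w - a)%C). apply cder_minus; [apply cder_id|apply cder_const].
Qed.

(** By scaling the mean is r^-(k+1) times its value at radius 1, while [mean_annulus] makes it
    independent of r; comparing radii 1 and 2 leaves only 0. *)
Lemma mean_inv_pow (a : C) (r : R) (k : nat) : 0 < r -> mean (fun w => / (w - a) ^ S k)%C a r = 0.
Proof.
  intros Hr.
  set (c := mean (fun w => / (w - a) ^ S k)%C a 1).
  assert (Hn : forall r, 0 < r -> forall z, Cmod (z - a) = r -> holo_at (fun w => / (w - a) ^ S k)%C z).
  { intros r' Hr' z Hz. apply holo_at_inv_pow. intros ->. replace (a - a)%C with (RtoC 0) in Hz by ring.
    rewrite Cmod_0 in Hz. lra. }
  assert (E : forall r, 0 < r -> mean (fun w => / (w - a) ^ S k)%C a r = (RtoC (/ r ^ S k) * c)%C).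
  { intros r' Hr'. unfold mean at 1. apply is_CInt_unique.
    pose proof (is_CInt_scal (RtoC (/ r' ^ S k)) _ 0 1 _ (mean_correct _ a 1 ltac:(lra) (Hn 1 Rlt_0_1))) as I.
    eapply is_CInt_ext; [lra| |exact I]. intros t _. cbv beta.
    replace (a + RtoC r' * cis (2 * PI * t) - a)%C with (RtoC r' * cis (2 * PI * t))%C by ring.
    replace (a + 1 * cis (2 * PI * t) - a)%C with (cis (2 * PI * t)) by ring.
    rewrite Cpow_mult_l, RtoC_inv by (apply Rgt_not_eq, pow_lt, Hr'). rewrite RtoC_pow. field. split.
    - apply Cpow_nz, cis_neq_0.
    - apply Cpow_nz. intros E. injection E. lra. }
  assert (E2 : forall r1 r2, 0 < r1 -> r1 <= r2 -> mean (fun w => / (w - a) ^ S k)%C a r1 = mean (fun w => / (w - a) ^ S k)%C a r2).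
  { intros r1 r2 H1 H2. apply (mean_annulus _ a 0 (r2 + 1)); try lra. intros z Hz. apply (Hn (Cmod (z - a))); [lra|reflexivity]. }
  assert (Hc : c = 0).
  { pose proof (E2 1 2 ltac:(lra) ltac:(lra)) as H. rewrite (E 1), (E 2) in H by lra.
    rewrite pow1 in H.
    assert (H' : (RtoC (1 - / 2 ^ S k) * c)%C = 0).
    { rewrite RtoC_minus. replace (RtoC (/ 1) * c)%C with c in H by (rewrite Rinv_1; ring).
      replace ((1 - RtoC (/ 2 ^ S k)) * c)%C with (c - RtoC (/ 2 ^ S k) * c)%C by ring.
      rewrite <- H. ring. }
    destruct (Ceq_dec c 0) as [Z|Z]; [exact Z|]. exfalso. revert H'. apply Cmult_neq_0; [|exact Z].
    intros E'. apply RtoC_inj in E'.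
    assert (E3 : / 2 ^ S k <= / 2).
    { apply Rinv_le_contravar; [lra|]. simpl. pose proof (pow_R1_Rle 2 k ltac:(lra)). lra. }
    lra. }
  rewrite E, Hc by exact Hr. ring.
Qed.

Lemma csum_0 (F : nat -> C) : sum_n F 0 = F 0%nat :> C.
Proof. apply sum_O. Qed.

Lemma csum_S (F : nat -> C) (n : nat) : sum_n F (S n) = (sum_n F n + F (S n))%C :> C.
Proof. change (sum_n F (S n) = plus (sum_n F n) (F (S n)) :> C). apply sum_Sn. Qed.

Lemma geom_identity (x : C) (n : nat) : x <> 1 ->
  sum_n (fun k => x ^ k)%C n = ((1 - x ^ S n) / (1 - x))%C :> C.
Proof.
  intros Hx. assert (H1 : (1 - x)%C <> 0).
  { intros E. apply Hx. replace x with (1 - (1 - x))%C by ring. rewrite E. ring. }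
  induction n as [|n IH].
  - rewrite csum_0. simpl. field. exact H1.
  - rewrite csum_S, IH. simpl Cpow. field. exact H1.
Qed.

Lemma is_CInt_sum (F : nat -> R -> C) (I : nat -> C) (a b : R) (n : nat) :
  (forall k, is_CInt (F k) a b (I k)) ->
  is_CInt (fun t => sum_n (fun k => F k t) n) a b (sum_n I n).
Proof.
  intros H. induction n as [|n IH].
  - rewrite sum_O. eapply is_RInt_ext; [|apply (H 0%nat)]. intros x _. rewrite sum_O. reflexivity.
  - rewrite sum_Sn. eapply is_RInt_ext; [|apply (is_CInt_plus _ _ _ _ _ _ IH (H (S n)))].
    intros x _. cbv beta. rewrite sum_Sn. reflexivity.
Qed.

Lemma sum_n_Cmult_l (c : C) (F : nat -> C) (n : nat) :
  sum_n (fun k => c * F k)%C n = (c * sum_n F n)%C :> C.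
Proof. exact (sum_n_mult_l (K := C_Ring) c F n). Qed.

(** The difference f - f(a + h) is integrated against the geometric sum of h / u. This sum differs
    from the full kernel u / (u - h) by the factor 1 - (h / u)^(n+1), and the full kernel
    contributes 0 by [cauchy_quotient]. *)
Lemma Cauchy_taylor_remainder (f : C -> C) (a h : C) (R0 r B : R) (n : nat) :
  (forall w, Cmod (w - a) < R0 -> holo_at f w) -> Cmod h < r -> r < R0 ->
  (forall t, 0 <= t <= 1 -> Cmod (f (a + RtoC r * cis (2 * PI * t))%C) <= B) ->
  Cmod (sum_n (fun k => taylor_coeff f a r k * h ^ k)%C n - f (a + h))%C
   <= (B + Cmod (f (a + h)%C)) * (r / (r - Cmod h)) * (Cmod h / r) ^ S n.
Proof.
  intros H Hh HrR HB. pose proof (Cmod_ge_0 h) as Hh0.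
  assert (Hr : 0 < r) by lra.
  set (u := fun t => (RtoC r * cis (2 * PI * t))%C).
  assert (Hu : forall t, Cmod (u t) = r).
  { intros t. unfold u. rewrite Cmod_mult, Cmod_cis, Cmod_R, Rabs_right by lra. ring. }
  assert (Hu0 : forall t, u t <> 0).
  { intros t. apply Cmod_gt_0. rewrite Hu. exact Hr. }
  assert (Huh : forall t, (u t - h)%C <> 0).
  { intros t. apply Cmod_gt_0. pose proof (Cmod_triangle_rev (u t) h). rewrite Hu in H0. lra. }
  set (z := (a + h)%C).
  assert (Hz : Cmod (z - a) < r) by (unfold z; replace (a + h - a)%C with h by ring; exact Hh).
  pose proof (cauchy_quotient f a z R0 r H Hz HrR) as Q.
  (* By [mean_inv_pow] the subtracted constant f z survives only for k = 0. *)
  assert (Hk : forall k, is_CInt (fun t => (f (a + u t) - f z) * (h / u t) ^ k)%C 0 1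
      (taylor_coeff f a r k * h ^ k - (if Nat.eqb k 0 then f z else 0))%C).
  { intros k.
    assert (I1 : is_CInt (fun t => f (a + u t) / (a + u t - a) ^ k)%C 0 1 (taylor_coeff f a r k)).
    { apply (mean_correct (fun w => f w / (w - a) ^ k)%C a r); [lra|]. intros w Hw.
      destruct (H w ltac:(lra)) as [l Hl].
      destruct (holo_at_inv_pow a w k) as [m Hm].
      { intros ->. replace (a - a)%C with (RtoC 0) in Hw by ring. rewrite Cmod_0 in Hw. lra. }
      eexists. apply cder_mult; [exact Hl|exact Hm]. }
    assert (I2 : is_CInt (fun t => / (a + u t - a) ^ k)%C 0 1 (if Nat.eqb k 0 then RtoC 1 else RtoC 0)).
    { destruct k as [|k].
      - simpl. pose proof (is_CInt_const 1 0 1) as K.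
        replace (RtoC (1 - 0) * 1)%C with (RtoC 1) in K by (rewrite Rminus_0_r; ring).
        eapply is_CInt_ext; [lra| |exact K]. intros t _. cbv beta.
        rewrite <- RtoC_inv by lra. f_equal. lra.
      - change (if Nat.eqb (S k) 0 then RtoC 1 else RtoC 0) with (RtoC 0).
        rewrite <- (mean_inv_pow a r k Hr).
        apply (mean_correct (fun w => / (w - a) ^ S k)%C a r); [lra|]. intros w Hw. apply holo_at_inv_pow.
        intros ->. replace (a - a)%C with (RtoC 0) in Hw by ring. rewrite Cmod_0 in Hw. lra. }
    pose proof (is_CInt_minus _ _ _ _ _ _ (is_CInt_scal (h ^ k)%C _ _ _ _ I1) (is_CInt_scal (f z * h ^ k)%C _ _ _ _ I2)) as I.
    replace (taylor_coeff f a r k * h ^ k - (if Nat.eqb k 0 then f z else 0))%C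
      with (h ^ k * taylor_coeff f a r k - f z * h ^ k * (if Nat.eqb k 0 then 1 else 0))%C.
    2:{ destruct k; simpl; ring. }
    eapply is_CInt_ext; [lra| |exact I]. intros t _. cbv beta.
    replace (a + u t - a)%C with (u t) by ring.
    unfold Cdiv. rewrite Cpow_mult_l, Cpow_inv by apply Hu0. field. apply Cpow_nz, Hu0. }
  assert (J : is_CInt (fun t => (f (a + u t) - f z) * (1 - (h / u t) ^ S n) * (u t / (u t - h)))%C 0 1
     (sum_n (fun k => taylor_coeff f a r k * h ^ k)%C n - f z)%C).
  { pose proof (is_CInt_sum _ _ 0 1 n Hk) as S.
    replace (sum_n (fun k => taylor_coeff f a r k * h ^ k)%C n - f z)%C
      with (sum_n (fun k => taylor_coeff f a r k * h ^ k - (if Nat.eqb k 0 then f z else 0))%C n).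
    - eapply is_CInt_ext; [lra| |exact S]. intros t _. cbv beta.
      rewrite sum_n_Cmult_l, geom_identity.
      + field. repeat split; first [apply Huh|apply Hu0].
      + intros E. apply (Huh t). replace (u t - h)%C with (u t * (1 - h / u t))%C by (field; apply Hu0).
        rewrite E. ring.
    - clear. induction n as [|n IH].
      + rewrite !csum_0. simpl. ring.
      + rewrite !csum_S, IH. simpl. ring. }
  assert (Q' : is_CInt (fun t => (f (a + u t) - f z) * (u t / (u t - h)))%C 0 1 (RtoC 0)).
  { eapply is_CInt_ext; [lra| |exact Q]. intros t _. cbv beta. fold (u t). unfold z.
    replace (a + u t - (a + h))%C with (u t - h)%C by ring. unfold Cdiv. ring. }
  pose proof (is_CInt_minus _ _ _ _ _ _ J Q') as K.
  replace (sum_n (fun k => taylor_coeff f a r k * h ^ k)%C n - f z - 0)%C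
    with (sum_n (fun k => taylor_coeff f a r k * h ^ k)%C n - f z)%C in K by ring.
  eapply Rle_trans; [eapply (CInt_bound _ 0 1 ((B + Cmod (f z)) * (r / (r - Cmod h)) * (Cmod h / r) ^ S n)); [lra| |exact K]|lra].
  intros t Ht. cbv beta.
  replace ((f (a + u t) - f z) * (1 - (h / u t) ^ S n) * (u t / (u t - h)) - (f (a + u t) - f z) * (u t / (u t - h)))%C
    with (- ((f (a + u t) - f z) * (u t / (u t - h)) * (h / u t) ^ S n))%C by ring.
  rewrite Cmod_opp, !Cmod_mult, Cmod_pow, !Cmod_div, Hu by (try apply Hu0; apply Huh).
  apply Rmult_le_compat_r; [apply pow_le; apply Rle_div_r; lra|].
  apply Rmult_le_compat.
  - apply Cmod_ge_0.
  - apply Rmult_le_pos; [lra|]. apply Rlt_le, Rinv_0_lt_compat, Cmod_gt_0, Huh.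
  - eapply Rle_trans; [apply Cmod_triangle_sub|]. specialize (HB t Ht). fold (u t) in HB. lra.
  - unfold Rdiv. apply Rmult_le_compat_l; [lra|]. apply Rinv_le_contravar; [lra|].
    pose proof (Cmod_triangle_rev (u t) h). rewrite Hu in H0. lra.
Qed.

(** * Quantitative estimates on discs *)

Definition holo_disc (f : C -> C) (a : C) (R0 : R) : Prop :=
  forall w, Cmod (w - a) < R0 -> holo_at f w.

Lemma Cmod_sub_self (a : C) : Cmod (a - a) = 0.
Proof. replace (a - a)%C with (RtoC 0) by ring. apply Cmod_0. Qed.

Lemma RtoC_neq_0 (x : R) : x <> 0 -> RtoC x <> 0.
Proof. intros H E. apply RtoC_inj in E. contradiction. Qed.

Lemma mean_le (f : C -> C) (a : C) (r B : R) : 0 <= r ->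
  (forall z, Cmod (z - a) = r -> holo_at f z) ->
  (forall z, Cmod (z - a) = r -> Cmod (f z) <= B) -> Cmod (mean f a r) <= B.
Proof.
  intros Hr H HB. eapply Rle_trans; [eapply (CInt_bound _ 0 1 B); [lra| |apply mean_correct; assumption]|lra].
  intros t _. apply HB, circle_dist, Hr.
Qed.

Lemma holo_div_pow (f : C -> C) (a w : C) (k : nat) : w <> a -> holo_at f w ->
  holo_at (fun w => f w / (w - a) ^ k)%C w.
Proof.
  intros Hw [l Hl]. destruct (holo_at_inv_pow a w k Hw) as [m Hm].
  eexists. apply cder_mult; [exact Hl|exact Hm].
Qed.

Lemma circle_neq (a z : C) (r : R) : 0 < r -> Cmod (z - a) = r -> z <> a.
Proof. intros Hr Hz ->. rewrite Cmod_sub_self in Hz. lra. Qed.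

Lemma taylor_coeff_le (f : C -> C) (a : C) (R0 r B : R) (k : nat) :
  holo_disc f a R0 -> 0 < r < R0 -> (forall z, Cmod (z - a) = r -> Cmod (f z) <= B) ->
  Cmod (taylor_coeff f a r k) <= B / r ^ k.
Proof.
  intros H Hr HB. apply mean_le; [lra| |]; intros z Hz.
  - apply holo_div_pow; [apply (circle_neq a z r); [lra|exact Hz]|apply H; lra].
  - assert (Hza : (z - a)%C <> 0) by (apply Cmod_gt_0; lra).
    rewrite Cmod_div by (apply Cpow_nz; exact Hza). rewrite Cmod_pow, Hz.
    unfold Rdiv. apply Rmult_le_compat_r; [|apply HB, Hz].
    apply Rlt_le, Rinv_0_lt_compat, pow_lt; lra.
Qed.

Lemma taylor_coeff_0 (f : C -> C) (a : C) (R0 r : R) :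
  holo_disc f a R0 -> 0 < r < R0 -> taylor_coeff f a r 0 = f a.
Proof.
  intros H Hr. unfold taylor_coeff. rewrite (mean_ext _ f).
  - apply (mean_center f a R0); [exact Hr|intros z Hz; apply H; lra|].
    apply holo_cont_at, H. rewrite Cmod_sub_self. lra.
  - lra.
  - intros w _. simpl. field.
Qed.

(** The remainder depends on the radius and the bound alone; this uniformity is what lets
    derivatives pass through limits and integrals. The circle of radius 3/4 R0 gives the constant 2
    * 3 * 16/9 = 32/3, rounded up to 11. *)
Lemma holo_quad (f : C -> C) (a : C) (R0 B : R) : 0 < R0 ->
  holo_disc f a R0 -> (forall z, Cmod (z - a) < R0 -> Cmod (f z) <= B) ->
  exists l, cder f a l /\ Cmod l <= 2 * B / R0 /\
    forall h, Cmod h <= R0 / 2 -> Cmod (f (a + h) - f a - l * h)%C <= 11 * B / (R0 * R0) * (Cmod h * Cmod h).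
Proof.
  intros HR H HB.
  assert (HB0 : 0 <= B).
  { eapply Rle_trans; [apply Cmod_ge_0|apply (HB a)]. rewrite Cmod_sub_self. lra. }
  set (r := 3 / 4 * R0). set (l := taylor_coeff f a r 1).
  assert (Hr : 0 < r < R0) by (unfold r; lra).
  assert (Q : forall h, Cmod h <= R0 / 2 -> Cmod (f (a + h) - f a - l * h)%C <= 11 * B / (R0 * R0) * (Cmod h * Cmod h)).
  { intros h Hh. pose proof (Cmod_ge_0 h) as Hh0.
    pose proof (Cauchy_taylor_remainder f a h R0 r B 1 H ltac:(unfold r; lra) ltac:(lra)) as T.
    specialize (T ltac:(intros t _; apply HB; rewrite circle_dist; lra)).
    rewrite csum_S, csum_0 in T. rewrite (taylor_coeff_0 f a R0 r H Hr) in T. fold l in T.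
    replace (f (a + h) - f a - l * h)%C with (- (f a * h ^ 0 + l * h ^ 1 - f (a + h)))%C by (simpl; ring).
    rewrite Cmod_opp. eapply Rle_trans; [exact T|].
    assert (Hfh : Cmod (f (a + h)%C) <= B).
    { apply HB. replace (a + h - a)%C with h by ring. lra. }
    apply Rle_trans with ((B + B) * 3 * (Cmod h / r) ^ 2).
    - apply Rmult_le_compat_r; [apply pow2_ge_0|]. apply Rmult_le_compat; try lra.
      + pose proof (Cmod_ge_0 (f (a + h)%C)). lra.
      + apply Rlt_le, Rdiv_lt_0_compat; unfold r; lra.
      + apply Rle_div_l; unfold r; lra.
    - unfold r. replace ((B + B) * 3 * (Cmod h / (3 / 4 * R0)) ^ 2) with (32 / 3 * B / (R0 * R0) * (Cmod h * Cmod h)) by (field; lra).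
      apply Rmult_le_compat_r; [nra|]. unfold Rdiv. apply Rmult_le_compat_r; [apply Rlt_le, Rinv_0_lt_compat; nra|]. lra. }
  exists l. split; [|split; [|exact Q]].
  - intros e He. exists (Rmin (R0 / 2) (e / (11 * B / (R0 * R0) + 1))).
    assert (K0 : 0 <= 11 * B / (R0 * R0)) by (apply Rdiv_le_0_compat; nra).
    split; [apply Rmin_pos; [lra|apply Rdiv_lt_0_compat; lra]|]. intros w Hw.
    assert (H1 : Cmod (w - a) < R0 / 2) by (eapply Rlt_le_trans; [exact Hw|apply Rmin_l]).
    assert (H2 : Cmod (w - a) < e / (11 * B / (R0 * R0) + 1)) by (eapply Rlt_le_trans; [exact Hw|apply Rmin_r]).
    specialize (Q (w - a)%C ltac:(lra)). replace (a + (w - a))%C with w in Q by ring.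
    eapply Rle_trans; [exact Q|]. pose proof (Cmod_ge_0 (w - a)). set (x := Cmod (w - a)) in *.
    rewrite <- Rmult_assoc. apply Rmult_le_compat_r; [lra|].
    apply Rle_trans with ((11 * B / (R0 * R0) + 1) * x); [nra|].
    apply Rle_trans with ((11 * B / (R0 * R0) + 1) * (e / (11 * B / (R0 * R0) + 1))).
    + apply Rmult_le_compat_l; lra.
    + right. field. nra.
  - eapply Rle_trans; [apply (taylor_coeff_le f a R0 r B 1 H Hr)|].
    + intros z Hz. apply HB. lra.
    + unfold r. rewrite pow_1. replace (B / (3 / 4 * R0)) with (4 / 3 * B / R0) by (field; lra).
      unfold Rdiv. apply Rmult_le_compat_r; [apply Rlt_le, Rinv_0_lt_compat; lra|lra].
Qed.

(** * Uniform limits, higher derivatives and Taylor series *)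

Lemma C_cauchy_limit (u : nat -> C) :
  (forall e, 0 < e -> exists N, forall n m, (N <= n)%nat -> (N <= m)%nat -> Cmod (u n - u m) <= e) ->
  exists l, forall e, 0 < e -> exists N, forall n, (N <= n)%nat -> Cmod (u n - l) <= e.
Proof.
  intros H.
  assert (Hre : ex_finite_lim_seq (fun n => Re (u n))).
  { apply ex_lim_seq_cauchy_corr. intros e. destruct (H (e / 2) (is_pos_div_2 e)) as [N HN].
    exists N. intros n m Hn Hm. pose proof (re_le_Cmod (u n - u m)) as L. specialize (HN n m Hn Hm).
    change (Re (u n - u m)%C) with (Re (u n) - Re (u m)) in L. pose proof (cond_pos e). lra. }
  assert (Him : ex_finite_lim_seq (fun n => Im (u n))).
  { apply ex_lim_seq_cauchy_corr. intros e. destruct (H (e / 2) (is_pos_div_2 e)) as [N HN].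
    exists N. intros n m Hn Hm. pose proof (im_le_Cmod (u n - u m)) as L. specialize (HN n m Hn Hm).
    change (Im (u n - u m)%C) with (Im (u n) - Im (u m)) in L. pose proof (cond_pos e). lra. }
  destruct Hre as [x Hx]. destruct Him as [y Hy]. exists (x, y). intros e He.
  assert (He2 : 0 < e / 2) by lra.
  apply is_lim_seq_spec in Hx. apply is_lim_seq_spec in Hy.
  destruct (Hx (mkposreal _ He2)) as [N1 H1]. destruct (Hy (mkposreal _ He2)) as [N2 H2].
  exists (N1 + N2)%nat. intros n Hn. specialize (H1 n ltac:(lia)). specialize (H2 n ltac:(lia)). simpl in H1, H2.
  replace (u n - (x, y))%C with (RtoC (Re (u n) - x) + Ci * RtoC (Im (u n) - y))%C
    by (apply injective_projections; unfold Re, Im; simpl; ring).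
  eapply Rle_trans; [apply Cmod_triangle|]. rewrite Cmod_mult, Cmod_Ci, !Cmod_R. lra.
Qed.

Lemma C_lim_le (u : nat -> C) (l : C) (B : R) :
  (forall e, 0 < e -> exists N, forall n, (N <= n)%nat -> Cmod (u n - l) <= e) ->
  (forall n, Cmod (u n) <= B) -> Cmod l <= B.
Proof.
  intros H HB. apply Rnot_lt_le. intros L.
  destruct (H ((Cmod l - B) / 2) ltac:(lra)) as [N HN]. specialize (HN N (le_n N)). specialize (HB N).
  pose proof (Cmod_triangle_rev l (l - u N)) as T. replace (l - (l - u N))%C with (u N) in T by ring.
  rewrite (Cmod_sub_sym l) in T. lra.
Qed.

(** The estimate of [holo_quad] on differences F n - F m makes the derivatives at a a Cauchy
    sequence, and the common quadratic remainder of the F n passes to the limit. *)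
Lemma weierstrass (F : nat -> C -> C) (f : C -> C) (a : C) (R0 B : R) : 0 < R0 ->
  (forall n, holo_disc (F n) a R0) ->
  (forall n z, Cmod (z - a) < R0 -> Cmod (F n z) <= B) ->
  (forall e, 0 < e -> exists N, forall n z, (N <= n)%nat -> Cmod (z - a) < R0 -> Cmod (F n z - f z) <= e) ->
  holo_at f a.
Proof.
  intros HR H HB Hlim.
  assert (Ha : Cmod (a - a) < R0) by (rewrite Cmod_sub_self; lra).
  assert (HB0 : 0 <= B) by (eapply Rle_trans; [apply Cmod_ge_0|apply (HB 0%nat a Ha)]).
  assert (HL : forall n, exists l, cder (F n) a l /\
    forall h, Cmod h <= R0 / 2 -> Cmod (F n (a + h) - F n a - l * h)%C <= 11 * B / (R0 * R0) * (Cmod h * Cmod h)).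
  { intros n. destruct (holo_quad (F n) a R0 B HR (H n) (HB n)) as [l [H1 [_ H2]]]. exists l. split; assumption. }
  set (L := fun n => proj1_sig (constructive_indefinite_description _ (HL n))).
  assert (HL1 : forall n, cder (F n) a (L n)).
  { intros n. unfold L. destruct (constructive_indefinite_description _ (HL n)) as [l Hl]. simpl. apply Hl. }
  assert (HL2 : forall n h, Cmod h <= R0 / 2 -> Cmod (F n (a + h) - F n a - L n * h)%C <= 11 * B / (R0 * R0) * (Cmod h * Cmod h)).
  { intros n. unfold L. destruct (constructive_indefinite_description _ (HL n)) as [l Hl]. simpl. apply Hl. }
  destruct (C_cauchy_limit L) as [l Hl].
  { intros e He. destruct (Hlim (e * R0 / 4) ltac:(apply Rdiv_lt_0_compat; nra)) as [N HN].
    exists N. intros n m Hn Hm.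
    destruct (holo_quad (fun z => F n z - F m z)%C a R0 (e * R0 / 2) HR) as [d [D1 [D2 _]]].
    - intros w Hw. destruct (H n w Hw) as [p Hp]. destruct (H m w Hw) as [q Hq]. eexists. apply cder_minus; eassumption.
    - intros z Hz. replace (F n z - F m z)%C with ((F n z - f z) - (F m z - f z))%C by ring.
      eapply Rle_trans; [apply Cmod_triangle_sub|]. pose proof (HN n z Hn Hz). pose proof (HN m z Hm Hz). lra.
    - rewrite (cder_unique _ _ _ _ (cder_minus _ _ _ _ _ (HL1 n) (HL1 m)) D1). eapply Rle_trans; [exact D2|].
      right. field. lra. }
  set (K := 11 * B / (R0 * R0)) in *.
  assert (K0 : 0 <= K) by (apply Rdiv_le_0_compat; nra).
  assert (Q : forall h, Cmod h <= R0 / 2 -> Cmod (f (a + h) - f a - l * h)%C <= K * (Cmod h * Cmod h)).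
  { intros h Hh. pose proof (Cmod_ge_0 h) as Hh0. apply Rle_plus_epsilon. intros e He.
    destruct (Hlim (e / 4) ltac:(lra)) as [N1 HN1].
    destruct (Hl (e / (4 * (Cmod h + 1))) ltac:(apply Rdiv_lt_0_compat; lra)) as [N2 HN2].
    set (n := (N1 + N2)%nat).
    pose proof (HN1 n (a + h)%C ltac:(lia) ltac:(replace (a + h - a)%C with h by ring; lra)) as A1.
    pose proof (HN1 n a ltac:(lia) Ha) as A2. pose proof (HN2 n ltac:(lia)) as A3.
    pose proof (HL2 n h Hh) as A4.
    replace (f (a + h) - f a - l * h)%C with ((F n (a + h) - F n a - L n * h) - (F n (a + h) - f (a + h)) + (F n a - f a) + (L n - l) * h)%C by ring.
    eapply Rle_trans; [apply Cmod_triangle|].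
    eapply Rle_trans; [apply Rplus_le_compat_r, Cmod_triangle|].
    eapply Rle_trans; [apply Rplus_le_compat_r, Rplus_le_compat_r, Cmod_triangle_sub|].
    rewrite Cmod_mult.
    assert (A5 : Cmod (L n - l) * Cmod h <= e / 4).
    { apply Rle_trans with (e / (4 * (Cmod h + 1)) * (Cmod h + 1)).
      - apply Rmult_le_compat; try apply Cmod_ge_0; lra.
      - right. field. lra. }
    lra. }
  exists l. intros e He. exists (Rmin (R0 / 2) (e / (K + 1))).
  split; [apply Rmin_pos; [lra|apply Rdiv_lt_0_compat; lra]|]. intros w Hw.
  assert (H1 : Cmod (w - a) < R0 / 2) by (eapply Rlt_le_trans; [exact Hw|apply Rmin_l]).
  assert (H2 : Cmod (w - a) < e / (K + 1)) by (eapply Rlt_le_trans; [exact Hw|apply Rmin_r]).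
  specialize (Q (w - a)%C ltac:(lra)). replace (a + (w - a))%C with w in Q by ring.
  eapply Rle_trans; [exact Q|]. pose proof (Cmod_ge_0 (w - a)). set (x := Cmod (w - a)) in *.
  rewrite <- Rmult_assoc. apply Rmult_le_compat_r; [lra|].
  apply Rle_trans with ((K + 1) * x); [nra|].
  apply Rle_trans with ((K + 1) * (e / (K + 1))).
  - apply Rmult_le_compat_l; lra.
  - right. field. lra.
Qed.

Lemma holo_C_derive (f : C -> C) (z : C) : holo_at f z -> cder f z (C_derive f z).
Proof. intros [l Hl]. rewrite (cder_C_derive _ _ _ Hl). exact Hl. Qed.

(** Near a the derivative is a uniform limit of difference quotients with fixed steps, which are
    holomorphic, so [weierstrass] applies. *)
Lemma holo_derive (f : C -> C) (a : C) (R0 : R) : 0 < R0 ->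
  holo_disc f a R0 -> holo_at (C_derive f) a.
Proof.
  intros HR0 H0.
  destruct (holo_cont_at f a (H0 a ltac:(rewrite Cmod_sub_self; lra)) 1 Rlt_0_1) as [d [Hd Hc]].
  set (R1 := Rmin d R0).
  assert (HR : 0 < R1) by (apply Rmin_pos; lra).
  assert (H : holo_disc f a R1) by (intros w Hw; apply H0; eapply Rlt_le_trans; [exact Hw|apply Rmin_r]).
  set (B := Cmod (f a) + 1).
  assert (HB : forall z, Cmod (z - a) < R1 -> Cmod (f z) <= B).
  { intros z Hz. specialize (Hc z ltac:(eapply Rlt_le_trans; [exact Hz|apply Rmin_l])).
    replace (f z) with (f a + (f z - f a))%C by ring. eapply Rle_trans; [apply Cmod_triangle|]. unfold B. lra. }
  assert (HB0 : 0 < B) by (unfold B; pose proof (Cmod_ge_0 (f a)); lra).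
  (* Steps of length at most R1 / 8 stay within reach of [holo_quad] on the discs of radius R1 / 2
     used below. *)
  set (h := fun n : nat => RtoC (R1 / 8 * / (INR n + 1))).
  assert (Hn : forall n, 0 < / (INR n + 1) <= 1).
  { intros n. pose proof (pos_INR n). split; [apply Rinv_0_lt_compat; lra|].
    rewrite <- Rinv_1. apply Rinv_le_contravar; lra. }
  assert (Hh : forall n, Cmod (h n) = R1 / 8 * / (INR n + 1)).
  { intros n. unfold h. rewrite Cmod_R, Rabs_right; [reflexivity|]. specialize (Hn n). nra. }
  assert (Hh0 : forall n, h n <> 0).
  { intros n. apply Cmod_gt_0. rewrite Hh. specialize (Hn n). nra. }
  assert (Q : forall z, Cmod (z - a) < R1 / 4 -> Cmod (C_derive f z) <= 4 * B / R1 /\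
     forall n, Cmod ((f (z + h n) - f z) / h n - C_derive f z)%C <= 44 * B / (R1 * R1) * Cmod (h n)).
  { intros z Hz.
    assert (Hsub : forall w, Cmod (w - z) < R1 / 2 -> Cmod (w - a) < R1).
    { intros w Hw. replace (w - a)%C with ((w - z) + (z - a))%C by ring.
      eapply Rle_lt_trans; [apply Cmod_triangle|]. lra. }
    destruct (holo_quad f z (R1 / 2) B ltac:(lra)) as [l [D1 [D2 D3]]].
    - intros w Hw. apply H, Hsub, Hw.
    - intros w Hw. apply HB, Hsub, Hw.
    - rewrite (cder_C_derive _ _ _ D1). split.
      + eapply Rle_trans; [exact D2|]. right. field. lra.
      + intros n. specialize (D3 (h n)). pose proof (Hn n). pose proof (Hh n) as E.
        assert (L : Cmod (h n) <= R1 / 2 / 2) by (rewrite E; nra). specialize (D3 L).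
        replace ((f (z + h n) - f z) / h n - l)%C with ((f (z + h n) - f z - l * h n) / h n)%C by (field; apply Hh0).
        rewrite Cmod_div by apply Hh0.
        assert (P : 0 < Cmod (h n)) by (apply Cmod_gt_0, Hh0).
        apply Rle_div_l; [exact P|]. eapply Rle_trans; [exact D3|]. right. field. lra. }
  apply (weierstrass (fun n z => (f (z + h n) - f z) / h n)%C (C_derive f) a (R1 / 4) (4 * B / R1 + 44 * B / (R1 * R1) * R1)); [lra| | |].
  - intros n w Hw.
    destruct (H w ltac:(lra)) as [l Hl].
    destruct (H (w + h n)%C) as [m Hm].
    { replace (w + h n - a)%C with ((w - a) + h n)%C by ring. eapply Rle_lt_trans; [apply Cmod_triangle|].
      rewrite Hh. specialize (Hn n). nra. }
    eexists. apply cder_mult; [|apply cder_const]. apply cder_minus; [|exact Hl].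
    apply (cder_comp f (fun w => w + h n)%C); [exact Hm|]. apply cder_plus; [apply cder_id|apply cder_const].
  - intros n z Hz. destruct (Q z Hz) as [Q1 Q2].
    replace ((f (z + h n) - f z) / h n)%C with (((f (z + h n) - f z) / h n - C_derive f z) + C_derive f z)%C by ring.
    eapply Rle_trans; [apply Cmod_triangle|].
    assert (L : 44 * B / (R1 * R1) * Cmod (h n) <= 44 * B / (R1 * R1) * R1).
    { apply Rmult_le_compat_l; [apply Rdiv_le_0_compat; nra|]. rewrite Hh. specialize (Hn n). nra. }
    specialize (Q2 n). lra.
  - intros e He.
    set (K := 44 * B / (R1 * R1) * (R1 / 8)).
    assert (HK : 0 < K) by (apply Rmult_lt_0_compat; [apply Rdiv_lt_0_compat; nra|lra]).
    destruct (nfloor_ex (K / e) ltac:(apply Rdiv_le_0_compat; lra)) as [N HN].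
    exists N. intros n z HnN Hz. destruct (Q z Hz) as [_ Q2].
    eapply Rle_trans; [apply Q2|]. rewrite Hh, <- Rmult_assoc. fold K.
    assert (INR N <= INR n) by (apply le_INR; exact HnN).
    apply Rle_div_l; [pose proof (pos_INR n); lra|].
    assert (K / e * e = K) by (field; lra). nra.
Qed.

(** The recursion differentiates f first, so inductions generalise over f; [Dn_S] gives the outer
    derivative. *)
Fixpoint Dn (k : nat) (f : C -> C) : C -> C :=
  match k with O => f | S k => Dn k (C_derive f) end.

Lemma Dn_S (k : nat) (f : C -> C) : Dn (S k) f = C_derive (Dn k f).
Proof. revert f. induction k as [|k IH]; intros f; [reflexivity|]. simpl in *. rewrite <- IH. reflexivity. Qed.

Lemma Dn_plus (j k : nat) (f : C -> C) : Dn j (Dn k f) = Dn (j + k) f.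
Proof.
  revert f. induction k as [|k IH]; intros f; [rewrite Nat.add_0_r; reflexivity|].
  rewrite Nat.add_succ_r. simpl. apply IH.
Qed.

Definition holo_on (D : C -> Prop) (f : C -> C) : Prop := forall z, D z -> holo_at f z.

Definition copen (D : C -> Prop) : Prop :=
  forall z, D z -> exists r, 0 < r /\ forall w, Cmod (w - z) < r -> D w.

Lemma holo_on_derive (D : C -> Prop) (f : C -> C) : copen D -> holo_on D f -> holo_on D (C_derive f).
Proof.
  intros HD H z Hz. destruct (HD z Hz) as [r [Hr Hr']]. apply (holo_derive f z r Hr).
  intros w Hw. apply H, Hr', Hw.
Qed.

Lemma holo_on_Dn (D : C -> Prop) (f : C -> C) (k : nat) : copen D -> holo_on D f -> holo_on D (Dn k f).
Proof.
  intros HD. revert f. induction k as [|k IH]; intros f H; [exact H|]. simpl. apply IH, holo_on_derive; assumption.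
Qed.

Lemma copen_disc (a : C) (R0 : R) : copen (fun w => Cmod (w - a) < R0).
Proof.
  intros z Hz. exists (R0 - Cmod (z - a)). split; [lra|]. intros w Hw.
  replace (w - a)%C with ((w - z) + (z - a))%C by ring. eapply Rle_lt_trans; [apply Cmod_triangle|]. lra.
Qed.

Lemma curve_der_circle (a : C) (r t : R) :
  curve_der (fun t => a + RtoC r * cis (2 * PI * t))%C t (RtoC (2 * PI) * Ci * (RtoC r * cis (2 * PI * t)))%C.
Proof.
  set (w0 := (RtoC (2 * PI) * Ci)%C).
  assert (E : forall s, Cexp (RtoC s * w0) = cis (2 * PI * s)).
  { intros s. unfold Cexp, w0; simpl.
    match goal with |- (RtoC (exp ?x) * cis ?y)%C = _ =>
      replace x with 0 by ring; replace y with (2 * PI * s) by ring end.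
    rewrite exp_0. ring. }
  apply (is_derive_ext (K := R_AbsRing) (V := C_R_NormedModule) (fun s => a + RtoC r * Cexp (RtoC s * w0))%C).
  { intros s. rewrite E. reflexivity. }
  replace (w0 * (RtoC r * cis (2 * PI * t)))%C with (RtoC r * (w0 * Cexp (RtoC t * w0)))%C by (rewrite E; ring).
  apply (curve_der_comp (fun w => a + RtoC r * w)%C (fun s => Cexp (RtoC s * w0)) t).
  - eapply cder_eq; [|apply cder_plus; [apply cder_const|apply cder_scal, cder_id]]. ring.
  - apply Cexp_curve_der.
Qed.

(** Integration by parts on the circle: the derivative of f(a + u) / u^(k+1) along the closed curve
    integrates to 0. *)
Lemma taylor_coeff_derive (f : C -> C) (a : C) (R0 r : R) (k : nat) :
  holo_disc f a R0 -> 0 < r < R0 ->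
  taylor_coeff (C_derive f) a r k = (RtoC (INR (S k)) * taylor_coeff f a r (S k))%C.
Proof.
  intros H Hr.
  assert (H' : holo_disc (C_derive f) a R0) by (apply holo_on_derive; [apply copen_disc|exact H]).
  set (u := fun t => (RtoC r * cis (2 * PI * t))%C).
  assert (Hu0 : forall t, u t <> 0).
  { intros t. apply Cmult_neq_0; [apply RtoC_neq_0; lra|apply cis_neq_0]. }
  assert (Hd : forall t, Cmod (a + u t - a) = r) by (intros t; apply circle_dist; lra).
  set (g := fun t => (f (a + u t) * / (a + u t - a) ^ S k)%C).
  set (dg := fun t => (RtoC (2 * PI) * Ci * (C_derive f (a + u t) / (a + u t - a) ^ k - RtoC (INR (S k)) * (f (a + u t) / (a + u t - a) ^ S k)))%C).
  assert (I : is_CInt dg 0 1 (g 1 - g 0)%C).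
  { apply CInt_derive; [lra| |].
    - intros t _. unfold g, dg.
      assert (Hf : cder f (a + u t)%C (C_derive f (a + u t)%C)) by (apply holo_C_derive, H; rewrite Hd; lra).
      assert (D : cder (fun w => f w * / (w - a) ^ S k)%C (a + u t)%C
        ((C_derive f (a + u t) / (a + u t - a) ^ k - RtoC (INR (S k)) * (f (a + u t) / (a + u t - a) ^ S k)) / u t)%C).
      { eapply cder_eq; [|apply cder_mult; [exact Hf|apply (cder_inv (fun w => (w - a) ^ S k)%C); [|apply (cder_pow (fun w => w - a)%C); apply cder_minus; [apply cder_id|apply cder_const]]]].
        - cbv beta. replace (a + u t - a)%C with (u t) by ring. simpl pred. rewrite Cpow_S.
          field. split; [apply Cpow_nz|]; apply Hu0.
        - cbv beta. replace (a + u t - a)%C with (u t) by ring. apply Cpow_nz, Hu0. }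
      pose proof (curve_der_comp _ (fun t => a + RtoC r * cis (2 * PI * t))%C t _ _ D (curve_der_circle a r t)) as E.
      fold (u t) in E.
      match type of E with curve_der _ _ ?x => match goal with |- curve_der _ _ ?y => replace y with x; [exact E|] end end.
      generalize (Hu0 t). generalize (u t). intros v Hv. unfold Cdiv.
      match goal with |- (?x * / v * (?y * ?i * v))%C = _ => transitivity (y * i * x * (/ v * v))%C; [ring|] end.
      rewrite Cinv_l by exact Hv. ring.
    - intros t _. unfold dg. apply ccont_mult; [apply ccont_const|]. apply ccont_minus; [|apply ccont_mult; [apply ccont_const|]].
      + apply (holo_at_ccont (fun w => C_derive f w / (w - a) ^ k)%C (fun t => a + u t)%C); [|apply ccont_circle].
        apply holo_div_pow; [apply (circle_neq a _ r); [lra|apply Hd]|apply H'; rewrite Hd; lra].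
      + apply (holo_at_ccont (fun w => f w / (w - a) ^ S k)%C (fun t => a + u t)%C); [|apply ccont_circle].
        apply holo_div_pow; [apply (circle_neq a _ r); [lra|apply Hd]|apply H; rewrite Hd; lra]. }
  assert (E01 : u 1 = u 0).
  { unfold u. rewrite Rmult_1_r, Rmult_0_r, cis_2PI, cis_0. reflexivity. }
  assert (Z : (g 1 - g 0)%C = 0) by (unfold g; rewrite E01; ring).
  rewrite Z in I.
  assert (I1 : is_CInt (fun t => C_derive f (a + u t) / (a + u t - a) ^ k)%C 0 1 (taylor_coeff (C_derive f) a r k)).
  { apply (mean_correct (fun w => C_derive f w / (w - a) ^ k)%C a r); [lra|]. intros z Hz.
    apply holo_div_pow; [apply (circle_neq a z r); [lra|exact Hz]|apply H'; lra]. }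
  assert (I2 : is_CInt (fun t => f (a + u t) / (a + u t - a) ^ S k)%C 0 1 (taylor_coeff f a r (S k))).
  { apply (mean_correct (fun w => f w / (w - a) ^ S k)%C a r); [lra|]. intros z Hz.
    apply holo_div_pow; [apply (circle_neq a z r); [lra|exact Hz]|apply H; lra]. }
  pose proof (is_CInt_scal (RtoC (2 * PI) * Ci)%C _ _ _ _ (is_CInt_minus _ _ _ _ _ _ I1 (is_CInt_scal (RtoC (INR (S k))) _ _ _ _ I2))) as J.
  pose proof (is_CInt_inj _ _ _ _ _ I J) as E.
  assert (N : (RtoC (2 * PI) * Ci)%C <> 0).
  { apply Cmult_neq_0; [apply RtoC_neq_0; pose proof PI_RGT_0; lra|]. intros X. injection X. lra. }
  destruct (Ceq_dec (taylor_coeff (C_derive f) a r k - RtoC (INR (S k)) * taylor_coeff f a r (S k))%C 0) as [Y|Y].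
  - replace (taylor_coeff (C_derive f) a r k) with ((taylor_coeff (C_derive f) a r k - RtoC (INR (S k)) * taylor_coeff f a r (S k)) + RtoC (INR (S k)) * taylor_coeff f a r (S k))%C by ring.
    rewrite Y. ring.
  - exfalso. apply (Cmult_neq_0 _ _ N Y). symmetry. exact E.
Qed.

Lemma fact_neq_0_C (k : nat) : RtoC (INR (fact k)) <> 0.
Proof. apply RtoC_neq_0, INR_fact_neq_0. Qed.

Lemma taylor_coeff_Dn (f : C -> C) (a : C) (R0 r : R) (k : nat) :
  holo_disc f a R0 -> 0 < r < R0 -> taylor_coeff f a r k = (Dn k f a / RtoC (INR (fact k)))%C.
Proof.
  intros H Hr. revert f H. induction k as [|k IH]; intros f H.
  - rewrite (taylor_coeff_0 f a R0 r H Hr). simpl. field.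
  - assert (H' : holo_disc (C_derive f) a R0) by (apply holo_on_derive; [apply copen_disc|exact H]).
    pose proof (taylor_coeff_derive f a R0 r k H Hr) as E. rewrite (IH _ H') in E. simpl Dn.
    rewrite fact_simpl, mult_INR, RtoC_mult.
    assert (HS : RtoC (INR (S k)) <> 0) by (apply RtoC_neq_0, not_0_INR; lia).
    pose proof (fact_neq_0_C k) as HF.
    replace (Dn k (C_derive f) a) with (Dn k (C_derive f) a / RtoC (INR (fact k)) * RtoC (INR (fact k)))%C by (field; exact HF).
    rewrite E. field. split; assumption.
Qed.

Lemma cauchy_estimate (f : C -> C) (a : C) (R0 r B : R) (k : nat) :
  holo_disc f a R0 -> 0 < r < R0 -> (forall z, Cmod (z - a) = r -> Cmod (f z) <= B) ->
  Cmod (Dn k f a) <= INR (fact k) * (B / r ^ k).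
Proof.
  intros H Hr HB. pose proof (taylor_coeff_le f a R0 r B k H Hr HB) as L.
  rewrite (taylor_coeff_Dn f a R0 r k H Hr), Cmod_div, Cmod_R, Rabs_right in L
    by (try apply fact_neq_0_C; apply Rle_ge, pos_INR).
  pose proof (INR_fact_lt_0 k) as F. apply (Rmult_le_compat_l (INR (fact k))) in L; [|lra].
  eapply Rle_trans; [|exact L]. right. field. lra.
Qed.

Lemma max_center (f : C -> C) (a : C) (R0 r B : R) :
  holo_disc f a R0 -> 0 < r < R0 -> (forall z, Cmod (z - a) = r -> Cmod (f z) <= B) -> Cmod (f a) <= B.
Proof.
  intros H Hr HB. pose proof (taylor_coeff_le f a R0 r B 0 H Hr HB) as L.
  rewrite (taylor_coeff_0 f a R0 r H Hr) in L. simpl in L. lra.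
Qed.

Lemma pow_n_Cpow (h : C) (k : nat) : pow_n (K := C_Ring) h k = Cpow h k.
Proof. induction k as [|k IH]; simpl; [reflexivity|]. rewrite IH. reflexivity. Qed.

Lemma is_pseries_C (a : nat -> C) (h l : C) :
  is_pseries (K := C_AbsRing) (V := C_NormedModule) a h l <->
  forall e, 0 < e -> exists N, forall n, (N <= n)%nat -> Cmod (sum_n (fun k => a k * h ^ k)%C n - l) < e.
Proof.
  assert (E : forall n, sum_n (fun k => scal (K := C_AbsRing) (V := C_NormedModule) (pow_n h k) (a k)) n = sum_n (fun k => a k * h ^ k)%C n).
  { intros n. apply sum_n_ext. intros k. change (scal (K := C_AbsRing) (V := C_NormedModule) (pow_n h k) (a k)) with (pow_n (K := C_Ring) h k * a k)%C.
    rewrite pow_n_Cpow. apply Cmult_comm. }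
  split.
  - intros H e He.
    assert (HP : locally (T := C_UniformSpace) l (fun w => Cmod (w - l) < e)) by (apply locally_C_disc; exists e; auto).
    destruct (H _ HP) as [N HN]. exists N. intros n Hn. rewrite <- E. apply HN, Hn.
  - intros H P HP. apply locally_C_disc in HP. destruct HP as [r [Hr HP]]. destruct (H r Hr) as [N HN].
    exists N. intros n Hn. apply HP. rewrite E. apply HN, Hn.
Qed.

Lemma taylor_series (f : C -> C) (a h : C) (R0 : R) :
  holo_disc f a R0 -> Cmod h < R0 ->
  is_pseries (K := C_AbsRing) (V := C_NormedModule) (fun k => Dn k f a / RtoC (INR (fact k)))%C h (f (a + h)%C).
Proof.
  intros H Hh. pose proof (Cmod_ge_0 h) as Hh0.
  set (r := (Cmod h + R0) / 2). assert (Hr : 0 < r < R0) by (unfold r; lra).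
  assert (Hhr : Cmod h < r) by (unfold r; lra).
  destruct (circle_bounded f a r ltac:(lra)) as [B [HB0 HB]].
  { intros z Hz. apply holo_cont_at, H. lra. }
  apply is_pseries_C. intros e He.
  set (K := (B + Cmod (f (a + h)%C)) * (r / (r - Cmod h))).
  pose proof (Cmod_ge_0 (f (a + h)%C)) as Hf0.
  assert (HK : 0 < K) by (apply Rmult_lt_0_compat; [lra|apply Rdiv_lt_0_compat; lra]).
  assert (Hx : 0 <= Cmod h / r < 1).
  { split; [apply Rdiv_le_0_compat; lra|]. apply Rlt_div_l; lra. }
  destruct (pow_lt_1_zero (Cmod h / r) ltac:(rewrite Rabs_right; lra) (e / K) ltac:(apply Rdiv_lt_0_compat; lra)) as [N HN].
  exists N. intros n Hn.
  rewrite (sum_n_ext _ (fun k => taylor_coeff f a r k * h ^ k)%C).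
  - eapply Rle_lt_trans; [apply (Cauchy_taylor_remainder f a h R0 r B n H Hhr); [lra|exact HB]|]. fold K.
    specialize (HN (S n) ltac:(lia)). rewrite Rabs_right in HN by (apply Rle_ge, pow_le; lra).
    apply (Rmult_lt_compat_l K) in HN; [|exact HK]. replace (K * (e / K)) with e in HN by (field; lra). exact HN.
  - intros k. rewrite (taylor_coeff_Dn f a R0 r k H Hr). reflexivity.
Qed.

(** * The coefficients of the formal solution *)

Lemma C_sqrt_ex (z : C) : exists w : C, (w * w)%C = z.
Proof.
  destruct z as [x y].
  pose proof (Cmod2_alt (x, y)) as E. simpl in E. pose proof (Cmod_ge_0 (x, y)) as H0.
  set (m := Cmod (x, y)) in *.
  assert (Hx : Rabs x <= m) by apply (re_le_Cmod (x, y)).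
  assert (Hx1 : x <= m) by (eapply Rle_trans; [apply Rle_abs|exact Hx]).
  assert (Hx2 : - x <= m) by (eapply Rle_trans; [apply Rle_abs|rewrite Rabs_Ropp; exact Hx]).
  set (p := sqrt ((m + x) / 2)). set (s := sqrt ((m - x) / 2)).
  assert (Hp : p * p = (m + x) / 2) by (apply sqrt_sqrt; lra).
  assert (Hs : s * s = (m - x) / 2) by (apply sqrt_sqrt; lra).
  assert (Hp0 : 0 <= p) by apply sqrt_pos. assert (Hs0 : 0 <= s) by apply sqrt_pos.
  assert (Hps : 2 * (p * s) = Rabs y).
  { apply Rsqr_inj; [nra|apply Rabs_pos|]. rewrite <- Rsqr_abs. unfold Rsqr. nra. }
  destruct (Rle_lt_dec 0 y) as [L|L].
  - rewrite Rabs_right in Hps by lra. exists (p, s). unfold Cmult; simpl. f_equal; lra.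
  - rewrite Rabs_left in Hps by lra. exists (p, - s). unfold Cmult; simpl. f_equal; lra.
Qed.

(** Replaces the carrier of a canonical structure in an equation by T, where [ring] and [field]
    recognise it. *)
Ltac eq_in T := match goal with |- @eq _ ?a ?b => change (@eq T a b) end.

Lemma sum_n_ends (F : nat -> R) (n : nat) :
  sum_n F (S (S n)) = F 0%nat + sum_n (fun i => F (S i)) n + F (S (S n)).
Proof.
  induction n as [|n IH].
  - rewrite !sum_Sn, !sum_O. reflexivity.
  - rewrite (sum_Sn F (S (S n))), IH, (sum_Sn (fun i => F (S i)) n). unfold plus; simpl. ring.
Qed.

Lemma csum_ends (F : nat -> C) (n : nat) :
  sum_n F (S (S n)) = (F 0%nat + sum_n (fun i => F (S i)) n + F (S (S n)))%C :> C.
Proof.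
  induction n as [|n IH].
  - rewrite !csum_S, !csum_0. reflexivity.
  - rewrite (csum_S F (S (S n))), IH, (csum_S (fun i => F (S i)) n). ring.
Qed.

Lemma csum_ext (F G : nat -> C) (n : nat) :
  (forall i, (i <= n)%nat -> F i = G i) -> sum_n F n = sum_n G n :> C.
Proof.
  intros H. induction n as [|n IH].
  - rewrite !csum_0. apply H. lia.
  - rewrite !csum_S, IH, (H (S n)); [reflexivity|lia|intros; apply H; lia].
Qed.

(* The recursion satisfied by the numbers d_n when q_n = d_n tau Y^n with q_0 = tau and
   Y^2 tau^5 = 25/6912 solves the equation; the constant puts
   the singularities of the sum of d_(n+1) z^n / n! on the unit circle. *)
Definition quad_rec (d : nat -> R) : Prop :=
  d 0%nat = 1 /\ d 1%nat = 0 /\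
  forall n, sum_n (fun i => d i * d (S (S n) - i)%nat) (S (S n)) = (2 * INR n ^ 2 - 8 / 25) * d n.

Definition next_coeff (f : nat -> R) (N : nat) : R :=
  match N with
  | S (S n) => ((2 * INR n ^ 2 - 8 / 25) * f n - sum_n (fun i => f (S i) * f (S n - i)%nat) n) / 2
  | _ => 0
  end.

(** Course-of-values recursion: the table of index n is correct up to n, and its diagonal is the
    sequence. *)
Fixpoint coeff_table (n : nat) : nat -> R :=
  match n with
  | O => fun _ => 1
  | S m => fun k => if (k <=? m)%nat then coeff_table m k else next_coeff (coeff_table m) (S m)
  end.

Lemma coeff_table_stable (m k : nat) : (k <= m)%nat -> coeff_table m k = coeff_table k k.
Proof.
  induction m as [|m IH]; intros H.
  - replace k with 0%nat by lia. reflexivity.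
  - destruct (Nat.eq_dec k (S m)) as [->|N]; [reflexivity|].
    simpl. replace (k <=? m)%nat with true by (symmetry; apply Nat.leb_le; lia). apply IH. lia.
Qed.

Lemma quad_rec_ex : exists d, quad_rec d.
Proof.
  exists (fun n => coeff_table n n). split; [reflexivity|]. split.
  - simpl. reflexivity.
  - intros n.
    assert (E : coeff_table (S (S n)) (S (S n)) = next_coeff (coeff_table (S n)) (S (S n))).
    { change (coeff_table (S (S n)) (S (S n))) with (if (S (S n) <=? S n)%nat then coeff_table (S n) (S (S n)) else next_coeff (coeff_table (S n)) (S (S n))).
      replace (S (S n) <=? S n)%nat with false by (symmetry; apply Nat.leb_gt; lia). reflexivity. }
    rewrite sum_n_ends. replace (S (S n) - 0)%nat with (S (S n)) by lia. rewrite Nat.sub_diag, E.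
    unfold next_coeff. rewrite (coeff_table_stable (S n) n) by lia.
    rewrite (sum_n_ext_loc (fun i => coeff_table (S n) (S i) * coeff_table (S n) (S n - i)%nat)
      (fun i => coeff_table (S i) (S i) * coeff_table (S (S n) - S i)%nat (S (S n) - S i)%nat)).
    + change (coeff_table 0 0) with 1. eq_in R. field.
    + intros i Hi. replace (S (S n) - S i)%nat with (S n - i)%nat by lia.
      rewrite (coeff_table_stable (S n) (S i)), (coeff_table_stable (S n) (S n - i)) by lia. reflexivity.
Qed.

Lemma sum_n_nonneg (F : nat -> R) (n : nat) : (forall i, (i <= n)%nat -> 0 <= F i) -> 0 <= sum_n F n.
Proof.
  intros H. induction n as [|n IH].
  - rewrite sum_O. apply H. lia.
  - rewrite sum_Sn. change (0 <= sum_n F n + F (S n)).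
    pose proof (H (S n) ltac:(lia)). specialize (IH ltac:(intros; apply H; lia)). lra.
Qed.

Lemma quad_rec_step (d : nat -> R) (n : nat) : quad_rec d ->
  2 * d (S (S n)) = (2 * INR n ^ 2 - 8 / 25) * d n - sum_n (fun i => d (S i) * d (S n - i)%nat) n.
Proof.
  intros [H0 [H1 H]]. rewrite <- H, sum_n_ends. replace (S (S n) - 0)%nat with (S (S n)) by lia.
  rewrite Nat.sub_diag, H0.
  rewrite (sum_n_ext (fun i => d (S i) * d (S (S n) - S i)%nat) (fun i => d (S i) * d (S n - i)%nat)); [ring|].
  intros i. reflexivity.
Qed.

(** When two indices have an odd sum, one of them is odd, so every product in the convolution
    vanishes by induction. *)
Lemma quad_rec_odd (d : nat -> R) : quad_rec d -> forall m, d (S (2 * m)) = 0.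
Proof.
  intros Hd m. induction m as [m IH] using lt_wf_ind. destruct m as [|m]; [apply Hd|].
  replace (S (2 * S m))%nat with (S (S (S (2 * m)))) by lia.
  pose proof (quad_rec_step d (S (2 * m)) Hd) as E. rewrite (IH m) in E by lia.
  rewrite (sum_n_ext_loc _ (fun _ => 0)) in E.
  - rewrite sum_n_const in E. lra.
  - intros i Hi. destruct (Nat.Even_or_Odd i) as [[k Hk]|[k Hk]].
    + replace (S i) with (S (2 * k)) by lia. rewrite (IH k) by lia. eq_in R. ring.
    + replace (S (S (2 * m)) - i)%nat with (S (2 * (m - k)))%nat by lia. rewrite (IH (m - k)%nat) by lia. eq_in R. ring.
Qed.

(** Products of two nonpositive numbers enter with a minus sign, and 2 n^2 - 8/25 is positive from n
    = 1 on. For n = 0 that factor is negative, but it meets d_0 = 1. *)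
Lemma quad_rec_sign (d : nat -> R) : quad_rec d ->
  forall n, d (S n) <= 0.
Proof.
  intros Hd n. induction n as [n IH] using lt_wf_ind. destruct n as [|n].
  - destruct Hd as [_ [-> _]]. lra.
  - pose proof (quad_rec_step d n Hd) as E.
    assert (S0 : 0 <= sum_n (fun i => d (S i) * d (S n - i)%nat) n).
    { apply sum_n_nonneg. intros i Hi. pose proof (IH i ltac:(lia)) as A.
      pose proof (IH (n - i)%nat ltac:(lia)) as B. replace (S (n - i)) with (S n - i)%nat in B by lia. nra. }
    destruct n as [|n].
    + destruct Hd as [H0 _]. rewrite H0 in E. simpl in E. simpl in S0. lra.
    + pose proof (IH n ltac:(lia)) as A. rewrite S_INR in E. pose proof (pos_INR n).
      assert (0 <= 2 * (INR n + 1) ^ 2 - 8 / 25) by nra. nra.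
Qed.

(** Dropping the convolution sum, whose sign is known, leaves the linear part of the recursion; it
    forces factorial growth. *)
Lemma quad_rec_growth (d : nat -> R) (n : nat) : quad_rec d ->
  (INR (S n) ^ 2 - 4 / 25) * - d (S n) <= - d (S (S (S n))).
Proof.
  intros Hd. pose proof (quad_rec_step d (S n) Hd) as E.
  assert (S0 : 0 <= sum_n (fun i => d (S i) * d (S (S n) - i)%nat) (S n)).
  { apply sum_n_nonneg. intros i Hi. pose proof (quad_rec_sign d Hd i) as A.
    pose proof (quad_rec_sign d Hd (S n - i)%nat) as B. replace (S (S n - i)) with (S (S n) - i)%nat in B by lia. nra. }
  lra.
Qed.

Lemma quad_rec_2 (d : nat -> R) : quad_rec d -> d 2%nat = - (4 / 25).
Proof.
  intros Hd. pose proof (quad_rec_step d 0 Hd) as E. rewrite sum_O in E. destruct Hd as [H0 [H1 _]].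
  simpl in E. rewrite H0, H1 in E. lra.
Qed.

Lemma RtoC_sum (F : nat -> R) (n : nat) : RtoC (sum_n F n) = sum_n (fun i => RtoC (F i)) n.
Proof.
  induction n as [|n IH].
  - rewrite csum_0, sum_O. reflexivity.
  - rewrite csum_S, <- IH, sum_Sn, <- RtoC_plus. reflexivity.
Qed.

(** Uniqueness of a formal square root: the top term enters the convolution square linearly, with
    coefficient 2 x_0. Both the formal solution and the Taylor coefficients of b are identified in
    this way. *)
Lemma conv_unique (x y : nat -> C) (N : nat) :
  x 0%nat = y 0%nat -> x 0%nat <> 0 -> (forall i, (i < S N)%nat -> x i = y i) ->
  sum_n (fun i => x i * x (S N - i)%nat)%C (S N) = sum_n (fun i => y i * y (S N - i)%nat)%C (S N) :> C ->
  x (S N) = y (S N).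
Proof.
  intros H0 Hx H E.
  assert (E2 : (2 * x 0%nat * (x (S N) - y (S N)))%C = 0).
  { destruct N as [|N].
    - rewrite !csum_S, !csum_0 in E. simpl in E. rewrite <- H0 in E.
      replace (2 * x 0%nat * (x 1%nat - y 1%nat))%C with ((x 0%nat * x 1%nat + x 1%nat * x 0%nat) - (x 0%nat * y 1%nat + y 1%nat * x 0%nat))%C by ring.
      rewrite E. ring.
    - rewrite !csum_ends in E. replace (S (S N) - 0)%nat with (S (S N)) in E by lia.
      rewrite Nat.sub_diag, <- H0 in E.
      rewrite (csum_ext (fun i => x (S i) * x (S (S N) - S i)%nat)%C (fun i => y (S i) * y (S (S N) - S i)%nat)%C) in E.
      + set (s := sum_n (fun i => y (S i) * y (S (S N) - S i)%nat)%C N : C) in *.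
        replace (2 * x 0%nat * (x (S (S N)) - y (S (S N))))%C with
          ((x 0%nat * x (S (S N)) + s + x (S (S N)) * x 0%nat) - (x 0%nat * y (S (S N)) + s + y (S (S N)) * x 0%nat))%C by ring.
        rewrite E. ring.
      + intros i Hi. rewrite !H by lia. reflexivity. }
  assert (N2 : (2 * x 0%nat)%C <> 0) by (apply Cmult_neq_0; [apply RtoC_neq_0; lra|exact Hx]).
  destruct (Ceq_dec (x (S N) - y (S N))%C 0) as [Z|Z].
  - replace (x (S N)) with ((x (S N) - y (S N)) + y (S N))%C by ring. rewrite Z. ring.
  - exfalso. exact (Cmult_neq_0 _ _ N2 Z E2).
Qed.

Lemma conv_scaled (d : nat -> R) (tau Y : C) (n : nat) : quad_rec d ->
  sum_n (fun i => (RtoC (d i) * tau * Y ^ i) * (RtoC (d (S (S n) - i)%nat) * tau * Y ^ (S (S n) - i)))%C (S (S n))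
  = (tau * tau * Y ^ (S (S n)) * RtoC ((2 * INR n ^ 2 - 8 / 25) * d n))%C :> C.
Proof.
  intros [_ [_ H]]. rewrite <- H, RtoC_sum, <- sum_n_Cmult_l. apply csum_ext. intros i Hi.
  replace (S (S n)) with (i + (S (S n) - i))%nat at 3 by lia.
  rewrite Cpow_add_r, RtoC_mult. ring.
Qed.

Lemma C_derive_ext_on (D : C -> Prop) (f g : C -> C) (z : C) : copen D -> D z ->
  (forall w, D w -> f w = g w) -> holo_at g z -> C_derive f z = C_derive g z.
Proof.
  intros HD Hz H Hg. apply cder_C_derive. destruct (HD z Hz) as [r [Hr Hr']].
  apply (cder_ext_loc g f z _ r Hr); [|apply holo_C_derive, Hg]. intros w Hw. symmetry. apply H, Hr', Hw.
Qed.

Section FormalSolution.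
Variables (W : C -> Prop) (q : nat -> C -> C).
Hypothesis HW : copen W.
Hypothesis Hq : formal_solution W q.
Hypothesis Hq0 : forall t, W t -> q 0%nat t <> 0.

Lemma formal_holo (n : nat) (t : C) : W t -> holo_at (q n) t.
Proof. intros Ht. apply ex_derive_cder. apply (proj1 Hq n t Ht). Qed.

Lemma formal_q0_eq (t : C) : W t -> (6 * (q 0%nat t * q 0%nat t) + t)%C = 0.
Proof.
  intros Ht. pose proof (proj2 Hq 0%nat t Ht) as E. unfold lhs_coeff, rhs_coeff in E.
  rewrite csum_0 in E. symmetry. exact E.
Qed.

Lemma formal_q0_der (t : C) : W t -> cder (q 0%nat) t (- / (12 * q 0%nat t))%C.
Proof.
  intros Ht. pose proof (holo_C_derive _ _ (formal_holo 0 t Ht)) as D.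
  set (l := C_derive (q 0%nat) t) in *.
  assert (D1 : cder (fun w => 6 * (q 0%nat w * q 0%nat w) + w)%C t (12 * q 0%nat t * l + 1)%C).
  { eapply cder_eq; [|apply cder_plus; [apply cder_scal; apply cder_mult; exact D|apply cder_id]]. ring. }
  destruct (HW t Ht) as [r [Hr Hr']].
  assert (D2 : cder (fun w => 6 * (q 0%nat w * q 0%nat w) + w)%C t 0).
  { apply (cder_ext_loc (fun _ => RtoC 0) _ t _ r Hr); [|apply cder_const].
    intros w Hw. symmetry. apply formal_q0_eq, Hr', Hw. }
  pose proof (cder_unique _ _ _ _ D1 D2) as E.
  pose proof (Hq0 t Ht) as Hn.
  eapply cder_eq; [|exact D].
  replace l with ((12 * q 0%nat t * l + 1 - 1) / (12 * q 0%nat t))%C.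
  - rewrite E. field. exact Hn.
  - field. exact Hn.
Qed.

(** This is q_0^(1-k), written with natural exponents; implicit differentiation of 6 q_0^2 + t = 0
    lowers the exponent by 2. *)
Lemma formal_monomial_der (k : nat) (t : C) : W t ->
  cder (fun w => q 0%nat w * (/ q 0%nat w) ^ k)%C t (RtoC ((INR k - 1) / 12) * (/ q 0%nat t) ^ (S k))%C.
Proof.
  intros Ht. pose proof (formal_q0_der t Ht) as D. pose proof (Hq0 t Ht) as Hn.
  eapply cder_eq; [|apply cder_mult; [exact D|apply (cder_pow (fun w => / q 0%nat w)%C), cder_inv; [exact Hn|exact D]]].
  unfold Rdiv. rewrite RtoC_mult, RtoC_minus, RtoC_inv by lra. set (u := q 0%nat t) in *.
  destruct k as [|k].
  - simpl. field. exact Hn.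
  - simpl pred. rewrite !Cpow_S. field. exact Hn.
Qed.

Lemma formal_inv_pow_der (k : nat) (t : C) : W t ->
  cder (fun w => (/ q 0%nat w) ^ (S k))%C t (RtoC (INR (S k) / 12) * (/ q 0%nat t) ^ (S (S (S k))))%C.
Proof.
  intros Ht. pose proof (formal_q0_der t Ht) as D. pose proof (Hq0 t Ht) as Hn.
  eapply cder_eq; [|apply (cder_pow (fun w => / q 0%nat w)%C), cder_inv; [exact Hn|exact D]].
  unfold Rdiv. rewrite RtoC_mult, RtoC_inv by lra. set (u := q 0%nat t) in *.
  simpl pred. rewrite !Cpow_S. field. exact Hn.
Qed.

Lemma formal_monomial_der2 (c : C) (k : nat) (t : C) : W t ->
  C_derive (C_derive (fun w => c * (q 0%nat w * (/ q 0%nat w) ^ k))%C) t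
   = (c * RtoC ((INR k ^ 2 - 1) / 144) * (/ q 0%nat t) ^ (k + 3))%C.
Proof.
  intros Ht.
  rewrite (C_derive_ext_on W _ (fun w => c * RtoC ((INR k - 1) / 12) * (/ q 0%nat w) ^ (S k))%C t HW Ht).
  - apply cder_C_derive. eapply cder_eq; [|apply cder_scal, formal_inv_pow_der, Ht].
    replace (S (S (S k))) with (k + 3)%nat by lia. rewrite S_INR.
    rewrite Cmult_assoc. f_equal. rewrite <- !Cmult_assoc. f_equal. rewrite <- RtoC_mult. f_equal. field.
  - intros w Hw. apply cder_C_derive. rewrite <- Cmult_assoc. apply cder_scal, formal_monomial_der, Hw.
  - eexists. apply cder_scal, formal_inv_pow_der, Ht.
Qed.

(** The equation at order n + 1 prescribes the convolution square of the q_i through the second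
    derivative of q_(n-1), and [conv_unique] then isolates the top term. Y may be either root at
    each t separately, because the terms of odd order vanish. *)
Theorem formal_coeffs (d : nat -> R) : quad_rec d ->
  forall n t Y, W t -> (Y * Y * q 0%nat t ^ 5)%C = RtoC (25 / 6912) ->
    q n t = (RtoC (d n) * q 0%nat t * Y ^ n)%C.
Proof.
  intros Hd n. induction n as [n IH] using lt_wf_ind. intros t Y Ht HY.
  destruct n as [|n].
  { rewrite (proj1 Hd). simpl. ring. }
  assert (Hsum : sum_n (fun i => q i t * q (S n - i)%nat t)%C (S n)
    = sum_n (fun i => (RtoC (d i) * q 0%nat t * Y ^ i) * (RtoC (d (S n - i)%nat) * q 0%nat t * Y ^ (S n - i)))%C (S n) :> C).
  { pose proof (proj2 Hq (S n) t Ht) as E. unfold rhs_coeff in E.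
    set (s := sum_n (fun i => q i t * q (S n - i)%nat t)%C (S n) : C) in *.
    assert (Es : s = (lhs_coeff q (S n) t / 6)%C).
    { rewrite E. field. }
    rewrite Es. destruct n as [|n].
    - simpl lhs_coeff. rewrite csum_S, csum_0. simpl Nat.sub. rewrite (proj1 (proj2 Hd)). unfold Cdiv. ring.
    - rewrite (conv_scaled d (q 0%nat t) Y n Hd). simpl lhs_coeff.
      destruct (Nat.Even_or_Odd n) as [[m Hm]|[m Hm]].
      (* An even power of Y is a power of 1 / q_0, hence single-valued in t, and the induction
         hypothesis can be differentiated. *)
      + assert (Ef : forall w, W w -> q n w = (RtoC (d n * (25/6912)^m) * (q 0%nat w * (/ q 0%nat w) ^ (5 * m)))%C).
        { intros w Hw. destruct (C_sqrt_ex (RtoC (25/6912) * (/ q 0%nat w) ^ 5)%C) as [Z HZ].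
          pose proof (Hq0 w Hw) as Hn.
          rewrite (IH n ltac:(lia) w Z Hw).
          - rewrite Hm at 2. rewrite Cpow_mult_r. replace (Z ^ 2)%C with (Z * Z)%C by (simpl; ring).
            rewrite HZ, Cpow_mult_l, <- Cpow_mult_r, RtoC_mult, RtoC_pow. ring.
          - rewrite HZ. rewrite Cpow_inv by exact Hn. field. exact Hn. }
        assert (ED : C_derive (C_derive (q n)) t = C_derive (C_derive (fun w => RtoC (d n * (25/6912)^m) * (q 0%nat w * (/ q 0%nat w) ^ (5 * m)))%C) t).
        { assert (H1 : holo_on W (fun w => RtoC (d n * (25/6912)^m) * (q 0%nat w * (/ q 0%nat w) ^ (5 * m)))%C).
          { intros w Hw. eexists. apply cder_scal, formal_monomial_der, Hw. }
          apply (C_derive_ext_on W); [exact HW|exact Ht| |apply (holo_on_derive W); assumption].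
          intros w Hw. apply (C_derive_ext_on W); auto. }
        rewrite ED, formal_monomial_der2 by exact Ht.
        pose proof (Hq0 t Ht) as Hn. set (u := q 0%nat t) in *.
        assert (EY : (Y ^ S (S n))%C = (RtoC ((25/6912) ^ (S m)) * (/ u) ^ (5 * m + 5))%C).
        { rewrite Hm. replace (S (S (2 * m))) with (2 * S m)%nat by lia. rewrite Cpow_mult_r.
          replace (Y ^ 2)%C with (RtoC (25/6912) * (/ u) ^ 5)%C.
          - rewrite Cpow_mult_l, <- Cpow_mult_r, RtoC_pow. do 2 f_equal. lia.
          - rewrite <- HY, Cpow_inv by exact Hn. simpl. field. exact Hn. }
        rewrite EY.
        replace (5 * m + 5)%nat with ((5 * m + 3) + 2)%nat by lia. rewrite (Cpow_add_r (/ u) (5 * m + 3) 2).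
        replace ((/ u) ^ 2)%C with (/ (u * u))%C by (simpl; field; exact Hn).
        assert (En : INR n = 2 * INR m) by (rewrite Hm, mult_INR; reflexivity).
        assert (E5 : INR (5 * m) = 5 * INR m) by (rewrite mult_INR; simpl; ring).
        rewrite En, E5.
        (* The constants meet here: 25/6912 times 8 m^2 - 8/25 is (25 m^2 - 1) / 864, and 864 = 144
           * 6. *)
        transitivity (RtoC (d n * (25/6912)^m * ((5 * INR m) ^ 2 - 1) / 144 / 6) * (/ u) ^ (5 * m + 3))%C.
        * unfold Rdiv. rewrite !RtoC_mult, !RtoC_inv by lra. unfold Cdiv. ring.
        * transitivity (RtoC ((25/6912)^(S m) * ((2 * (2 * INR m) ^ 2 - 8 * / 25) * d n)) * (/ u) ^ (5 * m + 3))%C.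
          -- f_equal. f_equal. simpl. field.
          -- rewrite RtoC_mult. unfold Rdiv. field. exact Hn.
      + assert (Dn0 : d n = 0) by (rewrite Hm; replace (2 * m + 1)%nat with (S (2 * m)) by lia; apply (quad_rec_odd d Hd)).
        assert (Ef : forall w, W w -> q n w = 0).
        { intros w Hw. destruct (C_sqrt_ex (RtoC (25/6912) * (/ q 0%nat w) ^ 5)%C) as [Z HZ].
          pose proof (Hq0 w Hw) as Hn.
          rewrite (IH n ltac:(lia) w Z Hw), Dn0.
          - ring.
          - rewrite HZ. rewrite Cpow_inv by exact Hn. field. exact Hn. }
        rewrite Dn0, Rmult_0_r.
        rewrite (C_derive_ext_on W _ (fun _ => RtoC 0) t HW Ht).
        * rewrite (cder_C_derive _ _ _ (cder_const 0 t)). unfold Cdiv. ring.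
        * intros w Hw. rewrite (C_derive_ext_on W _ (fun _ => RtoC 0) w HW Hw Ef).
          -- apply cder_C_derive, cder_const.
          -- eexists. apply cder_const.
        * eexists. apply cder_const. }
  apply (conv_unique (fun i => q i t) (fun i => RtoC (d i) * q 0%nat t * Y ^ i)%C n).
  - rewrite (proj1 Hd). simpl. ring.
  - apply Hq0, Ht.
  - intros i Hi. apply IH; assumption.
  - exact Hsum.
Qed.
End FormalSolution.

(** * Convolution of holomorphic functions on star-shaped domains *)

(** [holo_quad] gives all slices the same quadratic remainder, so differentiation passes under the
    integral. *)
Lemma param_holo (K : R -> C -> C) (K' : R -> C) (z0 : C) (rho B : R) : 0 < rho ->
  (forall s, 0 <= s <= 1 -> holo_disc (K s) z0 rho) ->
  (forall s z, 0 <= s <= 1 -> Cmod (z - z0) < rho -> Cmod (K s z) <= B) ->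
  (forall s z, 0 <= s <= 1 -> Cmod (z - z0) < rho -> ccont (fun s => K s z) s) ->
  (forall s, 0 <= s <= 1 -> cder (K s) z0 (K' s)) ->
  (forall s, 0 <= s <= 1 -> ccont K' s) ->
  cder (fun z => CInt (fun s => K s z) 0 1) z0 (CInt K' 0 1).
Proof.
  intros Hr H HB Hc Hd Hc'.
  assert (Hz0 : Cmod (z0 - z0) < rho) by (rewrite Cmod_sub_self; exact Hr).
  assert (HB0 : 0 <= B) by (eapply Rle_trans; [apply Cmod_ge_0|apply (HB 0 z0 ltac:(lra) Hz0)]).
  set (k := 11 * B / (rho * rho)). assert (Hk : 0 <= k) by (apply Rdiv_le_0_compat; nra).
  intros e He. exists (Rmin (rho / 2) (e / (k + 1))).
  split; [apply Rmin_pos; [lra|apply Rdiv_lt_0_compat; lra]|]. intros w Hw.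
  assert (H1 : Cmod (w - z0) < rho / 2) by (eapply Rlt_le_trans; [exact Hw|apply Rmin_l]).
  assert (H2 : Cmod (w - z0) < e / (k + 1)) by (eapply Rlt_le_trans; [exact Hw|apply Rmin_r]).
  assert (I1 : forall z, Cmod (z - z0) < rho -> is_CInt (fun s => K s z) 0 1 (CInt (fun s => K s z) 0 1)).
  { intros z Hz. apply CInt_correct; [lra|]. intros s Hs. apply Hc; assumption. }
  pose proof (CInt_correct K' 0 1 ltac:(lra) Hc') as I2.
  pose proof (is_CInt_minus _ _ _ _ _ _ (is_CInt_minus _ _ _ _ _ _ (I1 w ltac:(lra)) (I1 z0 Hz0)) (is_CInt_scal (w - z0)%C _ _ _ _ I2)) as J.
  rewrite (Cmult_comm (CInt K' 0 1)).
  eapply Rle_trans; [eapply (CInt_bound _ 0 1 (k * (Cmod (w - z0) * Cmod (w - z0)))); [lra| |exact J]|].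
  - intros s Hs. cbv beta.
    destruct (holo_quad (K s) z0 rho B Hr (H s Hs) (fun z Hz => HB s z Hs Hz)) as [l [D1 [_ D2]]].
    rewrite (cder_unique _ _ _ _ (Hd s Hs) D1). specialize (D2 (w - z0)%C ltac:(lra)).
    replace (z0 + (w - z0))%C with w in D2 by ring. rewrite (Cmult_comm _ l). exact D2.
  - pose proof (Cmod_ge_0 (w - z0)). set (x := Cmod (w - z0)) in *.
    rewrite Rminus_0_r, Rmult_1_r, <- Rmult_assoc. apply Rmult_le_compat_r; [lra|].
    apply Rle_trans with ((k + 1) * x); [nra|].
    apply Rle_trans with ((k + 1) * (e / (k + 1))).
    + apply Rmult_le_compat_l; lra.
    + right. field. lra.
Qed.

Definition star (D : C -> Prop) : Prop := forall z s, D z -> 0 <= s <= 1 -> D (RtoC s * z)%C.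

(** Compactness of the segment from 0 to z0. One gauge d serves as radius and, through / d, as
    bound, so that a single covering argument delivers both. *)
Lemma star_uniform (D : C -> Prop) (f : C -> C) (z0 : C) :
  copen D -> star D -> holo_on D f -> D z0 ->
  exists rho B, 0 < rho /\ forall s w, 0 <= s <= 1 -> Cmod (w - RtoC s * z0) < rho -> D w /\ Cmod (f w) <= B.
Proof.
  intros HD Hs Hf Hz0. pose proof (Cmod_ge_0 z0) as Hm.
  assert (Hd : forall t, exists d : posreal, 0 <= t <= 1 ->
     forall w, Cmod (w - RtoC t * z0) < d * (Cmod z0 + 1) -> D w /\ Cmod (f w) <= / d).
  { intros t. destruct (classic (0 <= t <= 1)) as [Ht|Ht]; [|exists (mkposreal 1 Rlt_0_1); tauto].
    pose proof (Hs z0 t Hz0 Ht) as Dt.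
    destruct (HD _ Dt) as [r [Hr Hr']].
    destruct (holo_cont_at f _ (Hf _ Dt) 1 Rlt_0_1) as [d [Hd Hd']].
    set (b := Cmod (f (RtoC t * z0)%C) + 1). assert (Hb : 0 < b) by (unfold b; pose proof (Cmod_ge_0 (f (RtoC t * z0)%C)); lra).
    set (dd := Rmin (Rmin r d / (Cmod z0 + 1)) (/ b)).
    assert (Hdd : 0 < dd).
    { apply Rmin_pos; [apply Rdiv_lt_0_compat; [apply Rmin_pos; lra|lra]|apply Rinv_0_lt_compat, Hb]. }
    exists (mkposreal dd Hdd). intros _ w Hw. simpl in Hw.
    assert (Hw2 : Cmod (w - RtoC t * z0) < Rmin r d).
    { eapply Rlt_le_trans; [exact Hw|]. apply Rle_trans with (Rmin r d / (Cmod z0 + 1) * (Cmod z0 + 1)).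
      - apply Rmult_le_compat_r; [lra|apply Rmin_l].
      - right. field. lra. }
    split; [apply Hr'; eapply Rlt_le_trans; [exact Hw2|apply Rmin_l]|]. simpl.
    apply Rle_trans with b.
    - specialize (Hd' w ltac:(eapply Rlt_le_trans; [exact Hw2|apply Rmin_r])).
      replace (f w) with ((f w - f (RtoC t * z0)) + f (RtoC t * z0))%C by ring.
      eapply Rle_trans; [apply Cmod_triangle|]. unfold b. lra.
    - rewrite <- (Rinv_inv b). apply Rinv_le_contravar; [exact Hdd|apply Rmin_r]. }
  set (delta := fun t => proj1_sig (constructive_indefinite_description _ (Hd t))).
  destruct (compactness_value_1d 0 1 delta) as [d Hc].
  exists d, (/ d). split; [apply cond_pos|]. intros s w Hs1 Hw.
  apply NNPP. intros N. apply (Hc s Hs1). intros [t [Ht [Hst Hdt]]]. apply N.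
  unfold delta in Hst, Hdt. destruct (constructive_indefinite_description _ (Hd t)) as [dt Hdt']. simpl in Hst, Hdt.
  pose proof (cond_pos d) as Hd0. pose proof (cond_pos dt) as Hdt0.
  destruct (Hdt' Ht w) as [A1 A2].
  - replace (w - RtoC t * z0)%C with ((w - RtoC s * z0) + RtoC (s - t) * z0)%C by (rewrite RtoC_minus; ring).
    eapply Rle_lt_trans; [apply Cmod_triangle|]. rewrite Cmod_mult, Cmod_R. nra.
  - split; [exact A1|]. eapply Rle_trans; [exact A2|]. apply Rinv_le_contravar; assumption.
Qed.

(** The integrand of the convolution, the integral of f(z - x) g(x) dx from 0 to z, after the
    substitution x = s z. *)
Definition conv_kernel (f g : C -> C) (s : R) (z : C) : C :=
  (z * (f (RtoC (1 - s) * z) * g (RtoC s * z)))%C.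

Definition conv (f g : C -> C) (z : C) : C := CInt (fun s => conv_kernel f g s z) 0 1.

Lemma ccont_scal_line (z : C) (s : R) : ccont (fun s => RtoC s * z)%C s.
Proof. apply ccont_mult; [apply ccont_Rid|apply ccont_const]. Qed.

Lemma ccont_scal_line' (z : C) (s : R) : ccont (fun s => RtoC (1 - s) * z)%C s.
Proof.
  apply ccont_mult; [|apply ccont_const]. apply ccont_RtoC.
  apply (continuous_minus (V := R_NormedModule)); [apply continuous_const|apply continuous_id].
Qed.

Lemma cder_line (z c : C) : cder (fun z => c * z)%C z c.
Proof. eapply cder_eq; [|apply cder_scal, cder_id]. ring. Qed.

Section Convolution.
Variables (D : C -> Prop).
Hypothesis HD : copen D.
Hypothesis Hs : star D.

Lemma conv_kernel_cont (f g : C -> C) (z : C) (s : R) :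
  holo_on D f -> holo_on D g -> D z -> 0 <= s <= 1 -> ccont (fun s => conv_kernel f g s z) s.
Proof.
  intros Hf Hg Hz Hs1. unfold conv_kernel.
  apply ccont_mult; [apply ccont_const|]. apply ccont_mult.
  - apply (holo_at_ccont f (fun s => RtoC (1 - s) * z)%C); [apply Hf, Hs; [exact Hz|lra]|apply ccont_scal_line'].
  - apply (holo_at_ccont g (fun s => RtoC s * z)%C); [apply Hg, Hs; [exact Hz|lra]|apply ccont_scal_line].
Qed.

Lemma conv_correct (f g : C -> C) (z : C) :
  holo_on D f -> holo_on D g -> D z -> is_CInt (fun s => conv_kernel f g s z) 0 1 (conv f g z).
Proof. intros Hf Hg Hz. apply CInt_correct; [lra|]. intros s Hs1. apply conv_kernel_cont; assumption. Qed.

Lemma conv_der (f g : C -> C) (z : C) :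
  holo_on D f -> holo_on D g -> D z -> cder (conv f g) z (f 0 * g z + conv (C_derive f) g z)%C.
Proof.
  intros Hf Hg Hz.
  assert (Hf' : holo_on D (C_derive f)) by (apply holo_on_derive; assumption).
  assert (Hg' : holo_on D (C_derive g)) by (apply holo_on_derive; assumption).
  destruct (star_uniform D f z HD Hs Hf Hz) as [r1 [B1 [Hr1 HB1]]].
  destruct (star_uniform D g z HD Hs Hg Hz) as [r2 [B2 [Hr2 HB2]]].
  set (rho := Rmin r1 r2). assert (Hrho : 0 < rho) by (apply Rmin_pos; assumption).
  assert (Hin : forall s w, 0 <= s <= 1 -> Cmod (w - z) < rho -> Cmod (RtoC s * w - RtoC s * z) < rho).
  { intros s w Hs1 Hw. replace (RtoC s * w - RtoC s * z)%C with (RtoC s * (w - z))%C by ring.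
    rewrite Cmod_mult, Cmod_R, Rabs_right by lra. pose proof (Cmod_ge_0 (w - z)). nra. }
  assert (F1 : forall s w, 0 <= s <= 1 -> Cmod (w - z) < rho -> D (RtoC s * w)%C /\ Cmod (f (RtoC s * w)%C) <= B1).
  { intros s w Hs1 Hw. apply (HB1 s); [exact Hs1|]. eapply Rlt_le_trans; [apply Hin; assumption|apply Rmin_l]. }
  assert (F2 : forall s w, 0 <= s <= 1 -> Cmod (w - z) < rho -> D (RtoC s * w)%C /\ Cmod (g (RtoC s * w)%C) <= B2).
  { intros s w Hs1 Hw. apply (HB2 s); [exact Hs1|]. eapply Rlt_le_trans; [apply Hin; assumption|apply Rmin_r]. }
  set (K' := fun s => (f (RtoC (1 - s) * z) * g (RtoC s * z)
     + z * (RtoC (1 - s) * (C_derive f (RtoC (1 - s) * z) * g (RtoC s * z)) + RtoC s * (f (RtoC (1 - s) * z) * C_derive g (RtoC s * z))))%C).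
  assert (cf : forall h s, 0 <= s <= 1 -> holo_on D h -> ccont (fun s => h (RtoC (1 - s) * z)%C) s).
  { intros h s Hs1 Hh. apply (holo_at_ccont h (fun s => RtoC (1 - s) * z)%C); [apply Hh, Hs; [exact Hz|lra]|apply ccont_scal_line']. }
  assert (cg : forall h s, 0 <= s <= 1 -> holo_on D h -> ccont (fun s => h (RtoC s * z)%C) s).
  { intros h s Hs1 Hh. apply (holo_at_ccont h (fun s => RtoC s * z)%C); [apply Hh, Hs; [exact Hz|lra]|apply ccont_scal_line]. }
  assert (c1 : forall s : R, ccont (fun s => RtoC (1 - s)) s).
  { intros s. apply ccont_RtoC. apply (continuous_minus (V := R_NormedModule)); [apply continuous_const|apply continuous_id]. }
  assert (CK : forall s, 0 <= s <= 1 -> ccont K' s).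
  { intros s Hs1. unfold K'. apply ccont_plus; [apply ccont_mult; auto|].
    apply ccont_mult; [apply ccont_const|]. apply ccont_plus; apply ccont_mult; auto using ccont_Rid; apply ccont_mult; auto. }
  assert (DK : cder (conv f g) z (CInt K' 0 1)).
  { apply (param_holo (conv_kernel f g) K' z rho ((Cmod z + rho) * (B1 * B2)) Hrho).
    - intros s Hs1 w Hw. unfold conv_kernel.
      destruct (Hf (RtoC (1 - s) * w)%C ltac:(apply (F1 (1 - s) w); [lra|exact Hw])) as [l Hl].
      destruct (Hg (RtoC s * w)%C ltac:(apply (F2 s w); [lra|exact Hw])) as [m Hm'].
      eexists. apply cder_mult; [apply cder_id|]. apply cder_mult.
      + apply (cder_comp f (fun w => RtoC (1 - s) * w)%C); [exact Hl|apply cder_line].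
      + apply (cder_comp g (fun w => RtoC s * w)%C); [exact Hm'|apply cder_line].
    - intros s w Hs1 Hw. unfold conv_kernel. rewrite !Cmod_mult.
      destruct (F1 (1 - s) w ltac:(lra) Hw) as [_ A1]. destruct (F2 s w Hs1 Hw) as [_ A2].
      apply Rmult_le_compat; [apply Cmod_ge_0|apply Rmult_le_pos; apply Cmod_ge_0| |].
      + replace w with (z + (w - z))%C by ring. eapply Rle_trans; [apply Cmod_triangle|]. lra.
      + apply Rmult_le_compat; try apply Cmod_ge_0; assumption.
    - intros s w Hs1 Hw. apply conv_kernel_cont; try assumption.
      replace w with (RtoC 1 * w)%C by ring. apply (F1 1 w); [lra|exact Hw].
    - intros s Hs1. unfold conv_kernel, K'.
      pose proof (holo_C_derive f (RtoC (1 - s) * z)%C (Hf _ (Hs z (1 - s) Hz ltac:(lra)))) as Hl.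
      pose proof (holo_C_derive g (RtoC s * z)%C (Hg _ (Hs z s Hz ltac:(lra)))) as Hm'.
      eapply cder_eq; [|apply cder_mult; [apply cder_id|apply cder_mult;
         [apply (cder_comp f (fun w => RtoC (1 - s) * w)%C); [exact Hl|apply cder_line]
         |apply (cder_comp g (fun w => RtoC s * w)%C); [exact Hm'|apply cder_line]]]].
      cbv beta. ring.
    - exact CK. }
  eapply cder_eq; [|exact DK].
  (* The differentiated integrand K' exceeds the kernel of f' convolved with g by the exact
     s-derivative of g1, whose boundary values give f(0) g(z). *)
  set (g1 := fun s => (RtoC s * (f (RtoC (1 - s) * z) * g (RtoC s * z)))%C).
  set (dg1 := fun s => (K' s - conv_kernel (C_derive f) g s z)%C).
  assert (I1 : is_CInt dg1 0 1 (g1 1 - g1 0)%C).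
  { apply CInt_derive; [lra| |].
    - intros s Hs1.
      assert (Hl : cder f (RtoC 1 * z - RtoC s * z)%C (C_derive f (RtoC (1 - s) * z)%C)).
      { replace (RtoC 1 * z - RtoC s * z)%C with (RtoC (1 - s) * z)%C by (rewrite RtoC_minus; ring).
        apply holo_C_derive, Hf, Hs; [exact Hz|lra]. }
      pose proof (holo_C_derive g (RtoC s * z)%C (Hg _ (Hs z s Hz ltac:(lra)))) as Hm'.
      assert (Dz : cder (fun w => w * (f (RtoC 1 * z - w * z) * g (w * z)))%C (RtoC s) (dg1 s)).
      { eapply cder_eq; [|apply cder_mult; [apply cder_id|apply cder_mult;
         [apply (cder_comp f (fun w => RtoC 1 * z - w * z)%C); [exact Hl|apply cder_minus; [apply cder_const|apply cder_mult; [apply cder_id|apply cder_const]]]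
         |apply (cder_comp g (fun w => w * z)%C); [exact Hm'|apply cder_mult; [apply cder_id|apply cder_const]]]]].
        cbv beta. unfold dg1, K', conv_kernel.
        replace (RtoC 1 * z - RtoC s * z)%C with (RtoC (1 - s) * z)%C by (rewrite RtoC_minus; ring).
        generalize (f (RtoC (1 - s) * z)%C) (g (RtoC s * z)%C) (C_derive f (RtoC (1 - s) * z)%C) (C_derive g (RtoC s * z)%C).
        intros x1 x2 x3 x4. rewrite RtoC_minus. ring. }
      assert (E1 : curve_der (fun s => RtoC s) s 1).
      { pose proof (curve_der_affine 0 1 s) as A.
        apply (is_derive_ext (K := R_AbsRing) (V := C_R_NormedModule) (fun s => 0 + RtoC s * 1)%C); [|exact A].
        intros t. eq_in C. ring. }
      pose proof (curve_der_comp _ _ _ _ _ Dz E1) as A. rewrite Cmult_1_r in A.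
      apply (is_derive_ext (K := R_AbsRing) (V := C_R_NormedModule) (fun s => RtoC s * (f (RtoC 1 * z - RtoC s * z) * g (RtoC s * z)))%C); [|exact A].
      intros t. unfold g1. eq_in C. do 3 f_equal. rewrite RtoC_minus. ring.
    - intros s Hs1. apply ccont_minus; [apply CK, Hs1|apply conv_kernel_cont; assumption]. }
  pose proof (conv_correct (C_derive f) g z Hf' Hg Hz) as I2.
  pose proof (is_CInt_plus _ _ _ _ _ _ I1 I2) as J.
  assert (J' : is_CInt K' 0 1 (g1 1 - g1 0 + conv (C_derive f) g z)%C).
  { eapply is_CInt_ext; [lra| |exact J]. intros s _. unfold dg1. ring. }
  rewrite (is_CInt_unique _ _ _ _ J'). unfold g1.
  replace (RtoC (1 - 1) * z)%C with (RtoC 0) by (rewrite Rminus_diag; ring).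
  rewrite !Cmult_1_l, !Cmult_0_l. ring.
Qed.

Lemma conv_holo (f g : C -> C) : holo_on D f -> holo_on D g -> holo_on D (conv f g).
Proof. intros Hf Hg z Hz. eexists. apply conv_der; assumption. Qed.

Lemma conv_minus_l (f1 f2 g : C -> C) (z : C) :
  holo_on D f1 -> holo_on D f2 -> holo_on D g -> D z ->
  conv (fun z => f1 z - f2 z)%C g z = (conv f1 g z - conv f2 g z)%C.
Proof.
  intros H1 H2 Hg Hz. apply is_CInt_unique.
  eapply is_CInt_ext; [lra| |apply is_CInt_minus; apply conv_correct; eassumption].
  intros s _. unfold conv_kernel. ring.
Qed.

Lemma conv_minus_r (f g1 g2 : C -> C) (z : C) :
  holo_on D f -> holo_on D g1 -> holo_on D g2 -> D z ->
  conv f (fun z => g1 z - g2 z)%C z = (conv f g1 z - conv f g2 z)%C.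
Proof.
  intros Hf H1 H2 Hz. apply is_CInt_unique.
  eapply is_CInt_ext; [lra| |apply is_CInt_minus; apply conv_correct; eassumption].
  intros s _. unfold conv_kernel. ring.
Qed.

(** The weights at (1 - s) z and s z multiply to exactly exp (K |z|), so exponential bounds survive
    convolution at the price of one factor |z|. *)
Lemma conv_bound (f g : C -> C) (z : C) (K A B : R) :
  holo_on D f -> holo_on D g -> D z ->
  (forall w, D w -> Cmod (f w) <= A * exp (K * Cmod w)) ->
  (forall w, D w -> Cmod (g w) <= B * exp (K * Cmod w)) ->
  Cmod (conv f g z) <= A * B * Cmod z * exp (K * Cmod z).
Proof.
  intros Hf Hg Hz HA HB.
  eapply Rle_trans; [eapply (CInt_bound _ 0 1 (A * B * Cmod z * exp (K * Cmod z))); [lra| |apply conv_correct; assumption]|lra].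
  intros s Hs1. unfold conv_kernel. rewrite !Cmod_mult.
  specialize (HA _ (Hs z (1 - s) Hz ltac:(lra))). specialize (HB _ (Hs z s Hz ltac:(lra))).
  rewrite Cmod_mult, Cmod_R, Rabs_right in HA, HB by lra.
  replace (A * B * Cmod z * exp (K * Cmod z)) with
    (Cmod z * ((A * exp (K * ((1 - s) * Cmod z))) * (B * exp (K * (s * Cmod z))))).
  - apply Rmult_le_compat_l; [apply Cmod_ge_0|]. apply Rmult_le_compat; try apply Cmod_ge_0; assumption.
  - replace (K * Cmod z) with (K * ((1 - s) * Cmod z) + K * (s * Cmod z)) by ring. rewrite exp_plus. ring.
Qed.

Lemma exp_int_bound (K x : R) : 0 < K -> 0 <= x ->
  exists J, is_RInt (fun s => x * exp (K * (s * x))) 0 1 J /\ J <= exp (K * x) / K.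
Proof.
  intros HK Hx. exists (exp (K * (1 * x)) / K - exp (K * (0 * x)) / K). split.
  - apply (is_RInt_derive (V := R_CompleteNormedModule) (fun s => exp (K * (s * x)) / K)).
    + intros s _. auto_derive; [trivial|field; lra].
    + intros s _. apply (ex_derive_continuous (K := R_AbsRing) (V := R_NormedModule)). auto_derive. trivial.
  - rewrite Rmult_1_l. pose proof (exp_pos (K * (0 * x))).
    assert (0 < exp (K * (0 * x)) / K) by (apply Rdiv_lt_0_compat; lra). lra.
Qed.

(* The gain 1/K makes the linear part of the integral operator a contraction for K large. *)
Lemma conv_bound_linear (f g : C -> C) (z : C) (K N : R) : 0 < K -> 0 <= N ->
  holo_on D f -> holo_on D g -> D z ->
  (forall s, 0 <= s <= 1 ->
     Cmod (f (RtoC (1 - s) * z)%C) * Cmod (g (RtoC s * z)%C) <= Cmod z * (N * exp (K * (s * Cmod z)))) ->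
  Cmod (conv f g z) <= Cmod z * (N * exp (K * Cmod z) / K).
Proof.
  intros HK HN Hf Hg Hz H.
  destruct (exp_int_bound K (Cmod z) HK (Cmod_ge_0 z)) as [J [HJ HJ']].
  apply Rle_trans with (Cmod z * N * J).
  - apply (CInt_bound_fun (fun s => conv_kernel f g s z) (fun s => Cmod z * N * (Cmod z * exp (K * (s * Cmod z)))) 0 1); [lra| |apply conv_correct; assumption|].
    + intros s Hs1. unfold conv_kernel. rewrite !Cmod_mult. specialize (H s Hs1).
      pose proof (Cmod_ge_0 z). nra.
    + apply (is_RInt_scal (V := R_NormedModule)). exact HJ.
  - rewrite Rmult_assoc. apply Rmult_le_compat_l; [apply Cmod_ge_0|].
    unfold Rdiv in *. rewrite Rmult_assoc. apply Rmult_le_compat_l; assumption.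
Qed.
End Convolution.

(** * The Borel transform *)

(* As m decreases to 0 these convex domains exhaust the open right half-plane; none contains the
   singularities i and -i. *)
Definition Omega (m : R) (z : C) : Prop := m * Rabs (Im z) < Re z + m / 2.

Lemma Omega_0 (m : R) : 0 < m -> Omega m 0.
Proof. intros H. unfold Omega; simpl. rewrite Rabs_R0. lra. Qed.

Lemma Omega_star (m : R) : 0 < m -> star (Omega m).
Proof.
  intros H z s Hz Hs. unfold Omega in *.
  replace (Im (RtoC s * z)%C) with (s * Im z) by (simpl; unfold Im; ring).
  replace (Re (RtoC s * z)%C) with (s * Re z) by (simpl; unfold Re; ring).
  rewrite Rabs_mult, (Rabs_right s) by lra.
  destruct (Req_dec s 0) as [->|N]; [lra|]. assert (0 < s) by lra.
  apply Rle_lt_trans with (s * (m * Rabs (Im z))); [lra|].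
  apply Rlt_le_trans with (s * (Re z + m / 2)); [apply Rmult_lt_compat_l; assumption|]. nra.
Qed.

Lemma Omega_disc (m : R) (z : C) (r : R) : 0 < m -> Omega m z ->
  0 < r -> (1 + m) * r <= Re z + m / 2 - m * Rabs (Im z) ->
  forall w, Cmod (w - z) < r -> Omega m w.
Proof.
  intros H Hz Hr Hr' w Hw. unfold Omega in *.
  pose proof (im_le_Cmod (w - z)) as A. pose proof (re_le_Cmod (w - z)) as B.
  change (Im (w - z)%C) with (Im w - Im z) in A. change (Re (w - z)%C) with (Re w - Re z) in B.
  pose proof (Rabs_triang (Im w - Im z) (Im z)) as T. replace (Im w - Im z + Im z) with (Im w) in T by ring.
  assert (B' : Re z - Re w <= Cmod (w - z)).
  { eapply Rle_trans; [|exact B]. rewrite Rabs_minus_sym. apply Rle_abs. }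
  nra.
Qed.

Lemma Omega_open (m : R) : 0 < m -> copen (Omega m).
Proof.
  intros H z Hz. exists ((Re z + m / 2 - m * Rabs (Im z)) / (1 + m)).
  assert (P : 0 < (Re z + m / 2 - m * Rabs (Im z)) / (1 + m)) by (apply Rdiv_lt_0_compat; unfold Omega in Hz; lra).
  split; [exact P|]. apply Omega_disc; try assumption. right. field. lra.
Qed.

(** The form m |Im z| - Re z is below m / 2 on the domain, equals m at p, and is Lipschitz with
    constant 1 + m. *)
Lemma Omega_avoid (m : R) (z p : C) : 0 < m -> Omega m z -> Re p = 0 -> Rabs (Im p) = 1 ->
  m / 2 <= (1 + m) * Cmod (z - p).
Proof.
  intros H Hz Hp1 Hp2. unfold Omega in Hz.
  pose proof (im_le_Cmod (p - z)) as A. pose proof (re_le_Cmod (z - p)) as B. rewrite Cmod_sub_sym in A.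
  change (Im (p - z)%C) with (Im p - Im z) in A. change (Re (z - p)%C) with (Re z - Re p) in B.
  rewrite Hp1 in B. rewrite Rminus_0_r in B.
  pose proof (Rabs_triang (Im p - Im z) (Im z)) as T. replace (Im p - Im z + Im z) with (Im p) in T by ring.
  rewrite Hp2 in T. pose proof (Rle_abs (Re z)). nra.
Qed.

Definition lower_const (m : R) : R := m / (2 * (1 + m)).

(** [lower_const] bounds the distance to p from below and is at most 1; with |z| <= |z - p| + 1 this
    covers the behaviour near p and at infinity at once. *)
Lemma Omega_lower (m : R) (z p : C) : 0 < m -> Omega m z -> Re p = 0 -> Rabs (Im p) = 1 -> Cmod p = 1 ->
  lower_const m * (1 + Cmod z) <= 3 * Cmod (z - p).
Proof.
  intros H Hz Hp1 Hp2 Hp. pose proof (Omega_avoid m z p H Hz Hp1 Hp2) as A. unfold lower_const.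
  assert (L : m / (2 * (1 + m)) <= Cmod (z - p)).
  { apply Rle_div_l; lra. }
  assert (L1 : m / (2 * (1 + m)) <= 1) by (apply Rle_div_l; lra).
  assert (L0 : 0 < m / (2 * (1 + m))) by (apply Rdiv_lt_0_compat; lra).
  set (k := m / (2 * (1 + m))) in *.
  pose proof (Cmod_triangle (z - p) p) as T. replace (z - p + p)%C with z in T by ring. rewrite Hp in T. nra.
Qed.

Definition inv_const (m : R) : R := 9 / (lower_const m * lower_const m).

Lemma lower_const_pos (m : R) : 0 < m -> 0 < lower_const m <= 1.
Proof. intros H. unfold lower_const. split; [apply Rdiv_lt_0_compat; lra|apply Rle_div_l; lra]. Qed.

Lemma inv_const_ge_1 (m : R) : 0 < m -> 1 <= inv_const m.
Proof.
  intros H. pose proof (lower_const_pos m H). unfold inv_const. apply Rle_div_r; nra.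
Qed.

Lemma Omega_denominator (m : R) (z : C) : 0 < m -> Omega m z ->
  (1 + z * z)%C <> 0 /\ / Cmod (1 + z * z) <= inv_const m / ((1 + Cmod z) * (1 + Cmod z)).
Proof.
  intros H Hz. pose proof (lower_const_pos m H) as Hc. pose proof (Cmod_ge_0 z) as Hz0.
  pose proof (Omega_lower m z Ci H Hz ltac:(reflexivity) ltac:(simpl; apply Rabs_R1) Cmod_Ci) as A.
  assert (B : lower_const m * (1 + Cmod z) <= 3 * Cmod (z - - Ci)).
  { apply Omega_lower; try assumption; [simpl; ring|simpl; rewrite Rabs_Ropp; apply Rabs_R1|rewrite Cmod_opp; apply Cmod_Ci]. }
  assert (E : (1 + z * z)%C = ((z - Ci) * (z - - Ci))%C).
  { replace ((z - Ci) * (z - - Ci))%C with (z * z - Ci * Ci)%C by ring.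
    replace (Ci * Ci)%C with (- (1))%C; [ring|]. apply injective_projections; simpl; ring. }
  assert (L : (lower_const m * (1 + Cmod z)) * (lower_const m * (1 + Cmod z)) <= 9 * Cmod (1 + z * z)).
  { rewrite E, Cmod_mult.
    replace (9 * (Cmod (z - Ci) * Cmod (z - - Ci))) with ((3 * Cmod (z - Ci)) * (3 * Cmod (z - - Ci))) by ring.
    apply Rmult_le_compat; try assumption; apply Rmult_le_pos; lra. }
  assert (P : 0 < Cmod (1 + z * z)).
  { assert (0 < lower_const m * (1 + Cmod z)) by (apply Rmult_lt_0_compat; lra). nra. }
  split; [apply Cmod_gt_0, P|].
  unfold inv_const. set (k := lower_const m) in *. set (x := Cmod z) in *.
  replace (9 / (k * k) / ((1 + x) * (1 + x))) with (/ ((k * (1 + x)) * (k * (1 + x)) / 9)) by (field; lra).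
  apply Rinv_le_contravar; [|lra]. apply Rdiv_lt_0_compat; [|lra].
  apply Rmult_lt_0_compat; apply Rmult_lt_0_compat; lra.
Qed.

(* (1 + z^2) b = borel_rhs b is the Borel transform of the recursion quad_rec, in the variable z
   for which the singularities lie at i and -i; its derivatives at 0 are d_(n+1) (-i)^(n+1). *)
Definition borel_rhs (f : C -> C) (z : C) : C :=
  (conv (fun _ => 1) (fun w => w * f w) z + RtoC (4 / 25) * conv (fun w => w) f z
   + RtoC (4 / 25) * z - RtoC (1 / 2) * conv f f z)%C.

Definition borel_op (f : C -> C) (z : C) : C := (borel_rhs f z / (1 + z * z))%C.

Fixpoint borel_iter (n : nat) : C -> C :=
  match n with O => fun _ => RtoC 0 | S n => borel_op (borel_iter n) end.

Lemma holo_const (D : C -> Prop) (c : C) : holo_on D (fun _ => c).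
Proof. intros z _. eexists. apply cder_const. Qed.

Lemma holo_id (D : C -> Prop) : holo_on D (fun z => z).
Proof. intros z _. eexists. apply cder_id. Qed.

Lemma holo_plus (D : C -> Prop) (f g : C -> C) : holo_on D f -> holo_on D g -> holo_on D (fun z => f z + g z)%C.
Proof. intros Hf Hg z Hz. destruct (Hf z Hz), (Hg z Hz). eexists. apply cder_plus; eassumption. Qed.

Lemma holo_minus (D : C -> Prop) (f g : C -> C) : holo_on D f -> holo_on D g -> holo_on D (fun z => f z - g z)%C.
Proof. intros Hf Hg z Hz. destruct (Hf z Hz), (Hg z Hz). eexists. apply cder_minus; eassumption. Qed.

Lemma holo_mult (D : C -> Prop) (f g : C -> C) : holo_on D f -> holo_on D g -> holo_on D (fun z => f z * g z)%C.
Proof. intros Hf Hg z Hz. destruct (Hf z Hz), (Hg z Hz). eexists. apply cder_mult; eassumption. Qed.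

Section OnOmega.
Variable m : R.
Hypothesis Hm : 0 < m.
Let D := Omega m.
Let HD : copen D := Omega_open m Hm.
Let Hst : star D := Omega_star m Hm.
Let A := inv_const m.
Let M := / (4 * A).
Let K := 32 * (A * A).

(** M tames the quadratic term and K the others. The ball of radius M is mapped into itself because
    M/16 + M/8 + M/8 <= M, and the Lipschitz constant 2 A / K + A M is at most 5/16. *)
Lemma picard_constants : 1 <= A /\ 0 < M /\ A * M = / 4 /\ 0 < K /\ A * / K <= / 32 /\ A * / K <= M / 8.
Proof.
  pose proof (inv_const_ge_1 m Hm) as HA. fold A in HA.
  assert (HM : 0 < M) by (apply Rinv_0_lt_compat; lra).
  assert (HK : 0 < K) by (unfold K; nra).
  assert (E : A * / K = / (32 * A)) by (unfold K; field; lra).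
  repeat split; try assumption.
  - unfold M. field. lra.
  - rewrite E. apply Rinv_le_contravar; lra.
  - rewrite E. unfold M. right. field. lra.
Qed.

Lemma borel_rhs_holo (f : C -> C) : holo_on D f -> holo_on D (borel_rhs f).
Proof.
  intros Hf. unfold borel_rhs. apply holo_minus; [apply holo_plus; [apply holo_plus|]|].
  - apply conv_holo; [exact HD|exact Hst|apply holo_const|apply holo_mult; [apply holo_id|exact Hf]].
  - apply holo_mult; [apply holo_const|]. apply conv_holo; [exact HD|exact Hst|apply holo_id|exact Hf].
  - apply holo_mult; [apply holo_const|apply holo_id].
  - apply holo_mult; [apply holo_const|]. apply conv_holo; [exact HD|exact Hst|exact Hf|exact Hf].
Qed.

Lemma borel_op_holo (f : C -> C) : holo_on D f -> holo_on D (borel_op f).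
Proof.
  intros Hf z Hz. destruct (borel_rhs_holo f Hf z Hz) as [l Hl].
  destruct (Omega_denominator m z Hm Hz) as [Hn _].
  eexists. apply (cder_mult (borel_rhs f) (fun z => / (1 + z * z))%C); [exact Hl|].
  apply (cder_inv (fun z => 1 + z * z)%C); [exact Hn|].
  apply cder_plus; [apply cder_const|apply cder_mult; apply cder_id].
Qed.

Lemma conv_1_bound (f : C -> C) (z : C) (N : R) : 0 <= N -> holo_on D f -> D z ->
  (forall w, D w -> Cmod (f w) <= N * exp (K * Cmod w)) ->
  Cmod (conv (fun _ => 1) (fun w => w * f w)%C z) <= Cmod z * (N * exp (K * Cmod z) / K).
Proof.
  intros HN Hf Hz HB. destruct picard_constants as [_ [_ [_ [HK _]]]].
  apply (conv_bound_linear D); try assumption; [apply holo_const|apply holo_mult; [apply holo_id|exact Hf]|].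
  intros s Hs. cbv beta. rewrite Cmod_1, Rmult_1_l, Cmod_mult.
  specialize (HB _ (Hst z s Hz Hs)). rewrite !Cmod_mult, !Cmod_R, !(Rabs_right s) in * by lra.
  pose proof (Cmod_ge_0 z). apply Rmult_le_compat; try apply Cmod_ge_0; nra.
Qed.

Lemma conv_id_bound (f : C -> C) (z : C) (N : R) : 0 <= N -> holo_on D f -> D z ->
  (forall w, D w -> Cmod (f w) <= N * exp (K * Cmod w)) ->
  Cmod (conv (fun w => w) f z) <= Cmod z * (N * exp (K * Cmod z) / K).
Proof.
  intros HN Hf Hz HB. destruct picard_constants as [_ [_ [_ [HK _]]]].
  apply (conv_bound_linear D); try assumption; [apply holo_id|].
  intros s Hs. cbv beta.
  specialize (HB _ (Hst z s Hz Hs)). rewrite !Cmod_mult, !Cmod_R, !(Rabs_right s), (Rabs_right (1 - s)) in * by lra.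
  pose proof (Cmod_ge_0 z). apply Rmult_le_compat; try apply Cmod_ge_0; nra.
Qed.

(** The convolutions cost at most one power of 1 + |z|, and the denominator offers two. *)
Lemma div_denominator_bound (z N : C) (Q : R) : D z -> 0 <= Q ->
  Cmod N <= (1 + Cmod z) * Q -> Cmod (N / (1 + z * z))%C <= A * Q.
Proof.
  intros Hz HQ HN. destruct (Omega_denominator m z Hm Hz) as [Hn Hd]. fold A in Hd.
  rewrite Cmod_div by exact Hn. pose proof (Cmod_ge_0 z) as Hz0.
  pose proof (inv_const_ge_1 m Hm) as HA. fold A in HA.
  apply Rle_trans with ((1 + Cmod z) * Q * (A / ((1 + Cmod z) * (1 + Cmod z)))).
  - apply Rmult_le_compat; [apply Cmod_ge_0|apply Rlt_le, Rinv_0_lt_compat, Cmod_gt_0, Hn|exact HN|exact Hd].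
  - replace ((1 + Cmod z) * Q * (A / ((1 + Cmod z) * (1 + Cmod z)))) with (A * Q * / (1 + Cmod z)) by (field; lra).
    rewrite <- (Rmult_1_r (A * Q)) at 2. apply Rmult_le_compat_l; [nra|].
    rewrite <- Rinv_1. apply Rinv_le_contravar; lra.
Qed.

(** Gives the inhomogeneous term (4/25) z the same gain 1 / K as the linear ones. *)
Lemma exp_K_ge (z : C) : Cmod z <= exp (K * Cmod z) / K.
Proof.
  destruct picard_constants as [_ [_ [_ [HK _]]]]. apply Rle_div_r; [exact HK|].
  pose proof (exp_ineq1_le (K * Cmod z)). lra.
Qed.

Lemma borel_op_bound (f : C -> C) : holo_on D f ->
  (forall w, D w -> Cmod (f w) <= M * exp (K * Cmod w)) ->
  forall z, D z -> Cmod (borel_op f z) <= M * exp (K * Cmod z).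
Proof.
  intros Hf HB z Hz. destruct picard_constants as [HA [HM [HAM [HK [HK1 HK2]]]]].
  pose proof (exp_pos (K * Cmod z)) as He. set (E := exp (K * Cmod z)) in *.
  pose proof (Cmod_ge_0 z) as Hz0.
  pose proof (conv_1_bound f z M ltac:(lra) Hf Hz HB) as B1.
  pose proof (conv_id_bound f z M ltac:(lra) Hf Hz HB) as B2.
  pose proof (conv_bound D Hst f f z K M M Hf Hf Hz HB HB) as B3.
  pose proof (exp_K_ge z) as B4. fold E in B1, B2, B3, B4.
  unfold borel_op.
  eapply Rle_trans; [apply (div_denominator_bound z _ (E * (2 * M * / K + / K + M * M / 2)) Hz)|].
  - apply Rmult_le_pos; [lra|]. pose proof (Rinv_0_lt_compat K HK). nra.
  - unfold borel_rhs.
    eapply Rle_trans; [apply Cmod_triangle_sub|].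
    eapply Rle_trans; [apply Rplus_le_compat_r, Cmod_triangle|].
    eapply Rle_trans; [apply Rplus_le_compat_r, Rplus_le_compat_r, Cmod_triangle|].
    rewrite !Cmod_mult, !Cmod_R, !Rabs_right by lra.
    unfold Rdiv in B1, B2, B4 |- *. pose proof (Rinv_0_lt_compat K HK) as HiK. set (k := / K) in *.
    assert (0 <= M * E * k) by (apply Rmult_le_pos; [apply Rmult_le_pos; lra|lra]).
    assert (0 <= E * k) by (apply Rmult_le_pos; lra).
    assert (0 <= M * M * E) by (apply Rmult_le_pos; [apply Rmult_le_pos; lra|lra]).
    set (x := Cmod z) in *.
    apply Rle_trans with (x * (M * E * k) + (4 * / 25) * (x * (M * E * k)) + E * k + 1 * / 2 * (M * M * x * E)); [lra|].
    replace ((1 + x) * (E * (2 * M * k + k + M * M * / 2))) with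
     ((2 * (M * E * k) + E * k + (M * M * E) * / 2) + x * (2 * (M * E * k)) + x * (E * k) + x * (M * M * E) * / 2) by ring.
    assert (0 <= x * (M * E * k)) by nra. assert (0 <= x * (E * k)) by nra. lra.
  - replace (A * (E * (2 * M * / K + / K + M * M / 2))) with (E * (2 * M * (A * / K) + A * / K + (A * M) * M / 2)) by (unfold Rdiv; ring).
    rewrite HAM. rewrite (Rmult_comm M E). apply Rmult_le_compat_l; [lra|]. nra.
Qed.

(** With conv f g written as a product, f f - g g is split as (f - g) f + g (f - g), and each
    summand is bounded by M N; the other terms are linear and gain 1 / K. *)
Lemma borel_op_contract (f g : C -> C) (N : R) : 0 <= N -> holo_on D f -> holo_on D g ->
  (forall w, D w -> Cmod (f w) <= M * exp (K * Cmod w)) ->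
  (forall w, D w -> Cmod (g w) <= M * exp (K * Cmod w)) ->
  (forall w, D w -> Cmod (f w - g w) <= N * exp (K * Cmod w)) ->
  forall z, D z -> Cmod (borel_op f z - borel_op g z) <= N / 2 * exp (K * Cmod z).
Proof.
  intros HN Hf Hg HBf HBg HBd z Hz. destruct picard_constants as [HA [HM [HAM [HK [HK1 HK2]]]]].
  pose proof (exp_pos (K * Cmod z)) as He. set (E := exp (K * Cmod z)) in *.
  pose proof (Cmod_ge_0 z) as Hz0.
  assert (Hd : holo_on D (fun w => f w - g w)%C) by (apply holo_minus; assumption).
  pose proof (conv_1_bound _ z N HN Hd Hz HBd) as B1.
  pose proof (conv_id_bound _ z N HN Hd Hz HBd) as B2.
  pose proof (conv_bound D Hst _ f z K N M Hd Hf Hz HBd HBf) as B3.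
  pose proof (conv_bound D Hst g _ z K M N Hg Hd Hz HBg HBd) as B4. fold E in B1, B2, B3, B4.
  rewrite (conv_minus_l D Hst f g f z Hf Hg Hf Hz) in B3.
  rewrite (conv_minus_r D Hst g f g z Hg Hf Hg Hz) in B4.
  rewrite (conv_minus_r D Hst (fun w => w) f g z (holo_id D) Hf Hg Hz) in B2.
  cbv beta in B1. replace (fun w : C => (w * (f w - g w))%C) with (fun w : C => (w * f w - w * g w)%C) in B1
    by (apply functional_extensionality; intros w; ring).
  rewrite (conv_minus_r D Hst (fun _ => RtoC 1) _ _ z (holo_const D 1) (holo_mult D _ _ (holo_id D) Hf) (holo_mult D _ _ (holo_id D) Hg) Hz) in B1.
  unfold borel_op.
  replace (borel_rhs f z / (1 + z * z) - borel_rhs g z / (1 + z * z))%C with ((borel_rhs f z - borel_rhs g z) / (1 + z * z))%C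
    by (unfold Cdiv; ring).
  eapply Rle_trans; [apply (div_denominator_bound z _ (E * (2 * N * / K + M * N)) Hz)|].
  - apply Rmult_le_pos; [lra|]. pose proof (Rinv_0_lt_compat K HK). nra.
  - unfold borel_rhs.
    set (a1 := conv (fun _ => RtoC 1) (fun w => w * f w)%C z) in *.
    set (a2 := conv (fun _ => RtoC 1) (fun w => w * g w)%C z) in *.
    set (b1 := conv (fun w => w) f z) in *. set (b2 := conv (fun w => w) g z) in *.
    set (c1 := conv f f z) in *. set (c2 := conv g f z) in *. set (c3 := conv g g z) in *.
    replace (a1 + RtoC (4 / 25) * b1 + RtoC (4 / 25) * z - RtoC (1 / 2) * c1 - (a2 + RtoC (4 / 25) * b2 + RtoC (4 / 25) * z - RtoC (1 / 2) * c3))%C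
     with ((a1 - a2) + RtoC (4 / 25) * (b1 - b2) - RtoC (1 / 2) * ((c1 - c2) + (c2 - c3)))%C by ring.
    eapply Rle_trans; [apply Cmod_triangle_sub|].
    eapply Rle_trans; [apply Rplus_le_compat_r, Cmod_triangle|].
    rewrite !Cmod_mult, !Cmod_R, !Rabs_right by lra.
    pose proof (Cmod_triangle (c1 - c2) (c2 - c3)) as B5.
    unfold Rdiv in B1, B2 |- *. pose proof (Rinv_0_lt_compat K HK) as HiK. set (k := / K) in *.
    assert (0 <= N * E * k) by (apply Rmult_le_pos; [apply Rmult_le_pos; lra|lra]).
    assert (0 <= M * N * E) by (apply Rmult_le_pos; [apply Rmult_le_pos; lra|lra]).
    set (x := Cmod z) in *.
    replace ((1 + x) * (E * (2 * N * k + M * N))) with (2 * (N * E * k) + M * N * E + x * (2 * (N * E * k)) + x * (M * N * E)) by ring.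
    assert (0 <= x * (N * E * k)) by nra.
    replace (N * M * x * E) with (x * (M * N * E)) in B3 by ring.
    replace (M * N * x * E) with (x * (M * N * E)) in B4 by ring.
    lra.
  - replace (A * (E * (2 * N * / K + M * N))) with (E * (N * (2 * (A * / K) + A * M))) by ring.
    rewrite HAM, (Rmult_comm (N / 2) E). apply Rmult_le_compat_l; [lra|]. unfold Rdiv. apply Rmult_le_compat_l; [exact HN|]. lra.
Qed.

Lemma borel_iter_props (n : nat) : holo_on D (borel_iter n) /\
  (forall w, D w -> Cmod (borel_iter n w) <= M * exp (K * Cmod w)) /\
  (forall w, D w -> Cmod (borel_iter (S n) w - borel_iter n w) <= M * (/ 2) ^ n * exp (K * Cmod w)).
Proof.
  destruct picard_constants as [HA [HM _]].
  assert (P : forall n, holo_on D (borel_iter n) /\ (forall w, D w -> Cmod (borel_iter n w) <= M * exp (K * Cmod w))).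
  { clear n. induction n as [|n [IH1 IH2]].
    - split; [apply holo_const|]. intros w _. simpl. rewrite Cmod_0. apply Rmult_le_pos; [lra|apply Rlt_le, exp_pos].
    - split; [apply borel_op_holo, IH1|]. apply borel_op_bound; assumption. }
  split; [apply P|]. split; [apply P|].
  induction n as [|n IH]; intros w Hw.
  - change (borel_iter 0 w) with (RtoC 0). replace (borel_iter 1 w - 0)%C with (borel_iter 1 w) by ring.
    simpl pow. rewrite Rmult_1_r. apply (P 1%nat), Hw.
  - change (borel_iter (S (S n)) w - borel_iter (S n) w)%C with (borel_op (borel_iter (S n)) w - borel_op (borel_iter n) w)%C.
    replace (M * (/ 2) ^ S n) with (M * (/ 2) ^ n / 2) by (simpl; field).
    apply borel_op_contract; try apply P; try assumption.
    apply Rmult_le_pos; [lra|apply pow_le; lra].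
Qed.

Lemma borel_iter_dist (n k : nat) (w : C) : D w ->
  Cmod (borel_iter (n + k) w - borel_iter n w) <= 2 * M * (/ 2) ^ n * exp (K * Cmod w).
Proof.
  intros Hw. destruct picard_constants as [_ [HM _]]. pose proof (exp_pos (K * Cmod w)) as He. set (E := exp (K * Cmod w)) in *.
  assert (P : Cmod (borel_iter (n + k) w - borel_iter n w) <= 2 * M * ((/ 2) ^ n - (/ 2) ^ (n + k)) * E).
  { induction k as [|k IH].
    - rewrite Nat.add_0_r, Cmod_sub_self. lra.
    - rewrite Nat.add_succ_r.
      replace (borel_iter (S (n + k)) w - borel_iter n w)%C with ((borel_iter (S (n + k)) w - borel_iter (n + k) w) + (borel_iter (n + k) w - borel_iter n w))%C by ring.
      eapply Rle_trans; [apply Cmod_triangle|].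
      destruct (borel_iter_props (n + k)) as [_ [_ H]]. specialize (H w Hw). fold E in H.
      simpl pow. lra. }
  eapply Rle_trans; [exact P|]. apply Rmult_le_compat_r; [lra|]. apply Rmult_le_compat_l; [lra|].
  pose proof (pow_half_pos (n + k)). lra.
Qed.
End OnOmega.

Definition is_clim (u : nat -> C) (l : C) : Prop :=
  forall e, 0 < e -> exists N, forall n, (N <= n)%nat -> Cmod (u n - l) <= e.

(** The iterates do not involve m. Taking the limit point by point makes the solutions on the
    various domains restrictions of one function. *)
Definition borel_fun (z : C) : C := epsilon (inhabits (RtoC 0)) (is_clim (fun n => borel_iter n z)).

Lemma borel_fun_lim (m : R) (z : C) : 0 < m -> Omega m z -> is_clim (fun n => borel_iter n z) (borel_fun z).
Proof.
  intros Hm Hz. unfold borel_fun. apply epsilon_spec. apply C_cauchy_limit. intros e He.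
  destruct (picard_constants m Hm) as [_ [HM _]]. set (M := / (4 * inv_const m)) in *.
  set (E := exp (32 * (inv_const m * inv_const m) * Cmod z)). assert (HE : 0 < E) by apply exp_pos.
  assert (P : 0 < 4 * M * E) by nra.
  destruct (pow_lt_1_zero (/2) ltac:(rewrite Rabs_right; lra) (e / (4 * M * E)) ltac:(apply Rdiv_lt_0_compat; lra)) as [N HN].
  specialize (HN N (le_n N)). rewrite Rabs_right in HN by (apply Rle_ge, pow_le; lra).
  apply (Rmult_lt_compat_l (4 * M * E)) in HN; [|exact P].
  replace (4 * M * E * (e / (4 * M * E))) with e in HN by (field; lra).
  exists N. intros n k Hn Hk.
  pose proof (borel_iter_dist m Hm N (n - N) z Hz) as A1. pose proof (borel_iter_dist m Hm N (k - N) z Hz) as A2.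
  replace (N + (n - N))%nat with n in A1 by lia. replace (N + (k - N))%nat with k in A2 by lia.
  fold M in A1, A2. fold E in A1, A2.
  replace (borel_iter n z - borel_iter k z)%C with ((borel_iter n z - borel_iter N z) - (borel_iter k z - borel_iter N z))%C by ring.
  eapply Rle_trans; [apply Cmod_triangle_sub|]. lra.
Qed.

Lemma borel_fun_dist (m : R) (n : nat) (z : C) : 0 < m -> Omega m z ->
  Cmod (borel_fun z - borel_iter n z) <= 2 * / (4 * inv_const m) * (/ 2) ^ n * exp (32 * (inv_const m * inv_const m) * Cmod z).
Proof.
  intros Hm Hz. apply (C_lim_le (fun k => borel_iter (n + k) z - borel_iter n z)%C).
  - intros e He. destruct (borel_fun_lim m z Hm Hz e He) as [N HN]. exists N. intros k Hk.
    replace (borel_iter (n + k) z - borel_iter n z - (borel_fun z - borel_iter n z))%C with (borel_iter (n + k) z - borel_fun z)%C by ring.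
    apply HN. lia.
  - intros k. apply borel_iter_dist; assumption.
Qed.

Theorem borel_fun_exists (m : R) : 0 < m -> exists K0 K1, 0 < K0 /\ 0 < K1 /\
  holo_on (Omega m) borel_fun /\
  (forall z, Omega m z -> Cmod (borel_fun z) <= K0 * exp (K1 * Cmod z)) /\
  (forall z, Omega m z -> ((1 + z * z) * borel_fun z)%C = borel_rhs borel_fun z).
Proof.
  intros Hm. destruct (picard_constants m Hm) as [HA [HM [_ [HK _]]]].
  set (M := / (4 * inv_const m)) in *. set (K := 32 * (inv_const m * inv_const m)) in *.
  assert (HB : forall z, Omega m z -> Cmod (borel_fun z) <= M * exp (K * Cmod z)).
  { intros z Hz. apply (C_lim_le (fun n => borel_iter n z)); [apply (borel_fun_lim m z Hm Hz)|].
    intros n. apply (borel_iter_props m Hm n), Hz. }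
  assert (HH : holo_on (Omega m) borel_fun).
  { intros z Hz. destruct (Omega_open m Hm z Hz) as [r [Hr Hr']].
    set (E := exp (K * (Cmod z + r))). assert (HE : 0 < E) by apply exp_pos.
    assert (Hexp : forall w, Cmod (w - z) < r -> exp (K * Cmod w) <= E).
    { intros w Hw. apply exp_le. apply Rmult_le_compat_l; [lra|].
      replace w with (z + (w - z))%C by ring. eapply Rle_trans; [apply Cmod_triangle|]. lra. }
    apply (weierstrass borel_iter borel_fun z r (M * E) Hr).
    - intros n w Hw. apply (borel_iter_props m Hm n), Hr', Hw.
    - intros n w Hw. eapply Rle_trans; [apply (borel_iter_props m Hm n), Hr', Hw|].
      apply Rmult_le_compat_l; [fold M; lra|apply Hexp, Hw].
    - intros e He.
      destruct (pow_lt_1_zero (/2) ltac:(rewrite Rabs_right; lra) (e / (2 * M * E)) ltac:(apply Rdiv_lt_0_compat; nra)) as [N HN].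
      exists N. intros n w Hn Hw. specialize (HN n Hn). rewrite Rabs_right in HN by (apply Rle_ge, pow_le; lra).
      rewrite Cmod_sub_sym. eapply Rle_trans; [apply (borel_fun_dist m n w Hm), Hr', Hw|]. fold M. fold K.
      apply Rle_trans with (2 * M * (/ 2) ^ n * E).
      + apply Rmult_le_compat_l; [|apply Hexp, Hw]. apply Rmult_le_pos; [lra|apply pow_le; lra].
      + apply Rle_trans with (2 * M * E * (e / (2 * M * E))).
        * replace (2 * M * (/ 2) ^ n * E) with (2 * M * E * (/ 2) ^ n) by ring. apply Rmult_le_compat_l; nra.
        * right. field. split; lra. }
  exists M, K. split; [exact HM|]. split; [exact HK|]. split; [exact HH|]. split; [exact HB|].
  intros z Hz. destruct (Omega_denominator m z Hm Hz) as [Hn _].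
  assert (E : borel_fun z = borel_op borel_fun z).
  { apply Ceq_of_small. intros e He.
    set (E := exp (K * Cmod z)). assert (HE : 0 < E) by apply exp_pos.
    destruct (pow_lt_1_zero (/2) ltac:(rewrite Rabs_right; lra) (e / (4 * M * E)) ltac:(apply Rdiv_lt_0_compat; nra)) as [N HN].
    specialize (HN N (le_n N)). rewrite Rabs_right in HN by (apply Rle_ge, pow_le; lra).
    apply (Rmult_lt_compat_l (4 * M * E)) in HN; [|nra].
    replace (4 * M * E * (e / (4 * M * E))) with e in HN by (field; split; lra).
    pose proof (borel_fun_dist m (S N) z Hm Hz) as A1. fold M in A1. fold K in A1. fold E in A1.
    destruct (borel_iter_props m Hm N) as [P1 [P2 _]].
    assert (NN : 0 <= 2 * M * (/ 2) ^ N) by (apply Rmult_le_pos; [lra|apply pow_le; lra]).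
    pose proof (borel_op_contract m Hm borel_fun (borel_iter N) (2 * M * (/ 2) ^ N) NN HH P1 HB P2
       (fun w Hw => borel_fun_dist m N w Hm Hw) z Hz) as A2. fold K in A2. fold E in A2.
    replace (borel_fun z - borel_op borel_fun z)%C with ((borel_fun z - borel_iter (S N) z) - (borel_op borel_fun z - borel_op (borel_iter N) z))%C by (simpl; ring).
    eapply Rle_trans; [apply Cmod_triangle_sub|]. simpl pow in A1. pose proof (pow_half_pos N).
    assert (0 <= M * (/2)^N * E) by (apply Rmult_le_pos; [apply Rmult_le_pos; lra|lra]). lra. }
  rewrite E at 1. unfold borel_op. field. exact Hn.
Qed.

(** * Taylor coefficients of the Borel transform at 0 *)

Section DerivativesOnOpen.
Variable D : C -> Prop.
Hypothesis HD : copen D.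

Lemma Dn_ext_on (n : nat) (f g : C -> C) (z : C) : D z ->
  (forall w, D w -> f w = g w) -> holo_on D g -> Dn n f z = Dn n g z.
Proof.
  revert f g. induction n as [|n IH]; intros f g Hz H Hg; [apply H, Hz|].
  simpl. apply IH; [exact Hz| |apply holo_on_derive; assumption].
  intros w Hw. apply (C_derive_ext_on D); auto.
Qed.

Lemma Dn_plus_on (n : nat) (f g : C -> C) (z : C) : D z -> holo_on D f -> holo_on D g ->
  Dn n (fun w => f w + g w)%C z = (Dn n f z + Dn n g z)%C.
Proof.
  revert f g. induction n as [|n IH]; intros f g Hz Hf Hg; [reflexivity|]. simpl.
  rewrite <- IH; [|exact Hz|apply holo_on_derive; assumption|apply holo_on_derive; assumption].
  apply Dn_ext_on; [exact Hz| |apply holo_plus; apply holo_on_derive; assumption].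
  intros w Hw. apply cder_C_derive, cder_plus; apply holo_C_derive; auto.
Qed.

Lemma Dn_scal_on (n : nat) (c : C) (f : C -> C) (z : C) : D z -> holo_on D f ->
  Dn n (fun w => c * f w)%C z = (c * Dn n f z)%C.
Proof.
  revert f. induction n as [|n IH]; intros f Hz Hf; [reflexivity|]. simpl.
  rewrite <- IH; [|exact Hz|apply holo_on_derive; assumption].
  apply Dn_ext_on; [exact Hz| |apply holo_mult; [apply holo_const|apply holo_on_derive; assumption]].
  intros w Hw. apply cder_C_derive, cder_scal, holo_C_derive; auto.
Qed.

Lemma Dn_minus_on (n : nat) (f g : C -> C) (z : C) : D z -> holo_on D f -> holo_on D g ->
  Dn n (fun w => f w - g w)%C z = (Dn n f z - Dn n g z)%C.
Proof.
  revert f g. induction n as [|n IH]; intros f g Hz Hf Hg; [reflexivity|]. simpl.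
  rewrite <- IH; [|exact Hz|apply holo_on_derive; assumption|apply holo_on_derive; assumption].
  apply Dn_ext_on; [exact Hz| |apply holo_minus; apply holo_on_derive; assumption].
  intros w Hw. apply cder_C_derive, cder_minus; apply holo_C_derive; auto.
Qed.

Hypothesis D0 : D 0.

Lemma Dn_id_mult_0 (n : nat) (g : C -> C) : holo_on D g ->
  Dn (S n) (fun w => w * g w)%C 0 = (RtoC (INR (S n)) * Dn n g 0)%C.
Proof.
  assert (E : forall g, holo_on D g -> forall n, Dn (S n) (fun w => w * g w)%C 0 = (Dn n g 0 + Dn n (fun w => w * C_derive g w)%C 0)%C).
  { intros h Hh k. simpl.
    assert (Hh' : holo_on D (C_derive h)) by (apply holo_on_derive; assumption).
    rewrite <- Dn_plus_on; [|exact D0|exact Hh|apply holo_mult; [apply holo_id|exact Hh']].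
    apply Dn_ext_on; [exact D0| |apply holo_plus; [exact Hh|apply holo_mult; [apply holo_id|exact Hh']]].
    intros w Hw. apply cder_C_derive. eapply cder_eq; [|apply cder_mult; [apply cder_id|apply holo_C_derive, Hh, Hw]].
    cbv beta. ring. }
  revert g. induction n as [|n IH]; intros g Hg; rewrite E by exact Hg.
  - simpl. ring.
  - rewrite IH by (apply holo_on_derive; assumption). change (Dn (S n) g 0) with (Dn n (C_derive g) 0).
    generalize (Dn n (C_derive g) 0). intros x. rewrite (S_INR (S n)), RtoC_plus. ring.
Qed.

Lemma conv_0 (f g : C -> C) : conv f g 0 = 0.
Proof.
  apply is_CInt_unique. pose proof (is_CInt_const 0 0 1) as I.
  replace (RtoC (1 - 0) * 0)%C with (RtoC 0) in I by ring.
  eapply is_CInt_ext; [lra| |exact I]. intros s _. unfold conv_kernel. ring.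
Qed.

Hypothesis Hst : star D.

Lemma Dn_conv_step (n : nat) (f g : C -> C) : holo_on D f -> holo_on D g ->
  Dn (S n) (conv f g) 0 = (f 0 * Dn n g 0 + Dn n (conv (C_derive f) g) 0)%C.
Proof.
  intros Hf Hg. simpl.
  assert (Hf' : holo_on D (C_derive f)) by (apply holo_on_derive; assumption).
  assert (Hc : holo_on D (conv (C_derive f) g)) by (apply conv_holo; assumption).
  rewrite <- (Dn_scal_on n (f 0) g 0 D0 Hg).
  rewrite <- Dn_plus_on; [|exact D0|apply holo_mult; [apply holo_const|exact Hg]|exact Hc].
  apply Dn_ext_on; [exact D0| |apply holo_plus; [apply holo_mult; [apply holo_const|exact Hg]|exact Hc]].
  intros w Hw. apply cder_C_derive. apply (conv_der D); assumption.
Qed.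

(** Iterating [conv_der] at 0: convolution becomes the Cauchy product of the derivatives, without
    binomial factors, shifted by one. This undoes the division by factorials in the Borel
    transform. *)
Lemma Dn_conv_0 (n : nat) (f g : C -> C) : holo_on D f -> holo_on D g ->
  Dn (S n) (conv f g) 0 = sum_n (fun i => Dn i f 0 * Dn (n - i) g 0)%C n :> C.
Proof.
  revert f. induction n as [|n IH]; intros f Hf Hg.
  - rewrite Dn_conv_step, csum_0 by assumption. simpl. rewrite conv_0. ring.
  - rewrite Dn_conv_step, IH by (try assumption; apply holo_on_derive; assumption).
    clear. replace (Dn (S n) g 0) with (Dn (S n - 0) g 0) by reflexivity.
    assert (E : forall (F : nat -> C) k, sum_n F (S k) = (F 0%nat + sum_n (fun i => F (S i)) k)%C :> C).
    { intros F k. induction k as [|k IHk].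
      - rewrite csum_S, !csum_0. reflexivity.
      - rewrite csum_S, IHk, (csum_S (fun i => F (S i))). ring. }
    rewrite E. reflexivity.
Qed.

(** Convolution with 1 is integration from 0, and with the identity it is integration twice. *)
Lemma Dn_conv_1 (n : nat) (g : C -> C) : holo_on D g -> Dn (S n) (conv (fun _ => 1) g) 0 = Dn n g 0.
Proof.
  intros Hg. rewrite Dn_conv_step by (try assumption; apply holo_const).
  rewrite (Dn_ext_on n (conv (C_derive (fun _ => 1)) g) (fun _ => RtoC 0)); [|exact D0| |apply holo_const].
  - replace (Dn n (fun _ => RtoC 0) 0) with (RtoC 0); [ring|].
    assert (E : Dn n (fun _ => RtoC 0) 0 = (0 * Dn n (fun _ => RtoC 0) 0)%C).
    { rewrite <- (Dn_scal_on n 0 (fun _ => RtoC 0) 0 D0 (holo_const D 0)). f_equal.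
      apply functional_extensionality. intros w. ring. }
    rewrite E. ring.
  - intros w Hw. apply is_CInt_unique. pose proof (is_CInt_const 0 0 1) as I.
    replace (RtoC (1 - 0) * 0)%C with (RtoC 0) in I by ring.
    eapply is_CInt_ext; [lra| |exact I]. intros s _. unfold conv_kernel.
    rewrite (cder_C_derive _ _ _ (cder_const 1 _)). ring.
Qed.

Lemma Dn_conv_id (n : nat) (g : C -> C) : holo_on D g -> Dn (S (S n)) (conv (fun w => w) g) 0 = Dn n g 0.
Proof.
  intros Hg. rewrite Dn_conv_step by (try assumption; apply holo_id).
  replace (C_derive (fun w => w)) with (fun _ : C => RtoC 1).
  - rewrite Dn_conv_1 by exact Hg. ring.
  - apply functional_extensionality. intros w. symmetry. apply cder_C_derive, cder_id.
Qed.
End DerivativesOnOpen.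

Definition bd (n : nat) : C := Dn n borel_fun 0.

Lemma Dn_id_0 (n : nat) : Dn n (fun w => w) 0 = (if (n =? 1)%nat then RtoC 1 else RtoC 0).
Proof.
  assert (Z1 : forall c : C, C_derive (fun _ => c) = (fun _ => RtoC 0)).
  { intros c. apply functional_extensionality. intros w. apply cder_C_derive, cder_const. }
  assert (Z : forall k (c : C), Dn (S k) (fun _ => c) 0 = 0).
  { intros k c. simpl. rewrite Z1. clear c. induction k as [|k IH]; [reflexivity|]. simpl. rewrite Z1. exact IH. }
  destruct n as [|n]; [reflexivity|]. simpl Dn.
  replace (C_derive (fun w => w)) with (fun _ : C => RtoC 1).
  - destruct n as [|n]; [reflexivity|]. apply Z.
  - apply functional_extensionality. intros w. symmetry. apply cder_C_derive, cder_id.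
Qed.

Lemma bd_equation (n : nat) :
  Dn n (fun z => (1 + z * z) * borel_fun z)%C 0 = Dn n (borel_rhs borel_fun) 0.
Proof.
  destruct (borel_fun_exists 1 Rlt_0_1) as [K0 [K1 [_ [_ [HH [_ E]]]]]].
  apply (Dn_ext_on (Omega 1) (Omega_open 1 Rlt_0_1)); [apply Omega_0; lra|exact E|].
  apply borel_rhs_holo; [lra|exact HH].
Qed.

Lemma bd_0 : bd 0 = 0.
Proof.
  pose proof (bd_equation 0) as E. simpl in E. unfold bd. simpl.
  replace (borel_fun 0) with ((1 + 0 * 0) * borel_fun 0)%C by ring. rewrite E.
  unfold borel_rhs. rewrite !conv_0. ring.
Qed.

Lemma bd_lhs (n : nat) : Dn n (fun z => (1 + z * z) * borel_fun z)%C 0 =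
  (bd n + match n with S (S k) => RtoC (INR (S (S k)) * INR (S k)) * bd k | _ => 0 end)%C.
Proof.
  destruct (borel_fun_exists 1 Rlt_0_1) as [K0 [K1 [_ [_ [HH _]]]]].
  pose proof (Omega_open 1 Rlt_0_1) as HD. pose proof (Omega_0 1 Rlt_0_1) as D0.
  replace (fun z => ((1 + z * z) * borel_fun z)%C) with (fun z => (borel_fun z + z * (z * borel_fun z))%C)
    by (apply functional_extensionality; intros; ring).
  assert (H1 : holo_on (Omega 1) (fun z => z * borel_fun z)%C) by (apply holo_mult; [apply holo_id|exact HH]).
  rewrite (Dn_plus_on (Omega 1) HD); [|exact D0|exact HH|apply holo_mult; [apply holo_id|exact H1]].
  f_equal. destruct n as [|n]; [simpl; ring|].
  rewrite (Dn_id_mult_0 (Omega 1) HD D0) by exact H1.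
  destruct n as [|n]; [simpl; ring|].
  rewrite (Dn_id_mult_0 (Omega 1) HD D0) by exact HH. rewrite RtoC_mult. unfold bd. ring.
Qed.

Lemma bd_rhs (n : nat) : Dn n (borel_rhs borel_fun) 0 =
  (Dn n (conv (fun _ => RtoC 1) (fun w => w * borel_fun w)%C) 0 + RtoC (4 / 25) * Dn n (conv (fun w => w) borel_fun) 0
   + RtoC (4 / 25) * (if (n =? 1)%nat then RtoC 1 else RtoC 0) - RtoC (1 / 2) * Dn n (conv borel_fun borel_fun) 0)%C.
Proof.
  destruct (borel_fun_exists 1 Rlt_0_1) as [K0 [K1 [_ [_ [HH _]]]]].
  pose proof (Omega_open 1 Rlt_0_1) as HD. pose proof (Omega_0 1 Rlt_0_1) as D0. pose proof (Omega_star 1 Rlt_0_1) as Hs.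
  assert (H1 : holo_on (Omega 1) (fun z => z * borel_fun z)%C) by (apply holo_mult; [apply holo_id|exact HH]).
  assert (C1 := conv_holo (Omega 1) HD Hs (fun _ => RtoC 1) _ (holo_const _ 1) H1).
  assert (C2 := conv_holo (Omega 1) HD Hs (fun w => w) _ (holo_id _) HH).
  assert (C3 := conv_holo (Omega 1) HD Hs _ _ HH HH).
  assert (S2 : holo_on (Omega 1) (fun z => RtoC (4 / 25) * conv (fun w => w) borel_fun z)%C) by (apply holo_mult; [apply holo_const|exact C2]).
  assert (S3 : holo_on (Omega 1) (fun z => RtoC (1 / 2) * conv borel_fun borel_fun z)%C) by (apply holo_mult; [apply holo_const|exact C3]).
  assert (S4 : holo_on (Omega 1) (fun z => RtoC (4 / 25) * z)%C) by (apply holo_mult; [apply holo_const|apply holo_id]).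
  unfold borel_rhs.
  rewrite (Dn_minus_on (Omega 1) HD); [|exact D0|apply holo_plus; [apply holo_plus|]; assumption|exact S3].
  rewrite (Dn_plus_on (Omega 1) HD); [|exact D0|apply holo_plus; assumption|exact S4].
  rewrite (Dn_plus_on (Omega 1) HD); [|exact D0|assumption|assumption].
  rewrite !(Dn_scal_on (Omega 1) HD) by (try exact D0; try assumption; apply holo_id).
  rewrite Dn_id_0. reflexivity.
Qed.

Lemma bd_1 : bd 1 = RtoC (4 / 25).
Proof.
  destruct (borel_fun_exists 1 Rlt_0_1) as [K0 [K1 [_ [_ [HH _]]]]].
  pose proof (Omega_open 1 Rlt_0_1) as HD. pose proof (Omega_0 1 Rlt_0_1) as D0. pose proof (Omega_star 1 Rlt_0_1) as Hs.
  pose proof (bd_equation 1) as E. rewrite bd_lhs, bd_rhs in E.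
  assert (H1 : holo_on (Omega 1) (fun z => z * borel_fun z)%C) by (apply holo_mult; [apply holo_id|exact HH]).
  rewrite !(Dn_conv_0 (Omega 1) HD D0 Hs) in E by (try assumption; try apply holo_const; apply holo_id).
  rewrite !csum_0 in E. simpl in E. change (borel_fun 0) with (bd 0) in E. rewrite bd_0 in E.
  transitivity (bd 1 + 0)%C; [ring|]. rewrite E. ring.
Qed.

(** In degree n + 2 the factor z^2 on the left contributes (n + 2)(n + 1), and integration of w b(w)
    removes n + 1. What remains is (n + 1)^2 - 4/25, half the factor in [quad_rec]; the kernels in
    [borel_rhs] are made for this. *)
Lemma bd_step (n : nat) :
  (2 * bd (S (S n)) + sum_n (fun i => bd i * bd (S n - i)%nat)%C (S n))%C = (- (RtoC (2 * INR (S n) ^ 2 - 8 / 25) * bd n))%C.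
Proof.
  destruct (borel_fun_exists 1 Rlt_0_1) as [K0 [K1 [_ [_ [HH _]]]]].
  pose proof (Omega_open 1 Rlt_0_1) as HD. pose proof (Omega_0 1 Rlt_0_1) as D0. pose proof (Omega_star 1 Rlt_0_1) as Hs.
  pose proof (bd_equation (S (S n))) as E. rewrite bd_lhs, bd_rhs in E.
  assert (H1 : holo_on (Omega 1) (fun z => z * borel_fun z)%C) by (apply holo_mult; [apply holo_id|exact HH]).
  rewrite (Dn_conv_1 (Omega 1) HD D0 Hs) in E by exact H1.
  rewrite (Dn_id_mult_0 (Omega 1) HD D0) in E by exact HH.
  rewrite (Dn_conv_id (Omega 1) HD D0 Hs) in E by exact HH.
  rewrite (Dn_conv_0 (Omega 1) HD D0 Hs) in E by exact HH.
  change (S (S n) =? 1)%nat with false in E. cbv iota in E.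
  change (sum_n (fun i => Dn i borel_fun 0 * Dn (S n - i) borel_fun 0)%C (S n)) with (sum_n (fun i => bd i * bd (S n - i)%nat)%C (S n)) in E.
  fold (bd n) in E.
  set (s := sum_n (fun i => bd i * bd (S n - i)%nat)%C (S n) : C) in *.
  assert (E' : bd (S (S n)) = (RtoC (INR (S n)) * bd n + RtoC (4 / 25) * bd n + RtoC (4 / 25) * 0 - RtoC (1 / 2) * s - RtoC (INR (S (S n)) * INR (S n)) * bd n)%C).
  { rewrite <- E. ring. }
  rewrite E', (S_INR (S n)). set (x := INR (S n)).
  replace (RtoC (1 / 2)) with (/ 2)%C by (rewrite <- RtoC_inv by lra; f_equal; field).
  replace (RtoC (2 * x ^ 2 - 8 / 25)) with (RtoC (2 * ((x + 1) * x) - 2 * x - 2 * (4 / 25))) by (f_equal; field).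
  rewrite !RtoC_minus, (RtoC_mult 2 ((x + 1) * x)), (RtoC_mult 2 x), (RtoC_mult 2 (4/25)). field.
Qed.

(** Shifted by one and headed by the constant 1 in the place of d_0, the numbers [bd] satisfy the
    recursion of d with the opposite sign on the right; the factor (-i)^n accounts for the sign, and
    [conv_unique] concludes. *)
Theorem borel_fun_taylor (d : nat -> R) : quad_rec d ->
  forall n, bd n = (RtoC (d (S n)) * (- Ci) ^ (S n))%C.
Proof.
  intros Hd.
  set (a := fun n => match n with O => RtoC 1 | S k => bd k end).
  set (y := fun n => (RtoC (d n) * (- Ci) ^ n)%C).
  assert (Ci2 : (Ci * Ci)%C = (- (1))%C) by (apply injective_projections; simpl; ring).
  assert (E : forall n, a n = y n).
  { induction n as [n IH] using lt_wf_ind. destruct n as [|n].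
    - unfold a, y. rewrite (proj1 Hd). simpl. ring.
    - apply (conv_unique a y n).
      + apply IH. lia.
      + unfold a. apply RtoC_neq_0. lra.
      + intros i Hi. apply IH. exact Hi.
      + destruct n as [|n].
        * rewrite !csum_S, !csum_0. unfold a, y. simpl. rewrite bd_0, (proj1 (proj2 Hd)). ring.
        * transitivity (- (RtoC (2 * INR n ^ 2 - 8 / 25) * a n))%C.
          -- rewrite csum_ends. replace (S (S n) - 0)%nat with (S (S n)) by lia. rewrite Nat.sub_diag.
             destruct n as [|n].
             ++ rewrite csum_0. unfold a. simpl. rewrite bd_0, bd_1. rewrite <- !RtoC_mult, <- !RtoC_plus, <- RtoC_opp. f_equal. field.
             ++ change (a (S n)) with (bd n); rewrite <- (bd_step n).
                rewrite (csum_ext (fun i => a (S i) * a (S (S (S n)) - S i)%nat)%C (fun i => bd i * bd (S n - i)%nat)%C).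
                ** unfold a at 1 2 3 4. ring.
                ** intros i Hi. unfold a. replace (S (S (S n)) - S i)%nat with (S (S n - i))%nat by lia. reflexivity.
          -- rewrite (IH n) by lia. unfold y.
             pose proof (conv_scaled d 1 (- Ci) n Hd) as E. symmetry.
             transitivity (sum_n (fun i => RtoC (d i) * 1 * (- Ci) ^ i * (RtoC (d (S (S n) - i)%nat) * 1 * (- Ci) ^ (S (S n) - i)))%C (S (S n)) : C).
             ++ apply csum_ext. intros i _. ring.
             ++ rewrite E. rewrite !Cpow_S, RtoC_mult.
                replace (- Ci * (- Ci * (- Ci) ^ n))%C with (Ci * Ci * (- Ci) ^ n)%C by ring. rewrite Ci2. ring. }
  intros n. exact (E (S n)).
Qed.

(** * Laplace integrals *)

(** The improper integral from 0 to infinity. Existence of the finite integrals is part of the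
    claim, since [CInt] has a value even where there is no integral. *)
Definition clap (F : R -> C) (L : C) : Prop :=
  forall e, 0 < e -> exists X, 0 <= X /\ forall x, X <= x -> exists J, is_CInt F 0 x J /\ Cmod (J - L) <= e.

Lemma clap_is_RInt_gen (F : R -> C) (L : C) : clap F L ->
  is_RInt_gen (V := C_R_NormedModule) F (at_point 0) (Rbar_locally p_infty) L.
Proof.
  intros H P HP. apply locally_C_disc in HP. destruct HP as [r [Hr HP]].
  destruct (H (r / 2) ltac:(lra)) as [X [HX HJ]].
  exists (fun x => x = 0) (fun y => X < y).
  - reflexivity.
  - exists X. auto.
  - intros x y -> Hy. destruct (HJ y ltac:(lra)) as [J [J1 J2]]. exists J. split; [exact J1|]. apply HP. lra.
Qed.

Lemma clap_unique (F : R -> C) (L L' : C) : clap F L -> clap F L' -> L = L'.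
Proof.
  intros H H'. apply Ceq_of_small. intros e He.
  destruct (H (e / 2) ltac:(lra)) as [X [_ HX]]. destruct (H' (e / 2) ltac:(lra)) as [Y [_ HY]].
  destruct (HX (Rmax X Y) (Rmax_l _ _)) as [J [J1 J2]]. destruct (HY (Rmax X Y) (Rmax_r _ _)) as [J' [J1' J2']].
  rewrite (is_CInt_inj _ _ _ _ _ J1' J1) in J2'.
  replace (L - L')%C with ((J - L') - (J - L))%C by ring. eapply Rle_trans; [apply Cmod_triangle_sub|]. lra.
Qed.

Lemma clap_plus (F G : R -> C) (L M : C) : clap F L -> clap G M -> clap (fun r => F r + G r)%C (L + M)%C.
Proof.
  intros H H' e He.
  destruct (H (e / 2) ltac:(lra)) as [X [HX0 HX]]. destruct (H' (e / 2) ltac:(lra)) as [Y [HY0 HY]].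
  exists (Rmax X Y). split; [eapply Rle_trans; [exact HX0|apply Rmax_l]|]. intros x Hx.
  destruct (HX x ltac:(eapply Rle_trans; [apply Rmax_l|exact Hx])) as [J [J1 J2]].
  destruct (HY x ltac:(eapply Rle_trans; [apply Rmax_r|exact Hx])) as [J' [J1' J2']].
  exists (J + J')%C. split; [apply is_CInt_plus; assumption|].
  replace (J + J' - (L + M))%C with ((J - L) + (J' - M))%C by ring. eapply Rle_trans; [apply Cmod_triangle|]. lra.
Qed.

Lemma clap_scal (c : C) (F : R -> C) (L : C) : clap F L -> clap (fun r => c * F r)%C (c * L)%C.
Proof.
  intros H e He. pose proof (Cmod_ge_0 c) as Hc.
  destruct (H (e / (Cmod c + 1)) ltac:(apply Rdiv_lt_0_compat; lra)) as [X [HX0 HX]].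
  exists X. split; [exact HX0|]. intros x Hx. destruct (HX x Hx) as [J [J1 J2]].
  exists (c * J)%C. split; [apply is_CInt_scal, J1|].
  replace (c * J - c * L)%C with (c * (J - L))%C by ring. rewrite Cmod_mult.
  apply Rle_trans with ((Cmod c + 1) * (e / (Cmod c + 1))).
  - apply Rmult_le_compat; try apply Cmod_ge_0; lra.
  - right. field. lra.
Qed.

Lemma clap_minus (F G : R -> C) (L M : C) : clap F L -> clap G M -> clap (fun r => F r - G r)%C (L - M)%C.
Proof.
  intros H H'. pose proof (clap_plus _ _ _ _ H (clap_scal (- (1))%C _ _ H')) as P.
  replace (L - M)%C with (L + - (1) * M)%C by ring.
  replace (fun r => (F r - G r)%C) with (fun r => (F r + - (1) * G r)%C); [exact P|].
  apply functional_extensionality. intros r. ring.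
Qed.

Lemma clap_ext (F G : R -> C) (L : C) : (forall r, 0 <= r -> F r = G r) -> clap F L -> clap G L.
Proof.
  intros H HF e He. destruct (HF e He) as [X [HX0 HX]]. exists X. split; [exact HX0|].
  intros x Hx. destruct (HX x Hx) as [J [J1 J2]]. exists J. split; [|exact J2].
  eapply is_CInt_ext; [lra| |exact J1]. intros t Ht. apply H. lra.
Qed.

Lemma exp_decay_int (A eps x y : R) : 0 < eps ->
  is_RInt (fun r => A * exp (- eps * r)) x y (A / eps * exp (- eps * x) - A / eps * exp (- eps * y)).
Proof.
  intros He.
  replace (A / eps * exp (- eps * x) - A / eps * exp (- eps * y)) with (- (A / eps) * exp (- eps * y) - - (A / eps) * exp (- eps * x)) by ring.
  apply (is_RInt_derive (V := R_CompleteNormedModule) (fun r => - (A / eps) * exp (- eps * r))).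
  - intros s _. auto_derive; [trivial|field; lra].
  - intros s _. apply (ex_derive_continuous (K := R_AbsRing) (V := R_NormedModule)). auto_derive. trivial.
Qed.

Lemma exp_decay_small (A eps e : R) : 0 <= A -> 0 < eps -> 0 < e -> exists X, 0 <= X /\ forall x, X <= x -> A * exp (- eps * x) <= e.
Proof.
  intros HA Heps He. exists (A / (eps * e)). split; [apply Rdiv_le_0_compat; nra|]. intros x Hx.
  assert (H : A <= e * (1 + eps * x)).
  { apply (Rmult_le_compat_l (eps * e)) in Hx; [|nra].
    replace (eps * e * (A / (eps * e))) with A in Hx by (field; split; lra). nra. }
  pose proof (exp_ineq1_le (eps * x)) as E. pose proof (exp_pos (- eps * x)) as P.
  apply Rle_trans with (e * exp (eps * x) * exp (- eps * x)).
  - apply Rmult_le_compat_r; [lra|]. eapply Rle_trans; [exact H|]. apply Rmult_le_compat_l; lra.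
  - rewrite Rmult_assoc, <- exp_plus. replace (eps * x + - eps * x) with 0 by ring. rewrite exp_0. lra.
Qed.

(** The tail beyond x is at most A / eps exp (- eps x). Integrals up to integers form a Cauchy
    sequence, and the same bound handles real upper limits. *)
Lemma clap_exists (F : R -> C) (A eps : R) : 0 < eps ->
  (forall r, 0 <= r -> ccont F r) -> (forall r, 0 <= r -> Cmod (F r) <= A * exp (- eps * r)) ->
  exists L, clap F L.
Proof.
  intros He Hc HB.
  assert (HA : 0 <= A).
  { pose proof (HB 0 ltac:(lra)) as H. rewrite Rmult_0_r, exp_0 in H. pose proof (Cmod_ge_0 (F 0)). lra. }
  assert (Hx : forall x y, 0 <= x -> x <= y -> Cmod (CInt F 0 y - CInt F 0 x) <= A / eps * exp (- eps * x)).
  { intros x y H0 Hxy.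
    pose proof (CInt_correct F x y Hxy ltac:(intros; apply Hc; lra)) as I1.
    pose proof (CInt_correct F 0 x H0 ltac:(intros; apply Hc; lra)) as I2.
    assert (E : CInt F 0 y = (CInt F 0 x + CInt F x y)%C).
    { apply is_CInt_unique. apply (is_RInt_Chasles (V := C_R_NormedModule) F 0 x y); assumption. }
    rewrite E. replace (CInt F 0 x + CInt F x y - CInt F 0 x)%C with (CInt F x y) by ring.
    eapply Rle_trans; [apply (CInt_bound_fun F (fun r => A * exp (- eps * r)) x y (A / eps * exp (- eps * x) - A / eps * exp (- eps * y)) _ Hxy); [intros t Ht; apply HB; lra|exact I1|apply exp_decay_int, He]|].
    assert (0 <= A / eps * exp (- eps * y)) by (apply Rmult_le_pos; [apply Rdiv_le_0_compat; lra|apply Rlt_le, exp_pos]). lra. }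
  assert (HAe : 0 <= A / eps) by (apply Rdiv_le_0_compat; lra).
  destruct (C_cauchy_limit (fun n => CInt F 0 (INR n))) as [L HL].
  { intros e Hee. destruct (exp_decay_small (A / eps) eps (e / 2) HAe He ltac:(lra)) as [X [HX0 HX]].
    destruct (nfloor_ex X HX0) as [N HN]. exists (S N). intros n k Hn Hk.
    assert (HXN : X <= INR (S N)) by (rewrite S_INR; lra).
    apply le_INR in Hn. apply le_INR in Hk.
    pose proof (Hx (INR (S N)) (INR n) ltac:(lra) Hn) as B1. pose proof (Hx (INR (S N)) (INR k) ltac:(lra) Hk) as B2.
    specialize (HX _ HXN).
    replace (CInt F 0 (INR n) - CInt F 0 (INR k))%C with ((CInt F 0 (INR n) - CInt F 0 (INR (S N))) - (CInt F 0 (INR k) - CInt F 0 (INR (S N))))%C by ring.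
    eapply Rle_trans; [apply Cmod_triangle_sub|]. lra. }
  exists L. intros e Hee.
  destruct (exp_decay_small (A / eps) eps (e / 2) HAe He ltac:(lra)) as [X [HX0 HX]].
  exists X. split; [exact HX0|]. intros x Hxx. exists (CInt F 0 x). split; [apply CInt_correct; [lra|intros; apply Hc; lra]|].
  destruct (HL (e / 2) ltac:(lra)) as [N HN].
  destruct (nfloor_ex x ltac:(lra)) as [k Hk].
  set (n := (N + S k)%nat). specialize (HN n ltac:(lia)).
  assert (Hn : x <= INR n).
  { unfold n. rewrite plus_INR, S_INR. pose proof (pos_INR N). lra. }
  pose proof (Hx x (INR n) ltac:(lra) Hn) as B. specialize (HX x Hxx).
  replace (CInt F 0 x - L)%C with ((CInt F 0 (INR n) - L) - (CInt F 0 (INR n) - CInt F 0 x))%C by ring.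
  eapply Rle_trans; [apply Cmod_triangle_sub|]. lra.
Qed.

Lemma clap_bound (F : R -> C) (A eps : R) (L : C) : 0 < eps ->
  (forall r, 0 <= r -> Cmod (F r) <= A * exp (- eps * r)) -> clap F L -> Cmod L <= A / eps.
Proof.
  intros He HB HL.
  assert (HA : 0 <= A).
  { pose proof (HB 0 ltac:(lra)) as H. rewrite Rmult_0_r, exp_0 in H. pose proof (Cmod_ge_0 (F 0)). lra. }
  apply Rle_plus_epsilon. intros e Hee. destruct (HL e Hee) as [X [HX0 HX]].
  destruct (HX X ltac:(lra)) as [J [J1 J2]].
  pose proof (CInt_bound_fun F (fun r => A * exp (- eps * r)) 0 X _ J HX0 (fun t Ht => HB t (proj1 Ht)) J1 (exp_decay_int A eps 0 X He)) as B.
  rewrite Rmult_0_r, exp_0, Rmult_1_r in B.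
  assert (0 <= A / eps * exp (- eps * X)) by (apply Rmult_le_pos; [apply Rdiv_le_0_compat; lra|apply Rlt_le, exp_pos]).
  replace L with (J - (J - L))%C by ring. eapply Rle_trans; [apply Cmod_triangle_sub|]. lra.
Qed.

(** The fundamental theorem at infinity, where H decays; it is the boundary term in the integration
    by parts of [laplace_parts]. *)
Lemma clap_derivative (H h : R -> C) (A eps : R) : 0 < eps ->
  (forall r, 0 <= r -> curve_der H r (h r)) -> (forall r, 0 <= r -> ccont h r) ->
  (forall r, 0 <= r -> Cmod (H r) <= A * exp (- eps * r)) -> clap h (- H 0)%C.
Proof.
  intros He Hd Hc HB e Hee.
  assert (HA : 0 <= A).
  { pose proof (HB 0 ltac:(lra)) as H0. rewrite Rmult_0_r, exp_0 in H0. pose proof (Cmod_ge_0 (H 0)). lra. }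
  destruct (exp_decay_small A eps e HA He Hee) as [X [HX0 HX]].
  exists X. split; [exact HX0|]. intros x Hx. exists (H x - H 0)%C. split.
  - apply CInt_derive; [lra| |]; intros t Ht; [apply Hd|apply Hc]; lra.
  - replace (H x - H 0 - - H 0)%C with (H x) by ring. eapply Rle_trans; [apply HB; lra|apply HX, Hx].
Qed.

Definition in_sector (m : R) (v : C) : Prop := m * Rabs (Im v) <= Re v.

Lemma Re_scal (r : R) (v : C) : Re (RtoC r * v)%C = r * Re v.
Proof. simpl. unfold Re. ring. Qed.

Lemma Im_scal (r : R) (v : C) : Im (RtoC r * v)%C = r * Im v.
Proof. simpl. unfold Im. ring. Qed.

Lemma Cmod_scal (r : R) (v : C) : 0 <= r -> Cmod (RtoC r * v)%C = r * Cmod v.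
Proof. intros H. rewrite Cmod_mult, Cmod_R, Rabs_right by lra. reflexivity. Qed.

(** The shift m / 2 in [Omega] leaves a margin of fixed radius around the whole closed sector. *)
Lemma sector_margin (m r : R) (v : C) : 0 < m -> in_sector m v -> 0 <= r ->
  forall w, Cmod (w - RtoC r * v) < m / (2 * (1 + m)) -> Omega m w.
Proof.
  intros Hm Hv Hr. unfold in_sector in Hv.
  assert (E : m / 2 <= Re (RtoC r * v)%C + m / 2 - m * Rabs (Im (RtoC r * v)%C)).
  { rewrite Re_scal, Im_scal, Rabs_mult, (Rabs_right r) by lra.
    pose proof (Rmult_le_compat_l r _ _ Hr Hv). lra. }
  apply Omega_disc; [exact Hm|unfold Omega; lra|apply Rdiv_lt_0_compat; lra|].
  eapply Rle_trans; [|exact E]. right. field. lra.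
Qed.

(** Cauchy estimates on discs of one fixed radius along the ray: all derivatives share the
    exponential rate and cost k! A^k. This is the source of the factorial type. *)
Lemma borel_sector (m : R) : 0 < m -> exists A B K, 0 < A /\ 0 < B /\ 0 < K /\
  forall v, in_sector m v -> forall r, 0 <= r -> forall k,
    holo_at (Dn k borel_fun) (RtoC r * v)%C /\
    Cmod (Dn k borel_fun (RtoC r * v)%C) <= B * INR (fact k) * A ^ k * exp (K * (r * Cmod v)).
Proof.
  intros Hm. destruct (borel_fun_exists m Hm) as [K0 [K1 [HK0 [HK1 [HH [HB _]]]]]].
  set (rho := m / (2 * (1 + m))). assert (Hrho : 0 < rho) by (apply Rdiv_lt_0_compat; lra).
  exists (2 / rho), (K0 * exp (K1 * rho)), K1.
  split; [apply Rdiv_lt_0_compat; lra|]. split; [apply Rmult_lt_0_compat; [lra|apply exp_pos]|]. split; [exact HK1|].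
  intros v Hv r Hr k. pose proof (sector_margin m r v Hm Hv Hr) as Hin. fold rho in Hin.
  set (z := (RtoC r * v)%C) in *.
  split.
  - apply (holo_on_Dn (Omega m)); [apply Omega_open, Hm|exact HH|]. apply Hin. rewrite Cmod_sub_self. exact Hrho.
  - eapply Rle_trans; [apply (cauchy_estimate borel_fun z rho (rho / 2) (K0 * exp (K1 * rho) * exp (K1 * (r * Cmod v))) k)|].
    + intros w Hw. apply HH, Hin, Hw.
    + lra.
    + intros w Hw. eapply Rle_trans; [apply HB, Hin; lra|].
      rewrite Rmult_assoc, <- exp_plus. apply Rmult_le_compat_l; [lra|]. apply exp_le.
      rewrite <- Rmult_plus_distr_l. apply Rmult_le_compat_l; [lra|].
      replace w with ((w - z) + z)%C by ring. eapply Rle_trans; [apply Cmod_triangle|].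
      unfold z at 2. rewrite Cmod_scal by exact Hr. lra.
    + right. unfold Rdiv. rewrite !Rpow_mult_distr, !pow_inv. field. split; apply pow_nonzero; lra.
Qed.

(** With xi = r e^(i alpha) and p = e^(i alpha) / hbar, the resummation integral depends on (t,
    hbar) only through p and v(t), up to the prefactor. Higher k arise from integration by parts and
    differentiation in v. *)
Definition laplace_kernel (k : nat) (p v : C) (r : R) : C :=
  (Cexp (- (RtoC r * p)) * Dn k borel_fun (RtoC r * v))%C.

Definition laplace (p v : C) : C := epsilon (inhabits (RtoC 0)) (clap (laplace_kernel 0 p v)).

Lemma laplace_spec (p v L : C) : clap (laplace_kernel 0 p v) L -> laplace p v = L.
Proof.
  intros H. apply (clap_unique (laplace_kernel 0 p v)); [|exact H].
  unfold laplace. apply epsilon_spec. exists L. exact H.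
Qed.

Lemma Cmod_Cexp_neg (r : R) (p : C) : Cmod (Cexp (- (RtoC r * p))) = exp (- r * Re p).
Proof. rewrite Cmod_Cexp. f_equal. simpl. unfold Re. ring. Qed.

(** * The Laplace integral over a closed sector: expansion and regularity *)

Section Sector.
Variables (m A B K : R).
Hypothesis Hm : 0 < m.
Hypothesis HA : 0 < A.
Hypothesis HB : 0 < B.
Hypothesis HK : 0 < K.
Hypothesis Hsec : forall v, in_sector m v -> forall r, 0 <= r -> forall k,
    holo_at (Dn k borel_fun) (RtoC r * v)%C /\
    Cmod (Dn k borel_fun (RtoC r * v)%C) <= B * INR (fact k) * A ^ k * exp (K * (r * Cmod v)).

Lemma laplace_kernel_cont (k : nat) (p v : C) (r : R) : in_sector m v -> 0 <= r -> ccont (laplace_kernel k p v) r.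
Proof.
  intros Hv Hr. unfold laplace_kernel. apply ccont_mult.
  - apply (holo_at_ccont (fun z => Cexp (- (z * p)))%C (fun s => RtoC s)); [|apply ccont_Rid].
    eexists. apply (cder_comp Cexp (fun z => - (z * p))%C); [apply cder_Cexp|].
    apply cder_opp, cder_mult; [apply cder_id|apply cder_const].
  - apply (holo_at_ccont (Dn k borel_fun) (fun s => RtoC s * v)%C); [apply Hsec; assumption|apply ccont_scal_line].
Qed.

Lemma laplace_kernel_bound (k : nat) (p v : C) (eps r : R) : in_sector m v -> 0 <= r ->
  eps <= Re p - K * Cmod v -> Cmod (laplace_kernel k p v r) <= B * INR (fact k) * A ^ k * exp (- eps * r).
Proof.
  intros Hv Hr He. unfold laplace_kernel. rewrite Cmod_mult, Cmod_Cexp_neg.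
  destruct (Hsec v Hv r Hr k) as [_ H].
  assert (P : 0 <= B * INR (fact k) * A ^ k).
  { apply Rmult_le_pos; [apply Rmult_le_pos; [lra|apply pos_INR]|apply pow_le; lra]. }
  apply Rle_trans with (exp (- r * Re p) * (B * INR (fact k) * A ^ k * exp (K * (r * Cmod v)))).
  - apply Rmult_le_compat_l; [apply Rlt_le, exp_pos|exact H].
  - replace (exp (- r * Re p) * (B * INR (fact k) * A ^ k * exp (K * (r * Cmod v))))
      with (B * INR (fact k) * A ^ k * (exp (- r * Re p) * exp (K * (r * Cmod v)))) by ring.
    rewrite <- exp_plus. apply Rmult_le_compat_l; [exact P|]. apply exp_le. nra.
Qed.

Lemma laplace_kernel_clap (k : nat) (p v : C) : in_sector m v -> K * Cmod v < Re p ->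
  exists L, clap (laplace_kernel k p v) L.
Proof.
  intros Hv Hp. apply (clap_exists _ (B * INR (fact k) * A ^ k) (Re p - K * Cmod v)); [lra| |].
  - intros r Hr. apply laplace_kernel_cont; assumption.
  - intros r Hr. apply laplace_kernel_bound; [assumption|assumption|lra].
Qed.

Lemma laplace_clap (p v : C) : in_sector m v -> K * Cmod v < Re p -> clap (laplace_kernel 0 p v) (laplace p v).
Proof.
  intros Hv Hp. destruct (laplace_kernel_clap 0 p v Hv Hp) as [L HL]. rewrite (laplace_spec p v L HL). exact HL.
Qed.

Lemma laplace_parts (k : nat) (p v L L' : C) : in_sector m v -> K * Cmod v < Re p ->
  clap (laplace_kernel k p v) L -> clap (laplace_kernel (S k) p v) L' ->
  (p * L = Dn k borel_fun 0 + v * L')%C.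
Proof.
  intros Hv Hp HL HL'.
  pose proof (clap_derivative (laplace_kernel k p v)
    (fun r => - p * laplace_kernel k p v r + v * laplace_kernel (S k) p v r)%C
    (B * INR (fact k) * A ^ k) (Re p - K * Cmod v) ltac:(lra)) as HD.
  assert (HD' : clap (fun r => - p * laplace_kernel k p v r + v * laplace_kernel (S k) p v r)%C (- laplace_kernel k p v 0)%C).
  { apply HD.
    - intros r Hr. unfold laplace_kernel.
      assert (E1 : curve_der (fun s => RtoC s) r 1).
      { pose proof (curve_der_affine 0 1 r) as Af.
        apply (is_derive_ext (K := R_AbsRing) (V := C_R_NormedModule) (fun s => 0 + RtoC s * 1)%C); [|exact Af].
        intros t. eq_in C. ring. }
      pose proof (curve_der_comp (fun z => Cexp (- (z * p)) * Dn k borel_fun (z * v))%C (fun s => RtoC s) r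
        (- p * (Cexp (- (RtoC r * p)) * Dn k borel_fun (RtoC r * v)) + v * (Cexp (- (RtoC r * p)) * Dn (S k) borel_fun (RtoC r * v)))%C 1) as Cc.
      rewrite Cmult_1_r in Cc. apply Cc; [|exact E1].
      destruct (Hsec v Hv r Hr k) as [Hh _]. apply holo_C_derive in Hh. rewrite <- Dn_S in Hh.
      eapply cder_eq; [|apply cder_mult; [apply (cder_comp Cexp (fun z => - (z * p))%C); [apply cder_Cexp|apply cder_opp, cder_mult; [apply cder_id|apply cder_const]]
         |apply (cder_comp (Dn k borel_fun) (fun z => z * v)%C); [exact Hh|apply cder_mult; [apply cder_id|apply cder_const]]]].
      cbv beta. ring.
    - intros r Hr. apply ccont_plus; (apply ccont_mult; [apply ccont_const|apply laplace_kernel_cont; assumption]).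
    - intros r Hr. apply laplace_kernel_bound; [assumption|assumption|lra]. }
  pose proof (clap_plus _ _ _ _ (clap_scal (- p)%C _ _ HL) (clap_scal v _ _ HL')) as HP.
  pose proof (clap_unique _ _ _ HP HD') as E.
  assert (E0 : laplace_kernel k p v 0 = Dn k borel_fun 0).
  { unfold laplace_kernel. rewrite !Cmult_0_l. replace (- 0)%C with (RtoC 0) by ring. rewrite Cexp_0. ring. }
  rewrite E0 in E. replace (p * L)%C with (v * L' - (- p * L + v * L'))%C by ring. rewrite E. ring.
Qed.

(** Each integration by parts extracts one Taylor coefficient of b at 0 and replaces b by its
    derivative, so the remainder is (v / p)^n times a Laplace integral of the n-th derivative. *)
Lemma laplace_expansion (n : nat) (p v L : C) : in_sector m v -> K * Cmod v < Re p -> p <> 0 ->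
  clap (laplace_kernel n p v) L ->
  laplace p v = (partial_sum (fun k => (v / p) ^ k * Dn k borel_fun 0 / p) n + (v / p) ^ n * L)%C.
Proof.
  intros Hv Hp Hp0. revert L. induction n as [|n IH]; intros L HL.
  - rewrite (laplace_spec p v L HL). simpl. ring.
  - destruct (laplace_kernel_clap n p v Hv Hp) as [L0 HL0]. rewrite (IH L0 HL0).
    pose proof (laplace_parts n p v L0 L Hv Hp HL0 HL) as E.
    replace L0 with ((Dn n borel_fun 0 + v * L) / p)%C by (rewrite <- E; field; exact Hp0).
    assert (Ep : partial_sum (fun k => (v / p) ^ k * Dn k borel_fun 0 / p)%C (S n)
       = (partial_sum (fun k => (v / p) ^ k * Dn k borel_fun 0 / p)%C n + (v / p) ^ n * Dn n borel_fun 0 / p)%C).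
    { destruct n as [|n]; simpl partial_sum; [rewrite csum_0; ring|rewrite csum_S; reflexivity]. }
    rewrite Ep, Cpow_S. field. exact Hp0.
Qed.

(** The extra 1 in the hypothesis on Re p leaves decay exp (- r), so that integration adds no
    constant to n! A^n. *)
Lemma laplace_remainder (n : nat) (p v : C) (V : R) : in_sector m v -> K * Cmod v + 1 <= Re p -> Cmod v <= V ->
  Cmod (laplace p v - partial_sum (fun k => (v / p) ^ k * Dn k borel_fun 0 / p) n)%C
   <= B * INR (fact n) * (A * V) ^ n / Cmod p ^ n.
Proof.
  intros Hv Hp HV. pose proof (Cmod_ge_0 v) as Hv0.
  assert (Hp1 : 0 < Cmod p).
  { pose proof (Re_le_Cmod p). nra. }
  assert (Hp0 : p <> 0) by (apply Cmod_gt_0, Hp1).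
  destruct (laplace_kernel_clap n p v Hv ltac:(lra)) as [L HL].
  rewrite (laplace_expansion n p v L Hv ltac:(lra) Hp0 HL).
  match goal with |- Cmod ?x <= _ => replace x with ((v / p) ^ n * L)%C by ring end.
  pose proof (clap_bound _ (B * INR (fact n) * A ^ n) 1 L Rlt_0_1 (fun r Hr => laplace_kernel_bound n p v 1 r Hv Hr ltac:(lra)) HL) as HBd.
  rewrite Cmod_mult, Cmod_pow, Cmod_div by exact Hp0.
  apply Rle_trans with ((V / Cmod p) ^ n * (B * INR (fact n) * A ^ n / 1)).
  - apply Rmult_le_compat; [apply pow_le, Rdiv_le_0_compat; lra|apply Cmod_ge_0| |exact HBd].
    apply pow_incr. split; [apply Rdiv_le_0_compat; lra|]. apply Rmult_le_compat_r; [apply Rlt_le, Rinv_0_lt_compat, Hp1|exact HV].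
  - right. unfold Rdiv. rewrite !Rpow_mult_distr, !pow_inv. field. apply pow_nonzero. lra.
Qed.

Lemma segment_lipschitz (f : C -> C) (a k : C) (M : R) :
  (forall t, 0 <= t <= 1 -> holo_at f (a + RtoC t * k)%C /\ holo_at (C_derive f) (a + RtoC t * k)%C /\ Cmod (C_derive f (a + RtoC t * k)%C) <= M) ->
  Cmod (f (a + k) - f a)%C <= M * Cmod k.
Proof.
  intros H.
  assert (I : is_CInt (fun t => C_derive f (a + RtoC t * k) * k)%C 0 1 (f (a + RtoC 1 * k) - f (a + RtoC 0 * k))%C).
  { apply (CInt_derive (fun t => f (a + RtoC t * k)%C)); [lra| |].
    - intros t Ht. apply (curve_der_comp f (fun t => a + RtoC t * k)%C); [apply holo_C_derive, H, Ht|apply curve_der_affine].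
    - intros t Ht. apply ccont_mult; [|apply ccont_const].
      apply (holo_at_ccont (C_derive f) (fun t => a + RtoC t * k)%C); [apply H, Ht|apply ccont_affine]. }
  replace (a + RtoC 1 * k)%C with (a + k)%C in I by ring. replace (a + RtoC 0 * k)%C with a in I by ring.
  eapply Rle_trans; [eapply (CInt_bound _ 0 1 (M * Cmod k)); [lra| |exact I]|lra].
  intros t Ht. cbv beta. rewrite Cmod_mult. apply Rmult_le_compat_r; [apply Cmod_ge_0|]. apply H, Ht.
Qed.

Lemma segment_quad (f : C -> C) (a k : C) (M : R) :
  (forall t, 0 <= t <= 1 -> forall j, (j <= 2)%nat -> holo_at (Dn j f) (a + RtoC t * k)%C) ->
  (forall t, 0 <= t <= 1 -> Cmod (Dn 2 f (a + RtoC t * k)%C) <= M) ->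
  Cmod (f (a + k) - f a - C_derive f a * k)%C <= M * (Cmod k * Cmod k).
Proof.
  intros H HM.
  assert (I : is_CInt (fun t => C_derive f (a + RtoC t * k) * k)%C 0 1 (f (a + RtoC 1 * k) - f (a + RtoC 0 * k))%C).
  { apply (CInt_derive (fun t => f (a + RtoC t * k)%C)); [lra| |].
    - intros t Ht. apply (curve_der_comp f (fun t => a + RtoC t * k)%C); [apply holo_C_derive; apply (H t Ht 0%nat); lia|apply curve_der_affine].
    - intros t Ht. apply ccont_mult; [|apply ccont_const].
      apply (holo_at_ccont (C_derive f) (fun t => a + RtoC t * k)%C); [apply (H t Ht 1%nat); lia|apply ccont_affine]. }
  replace (a + RtoC 1 * k)%C with (a + k)%C in I by ring. replace (a + RtoC 0 * k)%C with a in I by ring.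
  pose proof (is_CInt_minus _ _ _ _ _ _ I (is_CInt_const (C_derive f a * k)%C 0 1)) as J.
  replace (RtoC (1 - 0) * (C_derive f a * k))%C with (C_derive f a * k)%C in J by (rewrite Rminus_0_r; ring).
  eapply Rle_trans; [eapply (CInt_bound _ 0 1 (M * (Cmod k * Cmod k))); [lra| |exact J]|lra].
  intros t Ht. cbv beta.
  replace (C_derive f (a + RtoC t * k) * k - C_derive f a * k)%C with ((C_derive f (a + RtoC t * k) - C_derive f a) * k)%C by ring.
  rewrite Cmod_mult, <- Rmult_assoc. apply Rmult_le_compat_r; [apply Cmod_ge_0|].
  eapply Rle_trans; [apply (segment_lipschitz (C_derive f) a (RtoC t * k)%C M)|].
  - intros s Hs. rewrite Cmult_assoc, <- RtoC_mult.
    assert (Hst : 0 <= s * t <= 1) by nra.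
    split; [apply (H _ Hst 1%nat); lia|]. split; [apply (H _ Hst 2%nat); lia|apply HM, Hst].
  - rewrite Cmod_scal by lra. apply Rmult_le_compat_l.
    + eapply Rle_trans; [apply Cmod_ge_0|apply (HM 0); lra].
    + pose proof (Cmod_ge_0 k). nra.
Qed.

Lemma sq_le_exp (c r : R) : 0 < c -> 0 <= r -> r * r <= 4 / (c * c) * exp (c * r).
Proof.
  intros Hc Hr. pose proof (exp_ineq1_le (c * r / 2)) as E.
  assert (E2 : exp (c * r) = exp (c * r / 2) * exp (c * r / 2)) by (rewrite <- exp_plus; f_equal; field).
  rewrite E2. apply (Rmult_le_reg_l (c * c / 4)); [nra|].
  replace (c * c / 4 * (4 / (c * c) * (exp (c * r / 2) * exp (c * r / 2)))) with (exp (c * r / 2) * exp (c * r / 2)) by (field; lra).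
  assert (0 <= c * r) by nra. nra.
Qed.

Lemma sector_segment (v h : C) (t : R) : in_sector m v -> in_sector m (v + h)%C -> 0 <= t <= 1 -> in_sector m (v + RtoC t * h)%C.
Proof.
  unfold in_sector. intros H1 H2 Ht.
  replace (v + RtoC t * h)%C with (RtoC (1 - t) * v + RtoC t * (v + h))%C by (rewrite RtoC_minus; ring).
  change (Re (RtoC (1 - t) * v + RtoC t * (v + h))%C) with (Re (RtoC (1 - t) * v)%C + Re (RtoC t * (v + h))%C).
  change (Im (RtoC (1 - t) * v + RtoC t * (v + h))%C) with (Im (RtoC (1 - t) * v)%C + Im (RtoC t * (v + h))%C).
  rewrite !Re_scal, !Im_scal.
  pose proof (Rabs_triang ((1 - t) * Im v) (t * Im (v + h)%C)) as T. rewrite !Rabs_mult, (Rabs_right t), (Rabs_right (1 - t)) in T by lra.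
  set (x := Rabs (Im v)) in *. set (y := Rabs (Im (v + h)%C)) in *.
  apply Rle_trans with ((1 - t) * (m * x) + t * (m * y)).
  - apply Rle_trans with (m * ((1 - t) * x + t * y)); [apply Rmult_le_compat_l; lra|right; ring].
  - apply Rplus_le_compat; apply Rmult_le_compat_l; lra.
Qed.

(* Joint differentiability with quadratic remainder, by differentiating under the integral sign. *)
Lemma laplace_quad (p v : C) : in_sector m v -> K * Cmod v < Re p ->
  exists a b Q eta, 0 < Q /\ 0 < eta /\ forall dp dv, Cmod dp < eta -> Cmod dv < eta -> in_sector m (v + dv)%C ->
    Cmod (laplace (p + dp) (v + dv) - laplace p v - a * dp - b * dv)%C <= Q * (Cmod dp + Cmod dv) ^ 2.
Proof.
  intros Hv Hp.
  set (g := Re p - K * Cmod v). assert (Hg : 0 < g) by (unfold g; lra).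
  (* The perturbation may cost g / 4 of the decay rate g; another g / 4 pays for the factor r^2, and
     g / 2 remains. *)
  set (eta := g / (4 * (1 + K))).
  assert (Heta : 0 < eta) by (apply Rdiv_lt_0_compat; lra).
  assert (Heta' : (1 + K) * eta = g / 4) by (unfold eta; field; lra).
  set (F1 := fun r => (RtoC r * laplace_kernel 0 p v r)%C).
  set (F2 := fun r => (RtoC r * laplace_kernel 1 p v r)%C).
  assert (Hr1 : forall r, 0 <= r -> r <= 2 / g * exp (g / 2 * r)).
  { intros r Hr. pose proof (exp_ineq1_le (g / 2 * r)) as E. apply (Rmult_le_reg_l (g / 2)); [lra|].
    replace (g / 2 * (2 / g * exp (g / 2 * r))) with (exp (g / 2 * r)) by (field; lra). lra. }
  assert (HF : forall k, exists L, clap (fun r => RtoC r * laplace_kernel k p v r)%C L).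
  { intros k. apply (clap_exists _ (2 / g * (B * INR (fact k) * A ^ k)) (g / 2)); [lra| |].
    - intros r Hr. apply ccont_mult; [apply ccont_Rid|apply laplace_kernel_cont; assumption].
    - intros r Hr. rewrite Cmod_scal by exact Hr.
      pose proof (laplace_kernel_bound k p v g r Hv Hr ltac:(unfold g; lra)) as L.
      eapply Rle_trans; [apply Rmult_le_compat; [exact Hr|apply Cmod_ge_0|apply Hr1, Hr|exact L]|].
      replace (2 / g * exp (g / 2 * r) * (B * INR (fact k) * A ^ k * exp (- g * r)))
        with (2 / g * (B * INR (fact k) * A ^ k) * (exp (g / 2 * r) * exp (- g * r))) by ring.
      rewrite <- exp_plus. right. do 2 f_equal. field. }
  destruct (HF 0%nat) as [L1 HL1]. destruct (HF 1%nat) as [L2 HL2].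
  (* One constant above B j! A^j for j = 0, 1, 2. *)
  set (BB := B * (1 + 1 * A + 2 * (A * A))).
  assert (HBB : 0 < BB) by (unfold BB; nra).
  set (Q0 := BB * (4 / ((g / 4) * (g / 4)))).
  assert (HQ0 : 0 < Q0) by (apply Rmult_lt_0_compat; [lra|apply Rdiv_lt_0_compat; nra]).
  exists (- L1)%C, L2, (Q0 / (g / 2)), eta. split; [apply Rdiv_lt_0_compat; lra|]. split; [exact Heta|].
  intros dp dv Hdp Hdv Hvdv.
  pose proof (Cmod_ge_0 dp) as Hdp0. pose proof (Cmod_ge_0 dv) as Hdv0.
  assert (Hp' : K * Cmod (v + dv) < Re (p + dp)%C).
  { change (Re (p + dp)%C) with (Re p + Re dp). pose proof (re_le_Cmod dp) as R1.
    assert (R2 : - Re dp <= Cmod dp) by (eapply Rle_trans; [apply Rle_abs|rewrite Rabs_Ropp; exact R1]).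
    pose proof (Cmod_triangle v dv) as T. unfold g in *. nra. }
  pose proof (laplace_clap p v Hv Hp) as C0. pose proof (laplace_clap _ _ Hvdv Hp') as C1.
  pose proof (clap_minus _ _ _ _ (clap_minus _ _ _ _ (clap_minus _ _ _ _ C1 C0) (clap_scal (- dp)%C _ _ HL1)) (clap_scal dv _ _ HL2)) as CC.
  replace (laplace (p + dp) (v + dv) - laplace p v - - L1 * dp - L2 * dv)%C
    with (laplace (p + dp) (v + dv) - laplace p v - - dp * L1 - dv * L2)%C by ring.
  replace (Q0 / (g / 2) * (Cmod dp + Cmod dv) ^ 2) with (Q0 * (Cmod dp + Cmod dv) ^ 2 / (g / 2)) by (field; lra).
  apply (clap_bound _ (Q0 * (Cmod dp + Cmod dv) ^ 2) (g / 2) _ ltac:(lra)) in CC; [exact CC|].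
  intros r Hr. unfold laplace_kernel. simpl Dn at 1 2 3.
  set (E := Cexp (- (RtoC r * p))). set (X := Cexp (- (RtoC r * dp))).
  replace (Cexp (- (RtoC r * (p + dp)))) with (E * X)%C by (unfold E, X; rewrite <- Cexp_plus; f_equal; ring).
  replace (RtoC r * (v + dv))%C with (RtoC r * v + RtoC r * dv)%C by ring.
  set (a := (RtoC r * v)%C). set (k := (RtoC r * dv)%C).
  change (Dn 1 borel_fun a) with (C_derive borel_fun a).
  replace (E * X * borel_fun (a + k) - E * borel_fun a - - dp * (RtoC r * (E * borel_fun a)) - dv * (RtoC r * (E * C_derive borel_fun a)))%C
    with (E * ((X - 1 - - (RtoC r * dp)) * borel_fun a + (X - 1) * (borel_fun (a + k) - borel_fun a) + (borel_fun (a + k) - borel_fun a - C_derive borel_fun a * k)))%C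
    by (unfold k; ring).
  set (W := exp (K * (r * (Cmod v + eta)))).
  assert (HW : 0 < W) by apply exp_pos.
  assert (Hseg : forall t, 0 <= t <= 1 -> forall j, holo_at (Dn j borel_fun) (a + RtoC t * k)%C /\
     Cmod (Dn j borel_fun (a + RtoC t * k)%C) <= B * INR (fact j) * A ^ j * W).
  { intros t Ht j. replace (a + RtoC t * k)%C with (RtoC r * (v + RtoC t * dv))%C by (unfold a, k; ring).
    destruct (Hsec _ (sector_segment v dv t Hv Hvdv Ht) r Hr j) as [S1 S2]. split; [exact S1|].
    eapply Rle_trans; [exact S2|].
    apply Rmult_le_compat_l; [apply Rmult_le_pos; [apply Rmult_le_pos; [lra|apply pos_INR]|apply pow_le; lra]|].
    apply exp_le. apply Rmult_le_compat_l; [lra|]. apply Rmult_le_compat_l; [lra|].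
    eapply Rle_trans; [apply Cmod_triangle|]. rewrite Cmod_scal by lra. nra. }
  assert (Y0 : Cmod (borel_fun a) <= BB * W).
  { destruct (Hseg 0 ltac:(lra) 0%nat) as [_ S]. replace (a + RtoC 0 * k)%C with a in S by ring. simpl in S.
    eapply Rle_trans; [exact S|]. apply Rmult_le_compat_r; [lra|]. unfold BB. nra. }
  assert (Y1 : Cmod (borel_fun (a + k) - borel_fun a)%C <= BB * W * Cmod k).
  { apply segment_lipschitz. intros t Ht. split; [apply (Hseg t Ht 0%nat)|]. split; [apply (Hseg t Ht 1%nat)|].
    destruct (Hseg t Ht 1%nat) as [_ S]. simpl in S. eapply Rle_trans; [exact S|]. apply Rmult_le_compat_r; [lra|]. unfold BB. nra. }
  assert (Y2 : Cmod (borel_fun (a + k) - borel_fun a - C_derive borel_fun a * k)%C <= BB * W * (Cmod k * Cmod k)).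
  { apply segment_quad.
    - intros t Ht j _. apply (Hseg t Ht j).
    - intros t Ht. destruct (Hseg t Ht 2%nat) as [_ S]. eapply Rle_trans; [exact S|]. apply Rmult_le_compat_r; [lra|].
      unfold BB. simpl. nra. }
  assert (Ek : Cmod k = r * Cmod dv) by (apply Cmod_scal, Hr).
  assert (Edp : Cmod (- (RtoC r * dp))%C = r * Cmod dp) by (rewrite Cmod_opp; apply Cmod_scal, Hr).
  pose proof (Cexp_minus_1_bound (- (RtoC r * dp))%C) as X1. pose proof (Cexp_quad_bound (- (RtoC r * dp))%C) as X2.
  fold X in X1, X2. rewrite Edp in X1, X2. rewrite Ek in Y1, Y2.
  set (Z := exp (r * eta)). assert (HZ1 : 1 <= Z) by (apply exp_ge_1; nra).
  assert (HZ : exp (r * Cmod dp) <= Z) by (apply exp_le; nra).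
  rewrite Cmod_mult. unfold E. rewrite Cmod_Cexp_neg.
  set (x := Cmod dp) in *. set (y := Cmod dv) in *.
  assert (HN : Cmod ((X - 1 - - (RtoC r * dp)) * borel_fun a + (X - 1) * (borel_fun (a + k) - borel_fun a) + (borel_fun (a + k) - borel_fun a - C_derive borel_fun a * k))%C
     <= r * r * (BB * (W * Z)) * (x + y) ^ 2).
  { eapply Rle_trans; [apply Cmod_triangle|]. eapply Rle_trans; [apply Rplus_le_compat_r, Cmod_triangle|]. rewrite !Cmod_mult.
    assert (T1 : Cmod (X - 1 - - (RtoC r * dp)) * Cmod (borel_fun a) <= (r * x) * (r * x) * Z * (BB * W)).
    { apply Rmult_le_compat; try apply Cmod_ge_0; [|exact Y0]. eapply Rle_trans; [exact X2|]. apply Rmult_le_compat_l; [nra|exact HZ]. }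
    assert (T2 : Cmod (X - 1) * Cmod (borel_fun (a + k) - borel_fun a) <= (r * x) * Z * (BB * W * (r * y))).
    { apply Rmult_le_compat; try apply Cmod_ge_0; [|exact Y1]. eapply Rle_trans; [exact X1|]. apply Rmult_le_compat_l; [nra|exact HZ]. }
    assert (T3 : Cmod (borel_fun (a + k) - borel_fun a - C_derive borel_fun a * k) <= BB * W * ((r * y) * (r * y)) * Z).
    { eapply Rle_trans; [exact Y2|]. rewrite <- (Rmult_1_r (BB * W * (r * y * (r * y)))) at 1.
      apply Rmult_le_compat_l; [|exact HZ1]. apply Rmult_le_pos; [nra|]. assert (0 <= r * y) by nra. nra. }
    set (P := r * r * (BB * (W * Z))). assert (HP : 0 <= P).
    { unfold P. apply Rmult_le_pos; [nra|]. apply Rmult_le_pos; [lra|]. apply Rmult_le_pos; lra. }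
    replace (r * x * (r * x) * Z * (BB * W)) with (P * (x * x)) in T1 by (unfold P; ring).
    replace (r * x * Z * (BB * W * (r * y))) with (P * (x * y)) in T2 by (unfold P; ring).
    replace (BB * W * (r * y * (r * y)) * Z) with (P * (y * y)) in T3 by (unfold P; ring).
    assert (0 <= P * (x * y)) by (apply Rmult_le_pos; nra).
    replace (P * (x + y) ^ 2) with (P * (x * x) + 2 * (P * (x * y)) + P * (y * y)) by ring. lra. }
  apply Rle_trans with (exp (- r * Re p) * (r * r * (BB * (W * Z)) * (x + y) ^ 2)).
  { apply Rmult_le_compat_l; [apply Rlt_le, exp_pos|exact HN]. }
  pose proof (sq_le_exp (g / 4) r ltac:(lra) Hr) as Sq.
  assert (EE : exp (- r * Re p) * (W * Z) * exp (g / 4 * r) = exp (- (g / 2) * r)).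
  { unfold W, Z. rewrite <- !exp_plus. f_equal. unfold g in *. nra. }
  apply Rle_trans with (exp (- r * Re p) * (4 / (g / 4 * (g / 4)) * exp (g / 4 * r) * (BB * (W * Z)) * (x + y) ^ 2)).
  { apply Rmult_le_compat_l; [apply Rlt_le, exp_pos|]. apply Rmult_le_compat_r; [apply pow2_ge_0|].
    apply Rmult_le_compat_r; [|exact Sq]. apply Rmult_le_pos; [lra|]. apply Rmult_le_pos; lra. }
  right. unfold Q0. rewrite <- EE. ring.
Qed.
End Sector.

(** * Geometry of Stokes sectors *)

(** If the open sets separated the endpoints of a path, the supremum of the parameters up to which
    it stays in A could belong to neither of them. *)
Lemma path_connected_connected {T : UniformSpace} (X : T -> Prop) :
  (forall x y, X x -> X y -> exists g, path_in X g /\ g 0 = x /\ g 1 = y) -> connected X.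
Proof.
  intros H A B HA HB Hcov [x [Xx Ax]] [y [Xy By]].
  apply NNPP. intros Hno.
  assert (Hd : forall z, X z -> A z -> B z -> False) by (intros z Xz Az Bz; apply Hno; exists z; auto).
  destruct (H x y Xx Xy) as [g [[Hc Hg] [Hg0 Hg1]]].
  set (E := fun s => 0 <= s <= 1 /\ forall u, 0 <= u <= s -> A (g u)).
  destruct (completeness E) as [s [Hs1 Hs2]].
  - exists 1. intros u [Hu _]. lra.
  - exists 0. split; [lra|]. intros u Hu. replace u with 0 by lra. rewrite Hg0. exact Ax.
  - assert (S0 : 0 <= s) by (apply Hs1; split; [lra|]; intros u Hu; replace u with 0 by lra; rewrite Hg0; exact Ax).
    assert (S1 : s <= 1) by (apply Hs2; intros u [Hu _]; lra).
    assert (Below : forall u, 0 <= u < s -> A (g u)).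
    { intros u Hu. apply NNPP. intros N.
      assert (s <= u); [|lra]. apply Hs2. intros w [Hw1 Hw2]. apply Rnot_lt_le. intros L. apply N, Hw2. lra. }
    destruct (Hcov (g s) (Hg s (conj S0 S1))) as [As|Bs].
    + destruct (Hc s A (HA _ As)) as [d Hd'].
      destruct (Req_dec s 1) as [->|Ns].
      { apply (Hd (g 1)); [apply Hg; lra|exact As|rewrite Hg1; exact By]. }
      set (s' := Rmin 1 (s + d / 2)).
      pose proof (cond_pos d) as Hdp.
      assert (Hs' : s < s' <= 1 /\ s' <= s + d / 2).
      { unfold s'. split; [split; [apply Rmin_glb_lt; lra|apply Rmin_l]|apply Rmin_r]. }
      assert (E s'); [|specialize (Hs1 s' H0); lra]. split; [lra|]. intros u Hu.
      destruct (Rlt_le_dec u s) as [L|L]; [apply Below; lra|].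
      apply Hd'. change (Rabs (u - s) < d). rewrite Rabs_right; lra.
    + destruct (Hc s B (HB _ Bs)) as [d Hd']. pose proof (cond_pos d) as Hdp.
      destruct (Req_dec s 0) as [->|Ns].
      { apply (Hd (g 0)); [apply Hg; lra|rewrite Hg0; exact Ax|exact Bs]. }
      set (u := Rmax 0 (s - d / 2)).
      assert (Hu : 0 <= u < s /\ s - d / 2 <= u).
      { unfold u. split; [split; [apply Rmax_l|apply Rmax_lub_lt; lra]|apply Rmax_r]. }
      apply (Hd (g u)); [apply Hg; lra|apply Below; lra|].
      apply Hd'. change (Rabs (u - s) < d). rewrite Rabs_left; lra.
Qed.

Definition convexC (X : C -> Prop) : Prop :=
  forall x y s, X x -> X y -> 0 <= s <= 1 -> X (x + RtoC s * (y - x))%C.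

Lemma convex_path (X : C -> Prop) : convexC X ->
  forall x y, X x -> X y -> exists g, path_in (T := C_UniformSpace) X g /\ g 0 = x /\ g 1 = y.
Proof.
  intros H x y Hx Hy. exists (fun s => x + RtoC s * (y - x))%C. split; [split|split].
  - intros s. apply ccont_affine.
  - intros s Hs. apply H; assumption.
  - cbv beta. eq_in C. ring.
  - cbv beta. eq_in C. ring.
Qed.

Lemma convex_connected (X : C -> Prop) : convexC X -> connected (T := C_UniformSpace) X.
Proof. intros H. apply path_connected_connected, convex_path, H. Qed.

(* The open sector |arg z| < beta, for 0 < beta < PI/2, as an intersection of two half planes. *)
Definition cone (beta : R) (z : C) : Prop :=
  0 < Re z * sin beta - Im z * cos beta /\ 0 < Re z * sin beta + Im z * cos beta.

Lemma cone_convex (beta : R) (c : C) : convexC (fun z => cone beta (z * c)%C).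
Proof.
  intros x y s [Hx1 Hx2] [Hy1 Hy2] Hs. unfold cone.
  replace ((x + RtoC s * (y - x)) * c)%C with (RtoC (1 - s) * (x * c) + RtoC s * (y * c))%C by (rewrite RtoC_minus; ring).
  change (Re (RtoC (1 - s) * (x * c) + RtoC s * (y * c))%C) with (Re (RtoC (1 - s) * (x * c))%C + Re (RtoC s * (y * c))%C).
  change (Im (RtoC (1 - s) * (x * c) + RtoC s * (y * c))%C) with (Im (RtoC (1 - s) * (x * c))%C + Im (RtoC s * (y * c))%C).
  rewrite !Re_scal, !Im_scal. destruct (Req_dec s 0) as [->|N]; [split; lra|].
  assert (0 < s) by lra. split.
  - replace (((1 - s) * Re (x * c)%C + s * Re (y * c)%C) * sin beta - ((1 - s) * Im (x * c)%C + s * Im (y * c)%C) * cos beta)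
     with ((1 - s) * (Re (x * c)%C * sin beta - Im (x * c)%C * cos beta) + s * (Re (y * c)%C * sin beta - Im (y * c)%C * cos beta)) by ring.
    apply Rplus_le_lt_0_compat; [apply Rmult_le_pos; lra|apply Rmult_lt_0_compat; lra].
  - replace (((1 - s) * Re (x * c)%C + s * Re (y * c)%C) * sin beta + ((1 - s) * Im (x * c)%C + s * Im (y * c)%C) * cos beta)
     with ((1 - s) * (Re (x * c)%C * sin beta + Im (x * c)%C * cos beta) + s * (Re (y * c)%C * sin beta + Im (y * c)%C * cos beta)) by ring.
    apply Rplus_le_lt_0_compat; [apply Rmult_le_pos; lra|apply Rmult_lt_0_compat; lra].
Qed.

Lemma linear_form_lt (a b : R) (z w : C) : Rabs a <= 1 -> Rabs b <= 1 ->
  Rabs ((Re w * a + Im w * b) - (Re z * a + Im z * b)) <= 2 * Cmod (w - z).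
Proof.
  intros Ha Hb.
  replace ((Re w * a + Im w * b) - (Re z * a + Im z * b)) with (Re (w - z)%C * a + Im (w - z)%C * b) by (simpl; unfold Re, Im; ring).
  eapply Rle_trans; [apply Rabs_triang|]. rewrite !Rabs_mult.
  pose proof (re_le_Cmod (w - z)). pose proof (im_le_Cmod (w - z)).
  pose proof (Rabs_pos (Re (w - z)%C)). pose proof (Rabs_pos (Im (w - z)%C)). pose proof (Rabs_pos a). pose proof (Rabs_pos b). nra.
Qed.

Lemma Rabs_cos (x : R) : Rabs (cos x) <= 1.
Proof. apply Rabs_le. pose proof (COS_bound x). lra. Qed.

Lemma Rabs_sin (x : R) : Rabs (sin x) <= 1.
Proof. apply Rabs_le. pose proof (SIN_bound x). lra. Qed.

Lemma half_plane_open (a b : R) (c : C) : Rabs a <= 1 -> Rabs b <= 1 -> Cmod c = 1 ->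
  copen (fun z => 0 < Re (z * c)%C * a + Im (z * c)%C * b).
Proof.
  intros Ha Hb Hc z Hz. exists ((Re (z * c)%C * a + Im (z * c)%C * b) / 2). split; [lra|]. intros w Hw.
  pose proof (linear_form_lt a b (z * c)%C (w * c)%C Ha Hb) as L.
  replace (w * c - z * c)%C with ((w - z) * c)%C in L by ring. rewrite Cmod_mult, Hc, Rmult_1_r in L.
  apply Rabs_le_between in L. lra.
Qed.

Lemma copen_and (X Y : C -> Prop) : copen X -> copen Y -> copen (fun z => X z /\ Y z).
Proof.
  intros HX HY z [Hx Hy]. destruct (HX z Hx) as [r [Hr Hr']]. destruct (HY z Hy) as [s [Hs Hs']].
  exists (Rmin r s). split; [apply Rmin_pos; assumption|]. intros w Hw.
  split; [apply Hr'|apply Hs']; (eapply Rlt_le_trans; [exact Hw|]); [apply Rmin_l|apply Rmin_r].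
Qed.

Lemma cone_open (beta : R) (c : C) : Cmod c = 1 -> copen (fun z => cone beta (z * c)%C).
Proof.
  intros Hc. unfold cone. apply copen_and.
  - intros z Hz. destruct (half_plane_open (sin beta) (- cos beta) c (Rabs_sin _) ltac:(rewrite Rabs_Ropp; apply Rabs_cos) Hc z ltac:(lra)) as [r [Hr Hr']].
    exists r. split; [exact Hr|]. intros w Hw. specialize (Hr' w Hw). cbv beta in Hr'. lra.
  - apply half_plane_open; [apply Rabs_sin|apply Rabs_cos|exact Hc].
Qed.

Lemma Re_polar (r t : R) : Re (RtoC r * cis t)%C = r * cos t.
Proof. apply Re_scal. Qed.

Lemma Im_polar (r t : R) : Im (RtoC r * cis t)%C = r * sin t.
Proof. apply Im_scal. Qed.

Lemma cone_polar (beta r t : R) :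
  cone beta (RtoC r * cis t)%C <-> 0 < r * sin (beta - t) /\ 0 < r * sin (beta + t).
Proof.
  unfold cone. rewrite Re_polar, Im_polar, sin_minus, sin_plus.
  split; intros [H1 H2]; split; nra.
Qed.

Lemma polar_right (z : C) : 0 < Re z -> exists r t, 0 < r /\ - (PI / 2) < t < PI / 2 /\ z = (RtoC r * cis t)%C.
Proof.
  destruct z as [x y]. simpl. intros Hx.
  exists (sqrt (x * x + y * y)), (atan (y / x)).
  assert (Hp : 0 < x * x + y * y) by nra.
  assert (Hq : 0 < sqrt (x * x + y * y)) by (apply sqrt_lt_R0, Hp).
  split; [exact Hq|]. split; [pose proof (atan_bound (y / x)); lra|].
  assert (E : sqrt (1 + (y / x)²) = sqrt (x * x + y * y) / x).
  { replace (1 + (y / x)²) with ((x * x + y * y) / (x * x)) by (unfold Rsqr; field; lra).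
    rewrite sqrt_div_alt by nra. rewrite sqrt_square by lra. reflexivity. }
  unfold cis. rewrite cos_atan, sin_atan, E. unfold Cmult, RtoC; simpl.
  f_equal; field; lra.
Qed.

(** A square root lies, up to sign, in the right half-plane or on the imaginary axis, where the
    polar form is explicit; squaring doubles the angle and removes the sign. *)
Lemma polar_ex (z : C) : z <> 0 -> exists r t, 0 < r /\ z = (RtoC r * cis t)%C.
Proof.
  intros Hz. destruct (C_sqrt_ex z) as [w Hw].
  assert (Hw0 : w <> 0) by (intros ->; apply Hz; rewrite <- Hw; ring).
  assert (HP : forall w : C, w <> 0 -> exists r t, 0 < r /\ (w = (RtoC r * cis t)%C \/ w = (- (RtoC r * cis t))%C)).
  { clear. intros [x y] Hw. destruct (Rtotal_order 0 x) as [H|[H|H]].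
    - destruct (polar_right (x, y) H) as [r [t [Hr [_ E]]]]. exists r, t. split; [exact Hr|left; exact E].
    - subst x. destruct (Rtotal_order 0 y) as [H|[H|H]].
      + exists y, (PI / 2). split; [exact H|left]. unfold cis. rewrite cos_PI2, sin_PI2. unfold Cmult, RtoC; simpl. f_equal; ring.
      + subst y. exfalso. apply Hw. reflexivity.
      + exists (- y), (PI / 2). split; [lra|right]. unfold cis. rewrite cos_PI2, sin_PI2. unfold Cmult, RtoC, Copp; simpl. f_equal; ring.
    - destruct (polar_right (- x, - y)) as [r [t [Hr [_ E]]]]; [simpl; lra|]. exists r, t. split; [exact Hr|right].
      rewrite <- E. unfold Copp; simpl. f_equal; ring. }
  destruct (HP w Hw0) as [r [t [Hr E]]]. exists (r * r), (t + t). split; [nra|].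
  rewrite <- Hw, cis_plus, RtoC_mult. destruct E as [-> | ->]; ring.
Qed.

Lemma cone_polar_ex (beta : R) (z : C) : 0 < beta < PI / 2 -> cone beta z ->
  exists r t, 0 < r /\ - beta < t < beta /\ z = (RtoC r * cis t)%C.
Proof.
  intros Hb Hz. assert (Hs : 0 < sin beta) by (apply sin_gt_0; pose proof PI_RGT_0; lra).
  assert (Hr : 0 < Re z) by (destruct Hz; nra).
  destruct (polar_right z Hr) as [r [t [Hr0 [Ht E]]]]. exists r, t. split; [exact Hr0|]. split; [|exact E].
  subst z. apply cone_polar in Hz. destruct Hz as [H1 H2]. pose proof PI_RGT_0 as HPI. split.
  - apply Rnot_le_lt. intros L. assert (0 <= sin (- (beta + t))) by (apply sin_ge_0; lra). rewrite sin_neg in H. nra.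
  - apply Rnot_le_lt. intros L. assert (0 <= sin (- (beta - t))) by (apply sin_ge_0; lra). rewrite sin_neg in H. nra.
Qed.

Lemma polar_cone (beta r t : R) : 0 < beta < PI / 2 -> 0 < r -> - beta < t < beta -> cone beta (RtoC r * cis t)%C.
Proof.
  intros Hb Hr Ht. pose proof PI_RGT_0 as HPI. apply cone_polar.
  split; apply Rmult_lt_0_compat; try exact Hr; apply sin_gt_0; lra.
Qed.

Lemma cis_opp_r (a : R) : (cis a * cis (- a))%C = 1.
Proof. rewrite <- cis_plus, Rplus_opp_r. apply cis_0. Qed.

Lemma cis_cancel (z : C) (a : R) : (z * cis (- a) * cis a)%C = z.
Proof. transitivity (z * (cis a * cis (- a)))%C; [ring|]. rewrite cis_opp_r. ring. Qed.

Lemma connected_union {T : UniformSpace} (X Y : T -> Prop) (x0 : T) :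
  connected X -> connected Y -> X x0 -> Y x0 -> connected (fun x => X x \/ Y x).
Proof.
  intros HX HY X0 Y0 A B HA HB Hcov [a [Ha Aa]] [b [Hb Bb]].
  destruct (Hcov x0 (or_introl X0)) as [A0|B0].
  - destruct Hb as [Hb|Hb].
    + destruct (HX A B HA HB) as [x [Hx1 Hx2]]; [intros x Hx; apply Hcov; auto|exists x0; auto|exists b; auto|].
      exists x. auto.
    + destruct (HY A B HA HB) as [x [Hx1 Hx2]]; [intros x Hx; apply Hcov; auto|exists x0; auto|exists b; auto|].
      exists x. auto.
  - destruct Ha as [Ha|Ha].
    + destruct (HX A B HA HB) as [x [Hx1 Hx2]]; [intros x Hx; apply Hcov; auto|exists a; auto|exists x0; auto|].
      exists x. auto.
    + destruct (HY A B HA HB) as [x [Hx1 Hx2]]; [intros x Hx; apply Hcov; auto|exists a; auto|exists x0; auto|].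
      exists x. auto.
Qed.

Lemma copen_open (D : C -> Prop) : copen D <-> open (T := C_UniformSpace) D.
Proof. symmetry. apply open_C_disc. Qed.

(** The open cone of half-angle PI / 5 about the middle phase th is connected, avoids the graph and
    has its edges in it. Maximality of the component gives one inclusion, connectedness the
    other. *)
Theorem stokes_sector_cone (alpha : R) (V : C -> Prop) : stokes_sector alpha V ->
  exists th, cis (5 * th) = (- cis (2 * alpha))%C /\ forall tau, V tau <-> cone (PI / 5) (tau * cis (- th))%C.
Proof.
  intros [[tau0 H0] [Vc [Vsub Vmax]]]. pose proof PI_RGT_0 as HPI.
  pose proof (Vsub _ H0) as N0.
  assert (T0 : (tau0 : C) <> RtoC 0).
  (* Rays include r = 0, so the origin lies on the graph. *)
  { intros ->. apply N0. exists (2 * alpha / 5). split; [exists 0%Z; simpl; field|]. exists 0. split; [lra|ring]. }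
  destruct (polar_ex tau0 T0) as [r0 [t0 [Hr0 E0]]].
  destruct (archimed ((5 * t0 - 2 * alpha) / (2 * PI))) as [A1 A2].
  set (k := (up ((5 * t0 - 2 * alpha) / (2 * PI)) - 1)%Z).
  assert (Hk : IZR k = IZR (up ((5 * t0 - 2 * alpha) / (2 * PI))) - 1) by (unfold k; rewrite minus_IZR; reflexivity).
  set (x := (5 * t0 - 2 * alpha) / (2 * PI)) in *.
  assert (Hx : 5 * t0 - 2 * alpha = 2 * PI * x) by (unfold x; field; lra).
  assert (Hkx : IZR k < x < IZR k + 1).
  { split; [|lra]. apply Rnot_le_lt. intros L. apply N0. exists t0. split.
    - exists k. rewrite Hx. f_equal. lra.
    - exists r0. split; [lra|exact E0]. }
  (* The midpoint of the two consecutive Stokes phases that enclose the phase of tau0. *)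
  set (th := (2 * alpha + 2 * PI * IZR k + PI) / 5).
  exists th.
  assert (c2k : forall k : Z, cis (2 * PI * IZR k) = 1).
  { assert (N : forall n : nat, cis (2 * PI * INR n) = 1).
    { intros n. rewrite (Rmult_comm (2 * PI)), <- cis_pow, cis_2PI. apply Cpow_1_l. }
    intros z. destruct (Z_le_gt_dec 0 z) as [L|L].
    - rewrite <- (Z2Nat.id z L), <- INR_IZR_INZ. apply N.
    - replace (2 * PI * IZR z) with (- (2 * PI * INR (Z.to_nat (- z)))).
      + rewrite cis_opp, N. rewrite <- RtoC_inv by lra. f_equal. field.
      + rewrite INR_IZR_INZ, Z2Nat.id by lia. rewrite opp_IZR. ring. }
  assert (cPI : cis PI = (- (1))%C) by (unfold cis; rewrite cos_PI, sin_PI; apply injective_projections; simpl; ring).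
  assert (H5 : cis (5 * th) = (- cis (2 * alpha))%C).
  { replace (5 * th) with (2 * alpha + 2 * PI * IZR k + PI) by (unfold th; field). rewrite !cis_plus, c2k, cPI. ring. }
  split; [exact H5|].
  set (Sg := fun tau : C => cone (PI / 5) (tau * cis (- th))%C).
  assert (Hb : 0 < PI / 5 < PI / 2) by lra.
  assert (S0 : Sg tau0).
  { unfold Sg. rewrite E0, <- Cmult_assoc, <- cis_plus. apply polar_cone; [exact Hb|exact Hr0|].
    unfold th. split; nra. }
  assert (Sc : connected (T := C_UniformSpace) Sg) by (apply convex_connected, cone_convex).
  assert (Ssub : forall tau, Sg tau -> ~ stokes_graph alpha tau).
  { intros tau Ht [theta [[k' Hk'] [r [Hr E]]]]. unfold Sg in Ht.
    destruct (cone_polar_ex (PI / 5) _ Hb Ht) as [rho [phi [Hrho [Hphi Ep]]]].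
    assert (E1 : tau = (RtoC rho * cis (phi + th))%C).
    { rewrite cis_plus, Cmult_assoc, <- Ep, cis_cancel. reflexivity. }
    assert (Er : r = rho).
    { apply (f_equal Cmod) in E1. rewrite E, !Cmod_scal, !Cmod_cis in E1 by lra. lra. }
    subst r. rewrite E in E1.
    assert (E2 : cis theta = cis (phi + th)).
    { assert (Hn : RtoC rho <> 0) by (apply RtoC_neq_0; lra).
      transitivity (/ RtoC rho * (RtoC rho * cis theta))%C; [field; exact Hn|]. rewrite E1. field. exact Hn. }
    assert (E3 : cis (5 * theta) = cis (5 * (phi + th))).
    { replace 5 with (INR 5) by (simpl; lra). rewrite <- !cis_pow, E2. reflexivity. }
    replace (5 * theta) with (2 * alpha + 2 * PI * IZR k') in E3 by lra.
    rewrite Rmult_plus_distr_l, !cis_plus, c2k, H5 in E3.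
    (* A Stokes line through the cone would require this, but |5 phi| < PI there and the cosine
       exceeds -1. *)
    assert (E4 : cis (5 * phi) = (- (1))%C).
    { transitivity (- (cis (5 * phi) * - cis (2 * alpha)) * / cis (2 * alpha))%C; [field; apply cis_neq_0|].
      rewrite <- E3. field. apply cis_neq_0. }
    injection E4. intros _ Ec.
    assert (P : cos (Rabs (5 * phi)) > cos PI).
    { assert (Q : Rabs (5 * phi) < PI) by (apply Rabs_def1; lra).
      apply cos_decreasing_1; [apply Rabs_pos|lra|lra|lra|exact Q]. }
    rewrite cos_PI in P. unfold Rabs in P. destruct (Rcase_abs (5 * phi)); [rewrite cos_neg in P|]; lra. }
  intros tau. split.
  - intros Vt. apply NNPP. intros Nt.
    set (L1 := fun z : C => Re (z * cis (- th))%C * sin (PI / 5) + Im (z * cis (- th))%C * - cos (PI / 5)).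
    set (L2 := fun z : C => Re (z * cis (- th))%C * sin (PI / 5) + Im (z * cis (- th))%C * cos (PI / 5)).
    assert (Hgr : forall z, Sg z \/ (0 < - L1 z \/ 0 < - L2 z) \/ stokes_graph alpha z).
    { intros z. destruct (classic (Sg z)) as [S|S]; [left; exact S|right].
      destruct (Rlt_le_dec (L1 z) 0) as [Q1|Q1]; [left; left; lra|].
      destruct (Rlt_le_dec (L2 z) 0) as [Q2|Q2]; [left; right; lra|]. right.
      assert (Hs : 0 < sin (PI / 5)) by (apply sin_gt_0; lra).
      assert (Hc : 0 < cos (PI / 5)) by (apply cos_gt_0; lra).
      set (a := Re (z * cis (- th))%C) in *. set (b := Im (z * cis (- th))%C) in *.
      assert (Hz : z = ((a, b) * cis th)%C).
      { replace ((a, b) : C) with (z * cis (- th))%C by (unfold a, b, Re, Im; destruct (z * cis (- th))%C; reflexivity).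
        symmetry. apply cis_cancel. }
      destruct (Rle_lt_or_eq_dec _ _ Q1) as [P1|P1]; [destruct (Rle_lt_or_eq_dec _ _ Q2) as [P2|P2]|].
      - exfalso. apply S. unfold Sg, cone. fold a. fold b. unfold L1, L2 in P1, P2. fold a b in P1, P2. split; lra.
      - exists (th - PI / 5). split; [exists k; unfold th; field|].
        unfold L2 in P2. unfold L1 in Q1. fold a b in P2, Q1.
        exists (a / cos (PI / 5)). split; [apply Rdiv_le_0_compat; nra|].
        replace (th - PI / 5) with (- (PI / 5) + th) by ring. rewrite cis_plus, Hz, Cmult_assoc. f_equal.
        unfold cis. rewrite cos_neg, sin_neg. unfold Cmult, RtoC; simpl. f_equal; [field; lra|].
        apply (Rmult_eq_reg_r (cos (PI / 5))); [|lra]. field_simplify; [|lra]. lra.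
      - exists (th + PI / 5). split; [exists (k + 1)%Z; rewrite plus_IZR; unfold th; field|].
        unfold L2 in Q2. unfold L1 in P1. fold a b in P1, Q2.
        exists (a / cos (PI / 5)). split; [apply Rdiv_le_0_compat; nra|].
        replace (th + PI / 5) with (PI / 5 + th) by ring. rewrite cis_plus, Hz, Cmult_assoc. f_equal.
        unfold cis. unfold Cmult, RtoC; simpl. f_equal; [field; lra|].
        apply (Rmult_eq_reg_r (cos (PI / 5))); [|lra]. field_simplify; [|lra]. lra. }
    (* Otherwise V would be separated by the open cone and the open exterior of its closure; the
       edges in between belong to the graph. *)
    destruct (Vc Sg (fun z => 0 < - L1 z \/ 0 < - L2 z)) as [z [Vz [Sz Bz]]].
    + apply copen_open, cone_open, Cmod_cis.
    + apply copen_open. intros z [Hz|Hz].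
      * destruct (half_plane_open (- sin (PI/5)) (cos (PI/5)) (cis (- th)) ltac:(rewrite Rabs_Ropp; apply Rabs_sin) (Rabs_cos _) (Cmod_cis _) z) as [r [Hr Hr']].
        { unfold L1 in Hz. lra. }
        exists r. split; [exact Hr|]. intros w Hw. specialize (Hr' w Hw). left. unfold L1. cbv beta in Hr'. lra.
      * destruct (half_plane_open (- sin (PI/5)) (- cos (PI/5)) (cis (- th)) ltac:(rewrite Rabs_Ropp; apply Rabs_sin) ltac:(rewrite Rabs_Ropp; apply Rabs_cos) (Cmod_cis _) z) as [r [Hr Hr']].
        { unfold L2 in Hz. lra. }
        exists r. split; [exact Hr|]. intros w Hw. specialize (Hr' w Hw). right. unfold L2. cbv beta in Hr'. lra.
    + intros z Vz. destruct (Hgr z) as [S|[S|S]]; [left; exact S|right; exact S|exfalso; exact (Vsub z Vz S)].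
    + exists tau0. auto.
    + exists tau. split; [exact Vt|]. destruct (Hgr tau) as [S|[S|S]]; [contradiction|exact S|exfalso; exact (Vsub tau Vt S)].
    + unfold Sg, cone in Sz. unfold L1, L2 in Bz. lra.
  - intros St. apply (Vmax (fun z => V z \/ Sg z)).
    + apply (connected_union V Sg tau0); assumption.
    + intros z [Hz|Hz]; [apply Vsub, Hz|apply Ssub, Hz].
    + intros z Hz. left. exact Hz.
    + right. exact St.
Qed.

(** Since - t = 6 tau^2, phases double and U is the cone of half-angle 2 PI / 5 about 2 th in the
    variable - t. This is below PI / 2, so U is still convex. *)
Lemma t_projection_cone (V : C -> Prop) (th : R) :
  (forall tau, V tau <-> cone (PI / 5) (tau * cis (- th))%C) ->
  forall t, t_projection V t <-> cone (2 * PI / 5) (- t * cis (- (2 * th)))%C.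
Proof.
  intros HV t. pose proof PI_RGT_0 as HPI. split.
  - intros [tau [Vt ->]]. apply HV in Vt.
    destruct (cone_polar_ex (PI / 5) _ ltac:(lra) Vt) as [r [phi [Hr [Hphi E]]]].
    replace (- tau_to_t tau * cis (- (2 * th)))%C with (RtoC (6 * (r * r)) * cis (2 * phi))%C.
    + apply polar_cone; [lra|nra|lra].
    + replace (- (2 * th)) with (- th + - th) by ring. replace (2 * phi) with (phi + phi) by ring.
      rewrite !cis_plus, !RtoC_mult. unfold tau_to_t.
      replace (RtoC (-6)) with (- (6))%C by (rewrite <- RtoC_opp; reflexivity).
      transitivity (6 * ((RtoC r * cis phi) * (RtoC r * cis phi)))%C; [ring|]. rewrite <- E. ring.
  - intros Ht. destruct (cone_polar_ex (2 * PI / 5) _ ltac:(lra) Ht) as [r [phi [Hr [Hphi E]]]].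
    set (rho := sqrt (r / 6)). assert (Hrho : rho * rho = r / 6) by (apply sqrt_sqrt; lra).
    assert (Hrho0 : 0 < rho) by (apply sqrt_lt_R0; lra).
    exists (RtoC rho * cis (phi / 2 + th))%C. split.
    + apply HV. rewrite <- Cmult_assoc, <- cis_plus. apply polar_cone; [lra|exact Hrho0|].
      replace (phi / 2 + th + - th) with (phi / 2) by ring. lra.
    + unfold tau_to_t. replace (RtoC (-6)) with (- (6))%C by (rewrite <- RtoC_opp; reflexivity).
      transitivity (- (RtoC (6 * (rho * rho)) * (cis (phi / 2 + th) * cis (phi / 2 + th))))%C.
      * rewrite Hrho. replace (6 * (r / 6)) with r by field. rewrite <- cis_plus.
        replace (phi / 2 + th + (phi / 2 + th)) with (phi + 2 * th) by field. rewrite cis_plus, Cmult_assoc, <- E.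
        rewrite cis_cancel. ring.
      * rewrite !RtoC_mult. ring.
Qed.

(** * The distinguished branch *)

(** From f x - f z = (w x - w z) / (f x + f z): the positive real parts keep the denominator away
    from 0. Thus a pointwise choice of root is continuous and then differentiable. *)
Lemma sqrt_branch_holo (D : C -> Prop) (f w : C -> C) (z : C) : copen D -> D z ->
  (forall x, D x -> (f x * f x)%C = w x /\ 0 < Re (f x)) -> holo_at w z -> holo_at f z.
Proof.
  intros HD Hz H [l Hl]. destruct (H z Hz) as [Hfz Hp]. set (p := Re (f z)) in *.
  assert (Hsum : forall x, D x -> p <= Cmod (f x + f z)).
  { intros x Hx. destruct (H x Hx) as [_ Hx']. eapply Rle_trans; [|apply Re_le_Cmod].
    change (Re (f x + f z)%C) with (Re (f x) + Re (f z)). fold p. lra. }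
  assert (Hn : forall x, D x -> (f x + f z)%C <> 0) by (intros x Hx; apply Cmod_gt_0; specialize (Hsum x Hx); lra).
  assert (Hdiff : forall x, D x -> (f x - f z)%C = ((w x - w z) / (f x + f z))%C).
  { intros x Hx. rewrite <- (proj1 (H x Hx)), <- Hfz. field. apply Hn, Hx. }
  assert (Hc : cont_at f z).
  { intros e He. destruct (cder_cont _ _ _ Hl (e * p) ltac:(nra)) as [d [Hd Hd']].
    destruct (HD z Hz) as [r [Hr Hr']].
    exists (Rmin d r). split; [apply Rmin_pos; assumption|]. intros x Hx.
    assert (Dx : D x) by (apply Hr'; eapply Rlt_le_trans; [exact Hx|apply Rmin_r]).
    specialize (Hd' x ltac:(eapply Rlt_le_trans; [exact Hx|apply Rmin_l])).
    rewrite (Hdiff x Dx), Cmod_div by (apply Hn, Dx). specialize (Hsum x Dx).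
    apply Rlt_div_l; [lra|]. eapply Rlt_le_trans; [exact Hd'|]. apply Rmult_le_compat_l; lra. }
  assert (Hn2 : (2 * f z)%C <> 0).
  { replace (2 * f z)%C with (f z + f z)%C by ring. apply Hn, Hz. }
  exists (l / (2 * f z))%C. intros e He.
  pose proof (Cmod_ge_0 l) as Hl0.
  destruct (HD z Hz) as [r [Hr Hr']].
  destruct (Hl (e * p / 2) ltac:(nra)) as [d1 [Hd1 H1]].
  destruct (Hc (e * (p * p) / (Cmod l + 1)) ltac:(apply Rdiv_lt_0_compat; [repeat apply Rmult_lt_0_compat; lra|lra])) as [d2 [Hd2 H2]].
  exists (Rmin r (Rmin d1 d2)). split; [repeat apply Rmin_pos; assumption|]. intros x Hx.
  assert (Dx : D x) by (apply Hr'; eapply Rlt_le_trans; [exact Hx|apply Rmin_l]).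
  assert (Hx2 : Cmod (x - z) < Rmin d1 d2) by (eapply Rlt_le_trans; [exact Hx|apply Rmin_r]).
  specialize (H1 x ltac:(eapply Rlt_le_trans; [exact Hx2|apply Rmin_l])).
  specialize (H2 x ltac:(eapply Rlt_le_trans; [exact Hx2|apply Rmin_r])).
  pose proof (Hsum x Dx) as S1. pose proof (Hsum z Hz) as S2.
  assert (S2' : 2 * p <= Cmod (2 * f z)).
  { rewrite Cmod_mult, Cmod_R, Rabs_right by lra. pose proof (Re_le_Cmod (f z)) as HR. fold p in HR. lra. }
  rewrite (Hdiff x Dx).
  replace ((w x - w z) / (f x + f z) - l / (2 * f z) * (x - z))%C
    with ((w x - w z - l * (x - z)) / (f x + f z) - l * (x - z) * (f x - f z) / ((f x + f z) * (2 * f z)))%C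
    by (field; split; first [apply (Hn x Dx)|intros E0; apply Hn2; rewrite E0; ring]).
  pose proof (Cmod_ge_0 (x - z)) as Hy. set (y := Cmod (x - z)) in *.
  eapply Rle_trans; [apply Cmod_triangle_sub|].
  rewrite !Cmod_div by (try apply Cmod_gt_0; try (rewrite Cmod_mult; apply Rmult_lt_0_compat); try (apply Hn, Dx); lra).
  rewrite !Cmod_mult. rewrite <- (Cmod_mult 2 (f z)). fold y.
  assert (T1 : Cmod (w x - w z - l * (x - z)) / Cmod (f x + f z) <= e / 2 * y).
  { apply Rle_div_l; [lra|]. eapply Rle_trans; [exact H1|].
    replace (e * p / 2 * y) with (e / 2 * y * p) by field. apply Rmult_le_compat_l; [|exact S1]. apply Rmult_le_pos; lra. }
  assert (T2 : Cmod l * y * Cmod (f x - f z) / (Cmod (f x + f z) * Cmod (2 * f z)) <= e / 2 * y).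
  { apply Rle_div_l; [apply Rmult_lt_0_compat; lra|].
    apply Rle_trans with (e / 2 * y * (p * (2 * p))).
    - apply Rle_trans with ((Cmod l + 1) * y * (e * (p * p) / (Cmod l + 1))).
      + apply Rmult_le_compat; [apply Rmult_le_pos; lra|apply Cmod_ge_0| |lra]. apply Rmult_le_compat_r; lra.
      + right. field. lra.
    - apply Rmult_le_compat_l; [apply Rmult_le_pos; lra|]. apply Rmult_le_compat; lra. }
  lra.
Qed.

(** The number e^(-i alpha) v rescales xi to the variable of b, so the ray xi = r e^(i alpha)
    becomes r v. The condition Re v > 0 says that it runs into the right half-plane. *)
Definition branch_data (alpha : R) (U : C -> Prop) (q : nat -> C -> C) (v : C -> C) : Prop :=
  copen U /\ convexC U /\ (exists t, U t) /\
  forall t, U t -> 0 < Re (v t) /\ holo_at v t /\ holo_at (q 0%nat) t /\ q 0%nat t <> 0 /\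
    (forall k, q (S k) t = (q 0%nat t * (cis (- alpha) * v t) ^ (S k) * bd k)%C).

Lemma cis_scaled_cone (th : R) (U : C -> Prop) :
  (forall t, U t <-> cone (2 * PI / 5) (- t * cis (- (2 * th)))%C) -> copen U /\ convexC U.
Proof.
  intros H.
  assert (E : forall t, (- t * cis (- (2 * th)))%C = (t * - cis (- (2 * th)))%C) by (intros; ring).
  split.
  - intros z Hz. apply H in Hz. rewrite E in Hz.
    destruct (cone_open (2 * PI / 5) (- cis (- (2 * th)))%C ltac:(rewrite Cmod_opp; apply Cmod_cis) z Hz) as [r [Hr Hr']].
    exists r. split; [exact Hr|]. intros w Hw. apply H. rewrite E. apply Hr', Hw.
  - intros x y s Hx Hy Hs. apply H. rewrite E. apply (cone_convex (2 * PI / 5) (- cis (- (2 * th)))%C); [| |exact Hs].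
    + rewrite <- E. apply H, Hx.
    + rewrite <- E. apply H, Hy.
Qed.

Lemma Ci_sq : (Ci * Ci)%C = (- (1))%C.
Proof. apply injective_projections; simpl; ring. Qed.

(** On V the phase of q_0 e^(-i th) lies in (-PI/5, PI/5), so its inverse fifth power has phase in
    (-PI, PI) and a square root with positive real part. *)
Theorem branch_exists (alpha th : R) (V : C -> Prop) (q : nat -> C -> C) :
  (exists tau, V tau) ->
  cis (5 * th) = (- cis (2 * alpha))%C -> (forall tau, V tau <-> cone (PI / 5) (tau * cis (- th))%C) ->
  distinguished_branch V q -> exists v, branch_data alpha (t_projection V) q v.
Proof.
  intros [tau0 Htau0] H5 HV [Hform Hdist]. pose proof PI_RGT_0 as HPI.
  set (U := t_projection V).
  destruct (cis_scaled_cone th U (t_projection_cone V th HV)) as [HU Hconv].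
  destruct quad_rec_ex as [d Hd].
  assert (Hq : forall t, U t -> V (q 0%nat t)).
  { intros t [tau [Ht ->]]. rewrite Hdist; assumption. }
  assert (Hex : forall t, exists w : C, U t -> (w * w * (q 0%nat t * cis (- th)) ^ 5)%C = RtoC (25 / 6912) /\ 0 < Re w).
  { intros t. destruct (classic (U t)) as [Ht|Ht]; [|exists (RtoC 0); tauto].
    pose proof (proj1 (HV _) (Hq t Ht)) as Hc.
    destruct (cone_polar_ex (PI / 5) _ ltac:(lra) Hc) as [r [phi [Hr [Hphi E]]]]. rewrite E.
    assert (Hr5 : 0 < r ^ 5) by (apply pow_lt, Hr).
    assert (Hp : 0 < 25 / 6912 / r ^ 5) by (apply Rdiv_lt_0_compat; lra).
    exists (RtoC (sqrt (25 / 6912 / r ^ 5)) * cis (- (5 * phi / 2)))%C. intros _. split.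
    - transitivity (RtoC (sqrt (25 / 6912 / r ^ 5) * sqrt (25 / 6912 / r ^ 5) * r ^ 5) * (cis (- (5 * phi / 2)) * cis (- (5 * phi / 2)) * cis phi ^ 5))%C.
      + rewrite Cpow_mult_l, !RtoC_mult, RtoC_pow. ring.
      + rewrite sqrt_sqrt by lra. rewrite cis_pow, <- !cis_plus.
        replace (- (5 * phi / 2) + - (5 * phi / 2) + INR 5 * phi) with 0 by (simpl; field). rewrite cis_0.
        replace (25 / 6912 / r ^ 5 * r ^ 5) with (25 / 6912) by (field; lra). ring.
    - rewrite Re_polar. apply Rmult_lt_0_compat; [apply sqrt_lt_R0, Hp|]. apply cos_gt_0; lra. }
  set (v := fun t => proj1_sig (constructive_indefinite_description _ (Hex t))).
  assert (Hv : forall t, U t -> (v t * v t * (q 0%nat t * cis (- th)) ^ 5)%C = RtoC (25 / 6912) /\ 0 < Re (v t)).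
  { intros t Ht. unfold v. destruct (constructive_indefinite_description _ (Hex t)) as [w Hw]. exact (Hw Ht). }
  assert (Hq0 : forall t, U t -> q 0%nat t <> 0).
  { intros t Ht E. destruct (Hv t Ht) as [E1 _]. rewrite E in E1.
    assert (E2 : RtoC (25 / 6912) = RtoC 0) by (rewrite <- E1; simpl; ring). apply RtoC_inj in E2. lra. }
  exists v. split; [exact HU|]. split; [exact Hconv|]. split; [exists (tau_to_t tau0), tau0; auto|].
  intros t Ht.
  assert (Hh0 : forall t, U t -> holo_at (q 0%nat) t) by (intros x Hx; apply (formal_holo U q Hform 0 x Hx)).
  assert (Hsig : forall x, U x -> (q 0%nat x * cis (- th))%C <> 0).
  { intros x Hx. apply Cmult_neq_0; [apply Hq0, Hx|apply cis_neq_0]. }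
  split; [apply Hv, Ht|]. split; [|split; [apply Hh0, Ht|split; [apply Hq0, Ht|]]].
  - apply (sqrt_branch_holo U v (fun x => RtoC (25 / 6912) * / (q 0%nat x * cis (- th)) ^ 5)%C); [exact HU|exact Ht| |].
    + intros x Hx. destruct (Hv x Hx) as [E1 E2]. split; [|exact E2]. rewrite <- E1. field. split; [apply cis_neq_0|apply Hq0, Hx].
    + destruct (Hh0 t Ht) as [l Hl]. eexists. apply cder_scal. apply (cder_inv (fun x => (q 0%nat x * cis (- th)) ^ 5)%C).
      * apply Cpow_nz, Hsig, Ht.
      * apply (cder_pow (fun x => q 0%nat x * cis (- th))%C). apply cder_mult; [exact Hl|apply cder_const].
  - intros k.
    (* The square of -i compensates the sign in cis (5 th) = - cis (2 alpha). *)
    set (Y := (- Ci * (cis (- alpha) * v t))%C).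
    assert (HY : (Y * Y * q 0%nat t ^ 5)%C = RtoC (25 / 6912)).
    { rewrite <- (proj1 (Hv t Ht)). unfold Y.
      assert (Ea : (cis (- alpha) * cis (- alpha))%C = (/ cis (2 * alpha))%C).
      { rewrite <- cis_plus, <- cis_opp. f_equal. ring. }
      assert (E5 : (cis (- th) ^ 5)%C = (/ cis (5 * th))%C).
      { rewrite cis_pow, <- cis_opp. f_equal. simpl. ring. }
      rewrite (Cpow_mult_l (q 0%nat t)), E5, H5.
      transitivity (Ci * Ci * (cis (- alpha) * cis (- alpha)) * (v t * v t) * q 0%nat t ^ 5)%C; [ring|].
      rewrite Ea, Ci_sq. field. apply cis_neq_0. }
    rewrite (formal_coeffs U q HU Hform Hq0 d Hd (S k) t Y Ht HY).
    rewrite (borel_fun_taylor d Hd k). unfold Y. rewrite (Cpow_mult_l (- Ci)). ring.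
Qed.

(** * Stable Borel summability *)

Lemma Rabs_sin_le (x : R) : Rabs (sin x) <= Rabs x.
Proof.
  assert (P : forall y, 0 < y -> sin y <= y) by (intros y Hy; apply Rlt_le, sin_lt_x, Hy).
  assert (Q : forall y, 0 < y -> Rabs (sin y) <= y).
  { intros y Hy. pose proof PI_RGT_0. pose proof PI2_1.
    destruct (Rle_lt_dec y (PI / 2)) as [L|L].
    - rewrite Rabs_right; [apply P, Hy|]. apply Rle_ge, sin_ge_0; lra.
    - pose proof (Rabs_sin y). lra. }
  destruct (Rtotal_order 0 x) as [H|[<-|H]].
  - rewrite (Rabs_right x) by lra. apply Q, H.
  - rewrite sin_0, Rabs_R0. lra.
  - rewrite (Rabs_left x) by lra. rewrite <- Rabs_Ropp, <- sin_neg. apply Q. lra.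
Qed.

Lemma cos_ge_half (x : R) : Rabs x <= 1 -> 1 / 2 <= cos x.
Proof.
  intros Hx. replace x with (2 * (x / 2)) by field. rewrite cos_2a_sin.
  pose proof (Rabs_sin_le (x / 2)) as S. assert (Hy : Rabs (x / 2) <= 1 / 2).
  { unfold Rdiv. rewrite Rabs_mult, (Rabs_right (/ 2)) by lra. lra. }
  assert (S2 : sin (x / 2) * sin (x / 2) <= 1 / 4).
  { pose proof (Rabs_pos (sin (x / 2))). rewrite <- (Rabs_pos_eq (sin (x/2) * sin (x/2))) by nra. rewrite Rabs_mult. nra. }
  lra.
Qed.

(** An open angle about the ray of phase alpha with its apex moved back by a, so that it contains 0
    and all rays of nearby phase: one D for all beta and all t near t0. *)
Definition ray_nbhd (alpha M a : R) (xi : C) : Prop :=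
  M * Rabs (Im (xi * cis (- alpha))%C) < Re (xi * cis (- alpha))%C + a.

Lemma ray_nbhd_open (alpha M a : R) : 0 < M -> copen (ray_nbhd alpha M a).
Proof.
  intros HM z Hz. unfold ray_nbhd in *. set (c := cis (- alpha)) in *.
  exists ((Re (z * c)%C + a - M * Rabs (Im (z * c)%C)) / (1 + M)). split; [apply Rdiv_lt_0_compat; lra|].
  intros w Hw. apply Rlt_div_r in Hw; [|lra].
  pose proof (re_le_Cmod ((z - w) * c)) as H1. pose proof (im_le_Cmod ((w - z) * c)) as H2.
  rewrite Cmod_mult in H1, H2. unfold c in H1 at 2. unfold c in H2 at 2. rewrite Cmod_cis, Rmult_1_r in H1, H2.
  rewrite Cmod_sub_sym in H1.
  replace (Re ((z - w) * c)%C) with (Re (z * c)%C - Re (w * c)%C) in H1 by (simpl; unfold Re, Im; ring).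
  replace (Im ((w - z) * c)%C) with (Im (w * c)%C - Im (z * c)%C) in H2 by (simpl; unfold Re, Im; ring).
  pose proof (Rle_abs (Re (z * c)%C - Re (w * c)%C)).
  pose proof (Rabs_triang (Im (w * c)%C - Im (z * c)%C) (Im (z * c)%C)) as T.
  replace (Im (w * c)%C - Im (z * c)%C + Im (z * c)%C) with (Im (w * c)%C) in T by ring. nra.
Qed.

Lemma ray_nbhd_ray (alpha beta M a : R) (xi : C) : 0 < M -> 0 < a ->
  Rabs (beta - alpha) < Rmin 1 (1 / (2 * M)) -> ray beta xi -> ray_nbhd alpha M a xi.
Proof.
  intros HM Ha Hb [r [Hr ->]]. unfold ray_nbhd. rewrite <- Cmult_assoc, <- cis_plus, Re_polar, Im_polar.
  replace (beta + - alpha) with (beta - alpha) by ring. set (x := beta - alpha) in *.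
  assert (H1 : Rabs x < 1) by (eapply Rlt_le_trans; [exact Hb|apply Rmin_l]).
  assert (H2 : Rabs x < 1 / (2 * M)) by (eapply Rlt_le_trans; [exact Hb|apply Rmin_r]).
  pose proof (cos_ge_half x ltac:(lra)) as Hc. pose proof (Rabs_sin_le x) as Hs.
  apply Rlt_div_r in H2; [|lra]. rewrite Rabs_mult, (Rabs_right r) by lra.
  assert (M * Rabs (sin x) <= cos x) by nra. nra.
Qed.

(** Write x + i y for xi e^(-i alpha). The choice m Q = p / 4 keeps m |Im v| below p / 4, M makes
    |y| (1 + m) Q at most (x + a) p / 4, and a keeps the loss behind the origin within the margin m
    / 2. *)
Lemma ray_nbhd_Omega (alpha p Q m M a : R) (v xi : C) : 0 < p -> p <= Q -> m = p / (4 * Q) ->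
  M = 4 * (1 + m) * Q / p -> a = m / (4 * ((1 + m) * Q + p)) ->
  3 / 4 * p <= Re v -> Cmod v <= Q -> ray_nbhd alpha M a xi -> Omega m (xi * cis (- alpha) * v)%C.
Proof.
  intros Hp HQ Hm HM Ha Hv HvQ Hxi. unfold ray_nbhd in Hxi. set (z := (xi * cis (- alpha))%C) in *.
  unfold Omega.
  replace (Re (z * v)%C) with (Re z * Re v - Im z * Im v) by (simpl; unfold Re, Im; ring).
  replace (Im (z * v)%C) with (Re z * Im v + Im z * Re v) by (simpl; unfold Re, Im; ring).
  assert (Hm0 : 0 < m) by (rewrite Hm; apply Rdiv_lt_0_compat; lra).
  assert (HmQ : m * Q = p / 4) by (rewrite Hm; field; lra).
  assert (HMp : M * p = 4 * (1 + m) * Q) by (rewrite HM; field; lra).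
  assert (HM0 : 0 < M) by (rewrite HM; apply Rdiv_lt_0_compat; [nra|lra]).
  assert (HaQ : a * ((1 + m) * Q + p) = m / 4) by (rewrite Ha; field; nra).
  assert (Ha0 : 0 < a) by (rewrite Ha; apply Rdiv_lt_0_compat; nra).
  pose proof (im_le_Cmod v) as Hiv. pose proof (Re_le_Cmod v) as Hrv. pose proof (Rabs_pos (Im v)) as Hiv0.
  set (x := Re z) in *. set (y := Im z) in *. set (r := Re v) in *. set (i := Im v) in *.
  pose proof (Rabs_pos y) as Hy0.
  assert (B1 : y * i <= Rabs y * Q).
  { eapply Rle_trans; [apply Rle_abs|]. rewrite Rabs_mult. apply Rmult_le_compat_l; lra. }
  assert (B2 : Rabs (x * i + y * r) <= Rabs x * Rabs i + Rabs y * Q).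
  { eapply Rle_trans; [apply Rabs_triang|]. rewrite !Rabs_mult, (Rabs_right r) by lra.
    apply Rplus_le_compat_l, Rmult_le_compat_l; lra. }
  assert (B3 : Rabs y * ((1 + m) * Q) <= (x + a) * (p / 4)).
  { replace ((1 + m) * Q) with (M * p / 4) by (rewrite HMp; field). nra. }
  assert (B4 : m * Rabs i <= p / 4) by (rewrite <- HmQ; apply Rmult_le_compat_l; lra).
  assert (B5 : m * Rabs (x * i + y * r) <= Rabs x * (m * Rabs i) + Rabs y * (m * Q)).
  { replace (Rabs x * (m * Rabs i) + Rabs y * (m * Q)) with (m * (Rabs x * Rabs i + Rabs y * Q)) by ring.
    apply Rmult_le_compat_l; lra. }
  assert (B6 : Rabs x * (m * Rabs i) <= Rabs x * (p / 4)) by (apply Rmult_le_compat_l; [apply Rabs_pos|exact B4]).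
  replace (Rabs y * ((1 + m) * Q)) with (Rabs y * Q + Rabs y * (m * Q)) in B3 by ring.
  assert (Hap : a * p <= m / 4) by nra.
  assert (HaQ2 : a * Q <= m / 4) by nra.
  destruct (Rle_lt_dec 0 x) as [L|L].
  - rewrite (Rabs_right x) in * by lra. assert (x * (3 / 4 * p) <= x * r) by (apply Rmult_le_compat_l; lra). assert (0 <= x * p) by (apply Rmult_le_pos; lra). lra.
  - rewrite (Rabs_left x) in * by lra.
    assert (X1 : - x < a) by nra.
    assert (X2 : - x * r <= a * Q) by (apply Rmult_le_compat; lra).
    assert (X3 : - x * (p / 4) <= a * (p / 4)) by (apply Rmult_le_compat_r; lra).
    assert (X4 : (x + a) * (p / 4) <= a * (p / 4)) by (apply Rmult_le_compat_r; lra).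
    lra.
Qed.

Definition borel_branch (alpha : R) (tau v xi : C) : C :=
  (tau * (cis (- alpha) * v) * borel_fun (xi * cis (- alpha) * v))%C.

Record local_data (alpha : R) (U : C -> Prop) (q : nat -> C -> C) (v : C -> C) (t0 : C)
    (N D : C -> Prop) (m Q T delta K0 K1 : R) : Prop := {
  ld_open : copen N;
  ld_in : N t0;
  ld_sub : forall t, N t -> U t;
  ld_m : 0 < m;
  ld_Q : 0 < Q;
  ld_sector : forall t, N t -> in_sector m (v t) /\ Cmod (v t) <= Q /\ Cmod (q 0%nat t) <= T;
  ld_delta : 0 < delta;
  ld_borel : forall beta, Rabs (beta - alpha) < delta -> forall t, N t ->
     borel_continuation q t beta D K0 K1 (borel_branch alpha (q 0%nat t) (v t)) }.

(** Only Re v >= 3 p / 4, |v| <= Q and |q_0| <= T enter the estimates, and continuity provides them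
    near t0; hence the domain and the constants are common to all t and beta. *)
Theorem local_borel (alpha : R) (U : C -> Prop) (q : nat -> C -> C) (v : C -> C) (t0 : C) :
  branch_data alpha U q v -> U t0 ->
  exists N D m Q T delta K0 K1, local_data alpha U q v t0 N D m Q T delta K0 K1.
Proof.
  intros [HU [_ [_ Hb]]] Ht0. destruct (Hb t0 Ht0) as [Hp [Hv [Hq _]]].
  set (p := Re (v t0)) in *. set (Q := Cmod (v t0) + p). set (m := p / (4 * Q)).
  set (M := 4 * (1 + m) * Q / p). set (a := m / (4 * ((1 + m) * Q + p))).
  pose proof (Cmod_ge_0 (v t0)) as Hv0.
  assert (HQ : 0 < Q) by (unfold Q; lra).
  assert (HpQ : p <= Q) by (unfold Q; lra).
  assert (Hm : 0 < m) by (apply Rdiv_lt_0_compat; lra).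
  assert (HM : 0 < M) by (apply Rdiv_lt_0_compat; nra).
  assert (Ha : 0 < a) by (apply Rdiv_lt_0_compat; nra).
  destruct (holo_cont_at _ _ Hv (p / 4) ltac:(lra)) as [d1 [Hd1 Hd1']].
  destruct (holo_cont_at _ _ Hq 1 Rlt_0_1) as [d2 [Hd2 Hd2']].
  destruct (HU t0 Ht0) as [d3 [Hd3 Hd3']].
  set (d := Rmin d1 (Rmin d2 d3)). assert (Hd : 0 < d) by (repeat apply Rmin_pos; assumption).
  set (N := fun t => Cmod (t - t0) < d). set (T := Cmod (q 0%nat t0) + 1).
  assert (HN1 : forall t, N t -> Cmod (t - t0) < d1) by (intros t Ht; eapply Rlt_le_trans; [exact Ht|apply Rmin_l]).
  assert (HN2 : forall t, N t -> Cmod (t - t0) < d2).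
  { intros t Ht; eapply Rlt_le_trans; [exact Ht|]. eapply Rle_trans; [apply Rmin_r|apply Rmin_l]. }
  assert (HN3 : forall t, N t -> U t).
  { intros t Ht. apply Hd3'. eapply Rlt_le_trans; [exact Ht|]. eapply Rle_trans; [apply Rmin_r|apply Rmin_r]. }
  assert (Hvt : forall t, N t -> 3 / 4 * p <= Re (v t) /\ Cmod (v t) <= Q /\ Cmod (q 0%nat t) <= T).
  { intros t Ht. specialize (Hd1' t (HN1 t Ht)). specialize (Hd2' t (HN2 t Ht)). split; [|split].
    - pose proof (re_le_Cmod (v t0 - v t)) as R1. rewrite Cmod_sub_sym in R1.
      change (Re (v t0 - v t)%C) with (p - Re (v t)) in R1. pose proof (Rle_abs (p - Re (v t))). lra.
    - replace (v t) with ((v t - v t0) + v t0)%C by ring. eapply Rle_trans; [apply Cmod_triangle|]. unfold Q. lra.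
    - replace (q 0%nat t) with ((q 0%nat t - q 0%nat t0) + q 0%nat t0)%C by ring. eapply Rle_trans; [apply Cmod_triangle|]. unfold T. lra. }
  destruct (borel_fun_exists m Hm) as [K0 [K1 [HK0 [HK1 [HH [HB _]]]]]].
  exists N, (ray_nbhd alpha M a), m, Q, T, (Rmin 1 (1 / (2 * M))), (T * Q * K0), (K1 * Q).
  assert (HT : 0 < T) by (unfold T; pose proof (Cmod_ge_0 (q 0%nat t0)); lra).
  constructor; try assumption.
  - apply copen_disc.
  - unfold N. rewrite Cmod_sub_self. exact Hd.
  - intros t Ht. destruct (Hvt t Ht) as [V1 [V2 V3]]. split; [|split; assumption].
    unfold in_sector. apply Rle_trans with (m * Q).
    + apply Rmult_le_compat_l; [lra|]. eapply Rle_trans; [apply im_le_Cmod|exact V2].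
    + unfold m. replace (p / (4 * Q) * Q) with (p / 4) by (field; lra). lra.
  - apply Rmin_pos; [lra|apply Rdiv_lt_0_compat; lra].
  - intros beta Hbeta t Ht. destruct (Hvt t Ht) as [V1 [V2 V3]].
    assert (HOm : forall xi, ray_nbhd alpha M a xi -> Omega m (xi * cis (- alpha) * v t)%C).
    { intros xi Hxi. apply (ray_nbhd_Omega alpha p Q m M a); try assumption; reflexivity. }
    split; [|split; [|split; [|split]]].
    + apply copen_open, ray_nbhd_open, HM.
    + intros xi Hxi. apply (ray_nbhd_ray alpha beta); assumption.
    + intros xi Hxi. apply ex_derive_cder. destruct (HH _ (HOm xi Hxi)) as [l Hl].
      eexists. unfold borel_branch. apply cder_scal.
      apply (cder_comp borel_fun (fun xi => xi * cis (- alpha) * v t)%C); [exact Hl|].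
      apply cder_mult; [apply cder_mult; [apply cder_id|apply cder_const]|apply cder_const].
    + destruct (Omega_open m Hm 0 (Omega_0 m Hm)) as [r [Hr Hr']].
      exists (r / Q). split; [apply Rdiv_lt_0_compat; lra|]. intros xi Hxi.
      set (y := (cis (- alpha) * v t)%C).
      assert (Hy : Cmod y <= Q) by (unfold y; rewrite Cmod_mult, Cmod_cis; lra).
      assert (Hxy : Cmod (xi * y) < r).
      { rewrite Cmod_mult. apply Rlt_div_r in Hxi; [|lra]. pose proof (Cmod_ge_0 xi). pose proof (Cmod_ge_0 y). nra. }
      assert (Hdisc : holo_disc borel_fun 0 r) by (intros w Hw; apply HH, Hr', Hw).
      pose proof (proj1 (is_pseries_C _ _ _) (taylor_series borel_fun 0 (xi * y)%C r Hdisc Hxy)) as S.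
      apply is_pseries_C. intros e He.
      set (c := (q 0%nat t * y)%C). pose proof (Cmod_ge_0 c) as Hc.
      destruct (S (e / (Cmod c + 1)) ltac:(apply Rdiv_lt_0_compat; lra)) as [n0 Hn0].
      exists n0. intros n Hn. specialize (Hn0 n Hn).
      replace (sum_n (fun k => borel_coeff q t k * xi ^ k)%C n - borel_branch alpha (q 0%nat t) (v t) xi)%C
        with (c * (sum_n (fun k => Dn k borel_fun 0 / RtoC (INR (fact k)) * (xi * y) ^ k)%C n - borel_fun (0 + xi * y)))%C.
      * rewrite Cmod_mult. apply Rle_lt_trans with ((Cmod c + 1) * Cmod (sum_n (fun k => Dn k borel_fun 0 / RtoC (INR (fact k)) * (xi * y) ^ k)%C n - borel_fun (0 + xi * y))%C).
        -- apply Rmult_le_compat_r; [apply Cmod_ge_0|lra].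
        -- apply (Rmult_lt_compat_l (Cmod c + 1)) in Hn0; [|lra].
           replace ((Cmod c + 1) * (e / (Cmod c + 1))) with e in Hn0 by (field; lra). exact Hn0.
      * unfold borel_branch. fold y. fold c.
        replace (xi * cis (- alpha) * v t)%C with (0 + xi * y)%C by (unfold y; ring).
        rewrite (csum_ext (fun k => borel_coeff q t k * xi ^ k)%C (fun k => c * (Dn k borel_fun 0 / RtoC (INR (fact k)) * (xi * y) ^ k))%C).
        -- rewrite sum_n_Cmult_l. ring.
        -- intros k _. unfold borel_coeff. destruct (Hb t (HN3 t Ht)) as [_ [_ [_ [_ Hk]]]]. rewrite Hk. fold y. unfold bd, c.
           rewrite (Cpow_mult_l xi), Cpow_S. unfold Cdiv. ring.
    + intros xi Hxi. unfold borel_branch. specialize (HB _ (HOm xi Hxi)).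
      rewrite !Cmod_mult, Cmod_cis, Rmult_1_l in *. rewrite Rmult_1_r in HB.
      apply Rle_trans with (T * Q * (K0 * exp (K1 * (Cmod xi * Cmod (v t))))).
      * apply Rmult_le_compat; [apply Rmult_le_pos; apply Cmod_ge_0|apply Cmod_ge_0| |exact HB].
        apply Rmult_le_compat; try apply Cmod_ge_0; assumption.
      * rewrite <- Rmult_assoc. apply Rmult_le_compat_l; [apply Rmult_le_pos; [apply Rmult_le_pos|]; lra|].
        apply exp_le. rewrite Rmult_assoc. apply Rmult_le_compat_l; [lra|]. rewrite (Rmult_comm Q).
        apply Rmult_le_compat_l; [apply Cmod_ge_0|exact V2].
Qed.

Theorem stable_summability (alpha : R) (U : C -> Prop) (q : nat -> C -> C) (v : C -> C) :
  branch_data alpha U q v -> stably_borel_summable_locally_uniformly q alpha U.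
Proof.
  intros Hb t0 Ht0. destruct (local_borel alpha U q v t0 Hb Ht0) as [N [D [m [Q [T [delta [K0 [K1 L]]]]]]]].
  exists N. split; [apply copen_open, (ld_open _ _ _ _ _ _ _ _ _ _ _ _ _ L)|]. split; [apply (ld_in _ _ _ _ _ _ _ _ _ _ _ _ _ L)|].
  split; [apply (ld_sub _ _ _ _ _ _ _ _ _ _ _ _ _ L)|].
  exists delta. split; [apply (ld_delta _ _ _ _ _ _ _ _ _ _ _ _ _ L)|]. intros beta Hbeta.
  exists D, K0, K1. intros t Ht. exists (borel_branch alpha (q 0%nat t) (v t)).
  apply (ld_borel _ _ _ _ _ _ _ _ _ _ _ _ _ L); assumption.
Qed.

(** * Tangent discs and sectorial neighbourhoods *)

Lemma continuous_pair {T U V : UniformSpace} (f : T -> U) (g : T -> V) (x : T) :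
  continuous f x -> continuous g x -> continuous (fun y => (f y, g y)) x.
Proof.
  intros Hf Hg P [e He].
  pose proof (Hf _ (locally_ball (f x) e)) as H1. pose proof (Hg _ (locally_ball (g x) e)) as H2.
  unfold filtermap in *. generalize (filter_and _ _ H1 H2). apply filter_imp.
  intros y [A B]. apply He. split; assumption.
Qed.

(** The retraction of R onto [0,1]: paths and homotopies have to be continuous on all of R and
    R^2. *)
Definition clamp (s : R) : R := Rmax 0 (Rmin 1 s).

Lemma clamp_range (s : R) : 0 <= clamp s <= 1.
Proof. unfold clamp. split; [apply Rmax_l|]. apply Rmax_lub; [lra|apply Rmin_l]. Qed.

Lemma clamp_id (s : R) : 0 <= s <= 1 -> clamp s = s.
Proof. intros H. unfold clamp. rewrite Rmin_right, Rmax_right; lra. Qed.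

Lemma clamp_cont (s : R) : continuous clamp s.
Proof.
  intros P [e He]. exists e. intros y Hy. apply He. change (Rabs (clamp y - clamp s) < e).
  change (Rabs (y - s) < e) in Hy. eapply Rle_lt_trans; [|exact Hy].
  unfold clamp, Rmax, Rmin. repeat destruct (Rle_dec _ _); unfold Rabs; repeat destruct (Rcase_abs _); lra.
Qed.

Definition interp (p q : R * R) (u : R) : R * R :=
  ((1 - u) * fst p + u * fst q, (1 - u) * snd p + u * snd q).

Lemma interp_cont {T : UniformSpace} (p q : T -> R * R) (u : T -> R) (x : T) :
  continuous p x -> continuous q x -> continuous u x -> continuous (fun y => interp (p y) (q y) (u y)) x.
Proof.
  intros Hp Hq Hu. unfold interp.
  assert (H1 : continuous (fun y => 1 - u y) x).
  { apply (continuous_minus (V := R_NormedModule)); [apply continuous_const|exact Hu]. }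
  apply continuous_pair; apply (continuous_plus (V := R_NormedModule));
    apply (continuous_mult (K := R_AbsRing)); try assumption.
  - apply (continuous_comp p fst); [exact Hp|apply continuous_fst].
  - apply (continuous_comp q fst); [exact Hq|apply continuous_fst].
  - apply (continuous_comp p snd); [exact Hp|apply continuous_snd].
  - apply (continuous_comp q snd); [exact Hq|apply continuous_snd].
Qed.

Lemma interp_0 (p q : R * R) : interp p q 0 = p.
Proof. destruct p. unfold interp; simpl. f_equal; ring. Qed.

Lemma interp_1 (p q : R * R) : interp p q 1 = q.
Proof. destruct q. unfold interp; simpl. f_equal; ring. Qed.

Lemma interp_same (p : R * R) (u : R) : interp p p u = p.
Proof. destruct p. unfold interp; simpl. f_equal; ring. Qed.

(** Loops are contracted along straight lines in a convex chart. The clamped arguments never leave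
    K, which is where phi has to be continuous. *)
Lemma simply_connected_chart {T : UniformSpace} (X : T -> Prop) (K : R * R -> Prop)
    (phi : R * R -> T) (psi : T -> R * R) :
  (exists x, X x) ->
  (forall p q u, K p -> K q -> 0 <= u <= 1 -> K (interp p q u)) ->
  (forall x, X x -> K (psi x) /\ phi (psi x) = x) ->
  (forall p, K p -> X (phi p) /\ continuous phi p) ->
  (forall x, continuous psi x) ->
  simply_connected X.
Proof.
  intros Hne HK Hpsi Hphi Hc. split; [exact Hne|]. split.
  - intros x y Hx Hy. destruct (Hpsi x Hx) as [Kx Ex]. destruct (Hpsi y Hy) as [Ky Ey].
    exists (fun s => phi (interp (psi x) (psi y) (clamp s))). split; [split|].
    + intros s. apply (continuous_comp (fun s => interp (psi x) (psi y) (clamp s)) phi).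
      * apply interp_cont; [apply continuous_const|apply continuous_const|apply clamp_cont].
      * apply Hphi, HK; [exact Kx|exact Ky|apply clamp_range].
    + intros s _. apply Hphi, HK; [exact Kx|exact Ky|apply clamp_range].
    + rewrite !clamp_id, interp_0, interp_1 by lra. split; assumption.
  - intros g [Hg1 Hg2] Hg01.
    assert (Kg : forall s, K (psi (g (clamp s)))) by (intros s; apply Hpsi, Hg2, clamp_range).
    assert (K0 : K (psi (g 0))) by (apply Hpsi, Hg2; lra).
    exists (fun p => phi (interp (psi (g (clamp (fst p)))) (psi (g 0)) (clamp (snd p)))). split; [|split; [|split]].
    + intros [s u]. apply (continuous_comp (fun p : R * R => interp (psi (g (clamp (fst p)))) (psi (g 0)) (clamp (snd p))) phi).
      * apply (interp_cont (fun p : R * R => psi (g (clamp (fst p))))).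
        -- apply (continuous_comp (fun p : R * R => g (clamp (fst p))) psi); [|apply Hc].
           apply (continuous_comp (fun p : R * R => clamp (fst p)) g); [|apply Hg1].
           apply (continuous_comp (fun p : R * R => fst p) clamp); [apply continuous_fst|apply clamp_cont].
        -- apply continuous_const.
        -- apply (continuous_comp (fun p : R * R => snd p) clamp); [apply continuous_snd|apply clamp_cont].
      * apply Hphi, HK; [apply Kg|exact K0|apply clamp_range].
    + intros s u _ _. apply Hphi, HK; [apply Kg|exact K0|apply clamp_range].
    + intros s Hs. simpl. rewrite !(clamp_id s) by lra. rewrite !clamp_id, interp_0, interp_1 by lra.
      split; apply Hpsi, Hg2; [exact Hs|lra].
    + intros u Hu. simpl. rewrite (clamp_id 0), (clamp_id 1), (clamp_id u) by lra.
      rewrite <- Hg01, interp_same. split; apply Hpsi, Hg2; lra.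
Qed.

(** For c > 0, the open disc with diameter from 0 to e^(i alpha) / c; equivalently Re (e^(i alpha) /
    h) > c, cleared of the division. *)
Definition tdisc (alpha c : R) (h : C) : Prop := c * (Cmod h * Cmod h) < Re (h * cis (- alpha))%C.

Lemma Re_cis_le (h : C) (a : R) : Rabs (Re (h * cis a)%C) <= Cmod h.
Proof. eapply Rle_trans; [apply re_le_Cmod|]. rewrite Cmod_mult, Cmod_cis. lra. Qed.

Lemma tdisc_open (alpha c : R) : 0 < c -> copen (tdisc alpha c).
Proof.
  intros Hc h Hh. unfold tdisc in *. pose proof (Cmod_ge_0 h) as H0.
  set (g := Re (h * cis (- alpha))%C - c * (Cmod h * Cmod h)). assert (Hg : 0 < g) by (unfold g; lra).
  exists (Rmin 1 (g / (1 + c * (2 * Cmod h + 1)))).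
  assert (Hd : 0 < 1 + c * (2 * Cmod h + 1)) by nra.
  split; [apply Rmin_pos; [lra|apply Rdiv_lt_0_compat; lra]|]. intros w Hw.
  assert (H1 : Cmod (w - h) < 1) by (eapply Rlt_le_trans; [exact Hw|apply Rmin_l]).
  assert (H2 : Cmod (w - h) < g / (1 + c * (2 * Cmod h + 1))) by (eapply Rlt_le_trans; [exact Hw|apply Rmin_r]).
  apply Rlt_div_r in H2; [|exact Hd].
  pose proof (Re_cis_le (h - w) (- alpha)) as R1. rewrite Cmod_sub_sym in R1.
  replace (Re ((h - w) * cis (- alpha))%C) with (Re (h * cis (- alpha))%C - Re (w * cis (- alpha))%C) in R1 by (simpl; unfold Re, Im; ring).
  pose proof (Rle_abs (Re (h * cis (- alpha))%C - Re (w * cis (- alpha))%C)) as R2.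
  assert (R3 : Cmod w <= Cmod h + Cmod (w - h)).
  { replace w with (h + (w - h))%C at 1 by ring. apply Cmod_triangle. }
  pose proof (Cmod_ge_0 (w - h)) as R4. pose proof (Cmod_ge_0 w) as R5. set (e := Cmod (w - h)) in *. set (x := Cmod h) in *. set (y := Cmod w) in *.
  assert (R6 : y * y <= (x + e) * (x + e)) by (apply Rmult_le_compat; lra).
  assert (R7 : (x + e) * (x + e) <= x * x + e * (2 * x + 1)) by nra.
  assert (R8 : c * (y * y) <= c * (x * x + e * (2 * x + 1))) by (apply Rmult_le_compat_l; lra).
  unfold g in H2. nra.
Qed.

Lemma tdisc_convex (alpha c : R) : 0 < c -> convexC (tdisc alpha c).
Proof.
  intros Hc x y s Hx Hy Hs. unfold tdisc in *.
  replace (x + RtoC s * (y - x))%C with (RtoC (1 - s) * x + RtoC s * y)%C by (rewrite RtoC_minus; ring).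
  replace (Re ((RtoC (1 - s) * x + RtoC s * y) * cis (- alpha))%C) with ((1 - s) * Re (x * cis (- alpha))%C + s * Re (y * cis (- alpha))%C) by (simpl; unfold Re, Im; ring).
  assert (T : Cmod (RtoC (1 - s) * x + RtoC s * y) <= (1 - s) * Cmod x + s * Cmod y).
  { eapply Rle_trans; [apply Cmod_triangle|]. rewrite !Cmod_scal by lra. lra. }
  pose proof (Cmod_ge_0 (RtoC (1 - s) * x + RtoC s * y)) as T0. set (z := Cmod (RtoC (1 - s) * x + RtoC s * y)) in *.
  set (a := Cmod x) in *. set (b := Cmod y) in *.
  assert (T1 : z * z <= ((1 - s) * a + s * b) * ((1 - s) * a + s * b)) by (apply Rmult_le_compat; lra).
  assert (T2 : ((1 - s) * a + s * b) * ((1 - s) * a + s * b) <= (1 - s) * (a * a) + s * (b * b)).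
  { assert (0 <= (1 - s) * s * ((a - b) * (a - b))) by (apply Rmult_le_pos; [nra|apply Rle_0_sqr]). nra. }
  assert (T3 : c * (z * z) <= c * ((1 - s) * (a * a) + s * (b * b))) by (apply Rmult_le_compat_l; lra).
  destruct (Req_dec s 0) as [->|N]; [lra|].
  assert (P1 : (1 - s) * (c * (a * a)) <= (1 - s) * Re (x * cis (- alpha))%C) by (apply Rmult_le_compat_l; lra).
  assert (P2 : s * (c * (b * b)) < s * Re (y * cis (- alpha))%C) by (apply Rmult_lt_compat_l; lra).
  lra.
Qed.

Lemma tdisc_real (alpha c x : R) : 0 < c -> 0 < x -> c * x < 1 -> tdisc alpha c (RtoC x * cis alpha)%C.
Proof.
  intros Hc Hx Hcx. unfold tdisc. rewrite <- Cmult_assoc, cis_opp_r, Cmod_scal, Cmod_cis by lra.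
  rewrite Re_scal. simpl. nra.
Qed.

Lemma tdisc_nonempty (alpha c : R) : 0 < c -> exists h, tdisc alpha c h.
Proof.
  intros Hc. exists (RtoC (/ (2 * c)) * cis alpha)%C. apply tdisc_real; [exact Hc|apply Rinv_0_lt_compat; lra|].
  replace (c * / (2 * c)) with (/ 2) by (field; lra). lra.
Qed.

Lemma tdisc_neq_0 (alpha c : R) (h : C) : tdisc alpha c h -> h <> 0.
Proof.
  intros H ->. unfold tdisc in H. rewrite Cmod_0, Cmult_0_l in H. simpl in H. lra.
Qed.

Lemma tdisc_Re_inv (alpha c : R) (h : C) : tdisc alpha c h -> c < Re (cis alpha / h)%C.
Proof.
  intros H. pose proof (tdisc_neq_0 _ _ _ H) as Hn. unfold tdisc in H.
  assert (Hp : 0 < Cmod h) by (apply Cmod_gt_0, Hn).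
  assert (E : Re (cis alpha / h)%C = Re (h * cis (- alpha))%C / (Cmod h * Cmod h)).
  { pose proof (Cmod2_alt h) as E2. destruct h as [x y]. simpl in E2.
    assert (E3 : Cmod (x, y) * Cmod (x, y) = x * x + y * y) by (simpl in E2; lra).
    rewrite E3. unfold cis. rewrite cos_neg, sin_neg. unfold Cdiv, Cinv, Cmult; simpl. field.
    rewrite <- E3. nra. }
  rewrite E. apply Rlt_div_r; [nra|exact H].
Qed.

Lemma tdisc_mono (alpha c c' : R) (h : C) : c <= c' -> tdisc alpha c' h -> tdisc alpha c h.
Proof.
  intros Hc H. unfold tdisc in *. eapply Rle_lt_trans; [|exact H].
  apply Rmult_le_compat_r; [|exact Hc]. pose proof (Cmod_ge_0 h). nra.
Qed.

Lemma tdisc_simply_connected (alpha c : R) : 0 < c -> simply_connected (T := C_UniformSpace) (tdisc alpha c).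
Proof.
  intros Hc. apply (simply_connected_chart (T := C_UniformSpace) (tdisc alpha c) (tdisc alpha c) (fun p => p) (fun p => p)).
  - apply tdisc_nonempty, Hc.
  - intros p q u Hp Hq Hu. replace (interp p q u) with (p + RtoC u * (q - p))%C.
    + apply tdisc_convex; assumption.
    + destruct p, q. unfold interp. apply injective_projections; simpl; ring.
  - intros x Hx. split; [exact Hx|reflexivity].
  - intros p Hp. split; [exact Hp|apply continuous_id].
  - intros x. apply continuous_id.
Qed.

(** For h = r u the inequality of [tdisc] is divisible by r; the quotient still makes sense at r =
    0, where it cuts out the half-circle [Arc_pi]. *)
Definition blowup_disc (alpha c : R) (p : R * C) : Prop :=
  0 <= fst p /\ Cmod (snd p) = 1 /\ c * fst p < Re (snd p * cis (- alpha))%C.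

Lemma unit_circle_right (u : C) : Cmod u = 1 -> 0 < Re u -> u = (sqrt (1 - Im u * Im u), Im u).
Proof.
  intros H Hr. pose proof (Cmod2_alt u) as E. rewrite H in E. destruct u as [x y]. simpl in *. f_equal.
  replace (1 - y * y) with (x * x) by lra. rewrite sqrt_square; lra.
Qed.

(** After rotation by - alpha the direction has positive real part, so (r, Im u) is a chart; its
    image is convex because sqrt (1 - b^2) is concave. *)
Lemma blowup_disc_simply_connected (alpha c : R) : 0 < c ->
  simply_connected (T := prod_UniformSpace R_UniformSpace C_UniformSpace) (blowup_disc alpha c).
Proof.
  intros Hc.
  set (K := fun p : R * R => 0 <= fst p /\ snd p * snd p < 1 /\ c * fst p < sqrt (1 - snd p * snd p)).
  set (phi := fun p : R * R => (fst p, ((sqrt (1 - snd p * snd p), snd p) : C) * cis alpha)%C : R * C).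
  set (psi := fun x : R * C => (fst x, Im (snd x * cis (- alpha))%C) : R * R).
  apply (simply_connected_chart (T := prod_UniformSpace R_UniformSpace C_UniformSpace) (blowup_disc alpha c) K phi psi).
  - exists (0, cis alpha). unfold blowup_disc; simpl fst; simpl snd. rewrite cis_opp_r, Cmod_cis. simpl. repeat split; lra.
  - intros p q u [P1 [P2 P3]] [Q1 [Q2 Q3]] Hu. unfold K, interp; simpl fst; simpl snd.
    set (b := snd p) in *. set (d := snd q) in *. set (x := fst p) in *. set (y := fst q) in *.
    split; [|split].
    + apply Rplus_le_le_0_compat; apply Rmult_le_pos; lra.
    + assert (- 1 < b < 1) by nra. assert (- 1 < d < 1) by nra.
      assert (-1 < (1 - u) * b + u * d < 1); [|nra].
      destruct (Req_dec u 0) as [->|N]; [split; lra|]. assert (0 < u) by lra. split; nra.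
    + assert (S1 : 0 <= sqrt (1 - b * b)) by apply sqrt_pos. assert (S2 : 0 <= sqrt (1 - d * d)) by apply sqrt_pos.
      assert (E1 : sqrt (1 - b * b) * sqrt (1 - b * b) = 1 - b * b) by (apply sqrt_sqrt; lra).
      assert (E2 : sqrt (1 - d * d) * sqrt (1 - d * d) = 1 - d * d) by (apply sqrt_sqrt; lra).
      set (X := sqrt (1 - b * b)) in *. set (Y := sqrt (1 - d * d)) in *.
      apply Rlt_le_trans with ((1 - u) * X + u * Y).
      * destruct (Req_dec u 0) as [->|N]; [lra|]. assert (0 < u) by lra.
        assert ((1 - u) * (c * x) <= (1 - u) * X) by (apply Rmult_le_compat_l; lra).
        assert (u * (c * y) < u * Y) by (apply Rmult_lt_compat_l; lra). lra.
      * rewrite <- (sqrt_square ((1 - u) * X + u * Y)) by (apply Rplus_le_le_0_compat; apply Rmult_le_pos; lra).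
        apply sqrt_le_1_alt.
        (* Concavity comes down to the Cauchy-Schwarz inequality for the unit vectors (X, b) and (Y,
           d). *)
        assert (XY : X * Y + b * d <= 1).
        { assert (0 <= (X - Y) * (X - Y)) by apply Rle_0_sqr. assert (0 <= (b - d) * (b - d)) by apply Rle_0_sqr. nra. }
        assert (0 <= (1 - u) * u) by (apply Rmult_le_pos; lra).
        assert ((1 - u) * u * (X * Y + b * d) <= (1 - u) * u * 1) by (apply Rmult_le_compat_l; lra).
        replace (((1 - u) * X + u * Y) * ((1 - u) * X + u * Y)) with ((1 - u) * (1 - u) * (X * X) + u * u * (Y * Y) + 2 * ((1 - u) * u * (X * Y))) by ring.
        rewrite E1, E2. nra.
  - intros [r u] [H1 [H2 H3]]. simpl fst in *; simpl snd in *.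
    set (w := (u * cis (- alpha))%C) in *.
    change ((0 <= r /\ Im w * Im w < 1 /\ c * r < sqrt (1 - Im w * Im w)) /\
      (r, (((sqrt (1 - Im w * Im w), Im w) : C) * cis alpha)%C) = (r, u)).
    assert (Hw : Cmod w = 1) by (unfold w; rewrite Cmod_mult, Cmod_cis; lra).
    assert (Hr : 0 < Re w) by nra.
    pose proof (unit_circle_right w Hw Hr) as E.
    split.
    + pose proof (Cmod2_alt w) as E2. rewrite Hw in E2. split; [exact H1|]. split; [nra|].
      assert (E3 : Re w = sqrt (1 - Im w * Im w)) by exact (f_equal (@fst R R) E). rewrite <- E3. exact H3.
    + rewrite <- E. unfold w. rewrite cis_cancel. reflexivity.
  - intros [x b] [H1 [H2 H3]]. simpl fst in *; simpl snd in *. split.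
    + unfold phi, blowup_disc; simpl fst; simpl snd. split; [exact H1|].
      assert (E : sqrt (1 - b * b) * sqrt (1 - b * b) = 1 - b * b) by (apply sqrt_sqrt; lra).
      split.
      * rewrite Cmod_mult, Cmod_cis, Rmult_1_r. unfold Cmod; simpl.
        replace (sqrt (1 - b * b) * (sqrt (1 - b * b) * 1) + b * (b * 1)) with 1 by lra. apply sqrt_1.
      * rewrite <- Cmult_assoc, cis_opp_r, Cmult_1_r. exact H3.
    + apply (continuous_pair (T := prod_UniformSpace R_UniformSpace R_UniformSpace) (U := R_UniformSpace) (V := C_UniformSpace)); [apply continuous_fst|].
      assert (Hsq : continuous (fun p : R * R => sqrt (1 - snd p * snd p)) (x, b)).
      { apply (continuous_comp (fun p : R * R => 1 - snd p * snd p) sqrt).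
        - apply (continuous_minus (V := R_NormedModule)); [apply continuous_const|].
          apply (continuous_mult (K := R_AbsRing)); apply continuous_snd.
        - apply continuity_pt_filterlim, continuity_pt_sqrt. simpl. lra. }
      apply (continuous_pair (T := prod_UniformSpace R_UniformSpace R_UniformSpace) (U := R_UniformSpace) (V := R_UniformSpace)).
      * apply (continuous_minus (V := R_NormedModule)); apply (continuous_mult (K := R_AbsRing)); try apply continuous_const; [exact Hsq|apply continuous_snd].
      * apply (continuous_plus (V := R_NormedModule)); apply (continuous_mult (K := R_AbsRing)); try apply continuous_const; [exact Hsq|apply continuous_snd].
  - intros [r u]. apply (continuous_pair (T := prod_UniformSpace R_UniformSpace C_UniformSpace) (U := R_UniformSpace) (V := R_UniformSpace)); [apply continuous_fst|].
    assert (H1 : continuous (fun x : R * C => fst (snd x)) (r, u)) by (apply (continuous_comp (fun x : R * C => snd x) fst); [apply continuous_snd|apply continuous_fst]).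
    assert (H2 : continuous (fun x : R * C => snd (snd x)) (r, u)) by (apply (continuous_comp (fun x : R * C => snd x) snd); [apply continuous_snd|apply continuous_snd]).
    apply (continuous_plus (V := R_NormedModule)); apply (continuous_mult (K := R_AbsRing)); try apply continuous_const; assumption.
Qed.

Theorem tdisc_sectorial (alpha c : R) : 0 < c -> sectorial_neighbourhood (Arc_pi alpha) (tdisc alpha c).
Proof.
  intros Hc. split; [apply copen_open, tdisc_open, Hc|]. split; [apply tdisc_simply_connected, Hc|].
  split; [intros H; apply (tdisc_neq_0 _ _ _ H); reflexivity|].
  exists (blowup_disc alpha c). split; [|split; [|split; [|split]]].
  - intros [r u] [H1 [H2 _]]. split; assumption.
  - intros [r u] [H1 [H2 H3]]. simpl fst in *; simpl snd in *.
    set (g := Re (u * cis (- alpha))%C - c * r). assert (Hg : 0 < g) by (unfold g; lra).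
    assert (He : 0 < g / (2 + c)) by (apply Rdiv_lt_0_compat; lra).
    exists (mkposreal _ He). intros [r' u'] [B1 [B2 B3]] [H1' H2']. simpl in H1', H2'.
    split; [exact H1'|]. split; [exact H2'|]. simpl fst; simpl snd.
    change (Rabs (r' - r) < g / (2 + c)) in B1. change (Rabs (fst u' - fst u) < g / (2 + c)) in B2. change (Rabs (snd u' - snd u) < g / (2 + c)) in B3.
    pose proof (Rabs_cos (- alpha)) as C1. pose proof (Rabs_sin (- alpha)) as C2.
    assert (E : Re (u * cis (- alpha))%C - Re (u' * cis (- alpha))%C = - ((fst u' - fst u) * cos (- alpha)) + (snd u' - snd u) * sin (- alpha)).
    { simpl. unfold Re, Im; simpl. ring. }
    pose proof (Rabs_triang (- ((fst u' - fst u) * cos (- alpha))) ((snd u' - snd u) * sin (- alpha))) as T.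
    rewrite <- E, Rabs_Ropp, !Rabs_mult in T.
    pose proof (Rabs_pos (fst u' - fst u)). pose proof (Rabs_pos (snd u' - snd u)).
    set (e := g / (2 + c)) in *. assert (Ee : e * (2 + c) = g) by (unfold e; field; lra).
    pose proof (Rle_abs (Re (u * cis (- alpha))%C - Re (u' * cis (- alpha))%C)).
    pose proof (Rle_abs (r' - r)).
    assert (Rabs (fst u' - fst u) * Rabs (cos (- alpha)) <= Rabs (fst u' - fst u)) by nra.
    assert (Rabs (snd u' - snd u) * Rabs (sin (- alpha)) <= Rabs (snd u' - snd u)) by nra.
    assert (c * r' < c * (r + e)) by (apply Rmult_lt_compat_l; lra).
    unfold g in Ee. nra.
  - apply blowup_disc_simply_connected, Hc.
  - intros r u Hr Hu. unfold blowup_disc, tdisc. simpl fst; simpl snd.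
    rewrite Cmod_scal, Hu by lra. rewrite <- Cmult_assoc, Re_scal.
    split.
    + intros [_ [_ H]]. nra.
    + intros H. split; [lra|]. split; [reflexivity|]. nra.
  - intros u Hu. unfold blowup_disc. simpl fst; simpl snd. rewrite Rmult_0_r. split.
    + intros [_ [_ H]]. destruct (polar_right _ H) as [r [t [Hr [Ht E]]]].
      exists (t + alpha). split; [lra|].
      assert (Er : r = 1).
      { apply (f_equal Cmod) in E. rewrite Cmod_mult, Cmod_cis, Cmod_scal, Cmod_cis in E by lra. lra. }
      rewrite Er, Cmult_1_l in E. rewrite cis_plus, <- E. symmetry. apply cis_cancel.
    + intros [phi [Hphi ->]]. split; [lra|]. split; [apply Cmod_cis|]. rewrite <- cis_plus. simpl. apply cos_gt_0; lra.
Qed.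

(** * Joint complex differentiability *)

(** Joint differentiability with explicit partial derivatives, measured in the sum norm;
    [norm_CC_bounds] compares it with the norm of the product module. *)
Definition cder2 (f : C -> C -> C) (t h a b : C) : Prop :=
  forall e, 0 < e -> exists d, 0 < d /\ forall x y, Cmod (x - t) < d -> Cmod (y - h) < d ->
    Cmod (f x y - f t h - (a * (x - t) + b * (y - h)))%C <= e * (Cmod (x - t) + Cmod (y - h)).

Lemma locally_CC (P : C * C -> Prop) (t h : C) :
  locally (T := prod_UniformSpace C_UniformSpace C_UniformSpace) (t, h) P <->
  exists r, 0 < r /\ forall x y, Cmod (x - t) < r -> Cmod (y - h) < r -> P (x, y).
Proof.
  split.
  - intros [e He]. exists e. split; [apply cond_pos|]. intros x y Hx Hy. apply He.
    split; apply C_NormedModule_mixin_compat1; assumption.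
  - intros [r [Hr H]].
    assert (Hr2 : 0 < r / sqrt 2) by (apply Rdiv_lt_0_compat; [lra|apply sqrt_lt_R0; lra]).
    assert (E : sqrt 2 * (r / sqrt 2) = r) by (field; apply Rgt_not_eq, sqrt_lt_R0; lra).
    exists (mkposreal _ Hr2). intros [x y] [Hx Hy].
    apply H; [apply C_NormedModule_mixin_compat2 in Hx; simpl in Hx; rewrite E in Hx; exact Hx|
      apply C_NormedModule_mixin_compat2 in Hy; simpl in Hy; rewrite E in Hy; exact Hy].
Qed.

Notation CC := (prod_NormedModule C_AbsRing C_NormedModule C_NormedModule).

Lemma norm_CC (x y : C) : norm (K := C_AbsRing) (V := CC) (x, y) = sqrt (Cmod x ^ 2 + Cmod y ^ 2).
Proof. reflexivity. Qed.

Lemma norm_CC_bounds (x y : C) : Cmod x + Cmod y <= 2 * sqrt (Cmod x ^ 2 + Cmod y ^ 2) /\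
  sqrt (Cmod x ^ 2 + Cmod y ^ 2) <= Cmod x + Cmod y.
Proof.
  pose proof (Cmod_ge_0 x) as Hx. pose proof (Cmod_ge_0 y) as Hy. set (a := Cmod x) in *. set (b := Cmod y) in *.
  pose proof (sqrt_pos (a ^ 2 + b ^ 2)) as S. assert (E : sqrt (a ^ 2 + b ^ 2) * sqrt (a ^ 2 + b ^ 2) = a ^ 2 + b ^ 2) by (apply sqrt_sqrt; nra).
  set (n := sqrt (a ^ 2 + b ^ 2)) in *. pose proof (Rle_0_sqr (a - b)) as Q. unfold Rsqr in Q.
  split; apply Rsqr_incr_0_var; unfold Rsqr; nra.
Qed.

Lemma cder2_filterdiff (f : C -> C -> C) (t h a b : C) : cder2 f t h a b ->
  ex_filterdiff (K := C_AbsRing) (U := CC) (V := C_NormedModule) (fun x => f (fst x) (snd x)) (locally (t, h)).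
Proof.
  intros H. exists (fun x => a * fst x + b * snd x)%C. split.
  - constructor.
    + intros [x1 y1] [x2 y2]. change (a * (x1 + x2) + b * (y1 + y2) = (a * x1 + b * y1) + (a * x2 + b * y2))%C. ring.
    + intros k [x1 y1]. change (a * (k * x1) + b * (k * y1) = k * (a * x1 + b * y1))%C. ring.
    + exists (2 * (Cmod a + Cmod b) + 1). pose proof (Cmod_ge_0 a) as Ha. pose proof (Cmod_ge_0 b) as Hb.
      split; [lra|]. intros [x y]. rewrite norm_CC.
      change (Cmod (a * x + b * y) <= (2 * (Cmod a + Cmod b) + 1) * sqrt (Cmod x ^ 2 + Cmod y ^ 2)).
      destruct (norm_CC_bounds x y) as [B _]. pose proof (sqrt_pos (Cmod x ^ 2 + Cmod y ^ 2)) as S.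
      set (n := sqrt (Cmod x ^ 2 + Cmod y ^ 2)) in *.
      eapply Rle_trans; [apply Cmod_triangle|]. rewrite !Cmod_mult.
      pose proof (Cmod_ge_0 x). pose proof (Cmod_ge_0 y). nra.
  - intros p Hp.
    assert (Ep : p = (t, h)).
    { apply (is_filter_lim_unique (K := C_AbsRing) (V := CC) (F := locally (t, h))); [exact Hp|intros P HP; exact HP]. }
    subst p. intros e.
    destruct (H (e / 2) (is_pos_div_2 e)) as [d [Hd Hd']].
    apply locally_CC. exists d. split; [exact Hd|]. intros x y Hx Hy. specialize (Hd' x y Hx Hy).
    change (Cmod (f x y - f t h - (a * (x - t) + b * (y - h)))%C <= e * norm (K := C_AbsRing) (V := CC) ((x - t)%C, (y - h)%C)).
    rewrite norm_CC. destruct (norm_CC_bounds (x - t) (y - h)) as [B _].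
    eapply Rle_trans; [exact Hd'|]. pose proof (cond_pos e). nra.
Qed.

(** A competitor in the uniqueness claim is given as a jointly holomorphic function, whereas
    Watson's lemma is applied at fixed t. *)
Lemma filterdiff_slice (f : C -> C -> C) (t h : C) :
  ex_filterdiff (K := C_AbsRing) (U := CC) (V := C_NormedModule) (fun x => f (fst x) (snd x)) (locally (t, h)) ->
  holo_at (f t) h.
Proof.
  intros [l [[L1 L2 _] H]].
  specialize (H (t, h) (fun P HP => HP)).
  exists (l (RtoC 0, RtoC 1)). intros e He.
  destruct (proj1 (locally_CC _ _ _) (H (mkposreal _ He))) as [r [Hr Hr']].
  exists r. split; [exact Hr|]. intros w Hw.
  specialize (Hr' t w ltac:(rewrite Cmod_sub_self; exact Hr) Hw).
  change (Cmod (f t w - f t h - l ((t - t)%C, (w - h)%C))%C <= e * norm (K := C_AbsRing) (V := CC) ((t - t)%C, (w - h)%C)) in Hr'.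
  rewrite norm_CC in Hr'.
  replace ((t - t)%C, (w - h)%C) with (scal (K := C_AbsRing) (V := CC) (w - h)%C (RtoC 0, RtoC 1)) in Hr'.
  - rewrite L2 in Hr'. change (scal (w - h)%C (l (RtoC 0, RtoC 1))) with ((w - h) * l (RtoC 0, RtoC 1))%C in Hr'.
    rewrite (Cmult_comm (w - h)) in Hr'. eapply Rle_trans; [exact Hr'|]. apply Rmult_le_compat_l; [lra|].
    destruct (norm_CC_bounds (t - t) (w - h)) as [_ B]. rewrite Cmod_sub_self in B at 2. lra.
  - apply injective_projections; simpl.
    + change ((w - h) * 0 = t - t)%C. ring.
    + change ((w - h) * 1 = w - h)%C. ring.
Qed.

Lemma cder2_fst (f : C -> C) (t h l : C) : cder f t l -> cder2 (fun x _ => f x) t h l 0.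
Proof.
  intros H e He. destruct (H e He) as [d [Hd Hd']]. exists d. split; [exact Hd|]. intros x y Hx Hy.
  replace (f x - f t - (l * (x - t) + 0 * (y - h)))%C with (f x - f t - l * (x - t))%C by ring.
  eapply Rle_trans; [apply Hd', Hx|]. apply Rmult_le_compat_l; [lra|]. pose proof (Cmod_ge_0 (y - h)). lra.
Qed.

Lemma cder2_const (c t h : C) : cder2 (fun _ _ => c) t h 0 0.
Proof. apply (cder2_fst (fun _ => c)), cder_const. Qed.

Lemma cder2_plus (f g : C -> C -> C) (t h a b a' b' : C) :
  cder2 f t h a b -> cder2 g t h a' b' -> cder2 (fun x y => f x y + g x y)%C t h (a + a')%C (b + b')%C.
Proof.
  intros Hf Hg e He.
  destruct (Hf (e / 2) ltac:(lra)) as [d1 [Hd1 H1]]. destruct (Hg (e / 2) ltac:(lra)) as [d2 [Hd2 H2]].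
  exists (Rmin d1 d2). split; [apply Rmin_pos; assumption|]. intros x y Hx Hy.
  specialize (H1 x y ltac:(eapply Rlt_le_trans; [exact Hx|apply Rmin_l]) ltac:(eapply Rlt_le_trans; [exact Hy|apply Rmin_l])).
  specialize (H2 x y ltac:(eapply Rlt_le_trans; [exact Hx|apply Rmin_r]) ltac:(eapply Rlt_le_trans; [exact Hy|apply Rmin_r])).
  replace (f x y + g x y - (f t h + g t h) - ((a + a') * (x - t) + (b + b') * (y - h)))%C
    with ((f x y - f t h - (a * (x - t) + b * (y - h))) + (g x y - g t h - (a' * (x - t) + b' * (y - h))))%C by ring.
  eapply Rle_trans; [apply Cmod_triangle|]. lra.
Qed.

Lemma cder2_lip (f : C -> C -> C) (t h a b : C) : cder2 f t h a b ->
  exists L d, 0 < L /\ 0 < d /\ forall x y, Cmod (x - t) < d -> Cmod (y - h) < d ->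
    Cmod (f x y - f t h) <= L * (Cmod (x - t) + Cmod (y - h)).
Proof.
  intros H. destruct (H 1 Rlt_0_1) as [d [Hd H1]]. pose proof (Cmod_ge_0 a) as Ha. pose proof (Cmod_ge_0 b) as Hb.
  exists (1 + Cmod a + Cmod b), d. split; [lra|]. split; [exact Hd|]. intros x y Hx Hy. specialize (H1 x y Hx Hy).
  replace (f x y - f t h)%C with ((f x y - f t h - (a * (x - t) + b * (y - h))) + (a * (x - t) + b * (y - h)))%C by ring.
  eapply Rle_trans; [apply Cmod_triangle|].
  pose proof (Cmod_triangle (a * (x - t)) (b * (y - h))) as T. rewrite !Cmod_mult in T.
  pose proof (Cmod_ge_0 (x - t)). pose proof (Cmod_ge_0 (y - h)). nra.
Qed.

Lemma cder2_mult (f g : C -> C -> C) (t h a b a' b' : C) :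
  cder2 f t h a b -> cder2 g t h a' b' ->
  cder2 (fun x y => f x y * g x y)%C t h (a * g t h + f t h * a')%C (b * g t h + f t h * b')%C.
Proof.
  intros Hf Hg e He.
  destruct (cder2_lip _ _ _ _ _ Hf) as [L1 [r1 [HL1 [Hr1 Lf]]]]. destruct (cder2_lip _ _ _ _ _ Hg) as [L2 [r2 [HL2 [Hr2 Lg]]]].
  pose proof (Cmod_ge_0 (f t h)) as Hf0. pose proof (Cmod_ge_0 (g t h)) as Hg0.
  destruct (Hf (e / (3 * (Cmod (g t h) + 1))) ltac:(apply Rdiv_lt_0_compat; lra)) as [d1 [Hd1 H1]].
  destruct (Hg (e / (3 * (Cmod (f t h) + 1))) ltac:(apply Rdiv_lt_0_compat; lra)) as [d2 [Hd2 H2]].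
  assert (HLL : 0 < L1 * L2) by nra.
  set (d := Rmin (Rmin r1 r2) (Rmin (Rmin d1 d2) (e / (6 * (L1 * L2))))).
  assert (P : 0 < d /\ d <= r1 /\ d <= r2 /\ d <= d1 /\ d <= d2 /\ d <= e / (6 * (L1 * L2))).
  { unfold d. repeat split.
    - repeat apply Rmin_pos; try assumption. apply Rdiv_lt_0_compat; lra.
    - eapply Rle_trans; [apply Rmin_l|apply Rmin_l].
    - eapply Rle_trans; [apply Rmin_l|apply Rmin_r].
    - eapply Rle_trans; [apply Rmin_r|]. eapply Rle_trans; [apply Rmin_l|apply Rmin_l].
    - eapply Rle_trans; [apply Rmin_r|]. eapply Rle_trans; [apply Rmin_l|apply Rmin_r].
    - eapply Rle_trans; [apply Rmin_r|apply Rmin_r]. }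
  destruct P as [P0 [P1 [P2 [P3 [P4 P5]]]]].
  exists d. split; [exact P0|]. intros x y Hx Hy.
  specialize (H1 x y ltac:(lra) ltac:(lra)). specialize (H2 x y ltac:(lra) ltac:(lra)).
  specialize (Lf x y ltac:(lra) ltac:(lra)). specialize (Lg x y ltac:(lra) ltac:(lra)).
  replace (f x y * g x y - f t h * g t h - ((a * g t h + f t h * a') * (x - t) + (b * g t h + f t h * b') * (y - h)))%C
    with ((f x y - f t h - (a * (x - t) + b * (y - h))) * g t h + f t h * (g x y - g t h - (a' * (x - t) + b' * (y - h)))
       + (f x y - f t h) * (g x y - g t h))%C by ring.
  eapply Rle_trans; [apply Cmod_triangle|]. eapply Rle_trans; [apply Rplus_le_compat_r, Cmod_triangle|].
  rewrite !Cmod_mult.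
  pose proof (Cmod_ge_0 (x - t)) as Hx0. pose proof (Cmod_ge_0 (y - h)) as Hy0.
  set (s := Cmod (x - t) + Cmod (y - h)) in *. assert (Hs : 0 <= s < 2 * d) by (unfold s; lra).
  assert (A1 : Cmod (f x y - f t h - (a * (x - t) + b * (y - h))) * Cmod (g t h) <= e / 3 * s).
  { apply Rle_trans with (e / (3 * (Cmod (g t h) + 1)) * s * (Cmod (g t h) + 1)).
    - apply Rmult_le_compat; try apply Cmod_ge_0; lra.
    - right. field. lra. }
  assert (A2 : Cmod (f t h) * Cmod (g x y - g t h - (a' * (x - t) + b' * (y - h))) <= e / 3 * s).
  { apply Rle_trans with ((Cmod (f t h) + 1) * (e / (3 * (Cmod (f t h) + 1)) * s)).
    - apply Rmult_le_compat; try apply Cmod_ge_0; lra.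
    - right. field. lra. }
  assert (A3 : Cmod (f x y - f t h) * Cmod (g x y - g t h) <= e / 3 * s).
  { apply Rle_trans with ((L1 * s) * (L2 * s)).
    - apply Rmult_le_compat; try apply Cmod_ge_0; assumption.
    - replace (L1 * s * (L2 * s)) with (L1 * L2 * s * s) by ring. apply Rmult_le_compat_r; [lra|].
      apply Rle_trans with (L1 * L2 * (2 * (e / (6 * (L1 * L2))))); [apply Rmult_le_compat_l; lra|]. right. field. lra. }
  lra.
Qed.

(** A chain rule in which F is controlled only at second arguments attained by v on D: the closed
    sector of [laplace_quad] need not contain a full neighbourhood of v t. *)
Lemma cder2_quad_comp (F : C -> C -> C) (P v : C -> C) (D : C -> Prop) (t h l m a b : C) (Q eta : R) :
  0 < Q -> 0 < eta -> copen D -> D t ->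
  (forall dp dv, Cmod dp < eta -> Cmod dv < eta -> (exists x, D x /\ v x = (v t + dv)%C) ->
    Cmod (F (P h + dp) (v t + dv) - F (P h) (v t) - a * dp - b * dv)%C <= Q * (Cmod dp + Cmod dv) ^ 2) ->
  cder v t l -> cder P h m -> cder2 (fun x y => F (P y) (v x)) t h (b * l)%C (a * m)%C.
Proof.
  intros HQ Heta HD Dt HF Hv HP e He.
  pose proof (Cmod_ge_0 l) as Hl. pose proof (Cmod_ge_0 m) as Hm. pose proof (Cmod_ge_0 a) as Ha. pose proof (Cmod_ge_0 b) as Hb.
  destruct (HD t Dt) as [r0 [Hr0 HD0]].
  destruct (Hv 1 Rlt_0_1) as [r1 [Hr1 Hv1]]. destruct (HP 1 Rlt_0_1) as [r2 [Hr2 HP1]].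
  destruct (Hv (e / (3 * (Cmod b + 1))) ltac:(apply Rdiv_lt_0_compat; lra)) as [d1 [Hd1 H1]].
  destruct (HP (e / (3 * (Cmod a + 1))) ltac:(apply Rdiv_lt_0_compat; lra)) as [d2 [Hd2 H2]].
  set (L := Cmod l + Cmod m + 1). assert (HL : 1 <= L) by (unfold L; lra).
  set (d3 := Rmin (eta / (2 * L)) (e / (6 * (Q * (L * L))))).
  assert (HQL : 0 < Q * (L * L)) by (apply Rmult_lt_0_compat; nra).
  assert (Hd3 : 0 < d3) by (apply Rmin_pos; apply Rdiv_lt_0_compat; lra).
  set (d := Rmin (Rmin r0 (Rmin r1 r2)) (Rmin (Rmin d1 d2) d3)).
  assert (B : 0 < d /\ d <= r0 /\ d <= r1 /\ d <= r2 /\ d <= d1 /\ d <= d2 /\ d <= d3).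
  { unfold d. repeat split.
    - apply Rmin_pos; [|apply Rmin_pos; [apply Rmin_pos|]]; try assumption. apply Rmin_pos; [assumption|apply Rmin_pos; assumption].
    - eapply Rle_trans; [apply Rmin_l|apply Rmin_l].
    - eapply Rle_trans; [apply Rmin_l|]. eapply Rle_trans; [apply Rmin_r|apply Rmin_l].
    - eapply Rle_trans; [apply Rmin_l|]. eapply Rle_trans; [apply Rmin_r|apply Rmin_r].
    - eapply Rle_trans; [apply Rmin_r|]. eapply Rle_trans; [apply Rmin_l|apply Rmin_l].
    - eapply Rle_trans; [apply Rmin_r|]. eapply Rle_trans; [apply Rmin_l|apply Rmin_r].
    - eapply Rle_trans; [apply Rmin_r|apply Rmin_r]. }
  destruct B as [B0 [B1 [B2 [B3 [B4 [B5 B6]]]]]].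
  exists d. split; [exact B0|]. intros x y Hx Hy.
  specialize (Hv1 x ltac:(lra)). specialize (HP1 y ltac:(lra)). specialize (H1 x ltac:(lra)). specialize (H2 y ltac:(lra)).
  set (dv := (v x - v t)%C). set (dp := (P y - P h)%C).
  pose proof (Cmod_ge_0 (x - t)) as Hx0. pose proof (Cmod_ge_0 (y - h)) as Hy0.
  assert (Hdv : Cmod dv <= L * Cmod (x - t)).
  { unfold dv. replace (v x - v t)%C with ((v x - v t - l * (x - t)) + l * (x - t))%C by ring.
    eapply Rle_trans; [apply Cmod_triangle|]. rewrite Cmod_mult. unfold L. nra. }
  assert (Hdp : Cmod dp <= L * Cmod (y - h)).
  { unfold dp. replace (P y - P h)%C with ((P y - P h - m * (y - h)) + m * (y - h))%C by ring.
    eapply Rle_trans; [apply Cmod_triangle|]. rewrite Cmod_mult. unfold L. nra. }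
  assert (Hd3a : d3 <= eta / (2 * L)) by apply Rmin_l. assert (Hd3b : d3 <= e / (6 * (Q * (L * L)))) by apply Rmin_r.
  assert (HLd : L * d < eta).
  { apply Rle_lt_trans with (L * (eta / (2 * L))); [apply Rmult_le_compat_l; lra|]. replace (L * (eta / (2 * L))) with (eta / 2) by (field; lra). lra. }
  specialize (HF dp dv).
  assert (HF' : Cmod (F (P h + dp) (v t + dv) - F (P h) (v t) - a * dp - b * dv)%C <= Q * (Cmod dp + Cmod dv) ^ 2).
  { apply HF.
    - eapply Rle_lt_trans; [exact Hdp|]. nra.
    - eapply Rle_lt_trans; [exact Hdv|]. nra.
    - exists x. split; [apply HD0; lra|]. unfold dv. ring. }
  replace (P h + dp)%C with (P y) in HF' by (unfold dp; ring). replace (v t + dv)%C with (v x) in HF' by (unfold dv; ring).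
  replace (F (P y) (v x) - F (P h) (v t) - (b * l * (x - t) + a * m * (y - h)))%C
    with ((F (P y) (v x) - F (P h) (v t) - a * dp - b * dv) + a * (P y - P h - m * (y - h)) + b * (v x - v t - l * (x - t)))%C
    by (unfold dp, dv; ring).
  eapply Rle_trans; [apply Cmod_triangle|]. eapply Rle_trans; [apply Rplus_le_compat_r, Cmod_triangle|].
  rewrite !Cmod_mult.
  set (X := Cmod (x - t)) in *. set (Y := Cmod (y - h)) in *.
  assert (A2 : Cmod a * Cmod (P y - P h - m * (y - h)) <= e / 3 * Y).
  { apply Rle_trans with ((Cmod a + 1) * (e / (3 * (Cmod a + 1)) * Y)).
    - apply Rmult_le_compat; try apply Cmod_ge_0; lra.
    - right. field. lra. }
  assert (A3 : Cmod b * Cmod (v x - v t - l * (x - t)) <= e / 3 * X).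
  { apply Rle_trans with ((Cmod b + 1) * (e / (3 * (Cmod b + 1)) * X)).
    - apply Rmult_le_compat; try apply Cmod_ge_0; lra.
    - right. field. lra. }
  assert (A1 : Q * (Cmod dp + Cmod dv) ^ 2 <= e / 3 * (X + Y)).
  { apply Rle_trans with (Q * (L * (X + Y)) ^ 2).
    - apply Rmult_le_compat_l; [lra|]. apply pow_incr. pose proof (Cmod_ge_0 dp). pose proof (Cmod_ge_0 dv). split; lra.
    - replace (Q * (L * (X + Y)) ^ 2) with (Q * (L * L) * (X + Y) * (X + Y)) by ring. apply Rmult_le_compat_r; [lra|].
      apply Rle_trans with (Q * (L * L) * (2 * (e / (6 * (Q * (L * L)))))); [apply Rmult_le_compat_l; lra|]. right. field. split; lra. }
  assert (0 <= e * X) by (apply Rmult_le_pos; lra). assert (0 <= e * Y) by (apply Rmult_le_pos; lra). lra.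
Qed.

(** * The Borel resummation *)

(** The factor e^(-i alpha) in [borel_branch] cancels against d xi = e^(i alpha) dr, leaving q_0 v
    in front of the integral. *)
Definition resum (alpha : R) (q : nat -> C -> C) (v : C -> C) (t h : C) : C :=
  (q 0%nat t * (1 + v t * laplace (cis alpha / h) (v t)))%C.

Lemma partial_sum_S (F : nat -> C) (n : nat) : partial_sum F (S n) = (partial_sum F n + F n)%C.
Proof. destruct n as [|n]; simpl partial_sum; [rewrite csum_0; ring|apply csum_S]. Qed.

Definition resum_good (alpha : R) (U : C -> Prop) (q : nat -> C -> C) (v : C -> C) (t0 : C) (N : C -> Prop) (c : R) : Prop :=
  copen N /\ N t0 /\ (forall t, N t -> U t) /\ 0 < c /\
  (forall t h, N t -> tdisc alpha c h ->
     is_borel_sum q alpha t h (resum alpha q v t h) /\ exists a b, cder2 (resum alpha q v) t h a b) /\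
  factorial_bounds q (resum alpha q v) N (tdisc alpha c).

Theorem resum_local (alpha : R) (U : C -> Prop) (q : nat -> C -> C) (v : C -> C) (t0 : C) :
  branch_data alpha U q v -> U t0 -> exists N c, resum_good alpha U q v t0 N c.
Proof.
  intros Hb Ht0.
  destruct (local_borel alpha U q v t0 Hb Ht0) as [N [D [m [Q [T [delta [K0 [K1 [L1 L2 L3 L4 L5 L6 L7 L8]]]]]]]]].
  destruct Hb as [_ [_ [_ Hb]]].
  destruct (borel_sector m L4) as [A [B [K [HA [HB [HK Hsec]]]]]].
  (* On this tangent disc the Laplace integrand decays at least like exp (- r), for every t in N. *)
  set (c := K * Q + 1). assert (Hc : 0 < c) by (unfold c; nra).
  exists N, c. split; [exact L1|]. split; [exact L2|]. split; [exact L3|]. split; [exact Hc|].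
  assert (Hp : forall t h, N t -> tdisc alpha c h -> K * Cmod (v t) + 1 <= Re (cis alpha / h)%C).
  { intros t h Ht Hh. pose proof (tdisc_Re_inv alpha c h Hh) as R1. destruct (L6 t Ht) as [_ [V _]].
    unfold c in R1. assert (K * Cmod (v t) <= K * Q) by (apply Rmult_le_compat_l; lra). lra. }
  split.
  - intros t h Ht Hh. specialize (Hp t h Ht Hh). pose proof (tdisc_neq_0 _ _ _ Hh) as Hh0.
    destruct (L6 t Ht) as [Hs [HvQ _]]. destruct (Hb t (L3 t Ht)) as [Hre [Hv [Hq _]]]. split.
    + split; [exact Hh0|].
      exists D, K0, K1, (borel_branch alpha (q 0%nat t) (v t)), (q 0%nat t * v t * laplace (cis alpha / h) (v t))%C.
      split; [apply L8; [rewrite Rminus_diag, Rabs_R0; exact L7|exact Ht]|]. split.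
      * apply clap_is_RInt_gen.
        pose proof (laplace_clap m A B K HA HB Hsec (cis alpha / h) (v t) Hs ltac:(lra)) as Lc.
        eapply clap_ext; [|apply (clap_scal (q 0%nat t * v t)%C), Lc].
        intros r Hr. unfold laplace_kernel, borel_branch. simpl Dn.
        replace (- (RtoC r * (cis alpha / h)))%C with (- (RtoC r * cis alpha / h))%C by (unfold Cdiv; ring).
        replace (RtoC r * cis alpha * cis (- alpha) * v t)%C with (RtoC r * (cis alpha * cis (- alpha)) * v t)%C by ring.
        rewrite cis_opp_r.
        replace (RtoC r * 1 * v t)%C with (RtoC r * v t)%C by ring.
        transitivity (q 0%nat t * v t * (cis alpha * cis (- alpha)) * (Cexp (- (RtoC r * cis alpha / h)) * borel_fun (RtoC r * v t)))%C; [rewrite cis_opp_r; ring|ring].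
      * unfold resum. ring.
    + destruct (laplace_quad m A B K L4 HA HB HK Hsec (cis alpha / h) (v t) Hs ltac:(lra)) as [a [b [Qc [eta [HQc [Heta HF]]]]]].
      destruct Hv as [l Hl]. destruct Hq as [l0 Hl0].
      assert (HPd : cder (fun y => cis alpha / y)%C h (cis alpha * (- / (h * h)))%C).
      { apply cder_scal, cder_inv_at, Hh0. }
      assert (HC : cder2 (fun x y => laplace (cis alpha / y) (v x)) t h (b * l)%C (a * (cis alpha * (- / (h * h))))%C).
      { apply (cder2_quad_comp laplace (fun y => cis alpha / y)%C v N t h l _ a b Qc eta HQc Heta L1 Ht); [|exact Hl|exact HPd].
        intros dp dv Hdp Hdv [x [Nx Ex]]. apply HF; [exact Hdp|exact Hdv|]. rewrite <- Ex. apply L6, Nx. }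
      do 2 eexists. unfold resum.
      apply (cder2_mult (fun x _ => q 0%nat x) (fun x y => 1 + v x * laplace (cis alpha / y) (v x))%C).
      * apply cder2_fst, Hl0.
      * apply cder2_plus; [apply cder2_const|]. apply (cder2_mult (fun x _ => v x)); [apply cder2_fst, Hl|exact HC].
  (* T + 1 keeps KK positive, and M >= 1 allows (A Q)^n <= M^(n+1). *)
  - set (TT := T + 1). set (KK := TT * (1 + 2 * (Q * B))). set (M := A * Q + 1).
    assert (HT : 0 <= T).
    { destruct (L6 t0 L2) as [_ [_ H]]. eapply Rle_trans; [apply Cmod_ge_0|exact H]. }
    assert (HQB : 0 < Q * B) by (apply Rmult_lt_0_compat; lra).
    assert (HAQ : 0 < A * Q) by (apply Rmult_lt_0_compat; lra).
    exists KK, M. split; [unfold KK, TT; nra|]. split; [unfold M; lra|].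
    intros n t h Ht Hh. specialize (Hp t h Ht Hh). pose proof (tdisc_neq_0 _ _ _ Hh) as Hh0.
    destruct (L6 t Ht) as [Hs [HvQ HqT]]. destruct (Hb t (L3 t Ht)) as [_ [_ [_ [_ Hk]]]].
    set (p := (cis alpha / h)%C) in *.
    assert (Hhm : 0 < Cmod h) by (apply Cmod_gt_0, Hh0).
    assert (Hpm : Cmod p = / Cmod h).
    { unfold p. rewrite Cmod_div, Cmod_cis by exact Hh0. unfold Rdiv. ring. }
    assert (Hp0 : p <> 0) by (apply Cmod_gt_0; rewrite Hpm; apply Rinv_0_lt_compat, Hhm).
    assert (Hip : (/ p)%C = (h * cis (- alpha))%C).
    { unfold p. rewrite cis_opp. field. split; [apply cis_neq_0|exact Hh0]. }
    pose proof (fun k => laplace_remainder m A B K HA HB HK Hsec k p (v t) Q Hs Hp HvQ) as HR.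
    set (ps := fun k => partial_sum (fun k => (v t / p) ^ k * Dn k borel_fun 0 / p)%C k) in HR.
    destruct n as [|n].
    + simpl partial_sum. unfold resum. fold p.
      specialize (HR 0%nat). unfold ps in HR. simpl in HR.
      replace (laplace p (v t) - 0)%C with (laplace p (v t)) in HR by ring.
      replace (q 0%nat t * (1 + v t * laplace p (v t)) - 0)%C with (q 0%nat t * (1 + v t * laplace p (v t)))%C by ring.
      simpl. rewrite !Rmult_1_r. rewrite Cmod_mult.
      assert (HL : Cmod (laplace p (v t)) <= B) by lra.
      apply Rle_trans with (T * (1 + Q * B)).
      * apply Rmult_le_compat; try apply Cmod_ge_0; [exact HqT|].
        eapply Rle_trans; [apply Cmod_triangle|]. rewrite Cmod_1, Cmod_mult. apply Rplus_le_compat_l.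
        apply Rmult_le_compat; try apply Cmod_ge_0; assumption.
      * unfold KK, TT. nra.
    + assert (Eps : forall k, partial_sum (fun k => q k t * h ^ k)%C (S k) = (q 0%nat t * (1 + v t * ps k))%C).
      { induction k as [|k IH].
        - unfold ps. simpl. rewrite csum_0. ring.
        - rewrite partial_sum_S, IH. unfold ps. rewrite partial_sum_S. rewrite Hk. unfold bd.
          unfold Cdiv. rewrite Hip. rewrite (Cpow_mult_l (v t)), !(Cpow_mult_l h), (Cpow_mult_l (cis (- alpha))), !Cpow_S. ring. }
      rewrite Eps. unfold resum. fold p.
      (* The remainder after n terms of [ps] is only known to be of order |h|^n; one more term is
         split off and bounded on its own to reach the order n + 1. *)
      pose proof (HR (S n)) as HR1.
      assert (E1 : ps (S n) = (ps n + (v t / p) ^ n * Dn n borel_fun 0 / p)%C) by (unfold ps; apply partial_sum_S).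
      rewrite E1 in HR1.
      replace (q 0%nat t * (1 + v t * laplace p (v t)) - q 0%nat t * (1 + v t * ps n))%C
        with (q 0%nat t * v t * ((laplace p (v t) - (ps n + (v t / p) ^ n * Dn n borel_fun 0 / p)) + (v t / p) ^ n * Dn n borel_fun 0 / p))%C by ring.
      rewrite !Cmod_mult.
      set (w := (laplace p (v t) - (ps n + (v t / p) ^ n * Dn n borel_fun 0 / p))%C) in *.
      assert (Hbd : Cmod (Dn n borel_fun 0) <= B * INR (fact n) * A ^ n).
      { destruct (Hsec (v t) Hs 0 ltac:(lra) n) as [_ H]. rewrite Cmult_0_l, Rmult_0_l, Rmult_0_r, exp_0, Rmult_1_r in H. exact H. }
      assert (Hpow : forall k, / Cmod p ^ k = Cmod h ^ k) by (intros k; rewrite Hpm, pow_inv, Rinv_inv; reflexivity).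
      pose proof (INR_fact_lt_0 n) as Hfn.
      assert (Hfs : INR (fact n) <= INR (fact (S n))).
      { apply le_INR. simpl. lia. }
      assert (Hx : 0 <= Cmod h ^ S n) by (apply pow_le; lra).
      assert (HM1 : (A * Q) ^ S n <= M ^ S n) by (apply pow_incr; unfold M; lra).
      assert (HM2 : (A * Q) ^ n <= M ^ S n).
      { apply Rle_trans with (M ^ n); [apply pow_incr; unfold M; lra|]. simpl. pose proof (pow_le M n ltac:(unfold M; lra)). unfold M in *. nra. }
      set (F := INR (fact (S n))) in *. set (MM := M ^ S n) in *. set (X := Cmod h ^ S n) in *.
      assert (HF : 0 < F) by lra. assert (HMM : 0 < MM) by (apply pow_lt; unfold M; lra).
      assert (T1 : Cmod w <= B * (F * MM * X)).
      { eapply Rle_trans; [exact HR1|]. unfold Rdiv. rewrite Hpow. fold X.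
        rewrite !Rmult_assoc. apply Rmult_le_compat_l; [lra|]. apply Rmult_le_compat_l; [lra|]. apply Rmult_le_compat_r; assumption. }
      assert (T2 : Cmod ((v t / p) ^ n * Dn n borel_fun 0 / p) <= B * (F * MM * X)).
      { rewrite Cmod_div, Cmod_mult, Cmod_pow, Cmod_div by exact Hp0.
        apply Rle_trans with ((Q / Cmod p) ^ n * (B * INR (fact n) * A ^ n) / Cmod p).
        - unfold Rdiv at 1 3. apply Rmult_le_compat_r; [rewrite Hpm, Rinv_inv; lra|].
          apply Rmult_le_compat; [apply pow_le, Rmult_le_pos; [apply Cmod_ge_0|rewrite Hpm, Rinv_inv; lra]|apply Cmod_ge_0| |exact Hbd].
          apply pow_incr. split; [apply Rmult_le_pos; [apply Cmod_ge_0|rewrite Hpm, Rinv_inv; lra]|].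
          apply Rmult_le_compat_r; [rewrite Hpm, Rinv_inv; lra|exact HvQ].
        - rewrite Hpm. unfold Rdiv. rewrite Rinv_inv, Rpow_mult_distr.
          replace (Q ^ n * Cmod h ^ n * (B * INR (fact n) * A ^ n) * Cmod h) with (B * (INR (fact n) * (A * Q) ^ n * X))
            by (unfold X; rewrite Rpow_mult_distr; simpl; ring).
          apply Rmult_le_compat_l; [lra|]. apply Rmult_le_compat_r; [exact Hx|].
          apply Rmult_le_compat; [lra|apply pow_le; lra|exact Hfs|exact HM2]. }
      assert (T3 : Cmod (w + (v t / p) ^ n * Dn n borel_fun 0 / p) <= 2 * B * (F * MM * X)).
      { eapply Rle_trans; [apply Cmod_triangle|]. lra. }
      assert (HY : 0 <= F * MM * X) by (apply Rmult_le_pos; [nra|exact Hx]).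
      apply Rle_trans with (T * Q * (2 * B * (F * MM * X))).
      * apply Rmult_le_compat; [apply Rmult_le_pos; apply Cmod_ge_0|apply Cmod_ge_0| |exact T3].
        apply Rmult_le_compat; try apply Cmod_ge_0; assumption.
      * replace (KK * MM * F * X) with (KK * (F * MM * X)) by ring.
        replace (T * Q * (2 * B * (F * MM * X))) with (T * (2 * (Q * B)) * (F * MM * X)) by ring.
        apply Rmult_le_compat_r; [exact HY|]. unfold KK, TT. nra.
Qed.

(** * Uniqueness: Watson's lemma on tangent discs *)

(** The derivative exists, so it can be computed along the segment, where the difference quotients
    vanish. *)
Lemma Dn_zero_on_segment (f : C -> C) (a u : C) (R0 eps : R) (k : nat) : Cmod u = 1 -> eps <= R0 ->
  holo_disc f a R0 -> (forall t, Rabs t < eps -> f (a + RtoC t * u)%C = 0) ->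
  forall t, Rabs t < eps -> Dn k f (a + RtoC t * u)%C = 0.
Proof.
  intros Hu HeR Hf H0. induction k as [|k IH]; intros t Ht; [apply H0, Ht|].
  rewrite Dn_S. apply cder_C_derive.
  assert (Hh : holo_at (Dn k f) (a + RtoC t * u)%C).
  { apply (holo_on_Dn (fun w => Cmod (w - a) < R0)); [apply copen_disc|exact Hf|].
    replace (a + RtoC t * u - a)%C with (RtoC t * u)%C by ring. rewrite Cmod_mult, Cmod_R, Hu. lra. }
  destruct Hh as [l Hl]. replace (RtoC 0) with l; [exact Hl|].
  apply Ceq_of_small. intros e He. destruct (Hl e He) as [d [Hd Hd']].
  set (s := Rmin (d / 2) ((eps - Rabs t) / 2)).
  assert (Hs : 0 < s /\ s <= d / 2 /\ s <= (eps - Rabs t) / 2).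
  { unfold s. repeat split; [apply Rmin_pos; lra|apply Rmin_l|apply Rmin_r]. }
  assert (Hts : Rabs (t + s) < eps).
  { eapply Rle_lt_trans; [apply Rabs_triang|]. rewrite (Rabs_right s) by lra. lra. }
  specialize (Hd' (a + RtoC (t + s) * u)%C).
  replace (a + RtoC (t + s) * u - (a + RtoC t * u))%C with (RtoC s * u)%C in Hd' by (rewrite RtoC_plus; ring).
  rewrite (IH _ Hts), (IH _ Ht), Cmod_scal, Hu in Hd' by lra.
  specialize (Hd' ltac:(lra)).
  replace (0 - 0 - l * (RtoC s * u))%C with (- (RtoC s * (l * u)))%C in Hd' by ring.
  rewrite Cmod_opp, Cmod_scal, Cmod_mult, Hu in Hd' by lra.
  replace (l - 0)%C with l by ring. nra.
Qed.

Lemma identity_disc (f : C -> C) (a u : C) (R0 eps : R) : Cmod u = 1 -> 0 < eps ->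
  holo_disc f a R0 -> (forall t, Rabs t < eps -> f (a + RtoC t * u)%C = 0) ->
  forall z, Cmod (z - a) < R0 -> f z = 0.
Proof.
  intros Hu He Hf H0 z Hz. pose proof (Cmod_ge_0 (z - a)) as Hz0.
  set (eps' := Rmin eps R0). assert (He' : 0 < eps') by (apply Rmin_pos; lra).
  assert (HD : forall k, Dn k f a = 0).
  { intros k. replace a with (a + RtoC 0 * u)%C by ring.
    apply (Dn_zero_on_segment f a u R0 eps'); try assumption; [apply Rmin_r| |rewrite Rabs_R0; exact He'].
    intros t Ht. apply H0. eapply Rlt_le_trans; [exact Ht|apply Rmin_l]. }
  pose proof (proj1 (is_pseries_C _ _ _) (taylor_series f a (z - a)%C R0 Hf Hz)) as S.
  replace (a + (z - a))%C with z in S by ring.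
  apply Ceq_of_small. intros e Hee. destruct (S e Hee) as [N HN]. specialize (HN N (le_n N)).
  rewrite (csum_ext _ (fun _ => 0 * 0)%C) in HN.
  - rewrite sum_n_Cmult_l, Cmult_0_l in HN. rewrite Cmod_sub_sym. lra.
  - intros i _. rewrite HD. unfold Cdiv. ring.
Qed.

Lemma tdisc_of_Re_inv (alpha c : R) (p : C) : 0 < c -> c < Re p -> tdisc alpha c (cis alpha / p)%C.
Proof.
  intros Hc Hp. assert (Hp0 : p <> 0) by (intros ->; simpl in Hp; lra).
  assert (Hm : 0 < Cmod p) by (apply Cmod_gt_0, Hp0).
  unfold tdisc. rewrite Cmod_div, Cmod_cis by exact Hp0.
  replace (cis alpha / p * cis (- alpha))%C with (/ p)%C.
  - assert (E : Re (/ p)%C = Re p / (Cmod p * Cmod p)).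
    { pose proof (Cmod2_alt p) as E2. destruct p as [x y]. simpl in E2.
      assert (E3 : Cmod (x, y) * Cmod (x, y) = x * x + y * y) by (simpl in E2; lra).
      rewrite E3. simpl. field. rewrite <- E3. nra. }
    rewrite E. replace (c * (1 / Cmod p * (1 / Cmod p))) with (c / (Cmod p * Cmod p)) by (field; lra).
    apply Rmult_lt_compat_r; [apply Rinv_0_lt_compat; nra|exact Hp].
  - transitivity (cis alpha * cis (- alpha) / p)%C; [rewrite cis_opp_r; field; exact Hp0|unfold Cdiv; ring].
Qed.

(* In the coordinate p = cis alpha / h the tangent disc becomes the half plane Re p > c,
   which is the union of the discs of centre P and radius P - c as P goes to infinity. *)
Lemma tdisc_identity (alpha c eta : R) (g : C -> C) : 0 < c -> 0 < eta ->
  holo_on (tdisc alpha c) g -> (forall x, 0 < x -> x < eta -> g (RtoC x * cis alpha)%C = 0) ->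
  forall h, tdisc alpha c h -> g h = 0.
Proof.
  intros Hc Heta Hg H0 h Hh.
  set (p := (cis alpha / h)%C). pose proof (tdisc_Re_inv alpha c h Hh) as Hp. fold p in Hp.
  pose proof (tdisc_neq_0 _ _ _ Hh) as Hh0.
  assert (Hp0 : p <> 0) by (intros E; rewrite E in Hp; simpl in Hp; lra).
  set (G := fun w => g (cis alpha / w)%C).
  set (x := Re p) in *. set (y := Im p).
  (* The first entry places the real points near P over the segment where g vanishes; the second
     puts p into the disc of centre P and radius P - c. *)
  set (P := Rmax (1 + c + / eta) ((x * x + y * y) / (2 * (x - c)) + 1)).
  assert (HP1 : 1 + c + / eta <= P) by apply Rmax_l.
  assert (HP2 : (x * x + y * y) / (2 * (x - c)) + 1 <= P) by apply Rmax_r.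
  pose proof (Rinv_0_lt_compat eta Heta) as Hie.
  assert (HG : holo_disc G (RtoC P) (P - c)).
  { intros w Hw. assert (Hw' : c < Re w).
    { pose proof (re_le_Cmod (RtoC P - w)) as R1. rewrite Cmod_sub_sym in R1. pose proof (Rle_abs (Re (RtoC P - w)%C)) as R2.
      replace (Re (RtoC P - w)%C) with (P - Re w) in * by (simpl; unfold Re; ring). lra. }
    destruct (Hg _ (tdisc_of_Re_inv alpha c w Hc Hw')) as [l Hl].
    eexists. apply (cder_comp g (fun w => cis alpha / w)%C); [exact Hl|].
    apply cder_scal, cder_inv_at. intros ->. simpl in Hw'. lra. }
  assert (E : G p = 0).
  { apply (identity_disc G (RtoC P) 1 (P - c) 1 Cmod_1 Rlt_0_1 HG).
    - intros t Ht. apply Rabs_def2 in Ht. unfold G.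
      assert (Hq : / eta < P + t) by lra. assert (HPt : 0 < P + t) by lra.
      replace (cis alpha / (RtoC P + RtoC t * 1))%C with (RtoC (/ (P + t)) * cis alpha)%C.
      + apply H0; [apply Rinv_0_lt_compat, HPt|]. rewrite <- (Rinv_inv eta). apply Rinv_lt_contravar; [|exact Hq].
        apply Rmult_lt_0_compat; lra.
      + rewrite RtoC_inv by lra. rewrite RtoC_plus. field. rewrite <- RtoC_plus. apply RtoC_neq_0. lra.
    - assert (Em : Cmod (p - RtoC P) * Cmod (p - RtoC P) = (x - P) * (x - P) + y * y).
      { pose proof (Cmod2_alt (p - RtoC P)) as E2.
        replace (Re (p - RtoC P)) with (x - P) in E2 by (unfold x, Re; simpl; ring).
        replace (Im (p - RtoC P)) with y in E2 by (unfold y, Im; simpl; ring).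
        rewrite <- !Rsqr_pow2 in E2. unfold Rsqr in E2. exact E2. }
      assert (HPc : 0 < P - c) by lra.
      apply Rsqr_incrst_0; [|apply Cmod_ge_0|lra]. unfold Rsqr. rewrite Em.
      assert (Q : x * x + y * y < 2 * (x - c) * P).
      { apply Rlt_le_trans with (2 * (x - c) * ((x * x + y * y) / (2 * (x - c)) + 1)).
        - rewrite Rmult_plus_distr_l. replace (2 * (x - c) * ((x * x + y * y) / (2 * (x - c)))) with (x * x + y * y) by (field; lra). lra.
        - apply Rmult_le_compat_l; lra. }
      nra. }
  unfold G, p in E. replace (cis alpha / (cis alpha / h))%C with h in E; [exact E|].
  field. split; [exact Hh0|apply cis_neq_0].
Qed.

Lemma fact_le_pow (n : nat) : INR (fact n) <= INR n ^ n.
Proof.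
  induction n as [|n IH]; [simpl; lra|].
  rewrite fact_simpl, mult_INR, <- tech_pow_Rmult. apply Rmult_le_compat_l; [apply pos_INR|].
  eapply Rle_trans; [exact IH|]. apply pow_incr. split; [apply pos_INR|apply le_INR; lia].
Qed.

(** Optimal truncation: take n as the integer part of 1 / (3 M x). Then n! <= n^n makes the bound at
    most K 3^(-n) <= K e^(-n), and rounding costs the factor e. *)
Lemma factorial_to_exp (K M x y : R) : 0 <= K -> 0 < M -> 0 < x ->
  (forall n, y <= K * M ^ n * INR (fact n) * x ^ n) -> y <= K * exp 1 * exp (- (/ (3 * M)) / x).
Proof.
  intros HK HM Hx H. set (X := / (3 * M) / x).
  assert (HX : 0 < X) by (apply Rdiv_lt_0_compat; [apply Rinv_0_lt_compat; lra|exact Hx]).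
  destruct (nfloor_ex X ltac:(lra)) as [n [Hn1 Hn2]]. specialize (H n).
  eapply Rle_trans; [exact H|].
  apply Rle_trans with (K * exp (- INR n)).
  - rewrite !Rmult_assoc. apply Rmult_le_compat_l; [exact HK|].
    apply Rle_trans with ((M * INR n * x) ^ n).
    + rewrite !Rpow_mult_distr. rewrite !Rmult_assoc. apply Rmult_le_compat_l; [apply pow_le; lra|].
      apply Rmult_le_compat_r; [apply pow_le; lra|apply fact_le_pow].
    + apply Rle_trans with ((/ 3) ^ n).
      * apply pow_incr. split.
        -- apply Rmult_le_pos; [apply Rmult_le_pos; [lra|apply pos_INR]|lra].
        -- replace (/ 3) with (M * X * x) by (unfold X; field; lra). apply Rmult_le_compat_r; [lra|]. apply Rmult_le_compat_l; lra.
      * assert (E : exp (- INR n) = (exp (Ropp 1)) ^ n).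
        { clear. induction n as [|n IH]; [simpl; rewrite Ropp_0; apply exp_0|]. rewrite S_INR. simpl pow. rewrite <- IH, <- exp_plus. f_equal. ring. }
        rewrite E. apply pow_incr. split; [lra|]. rewrite exp_Ropp. apply Rinv_le_contravar; [apply exp_pos|apply exp_le_3].
  - rewrite Rmult_assoc. apply Rmult_le_compat_l; [exact HK|]. rewrite <- exp_plus. apply exp_le.
    replace (- / (3 * M) / x) with (- X) by (unfold X; field; lra). lra.
Qed.

(* The real part of this sum is a dyadic discretisation of the logarithmically divergent integral of a
   Poisson kernel; it is at most of order 1/|w| on a circle tangent to the imaginary axis at 0, yet grows
   linearly with N at the centre. *)
Fixpoint dyadic_sum (N : nat) (w : C) : C :=
  match N with O => RtoC 0 | S n => (dyadic_sum n w + / (w + RtoC ((/ 2) ^ n)))%C end.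

(** The hypothesis places w on the circle |w - rho|^2 = rho^2 - delta, where Re w is quadratically
    small near 0. The three terms come from |w|^2, from delta and from e in Re (w + e). *)
Lemma Re_inv_shift_bound (w : C) (rho delta e : R) : 0 < rho -> 0 <= delta -> 0 < e ->
  0 < Re w -> 2 * rho * Re w = Cmod w * Cmod w + delta ->
  Re (/ (w + RtoC e))%C <= 1 / (2 * rho) + delta / (2 * rho * (e * e)) + e / (Cmod w * Cmod w + e * e).
Proof.
  intros Hrho Hd He Hw E.
  pose proof (Cmod2_alt w) as E2. destruct w as [x y]. simpl in Hw, E, E2.
  set (m := Cmod (x, y)) in *. assert (Em : m * m = x * x + y * y) by lra.
  assert (Hden : 0 < m * m + e * e) by nra.
  assert (Er : Re (/ ((x, y) + RtoC e))%C = (x + e) / ((x + e) * (x + e) + y * y)).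
  { simpl. field. nra. }
  rewrite Er.
  assert (B1 : (x + e) / ((x + e) * (x + e) + y * y) <= (x + e) / (m * m + e * e)).
  { unfold Rdiv. apply Rmult_le_compat_l; [lra|]. apply Rinv_le_contravar; [exact Hden|]. nra. }
  assert (B2 : x / (m * m + e * e) <= 1 / (2 * rho) + delta / (2 * rho * (e * e))).
  { replace x with ((m * m + delta) / (2 * rho)) by (rewrite <- E; field; lra).
    replace ((m * m + delta) / (2 * rho) / (m * m + e * e)) with (1 / (2 * rho) * (m * m / (m * m + e * e)) + delta / (2 * rho) * / (m * m + e * e)) by (field; split; lra).
    assert (C1 : m * m / (m * m + e * e) <= 1) by (apply Rle_div_l; nra).
    assert (C2 : / (m * m + e * e) <= / (e * e)) by (apply Rinv_le_contravar; nra).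
    assert (C3 : 0 < 1 / (2 * rho)) by (apply Rdiv_lt_0_compat; lra).
    assert (C4 : 0 <= delta / (2 * rho)) by (apply Rdiv_le_0_compat; lra).
    replace (delta / (2 * rho * (e * e))) with (delta / (2 * rho) * / (e * e)) by (field; lra).
    apply Rplus_le_compat; [|apply Rmult_le_compat_l; assumption].
    rewrite <- (Rmult_1_r (1 / (2 * rho))) at 2. apply Rmult_le_compat_l; lra. }
  replace ((x + e) / (m * m + e * e)) with (x / (m * m + e * e) + e / (m * m + e * e)) in B1 by (field; lra). lra.
Qed.

(** The right side is a difference between e and e / 2, so the sum over dyadic e telescopes and
    stays below 4 / x whatever the number of terms. *)
Lemma dyadic_telescope (x e : R) : 0 < x -> 0 < e ->
  e / (x * x + e * e) <= 4 * (e / (x * (x + e)) - (e / 2) / (x * (x + e / 2))).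
Proof.
  intros Hx He.
  replace (4 * (e / (x * (x + e)) - (e / 2) / (x * (x + e / 2)))) with (4 * e / ((x + e) * (2 * x + e))) by (field; repeat split; lra).
  replace (4 * e / ((x + e) * (2 * x + e))) with (e * / ((x + e) * (2 * x + e) / 4)) by (field; split; lra).
  unfold Rdiv at 1. apply Rmult_le_compat_l; [lra|]. apply Rinv_le_contravar; [nra|]. pose proof (Rle_0_sqr (x - e)) as Q. unfold Rsqr in Q. nra.
Qed.

(** Collects the coefficients of delta. It is huge for large N, but delta is chosen after N. *)
Fixpoint dyadic_const (rho : R) (N : nat) : R :=
  match N with O => 0 | S n => dyadic_const rho n + / (2 * rho * ((/ 2) ^ n * (/ 2) ^ n)) end.

Lemma dyadic_const_nonneg (rho : R) (N : nat) : 0 < rho -> 0 <= dyadic_const rho N.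
Proof.
  intros Hr. induction N as [|N IH]; simpl; [lra|]. pose proof (pow_half_pos N).
  assert (0 < / (2 * rho * ((/ 2) ^ N * (/ 2) ^ N))) by (apply Rinv_0_lt_compat; repeat apply Rmult_lt_0_compat; lra). lra.
Qed.

Lemma dyadic_sum_circle (w : C) (rho delta : R) (N : nat) : 0 < rho -> 0 <= delta ->
  0 < Re w -> 2 * rho * Re w = Cmod w * Cmod w + delta ->
  Re (dyadic_sum N w) <= INR N / (2 * rho) + delta * dyadic_const rho N + 4 / Cmod w.
Proof.
  intros Hrho Hd Hw E.
  assert (Hx : 0 < Cmod w) by (pose proof (Re_le_Cmod w); lra). set (x := Cmod w) in *.
  assert (P : Re (dyadic_sum N w) <= INR N / (2 * rho) + delta * dyadic_const rho N + 4 * (1 / (x * (x + 1)) - (/ 2) ^ N / (x * (x + (/ 2) ^ N)))).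
  { induction N as [|N IH].
    - simpl. replace (0 / (2 * rho)) with 0 by (field; lra).
      replace (4 * (1 / (x * (x + 1)) - 1 / (x * (x + 1)))) with 0 by ring. lra.
    - pose proof (pow_half_pos N) as He.
      pose proof (Re_inv_shift_bound w rho delta ((/ 2) ^ N) Hrho Hd He Hw E) as B. fold x in B.
      pose proof (dyadic_telescope x ((/ 2) ^ N) Hx He) as T.
      change (dyadic_sum (S N) w) with (dyadic_sum N w + / (w + RtoC ((/ 2) ^ N)))%C.
      change (Re (dyadic_sum N w + / (w + RtoC ((/ 2) ^ N)))%C) with (Re (dyadic_sum N w) + Re (/ (w + RtoC ((/ 2) ^ N)))%C).
      rewrite S_INR. change (dyadic_const rho (S N)) with (dyadic_const rho N + / (2 * rho * ((/ 2) ^ N * (/ 2) ^ N))).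
      change ((/ 2) ^ S N) with (/ 2 * (/ 2) ^ N). set (e := (/ 2) ^ N) in *.
      replace (/ 2 * e) with (e / 2) by field.
      replace ((INR N + 1) / (2 * rho)) with (INR N / (2 * rho) + 1 / (2 * rho)) by (field; lra).
      replace (delta / (2 * rho * (e * e))) with (delta * / (2 * rho * (e * e))) in B by reflexivity. lra. }
  eapply Rle_trans; [exact P|]. apply Rplus_le_compat_l.
  pose proof (pow_half_pos N) as He.
  assert (A1 : 0 < (/ 2) ^ N / (x * (x + (/ 2) ^ N))) by (apply Rdiv_lt_0_compat; [lra|apply Rmult_lt_0_compat; lra]).
  assert (A2 : 1 / (x * (x + 1)) <= 1 / x).
  { unfold Rdiv. rewrite !Rmult_1_l. apply Rinv_le_contravar; nra. }
  unfold Rdiv in *. lra.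
Qed.

(** At the centre the sum grows like N / rho, against N / (2 rho) on the circle; this gap forces the
    vanishing. *)
Lemma dyadic_sum_center (rho : R) (N : nat) : 0 < rho ->
  INR N / rho - 2 / (rho * rho) <= Re (dyadic_sum N (RtoC rho)).
Proof.
  intros Hr.
  assert (P : INR N / rho - (2 - 2 * (/ 2) ^ N) / (rho * rho) <= Re (dyadic_sum N (RtoC rho))).
  { induction N as [|N IH].
    - simpl. replace (0 / rho - (2 - 2 * 1) / (rho * rho)) with 0 by (field; lra). lra.
    - pose proof (pow_half_pos N) as He.
      change (dyadic_sum (S N) (RtoC rho)) with (dyadic_sum N (RtoC rho) + / (RtoC rho + RtoC ((/ 2) ^ N)))%C.
      change (Re (dyadic_sum N (RtoC rho) + / (RtoC rho + RtoC ((/ 2) ^ N)))%C) with (Re (dyadic_sum N (RtoC rho)) + Re (/ (RtoC rho + RtoC ((/ 2) ^ N)))%C).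
      rewrite <- RtoC_plus, <- RtoC_inv by lra. rewrite S_INR. change ((/ 2) ^ S N) with (/ 2 * (/ 2) ^ N).
      set (e := (/ 2) ^ N) in *. change (Re (RtoC (/ (rho + e)))) with (/ (rho + e)).
      assert (B : 1 / rho - e / (rho * rho) <= / (rho + e)).
      { replace (1 / rho - e / (rho * rho)) with ((rho - e) / (rho * rho)) by (field; lra).
        apply Rle_div_l; [nra|]. apply (Rmult_le_reg_l (rho + e)); [lra|].
        replace ((rho + e) * (/ (rho + e) * (rho * rho))) with (rho * rho) by (field; lra). nra. }
      replace ((INR N + 1) / rho) with (INR N / rho + 1 / rho) by (field; lra).
      replace ((2 - 2 * (/ 2 * e)) / (rho * rho)) with ((2 - 2 * e) / (rho * rho) + e / (rho * rho)) by (field; lra). lra. }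
  eapply Rle_trans; [|exact P]. apply Rplus_le_compat_l, Ropp_le_contravar.
  unfold Rdiv. apply Rmult_le_compat_r; [apply Rlt_le, Rinv_0_lt_compat; nra|]. pose proof (pow_half_pos N). lra.
Qed.

Lemma dyadic_sum_holo (N : nat) : holo_on (fun w => 0 < Re w) (dyadic_sum N).
Proof.
  induction N as [|N IH]; intros w Hw.
  - eexists. apply cder_const.
  - destruct (IH w Hw) as [l Hl]. eexists. apply (cder_plus (dyadic_sum N)); [exact Hl|].
    apply (cder_inv (fun w => w + RtoC ((/ 2) ^ N))%C).
    + intros E. apply (f_equal Re) in E. change (Re (w + RtoC ((/ 2) ^ N))%C) with (Re w + (/ 2) ^ N) in E.
      simpl in E. pose proof (pow_half_pos N). lra.
    + apply cder_plus; [apply cder_id|apply cder_const].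
Qed.

(** The maximum principle for G exp (a [dyadic_sum] N) on a slightly smaller circle: the smallness
    of G absorbs the growth near 0, and the gap between circle and centre gives |G rho| <= const exp
    (- a N / (2 rho)) for every N. *)
Lemma watson_center (G : C -> C) (rho K' c1 : R) : 0 < rho -> 0 <= K' -> 0 < c1 ->
  holo_disc G (RtoC rho) rho ->
  (forall w, Cmod (w - RtoC rho) < rho -> Cmod (G w) <= K' * exp (- c1 / Cmod w)) -> G (RtoC rho) = 0.
Proof.
  intros Hr HK Hc HG HB.
  (* Then a times the term 4 / |w| of [dyadic_sum_circle] cancels - c1 / |w| exactly. *)
  set (a := c1 / 4). assert (Ha : 0 < a) by (unfold a; lra).
  assert (Hsq : forall w, Cmod (w - RtoC rho) * Cmod (w - RtoC rho) = Cmod w * Cmod w - 2 * rho * Re w + rho * rho).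
  { intros w. pose proof (Cmod2_alt (w - RtoC rho)) as E1. pose proof (Cmod2_alt w) as E2. unfold Re, Im in *. simpl in E1, E2 |- *. lra. }
  assert (HRe : forall w, Cmod (w - RtoC rho) < rho -> 0 < Re w).
  { intros w Hw. specialize (Hsq w). pose proof (Cmod_ge_0 (w - RtoC rho)). pose proof (Cmod_ge_0 w).
    assert (Cmod (w - RtoC rho) * Cmod (w - RtoC rho) < rho * rho) by nra. nra. }
  assert (Main : forall N, Cmod (G (RtoC rho)) <= K' * exp (a * (1 + 2 / (rho * rho) - INR N / (2 * rho)))).
  { intros N.
    set (f := fun w => (G w * Cexp (RtoC a * dyadic_sum N w))%C).
    assert (Hf : holo_disc f (RtoC rho) rho).
    { intros w Hw. destruct (HG w Hw) as [l Hl]. destruct (dyadic_sum_holo N w (HRe w Hw)) as [m Hm].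
      eexists. apply cder_mult; [exact Hl|]. apply (cder_comp Cexp (fun w => RtoC a * dyadic_sum N w)%C); [apply cder_Cexp|apply cder_scal, Hm]. }
    pose proof (dyadic_const_nonneg rho N Hr) as HT. set (T := dyadic_const rho N) in *.
    (* Retreats to a circle inside the open disc, at a cost delta T <= 1 in the exponent. *)
    set (delta := Rmin (rho * rho / 2) (/ (T + 1))).
    assert (Hd : 0 < delta /\ delta <= rho * rho / 2 /\ delta <= / (T + 1)).
    { unfold delta. repeat split; [apply Rmin_pos; [nra|apply Rinv_0_lt_compat; lra]|apply Rmin_l|apply Rmin_r]. }
    set (r := sqrt (rho * rho - delta)).
    assert (Hrr : r * r = rho * rho - delta) by (apply sqrt_sqrt; nra).
    assert (Hr0 : 0 < r) by (apply sqrt_lt_R0; nra).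
    assert (Hrlt : r < rho) by nra.
    assert (HdT : delta * T <= 1).
    { apply Rle_trans with (/ (T + 1) * (T + 1)); [apply Rmult_le_compat; lra|]. right. field. lra. }
    pose proof (max_center f (RtoC rho) rho r (K' * exp (a * (INR N / (2 * rho) + 1))) Hf ltac:(lra)) as MC.
    assert (MC' : Cmod (f (RtoC rho)) <= K' * exp (a * (INR N / (2 * rho) + 1))).
    { apply MC. intros w Hw. assert (Hwr : Cmod (w - RtoC rho) < rho) by lra.
      pose proof (HRe w Hwr) as Hre. assert (E : 2 * rho * Re w = Cmod w * Cmod w + delta).
      { specialize (Hsq w). rewrite Hw, Hrr in Hsq. lra. }
      pose proof (dyadic_sum_circle w rho delta N Hr ltac:(lra) Hre E) as DS. fold T in DS.
      unfold f. rewrite Cmod_mult, Cmod_Cexp, Re_scal.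
      apply Rle_trans with (K' * exp (- c1 / Cmod w) * exp (a * Re (dyadic_sum N w))).
      - apply Rmult_le_compat_r; [apply Rlt_le, exp_pos|apply HB, Hwr].
      - rewrite Rmult_assoc. apply Rmult_le_compat_l; [exact HK|]. rewrite <- exp_plus. apply exp_le.
        assert (Hx : 0 < Cmod w) by (pose proof (Re_le_Cmod w); lra).
        apply Rle_trans with (- c1 / Cmod w + a * (INR N / (2 * rho) + delta * T + 4 / Cmod w)).
        + apply Rplus_le_compat_l, Rmult_le_compat_l; lra.
        + replace (- c1 / Cmod w + a * (INR N / (2 * rho) + delta * T + 4 / Cmod w)) with (a * (INR N / (2 * rho) + delta * T)) by (unfold a; field; split; lra).
          apply Rmult_le_compat_l; lra. }
    unfold f in MC'. rewrite Cmod_mult, Cmod_Cexp, Re_scal in MC'.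
    pose proof (dyadic_sum_center rho N Hr) as DC.
    set (E := exp (a * Re (dyadic_sum N (RtoC rho)))) in *. assert (HE : 0 < E) by apply exp_pos.
    apply (Rmult_le_reg_r E); [exact HE|]. eapply Rle_trans; [exact MC'|].
    rewrite Rmult_assoc. apply Rmult_le_compat_l; [exact HK|]. unfold E. rewrite <- exp_plus. apply exp_le.
    rewrite <- Rmult_plus_distr_l. apply Rmult_le_compat_l; [lra|].
    replace (INR N / rho) with (2 * (INR N / (2 * rho))) in DC by (field; lra). lra. }
  apply Ceq_of_small. intros e He. replace (G (RtoC rho) - 0)%C with (G (RtoC rho)) by ring.
  set (A0 := K' * exp (a * (1 + 2 / (rho * rho)))).
  assert (HA0 : 0 <= A0) by (apply Rmult_le_pos; [exact HK|apply Rlt_le, exp_pos]).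
  destruct (exp_decay_small A0 (a / (2 * rho)) e HA0 ltac:(apply Rdiv_lt_0_compat; lra) He) as [X [HX0 HX]].
  destruct (nfloor_ex X HX0) as [N HN]. specialize (HX (INR (S N)) ltac:(rewrite S_INR; lra)).
  eapply Rle_trans; [apply (Main (S N))|]. eapply Rle_trans; [|exact HX].
  unfold A0. rewrite Rmult_assoc, <- exp_plus. apply Rmult_le_compat_l; [exact HK|]. apply exp_le. right. field. lra.
Qed.

(** For rho < 1 / (2 c) the disc about rho e^(i alpha) through 0 lies in the tangent disc, so g
    vanishes at its centre. These centres fill a segment, and [tdisc_identity] spreads the zero. *)
Theorem watson (alpha c K M : R) (g : C -> C) : 0 < c -> 0 <= K -> 0 < M ->
  holo_on (tdisc alpha c) g ->
  (forall n h, tdisc alpha c h -> Cmod (g h) <= K * M ^ n * INR (fact n) * Cmod h ^ n) ->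
  forall h, tdisc alpha c h -> g h = 0.
Proof.
  intros Hc HK HM Hg HB.
  apply (tdisc_identity alpha c (/ (2 * c)) g Hc ltac:(apply Rinv_0_lt_compat; lra) Hg).
  intros rho Hrho Hrc. set (G := fun w => g (w * cis alpha)%C).
  replace (g (RtoC rho * cis alpha)%C) with (G (RtoC rho)) by reflexivity.
  assert (Hcr : 2 * c * rho < 1).
  { apply (Rmult_lt_compat_l (2 * c)) in Hrc; [|lra]. rewrite Rinv_r in Hrc by lra. exact Hrc. }
  assert (Hin : forall w, Cmod (w - RtoC rho) < rho -> tdisc alpha c (w * cis alpha)%C).
  { intros w Hw. unfold tdisc. rewrite <- Cmult_assoc, cis_opp_r, Cmult_1_r, Cmod_mult, Cmod_cis, Rmult_1_r.
    pose proof (Cmod2_alt (w - RtoC rho)) as E1. pose proof (Cmod2_alt w) as E2. unfold Re, Im in *. simpl in E1, E2 |- *.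
    pose proof (Cmod_ge_0 (w - RtoC rho)) as P1. pose proof (Cmod_ge_0 w) as P2.
    assert (E3 : Cmod (w - RtoC rho) * Cmod (w - RtoC rho) < rho * rho) by nra.
    assert (E4 : Cmod w * Cmod w < 2 * rho * fst w) by nra.
    assert (P3 : 0 < fst w) by nra. nra. }
  apply (watson_center G rho (K * exp 1) (/ (3 * M)) Hrho).
  - apply Rmult_le_pos; [exact HK|apply Rlt_le, exp_pos].
  - apply Rinv_0_lt_compat; lra.
  - intros w Hw. destruct (Hg _ (Hin w Hw)) as [l Hl]. eexists. apply (cder_comp g (fun w => w * cis alpha)%C); [exact Hl|].
    apply cder_mult; [apply cder_id|apply cder_const].
  - intros w Hw. pose proof (Hin w Hw) as Ht.
    assert (Hx : 0 < Cmod (w * cis alpha)) by (apply Cmod_gt_0, (tdisc_neq_0 alpha c), Ht).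
    assert (Ex : Cmod (w * cis alpha) = Cmod w) by (rewrite Cmod_mult, Cmod_cis; ring).
    pose proof (factorial_to_exp K M (Cmod (w * cis alpha)) (Cmod (g (w * cis alpha)%C)) HK HM Hx (fun n => HB n _ Ht)) as F.
    rewrite Ex in F. exact F.
Qed.

(** * Maximality: a singularity on the ray at the boundary of a sector *)

Lemma Re_csum (a : nat -> C) (n : nat) : Re (sum_n a n : C) = sum_n (fun k => Re (a k)) n.
Proof. induction n as [|n IH]; [rewrite !sum_O; reflexivity|]. rewrite csum_S, sum_Sn, <- IH. reflexivity. Qed.

Lemma Im_csum (a : nat -> C) (n : nat) : Im (sum_n a n : C) = sum_n (fun k => Im (a k)) n.
Proof. induction n as [|n IH]; [rewrite !sum_O; reflexivity|]. rewrite csum_S, sum_Sn, <- IH. reflexivity. Qed.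

Lemma is_pseries_Re (a : nat -> C) (x : R) (l : C) :
  is_pseries (K := C_AbsRing) (V := C_NormedModule) a (RtoC x) l ->
  is_pseries (fun k => Re (a k)) x (Re l) /\ is_pseries (fun k => Im (a k)) x (Im l).
Proof.
  intros H. pose proof (proj1 (is_pseries_C a (RtoC x) l) H) as H1.
  assert (Ht : forall k, Re (a k * RtoC x ^ k)%C = Re (a k) * x ^ k /\ Im (a k * RtoC x ^ k)%C = Im (a k) * x ^ k).
  { intros k. rewrite <- RtoC_pow. simpl. unfold Re, Im. split; ring. }
  split; apply is_pseries_R;
    match goal with |- is_series ?u ?l => change (is_lim_seq (sum_n u) (Rbar.Finite l)) end;
    apply is_lim_seq_spec; intros e; destruct (H1 e (cond_pos e)) as [N HN]; exists N; intros n Hn; specialize (HN n Hn).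
  - pose proof (re_le_Cmod (sum_n (fun k => a k * RtoC x ^ k)%C n - l)) as B.
    change (Re (sum_n (fun k => a k * RtoC x ^ k)%C n - l)%C) with (Re (sum_n (fun k => a k * RtoC x ^ k)%C n : C) - Re l) in B.
    rewrite Re_csum in B. rewrite (sum_n_ext _ (fun k => Re (a k) * x ^ k)) in B by (intros k; apply Ht). lra.
  - pose proof (im_le_Cmod (sum_n (fun k => a k * RtoC x ^ k)%C n - l)) as B.
    change (Im (sum_n (fun k => a k * RtoC x ^ k)%C n - l)%C) with (Im (sum_n (fun k => a k * RtoC x ^ k)%C n : C) - Im l) in B.
    rewrite Im_csum in B. rewrite (sum_n_ext _ (fun k => Im (a k) * x ^ k)) in B by (intros k; apply Ht). lra.
Qed.

Lemma real_pseries_unique (a b : nat -> R) (f : R -> R) (rho : R) : 0 < rho ->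
  (forall x, Rabs x < rho -> is_pseries a x (f x)) -> (forall x, Rabs x < rho -> is_pseries b x (f x)) ->
  forall k, a k = b k.
Proof.
  intros Hr Ha Hb k.
  assert (CV : forall c, (forall x, Rabs x < rho -> is_pseries c x (f x)) -> Rbar_lt 0 (CV_radius c)).
  { intros c Hc. apply Rbar_lt_le_trans with (Rbar.Finite (rho / 2)); [simpl; lra|].
    apply Rbar_not_lt_le. intros L. apply (CV_disk_outside c (rho / 2)).
    - rewrite Rabs_right by lra. exact L.
    - apply ex_series_lim_0. exists (f (rho / 2)). apply is_pseries_R, Hc. rewrite Rabs_right; lra. }
  apply PSeries_ext_recip; [apply CV, Ha|apply CV, Hb|].
  exists (mkposreal rho Hr). intros x Hx.
  assert (Hx' : Rabs x < rho).
  { change (Rabs (x - 0) < rho) in Hx. rewrite Rminus_0_r in Hx. exact Hx. }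
  rewrite (is_pseries_unique _ _ _ (Ha x Hx')), (is_pseries_unique _ _ _ (Hb x Hx')). reflexivity.
Qed.

(** The given series is known on a real interval only, so it is compared with the Taylor series
    there, separately in real and imaginary parts. *)
Lemma Dn_of_series (f : C -> C) (e : nat -> R) (rho : R) : 0 < rho -> holo_disc f 0 rho ->
  (forall x, Rabs x < rho -> is_pseries (K := C_AbsRing) (V := C_NormedModule) (fun k => RtoC (e k)) (RtoC x) (f (RtoC x))) ->
  forall k, Dn k f 0 = RtoC (e k * INR (fact k)).
Proof.
  intros Hr Hf H k.
  set (b := fun k => (Dn k f 0 / RtoC (INR (fact k)))%C).
  assert (Hb : forall x, Rabs x < rho -> is_pseries (K := C_AbsRing) (V := C_NormedModule) b (RtoC x) (f (RtoC x))).
  { intros x Hx. pose proof (taylor_series f 0 (RtoC x) rho Hf ltac:(rewrite Cmod_R; exact Hx)) as T.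
    replace (0 + RtoC x)%C with (RtoC x) in T by ring. exact T. }
  assert (Er : Re (b k) = e k).
  { apply (real_pseries_unique (fun k => Re (b k)) e (fun x => Re (f (RtoC x))) rho Hr).
    - intros x Hx. apply is_pseries_Re, Hb, Hx.
    - intros x Hx. apply (is_pseries_Re (fun k => RtoC (e k))), H, Hx. }
  assert (Ei : Im (b k) = 0).
  { apply (real_pseries_unique (fun k => Im (b k)) (fun _ => 0) (fun x => Im (f (RtoC x))) rho Hr).
    - intros x Hx. apply is_pseries_Re, Hb, Hx.
    - intros x Hx. apply (is_pseries_Re (fun k => RtoC (e k))), H, Hx. }
  assert (Eb : b k = RtoC (e k)) by (destruct (b k) as [u w]; simpl in Er, Ei; subst; reflexivity).
  rewrite RtoC_mult, <- Eb. unfold b. field. apply fact_neq_0_C.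
Qed.

Definition real_nonneg (z : C) : Prop := 0 <= Re z /\ Im z = 0.

Lemma real_nonneg_closed (z : C) :
  (forall e, 0 < e -> exists w, real_nonneg w /\ Cmod (w - z) < e) -> real_nonneg z.
Proof.
  intros H. split.
  - apply Rnot_lt_le. intros L. destruct (H (- Re z) ltac:(lra)) as [w [[H1 _] H2]].
    pose proof (re_le_Cmod (w - z)) as B. pose proof (Rle_abs (Re (w - z)%C)) as B2.
    change (Re (w - z)%C) with (Re w - Re z) in *. lra.
  - apply NNPP. intros L. apply Rabs_pos_lt in L. destruct (H _ L) as [w [[_ H1] H2]].
    pose proof (im_le_Cmod (w - z)) as B. change (Im (w - z)%C) with (Im w - Im z) in B.
    rewrite H1, Rminus_0_l, Rabs_Ropp in B. lra.
Qed.

Lemma real_nonneg_csum (a : nat -> C) (n : nat) : (forall k, real_nonneg (a k)) -> real_nonneg (sum_n a n : C).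
Proof.
  intros H. induction n as [|n [IH1 IH2]]; [rewrite csum_0; apply H|].
  rewrite csum_S. destruct (H (S n)) as [H1 H2]. split.
  - change (Re (sum_n a n + a (S n))%C) with (Re (sum_n a n : C) + Re (a (S n))). lra.
  - change (Im (sum_n a n + a (S n))%C) with (Im (sum_n a n : C) + Im (a (S n))). lra.
Qed.

(** * Propagation of nonnegative derivatives along a ray *)

Section PositiveRay.
Variables (D : C -> Prop) (f : C -> C).
Hypothesis HD : copen D.
Hypothesis Hray : forall x, 0 <= x -> D (RtoC x).
Hypothesis Hf : holo_on D f.
Hypothesis H0 : forall k, real_nonneg (Dn k f 0).

(** Taylor expansion at s with nonnegative terms. The radius is the same for all k because all
    derivatives share the disc of holomorphy. *)
Lemma positive_step (s : R) : 0 <= s -> (forall k, real_nonneg (Dn k f (RtoC s))) ->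
  exists r, 0 < r /\ forall h, 0 <= h -> h < r -> forall k, real_nonneg (Dn k f (RtoC (s + h))).
Proof.
  intros Hs HP. destruct (HD _ (Hray s Hs)) as [r [Hr Hr']]. exists r. split; [exact Hr|].
  intros h Hh Hhr k.
  assert (Hk : holo_disc (Dn k f) (RtoC s) r) by (intros w Hw; apply (holo_on_Dn D); [exact HD|exact Hf|apply Hr', Hw]).
  pose proof (taylor_series (Dn k f) (RtoC s) (RtoC h) r Hk ltac:(rewrite Cmod_R, Rabs_right; lra)) as T.
  rewrite <- RtoC_plus in T. pose proof (proj1 (is_pseries_C _ _ _) T) as T1.
  apply real_nonneg_closed. intros e He. destruct (T1 e He) as [N HN]. specialize (HN N (le_n N)).
  eexists. split; [|exact HN]. apply real_nonneg_csum. intros j. rewrite Dn_plus.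
  destruct (HP (j + k)%nat) as [P1 P2]. set (z := Dn (j + k) f (RtoC s)) in *.
  replace (z / RtoC (INR (fact j)) * RtoC h ^ j)%C with (RtoC (Re z * (h ^ j / INR (fact j)))).
  - split; [|reflexivity]. change (0 <= Re z * (h ^ j / INR (fact j))). apply Rmult_le_pos; [exact P1|].
    apply Rdiv_le_0_compat; [apply pow_le, Hh|apply INR_fact_lt_0].
  - assert (Ez : z = RtoC (Re z)) by (destruct z as [u w]; simpl in P2; rewrite P2; reflexivity).
    rewrite Ez at 2. unfold Rdiv. rewrite !RtoC_mult, RtoC_pow, RtoC_inv by apply INR_fact_neq_0. unfold Cdiv. ring.
Qed.

(** Continuous induction: the property passes to limits by continuity of each derivative and extends
    to the right by [positive_step]. *)
Lemma positive_ray (X : R) : 0 <= X -> forall k, real_nonneg (Dn k f (RtoC X)).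
Proof.
  intros HX.
  set (E := fun x => 0 <= x <= X /\ forall y, 0 <= y <= x -> forall k, real_nonneg (Dn k f (RtoC y))).
  assert (E0 : E 0).
  { split; [lra|]. intros y Hy k. replace y with 0 by lra. apply H0. }
  destruct (completeness E) as [s [Hs1 Hs2]].
  { exists X. intros x [Hx _]. lra. }
  { exists 0. exact E0. }
  assert (Hs0 : 0 <= s) by (apply Hs1, E0).
  assert (HsX : s <= X) by (apply Hs2; intros x [Hx _]; lra).
  assert (below : forall y, 0 <= y < s -> forall k, real_nonneg (Dn k f (RtoC y))).
  { intros y Hy. apply NNPP. intros N. assert (s <= y); [|lra]. apply Hs2. intros x [Hx Hx'].
    apply Rnot_lt_le. intros L. apply N. intros k. apply Hx'. lra. }
  assert (at_s : forall k, real_nonneg (Dn k f (RtoC s))).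
  { intros k. destruct (Rle_lt_or_eq_dec _ _ Hs0) as [P|P]; [|rewrite <- P; apply H0].
    apply real_nonneg_closed. intros e He.
    destruct (holo_on_Dn D f k HD Hf _ (Hray s Hs0)) as [l Hl].
    destruct (cder_cont _ _ _ Hl e He) as [d [Hd Hd']].
    set (m := Rmin (d / 2) (s / 2)). assert (Hm : 0 < m /\ m <= d / 2 /\ m <= s / 2).
    { unfold m. repeat split; [apply Rmin_pos; lra|apply Rmin_l|apply Rmin_r]. }
    exists (Dn k f (RtoC (s - m))). split; [apply below; lra|].
    apply Hd'. rewrite <- RtoC_minus, Cmod_R, Rabs_left; lra. }
  assert (upto : forall y, 0 <= y <= s -> forall k, real_nonneg (Dn k f (RtoC y))).
  { intros y Hy. destruct (Req_dec y s) as [->|N]; [exact at_s|apply below; lra]. }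
  destruct (Rle_lt_or_eq_dec _ _ HsX) as [L|L]; [exfalso|rewrite <- L; exact at_s].
  destruct (positive_step s Hs0 at_s) as [r [Hr Hr']].
  set (m := Rmin (r / 2) (X - s)). assert (Hm : 0 < m /\ m <= r / 2 /\ m <= X - s).
  { unfold m. repeat split; [apply Rmin_pos; lra|apply Rmin_l|apply Rmin_r]. }
  assert (E (s + m)); [|specialize (Hs1 _ H); lra].
  split; [lra|]. intros y Hy. destruct (Rle_lt_dec y s) as [Q|Q]; [apply upto; lra|].
  replace y with (s + (y - s)) by ring. apply Hr'; lra.
Qed.

Lemma positive_ray_deriv (k : nat) (x : R) : 0 <= x ->
  is_derive (fun x => Re (Dn k f (RtoC x))) x (Re (Dn (S k) f (RtoC x))).
Proof.
  intros Hx. pose proof (holo_on_Dn D f k HD Hf _ (Hray x Hx)) as Hh. apply holo_C_derive in Hh.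
  rewrite <- Dn_S in Hh. set (l := Dn (S k) f (RtoC x)) in *.
  apply is_derive_Reals. intros e He. destruct (Hh (e / 2) ltac:(lra)) as [d [Hd Hd']].
  exists (mkposreal d Hd). intros h Hh0 Hhd. simpl in Hhd.
  specialize (Hd' (RtoC (x + h))). rewrite <- RtoC_minus in Hd'. replace (x + h - x) with h in Hd' by ring.
  rewrite Cmod_R in Hd'. specialize (Hd' Hhd).
  pose proof (re_le_Cmod (Dn k f (RtoC (x + h)) - Dn k f (RtoC x) - l * RtoC h)) as B.
  replace (Re (Dn k f (RtoC (x + h)) - Dn k f (RtoC x) - l * RtoC h)%C) with
    (Re (Dn k f (RtoC (x + h))) - Re (Dn k f (RtoC x)) - Re l * h) in B by (unfold Re; simpl; ring).
  assert (Hpos : 0 < Rabs h) by (apply Rabs_pos_lt, Hh0).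
  replace ((Re (Dn k f (RtoC (x + h))) - Re (Dn k f (RtoC x))) / h - Re l) with
    ((Re (Dn k f (RtoC (x + h))) - Re (Dn k f (RtoC x)) - Re l * h) / h) by (field; exact Hh0).
  rewrite Rabs_div by exact Hh0. apply (Rmult_lt_reg_r (Rabs h)); [exact Hpos|].
  unfold Rdiv. rewrite Rmult_assoc, Rinv_l by lra. nra.
Qed.

Lemma nondecreasing_from_0 (g g' : R -> R) (x : R) : 0 <= x ->
  (forall y, 0 <= y -> is_derive g y (g' y)) -> (forall y, 0 <= y -> 0 <= g' y) -> g 0 <= g x.
Proof.
  intros Hx Hg Hg'. destruct (MVT_gen g 0 x g') as [c [Hc E]].
  - intros y Hy. rewrite Rmin_left in Hy by exact Hx. apply Hg. lra.
  - intros y Hy. rewrite Rmin_left in Hy by exact Hx. apply continuity_pt_filterlim.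
    apply (ex_derive_continuous g). eexists. apply Hg. lra.
  - rewrite Rmin_left in Hc by exact Hx. specialize (Hg' c ltac:(lra)). nra.
Qed.

(** A one-term Taylor bound, obtained by integrating from 0 the inequality for the next derivative;
    the discarded terms are nonnegative. *)
Lemma positive_lower_bound (N k : nat) (x : R) : 0 <= x ->
  Re (Dn (k + N) f 0) * (x ^ N / INR (fact N)) <= Re (Dn k f (RtoC x)).
Proof.
  revert k x. induction N as [|N IH]; intros k x Hx.
  - rewrite Nat.add_0_r. simpl. replace (1 / 1) with 1 by field. rewrite Rmult_1_r.
    apply (nondecreasing_from_0 (fun x => Re (Dn k f (RtoC x))) (fun x => Re (Dn (S k) f (RtoC x))) x Hx).
    + intros y Hy. apply positive_ray_deriv, Hy.
    + intros y Hy. apply positive_ray, Hy.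
  - set (e := Re (Dn (k + S N) f 0)).
    pose proof (nondecreasing_from_0 (fun x => Re (Dn k f (RtoC x)) - e * (x ^ S N / INR (fact (S N))))
      (fun x => Re (Dn (S k) f (RtoC x)) - e * (x ^ N / INR (fact N))) x Hx) as M. cbv beta in M.
    assert (G : Re (Dn k f 0) - e * (0 ^ S N / INR (fact (S N))) <= Re (Dn k f (RtoC x)) - e * (x ^ S N / INR (fact (S N)))).
    { apply M.
      - intros y Hy. apply (is_derive_minus (fun x => Re (Dn k f (RtoC x))) (fun x => e * (x ^ S N / INR (fact (S N))))).
        + apply positive_ray_deriv, Hy.
        + auto_derive; [exact I|]. change (fact N + N * fact N)%nat with (fact (S N)).
          match goal with |- context [match N with O => 1 | S _ => INR N + 1 end] =>
            change (match N with O => 1 | S _ => INR N + 1 end) with (INR (S N)) end.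
          rewrite fact_simpl, mult_INR. field.
          split; [apply INR_fact_neq_0|apply not_0_INR; lia].
      - intros y Hy. specialize (IH (S k) y Hy). replace (S k + N)%nat with (k + S N)%nat in IH by lia. fold e in IH. lra. }
    replace (0 ^ S N) with 0 in G by (simpl; ring). destruct (H0 k) as [P _].
    unfold Rdiv in G at 1. rewrite Rmult_0_l, Rmult_0_r in G. lra.
Qed.
End PositiveRay.

(** These are the odd-degree terms of the series with coefficients - d_(n+1) / n! at the point 2,
    well outside the unit disc. By [quad_rec_growth] each is at least 4 (a^2 - 4/25) / (a (a + 1))
    >= 2 times the preceding one, where a >= 2. *)
Lemma quad_rec_unbounded (d : nat -> R) (B : R) : quad_rec d ->
  exists m, B < - d (2 * m + 2)%nat * (2 ^ (2 * m + 1) / INR (fact (2 * m + 1))).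
Proof.
  intros Hd. set (r := fun m => - d (2 * m + 2)%nat * (2 ^ (2 * m + 1) / INR (fact (2 * m + 1)))).
  assert (r0 : 8 / 25 <= r 0%nat).
  { unfold r. simpl. rewrite (quad_rec_2 d Hd). lra. }
  assert (rS : forall m, 2 * r m <= r (S m)).
  { intros m. unfold r.
    pose proof (quad_rec_growth d (2 * m + 1)%nat Hd) as G. pose proof (quad_rec_sign d Hd (2 * m + 1)%nat) as Sg.
    replace (2 * S m + 2)%nat with (S (S (S (2 * m + 1)))) by lia. replace (2 * m + 2)%nat with (S (2 * m + 1)) by lia.
    replace (2 * S m + 1)%nat with (S (S (2 * m + 1))) by lia. set (n := (2 * m + 1)%nat) in *.
    rewrite !fact_simpl, !mult_INR.
    assert (Hn : 2 <= INR (S n)) by (change 2 with (INR 2); apply le_INR; unfold n; lia).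
    rewrite (S_INR (S n)). set (a := INR (S n)) in *. set (F := 2 ^ n / INR (fact n)).
    assert (HF : 0 < F) by (apply Rdiv_lt_0_compat; [apply pow_lt; lra|apply INR_fact_lt_0]).
    replace (2 ^ S (S n) / ((a + 1) * (a * INR (fact n)))) with (4 / ((a + 1) * a) * F)
      by (unfold F; simpl; field; split; [apply INR_fact_neq_0|split; lra]).
    assert (K : 2 <= (a * a - 4 / 25) * (4 / ((a + 1) * a))).
    { replace ((a * a - 4 / 25) * (4 / ((a + 1) * a))) with (4 * (a * a - 4 / 25) / ((a + 1) * a)) by (field; split; lra).
      apply Rle_div_r; nra. }
    assert (Hc : 0 < 4 / ((a + 1) * a)) by (apply Rdiv_lt_0_compat; nra).
    set (u := - d (S n)) in *. assert (Hu : 0 <= u) by (unfold u; lra).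
    apply Rle_trans with ((a ^ 2 - 4 / 25) * u * (4 / ((a + 1) * a) * F)).
    - replace ((a ^ 2 - 4 / 25) * u * (4 / ((a + 1) * a) * F)) with ((a * a - 4 / 25) * (4 / ((a + 1) * a)) * (u * F)) by ring.
      rewrite <- Rmult_assoc. rewrite (Rmult_assoc 2). apply Rmult_le_compat_r; [apply Rmult_le_pos; lra|exact K].
    - apply Rmult_le_compat_r; [apply Rmult_le_pos; lra|exact G]. }
  assert (rN : forall m, (INR m + 1) * (8 / 25) <= r m).
  { intros m. induction m as [|m IH]; [simpl; lra|]. rewrite S_INR.
    assert (P : 0 <= INR m * (8/25)) by (apply Rmult_le_pos; [apply pos_INR|lra]). specialize (rS m). lra. }
  destruct (nfloor_ex (Rmax 0 (B * 25 / 8)) (Rmax_l _ _)) as [m [_ Hm]]. exists m. fold (r m).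
  pose proof (Rmax_r 0 (B * 25 / 8)). specialize (rN m). lra.
Qed.

(* All Taylor coefficients at 0 are nonnegative, so by positivity (Pringsheim) a continuation along the
   positive axis would dominate each single term of the series, but these terms are unbounded far out. *)
Lemma borel_no_continuation (d : nat -> R) (y rho : R) (D : C -> Prop) (f : C -> C) :
  quad_rec d -> 0 < y -> 0 < rho -> copen D -> (forall x, 0 <= x -> D (RtoC x)) -> holo_on D f ->
  (forall x, Rabs x < rho -> is_pseries (K := C_AbsRing) (V := C_NormedModule)
     (fun k => RtoC (- d (S k) * y ^ k / INR (fact k))) (RtoC x) (f (RtoC x))) -> False.
Proof.
  intros Hd Hy Hrho HD Hray Hf Hs.
  destruct (HD _ (Hray 0 (Rle_refl 0))) as [r [Hr Hr']].
  set (m := Rmin r rho). assert (Hm : 0 < m /\ m <= r /\ m <= rho).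
  { unfold m. repeat split; [apply Rmin_pos; lra|apply Rmin_l|apply Rmin_r]. }
  assert (E : forall k, Dn k f 0 = RtoC (- d (S k) * y ^ k)).
  { intros k. rewrite (Dn_of_series f (fun k => - d (S k) * y ^ k / INR (fact k)) m).
    - f_equal. field. apply INR_fact_neq_0.
    - apply Hm.
    - intros w Hw. apply Hf, Hr'. lra.
    - intros x Hx. apply Hs. lra. }
  assert (H0 : forall k, real_nonneg (Dn k f 0)).
  { intros k. rewrite E. split; [|reflexivity]. change (0 <= - d (S k) * y ^ k).
    apply Rmult_le_pos; [pose proof (quad_rec_sign d Hd k); lra|apply pow_le; lra]. }
  destruct (quad_rec_unbounded d (Re (f (RtoC (2 / y)))) Hd) as [N HN].
  assert (Hx : 0 <= 2 / y) by (apply Rdiv_le_0_compat; lra).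
  pose proof (positive_lower_bound D f HD Hray Hf H0 (2 * N + 1) 0 (2 / y) Hx) as B.
  rewrite Nat.add_0_l, E in B. simpl Dn in B.
  change (Re (RtoC (- d (S (2 * N + 1)) * y ^ (2 * N + 1)))) with (- d (S (2 * N + 1)) * y ^ (2 * N + 1)) in B.
  replace (S (2 * N + 1)) with (2 * N + 2)%nat in B by lia.
  replace ((2 / y) ^ (2 * N + 1)) with (2 ^ (2 * N + 1) * / y ^ (2 * N + 1)) in B by (unfold Rdiv; rewrite Rpow_mult_distr, pow_inv; reflexivity).
  replace (- d (2 * N + 2)%nat * y ^ (2 * N + 1) * (2 ^ (2 * N + 1) * / y ^ (2 * N + 1) / INR (fact (2 * N + 1)))) with
    (- d (2 * N + 2)%nat * (2 ^ (2 * N + 1) / INR (fact (2 * N + 1)))) in B.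
  - lra.
  - field. split; [apply pow_nonzero; lra|apply INR_fact_neq_0].
Qed.

(** If X missed both edges, the cone and its open exterior would separate it. *)
Lemma cone_boundary (beta g : R) (X : C -> Prop) : 0 < beta < PI / 2 ->
  copen X -> connected (T := C_UniformSpace) X ->
  (exists z, X z /\ cone beta (z * cis (- g))%C) -> (exists z, X z /\ ~ cone beta (z * cis (- g))%C) ->
  exists r phi, 0 < r /\ (phi = beta \/ phi = - beta) /\ X (RtoC r * cis (phi + g))%C.
Proof.
  intros Hb HX Hc [z0 [X0 C0]] [z1 [X1 C1]]. apply NNPP. intros Hno.
  assert (Hs : 0 < sin beta) by (apply sin_gt_0; lra).
  assert (Hco : 0 < cos beta) by (apply cos_gt_0; lra).
  set (L := fun (e : R) (z : C) => Re (z * cis (- g))%C * - sin beta + Im (z * cis (- g))%C * (e * cos beta)).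
  assert (Hedge : forall e a z, e = 1 \/ e = - (1) -> 0 <= a -> X z -> (z * cis (- g))%C = (a * cos beta, e * (a * sin beta)) -> False).
  { intros e a z He Ha Hz E.
    assert (P : forall r, 0 < r -> ~ X (RtoC r * cis (e * beta + g))%C).
    { intros r Hr HXr. apply Hno. exists r, (e * beta). split; [exact Hr|]. split; [|exact HXr].
      destruct He as [-> | ->]; [left|right]; ring. }
    assert (Ez : z = (RtoC a * cis (e * beta + g))%C).
    { rewrite <- (cis_cancel z g). rewrite E, cis_plus, Cmult_assoc. f_equal.
      unfold cis. destruct He as [-> | ->].
      - rewrite !Rmult_1_l. unfold Cmult, RtoC; simpl. f_equal; ring.
      - replace (- (1) * beta) with (- beta) by ring. rewrite cos_neg, sin_neg. unfold Cmult, RtoC; simpl. f_equal; ring. }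
    destruct (Rle_lt_or_eq_dec _ _ Ha) as [Ha'|Ha'].
    - apply (P a Ha'). rewrite <- Ez. exact Hz.
    (* At the apex, openness of X supplies a nonzero point of the same edge instead. *)
    - subst a. destruct (HX z Hz) as [r [Hr Hr']]. apply (P (r / 2) ltac:(lra)). apply Hr'.
      rewrite Ez. replace (RtoC (r / 2) * cis (e * beta + g) - 0 * cis (e * beta + g))%C with (RtoC (r / 2) * cis (e * beta + g))%C by ring.
      rewrite Cmod_scal, Cmod_cis by lra. lra. }
  assert (Hcov : forall z, X z -> cone beta (z * cis (- g))%C \/ (0 < L 1 z \/ 0 < L (- (1)) z)).
  { intros z Xz. destruct (classic (cone beta (z * cis (- g))%C)) as [Cz|Cz]; [left; exact Cz|right].
    apply NNPP. intros N. apply not_or_and in N. destruct N as [N1 N2]. apply Rnot_lt_le in N1. apply Rnot_lt_le in N2.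
    unfold L in N1, N2. unfold cone in Cz.
    assert (Hz : (z * cis (- g))%C = (Re (z * cis (- g))%C, Im (z * cis (- g))%C)) by (destruct (z * cis (- g))%C; reflexivity).
    set (a := Re (z * cis (- g))%C) in *. set (b := Im (z * cis (- g))%C) in *.
    assert (Ha : 0 <= a) by nra.
    assert (Ha2 : a = a / cos beta * cos beta) by (field; lra).
    destruct (Req_dec (a * sin beta - b * cos beta) 0) as [Q|Q].
    - apply (Hedge 1 (a / cos beta) z); [left; reflexivity|apply Rdiv_le_0_compat; lra|exact Xz|].
      rewrite Hz. f_equal; [exact Ha2|]. rewrite Rmult_1_l. apply (Rmult_eq_reg_r (cos beta)); [|lra].
      replace (a / cos beta * sin beta * cos beta) with (a * sin beta) by (field; lra). lra.
    - apply (Hedge (- (1)) (a / cos beta) z); [right; reflexivity|apply Rdiv_le_0_compat; lra|exact Xz|].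
      rewrite Hz. f_equal; [exact Ha2|]. apply (Rmult_eq_reg_r (cos beta)); [|lra].
      replace (- (1) * (a / cos beta * sin beta) * cos beta) with (- (a * sin beta)) by (field; lra).
      destruct (Req_dec (a * sin beta + b * cos beta) 0) as [Q'|Q']; [lra|]. exfalso. apply Cz. lra. }
  destruct (Hc (fun z => cone beta (z * cis (- g))%C) (fun z => 0 < L 1 z \/ 0 < L (- (1)) z)) as [z [Xz [Az Bz]]].
  - apply copen_open, cone_open, Cmod_cis.
  - assert (HL : forall e, e = 1 \/ e = - (1) -> copen (fun z => 0 < L e z)).
    { intros e He. apply half_plane_open; [rewrite Rabs_Ropp; apply Rabs_sin| |apply Cmod_cis].
      rewrite Rabs_mult. replace (Rabs e) with 1; [rewrite Rmult_1_l; apply Rabs_cos|].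
      destruct He as [-> | ->]; [rewrite Rabs_right|rewrite Rabs_left]; lra. }
    apply copen_open. intros z [Hz|Hz]; [destruct (HL 1 (or_introl eq_refl) z Hz) as [r [Hr Hr']]|destruct (HL (- (1)) (or_intror eq_refl) z Hz) as [r [Hr Hr']]];
      exists r; split; try exact Hr; intros w Hw; [left|right]; apply Hr', Hw.
  - exact Hcov.
  - exists z0. auto.
  - exists z1. split; [exact X1|]. destruct (Hcov z1 X1) as [Q|Q]; [contradiction|exact Q].
  - unfold cone in Az. unfold L in Bz. lra.
Qed.

Lemma ccont_limit_zero (F : R -> C) : ccont F 1 -> (forall s, 0 < s < 1 -> F s = 0) -> F 1 = 0.
Proof.
  intros HF H. apply Ceq_of_small. intros e He.
  destruct (proj1 (ccont_eps F 1) HF e He) as [d [Hd Hd']].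
  set (s := Rmax (1 / 2) (1 - d / 2)). assert (Hs : 1 / 2 <= s < 1 /\ 1 - d / 2 <= s).
  { unfold s. split; [split; [apply Rmax_l|apply Rmax_lub_lt; lra]|apply Rmax_r]. }
  specialize (Hd' s ltac:(rewrite Rabs_left; lra)). rewrite (H s ltac:(lra)) in Hd'.
  rewrite Cmod_sub_sym. lra.
Qed.

(** Decides which of the two roots q'_0 takes on the edge: approach it along an arc of constant
    radius inside V, where q'_0 is tau, and use continuity. *)
Lemma boundary_branch_value (th r phi : R) (V : C -> Prop) (q q' : nat -> C -> C) :
  (forall tau, V tau <-> cone (PI / 5) (tau * cis (- th))%C) ->
  (forall tau, V tau -> q O (tau_to_t tau) = tau) ->
  (forall t, t_projection V t -> q' 0%nat t = q 0%nat t) ->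
  0 < r -> Rabs phi = 2 * PI / 5 -> holo_at (q' 0%nat) (tau_to_t (RtoC r * cis (phi / 2 + th))%C) ->
  q' 0%nat (tau_to_t (RtoC r * cis (phi / 2 + th))%C) = (RtoC r * cis (phi / 2 + th))%C.
Proof.
  intros HV Hq Hq' Hr Hphi [l Hl]. pose proof PI_RGT_0 as HPI.
  set (u := fun s : R => (RtoC r * cis (s * (phi / 2) + th))%C).
  assert (Hu : ccont u 1).
  { apply ccont_mult; [apply ccont_const|]. apply ccont_cis.
    apply (ex_derive_continuous (fun s => s * (phi / 2) + th)). auto_derive. exact I. }
  assert (Eu : u 1 = (RtoC r * cis (phi / 2 + th))%C) by (unfold u; rewrite Rmult_1_l; reflexivity).
  rewrite <- Eu in Hl |- *.
  assert (F0 : (q' 0%nat (tau_to_t (u 1)) - u 1)%C = 0).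
  { apply (ccont_limit_zero (fun s => q' 0%nat (tau_to_t (u s)) - u s)%C).
    - apply ccont_minus; [|exact Hu]. apply (ccont_comp_cder (q' 0%nat) (fun s => tau_to_t (u s)) 1 l Hl).
      apply ccont_mult; [apply ccont_const|apply ccont_mult; exact Hu].
    - intros s Hs. assert (Vu : V (u s)).
      { apply HV. unfold u. rewrite <- Cmult_assoc, <- cis_plus. apply polar_cone; [lra|exact Hr|].
        replace (s * (phi / 2) + th + - th) with (s * (phi / 2)) by ring.
        unfold Rabs in Hphi. destruct (Rcase_abs phi); split; nra. }
      rewrite Hq' by (exists (u s); auto). rewrite Hq by exact Vu. ring. }
  replace (q' 0%nat (tau_to_t (u 1))) with ((q' 0%nat (tau_to_t (u 1)) - u 1) + u 1)%C by ring. rewrite F0. ring.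
Qed.

(** On a Stokes ray Y e^(i alpha) is a positive number y. At xi = x e^(i alpha) the Borel series is
    then tau Y times the sum of d_(k+1) (y x)^k / k!, and division by - tau Y leads to
    [borel_no_continuation]. *)
Lemma not_summable_on_stokes_ray (alpha rho : R) (W : C -> Prop) (q : nat -> C -> C) (t : C) :
  copen W -> formal_solution W q -> (forall t, W t -> q 0%nat t <> 0) -> W t ->
  0 < rho -> (q 0%nat t ^ 5)%C = (RtoC (rho ^ 5) * cis (2 * alpha))%C ->
  forall D K0 K1 omega, ~ borel_continuation q t alpha D K0 K1 omega.
Proof.
  intros HW Hq Hq0 Wt Hrho E5 D K0 K1 omega [OD [Dray [Hom [[r [Hr Hs]] _]]]].
  destruct quad_rec_ex as [d Hd].
  assert (Hr5 : 0 < rho ^ 5) by (apply pow_lt, Hrho).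
  set (y := sqrt (25 / 6912 / rho ^ 5)).
  assert (Hk : 0 < 25 / 6912 / rho ^ 5) by (apply Rdiv_lt_0_compat; lra).
  assert (Hy : 0 < y) by (apply sqrt_lt_R0, Hk).
  assert (Hyy : y * y = 25 / 6912 / rho ^ 5) by (apply sqrt_sqrt; lra).
  set (tau := q 0%nat t) in *. assert (Htau : tau <> 0) by (apply Hq0, Wt).
  set (Y := (RtoC y * cis (- alpha))%C).
  assert (HYn : Y <> 0) by (apply Cmult_neq_0; [apply RtoC_neq_0; lra|apply cis_neq_0]).
  assert (HY : (Y * Y * tau ^ 5)%C = RtoC (25 / 6912)).
  { rewrite E5. unfold Y. replace (2 * alpha) with (alpha + alpha) by ring. rewrite cis_plus.
    transitivity (RtoC (y * y * rho ^ 5) * (cis alpha * cis (- alpha)) * (cis alpha * cis (- alpha)))%C.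
    - rewrite !RtoC_mult. ring.
    - rewrite cis_opp_r, Hyy. replace (25 / 6912 / rho ^ 5 * rho ^ 5) with (25 / 6912) by (field; lra). ring. }
  assert (Hcoef : forall n, q n t = (RtoC (d n) * tau * Y ^ n)%C).
  { intros n. apply (formal_coeffs W q HW Hq Hq0 d Hd n t Y Wt HY). }
  apply (borel_no_continuation d y r (fun z => D (z * cis alpha)%C) (fun z => - / (tau * Y) * omega (z * cis alpha)%C)%C Hd Hy Hr).
  - intros z Hz. destruct (proj1 (open_C_disc D) OD _ Hz) as [e [He He']]. exists e. split; [exact He|].
    intros w Hw. apply He'. replace (w * cis alpha - z * cis alpha)%C with ((w - z) * cis alpha)%C by ring.
    rewrite Cmod_mult, Cmod_cis, Rmult_1_r. exact Hw.
  - intros x Hx. apply Dray. exists x. auto.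
  - intros z Hz. destruct (proj1 (ex_derive_cder omega _) (Hom _ Hz)) as [l Hl].
    eexists. apply cder_scal. apply (cder_comp omega (fun z => z * cis alpha)%C); [exact Hl|].
    apply cder_mult; [apply cder_id|apply cder_const].
  - intros x Hx. apply is_pseries_C. intros e He.
    assert (Hc : Cmod (RtoC x * cis alpha) < r) by (rewrite Cmod_mult, Cmod_cis, Cmod_R; lra).
    assert (HC : 0 < Cmod (- / (tau * Y)))
      by (rewrite Cmod_opp, Cmod_inv by (apply Cmult_neq_0; assumption); apply Rinv_0_lt_compat, Cmod_gt_0, Cmult_neq_0; assumption).
    destruct (proj1 (is_pseries_C _ _ _) (Hs _ Hc) (e / Cmod (- / (tau * Y))) ltac:(apply Rdiv_lt_0_compat; assumption)) as [N HN].
    exists N. intros n Hn. specialize (HN n Hn).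
    rewrite (csum_ext _ (fun k => - / (tau * Y) * (borel_coeff q t k * (RtoC x * cis alpha) ^ k))%C).
    + rewrite sum_n_Cmult_l.
      match goal with |- Cmod (?a * ?b - ?a * ?c) < _ => replace (a * b - a * c)%C with (a * (b - c))%C by ring end.
      rewrite Cmod_mult. apply (Rmult_lt_compat_l _ _ _ HC) in HN.
      replace (Cmod (- / (tau * Y)) * (e / Cmod (- / (tau * Y)))) with e in HN by (field; lra). exact HN.
    + intros k _. unfold borel_coeff. rewrite Hcoef.
      rewrite Cpow_mult_l. rewrite Cpow_S.
      assert (EY : (Y ^ k * cis alpha ^ k)%C = RtoC (y ^ k)).
      { rewrite <- Cpow_mult_l. unfold Y. rewrite <- Cmult_assoc, (Cmult_comm (cis (- alpha))), cis_opp_r, Cmult_1_r, RtoC_pow. reflexivity. }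
      transitivity (- (RtoC (d (S k)) * (Y ^ k * cis alpha ^ k) / RtoC (INR (fact k))) * RtoC x ^ k)%C.
      * rewrite EY. unfold Rdiv. rewrite !RtoC_mult, RtoC_opp, RtoC_inv by apply INR_fact_neq_0. unfold Cdiv. ring.
      * field. split; [apply fact_neq_0_C|split; assumption].
Qed.

Theorem borel_maximality (alpha th : R) (V : C -> Prop) (q : nat -> C -> C) :
  cis (5 * th) = (- cis (2 * alpha))%C ->
  (exists tau, V tau) ->
  (forall tau, V tau <-> cone (PI / 5) (tau * cis (- th))%C) ->
  (forall tau, V tau -> q O (tau_to_t tau) = tau) ->
  ~ (exists (U' : C -> Prop) (q' : nat -> C -> C),
       domain U' /\
       (forall t, t_projection V t -> U' t) /\ (exists t, U' t /\ ~ t_projection V t) /\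
       formal_solution U' q' /\
       (forall n t, t_projection V t -> q' n t = q n t) /\
       stably_borel_summable_locally_uniformly q' alpha U').
Proof.
  intros H5 [tau0 V0] HV Hq [U' [q' [[OU [_ CU]] [Hsub [[t0 [Ht0 Nt0]] [Hf [Hqq Hsum]]]]]]].
  pose proof PI_RGT_0 as HPI.
  pose proof (t_projection_cone V th HV) as HU.
  (* The minus sign in t = -6 tau^2 moves the axis of U to the phase 2 th - PI. *)
  assert (Hrot : forall t, (- t * cis (- (2 * th)))%C = (t * cis (- (2 * th - PI)))%C).
  { intros t. replace (- (2 * th - PI)) with (PI + - (2 * th)) by ring. rewrite cis_plus.
    replace (cis PI) with (- (1))%C by (unfold cis; rewrite cos_PI, sin_PI; apply injective_projections; simpl; ring). ring. }
  assert (OU' : copen U') by (exact (proj1 (open_C_disc U') OU)).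
  destruct (cone_boundary (2 * PI / 5) (2 * th - PI) U' ltac:(lra) OU' CU) as [R0 [phi [HR0 [Hphi HX]]]].
  { exists (tau_to_t tau0). assert (T : t_projection V (tau_to_t tau0)) by (exists tau0; auto).
    split; [apply Hsub, T|]. rewrite <- Hrot. apply HU, T. }
  { exists t0. split; [exact Ht0|]. rewrite <- Hrot. intros Q. apply Nt0, HU, Q. }
  set (rho := sqrt (R0 / 6)). assert (Hrr : rho * rho = R0 / 6) by (apply sqrt_sqrt; lra).
  assert (Hrho : 0 < rho) by (apply sqrt_lt_R0; lra).
  set (tau1 := (RtoC rho * cis (phi / 2 + th))%C).
  assert (Et : (RtoC R0 * cis (phi + (2 * th - PI)))%C = tau_to_t tau1).
  { unfold tau_to_t, tau1. replace R0 with (6 * (rho * rho)) by lra.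
    replace (phi + (2 * th - PI)) with ((phi / 2 + th) + (phi / 2 + th) + - PI) by field.
    rewrite !cis_plus, !RtoC_mult. replace (RtoC (-6)) with (- (6))%C by (rewrite <- RtoC_opp; reflexivity).
    replace (cis (- PI)) with (- (1))%C by (unfold cis; rewrite cos_neg, sin_neg, cos_PI, sin_PI; apply injective_projections; simpl; ring). ring. }
  rewrite Et in HX.
  assert (Hval : q' 0%nat (tau_to_t tau1) = tau1).
  { apply (boundary_branch_value th rho phi V q q' HV Hq); [intros t Ht; apply Hqq, Ht|exact Hrho| |].
    - destruct Hphi as [-> | ->]; [rewrite Rabs_right|rewrite Rabs_left]; lra.
    - apply ex_derive_cder, (proj1 Hf), HX. }
  destruct (Hsum _ HX) as [N [ON [Nt [_ [delta [Hdelta Hb]]]]]].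
  destruct (Hb alpha ltac:(rewrite Rminus_diag, Rabs_R0; exact Hdelta)) as [D [K0 [K1 HB]]].
  destruct (HB _ Nt) as [omega Hom].
  (* U' may contain 0, where q'_0 vanishes; [formal_coeffs] is applied away from it. *)
  set (W := fun t => U' t /\ t <> 0).
  assert (HW : copen W).
  { intros t [Ut Nz]. destruct (OU' t Ut) as [r [Hr Hr']]. exists (Rmin r (Cmod t)).
    split; [apply Rmin_pos; [exact Hr|apply Cmod_gt_0, Nz]|]. intros w Hw. split.
    - apply Hr'. eapply Rlt_le_trans; [exact Hw|apply Rmin_l].
    - intros ->. replace (0 - t)%C with (- t)%C in Hw by ring. rewrite Cmod_opp in Hw.
      pose proof (Rmin_r r (Cmod t)). lra. }
  assert (HfW : formal_solution W q').
  { split; [intros n t [Ut _]; apply (proj1 Hf), Ut|intros n t [Ut _]; apply (proj2 Hf), Ut]. }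
  assert (Ht1 : tau1 <> 0) by (apply Cmult_neq_0; [apply RtoC_neq_0; lra|apply cis_neq_0]).
  apply (not_summable_on_stokes_ray alpha rho W q' (tau_to_t tau1) HW HfW) in Hom; [exact Hom| | |exact Hrho|].
  - intros t Wt E. pose proof (formal_q0_eq W q' HfW t Wt) as F. rewrite E in F.
    apply (proj2 Wt). rewrite <- F. ring.
  - split; [exact HX|]. apply Cmult_neq_0; [apply RtoC_neq_0; lra|apply Cmult_neq_0; exact Ht1].
  - rewrite Hval. unfold tau1. rewrite Cpow_mult_l, RtoC_pow, cis_pow. f_equal.
    (* Both edges differ from th by PI / 5, so the fifth power gains a sign and - cis (2 alpha)
       becomes cis (2 alpha): tau1 lies on a Stokes line. *)
    replace (INR 5) with 5 by (simpl; ring).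
    destruct Hphi as [-> | ->].
    + replace (5 * (2 * PI / 5 / 2 + th)) with (PI + 5 * th) by field. rewrite cis_plus, H5.
      replace (cis PI) with (- (1))%C by (unfold cis; rewrite cos_PI, sin_PI; apply injective_projections; simpl; ring). ring.
    + replace (5 * (- (2 * PI / 5) / 2 + th)) with (- PI + 5 * th) by field. rewrite cis_plus, H5.
      replace (cis (- PI)) with (- (1))%C by (unfold cis; rewrite cos_neg, sin_neg, cos_PI, sin_PI; apply injective_projections; simpl; ring). ring.
Qed.

(** * The domain of the Borel resummation *)

Lemma connected_pairwise {T : UniformSpace} (X : T -> Prop) :
  (forall x y, X x -> X y -> exists Y, connected Y /\ (forall z, Y z -> X z) /\ Y x /\ Y y) -> connected X.
Proof.
  intros H A B HA HB Hc [x [Xx Ax]] [y [Xy By]].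
  destruct (H x y Xx Xy) as [Y [HY [HYX [Yx Yy]]]].
  destruct (HY A B HA HB) as [z [Yz Hz]]; [intros z Hz; apply Hc, HYX, Hz|exists x; auto|exists y; auto|].
  exists z. auto.
Qed.

(** The projections of two open pieces covering UU are open and cover U, hence share a point t;
    connectedness of the fibre over t then makes the pieces meet. *)
Lemma fibred_connected (U : C -> Prop) (UU : C * C -> Prop) :
  copen U -> connected (T := C_UniformSpace) U ->
  open (T := prod_UniformSpace C_UniformSpace C_UniformSpace) UU ->
  (forall t h, UU (t, h) -> U t) -> (forall t, U t -> exists h, UU (t, h)) ->
  (forall t, U t -> connected (T := C_UniformSpace) (fun h => UU (t, h))) ->
  connected (T := prod_UniformSpace C_UniformSpace C_UniformSpace) UU.
Proof.
  intros HU CU OUU Hsub Hne Hfib A B HA HB Hcov [[ta ha] [Ua Aa]] [[tb hb] [Ub Bb]].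
  assert (P : forall X, open (T := prod_UniformSpace C_UniformSpace C_UniformSpace) X ->
    copen (fun t => exists h, UU (t, h) /\ X (t, h)) /\ (forall t, copen (fun h => X (t, h)))).
  { intros X HX. split.
    - intros t [h [Uh Xh]].
      destruct (proj1 (locally_CC _ _ _) (OUU _ Uh)) as [r [Hr Hr']]. destruct (proj1 (locally_CC _ _ _) (HX _ Xh)) as [s [Hs Hs']].
      exists (Rmin r s). split; [apply Rmin_pos; assumption|]. intros w Hw. exists h. split.
      + apply Hr'; [eapply Rlt_le_trans; [exact Hw|apply Rmin_l]|rewrite Cmod_sub_self; exact Hr].
      + apply Hs'; [eapply Rlt_le_trans; [exact Hw|apply Rmin_r]|rewrite Cmod_sub_self; exact Hs].
    - intros t h Xh. destruct (proj1 (locally_CC _ _ _) (HX _ Xh)) as [s [Hs Hs']].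
      exists s. split; [exact Hs|]. intros w Hw. apply Hs'; [rewrite Cmod_sub_self; exact Hs|exact Hw]. }
  destruct (CU (fun t => exists h, UU (t, h) /\ A (t, h)) (fun t => exists h, UU (t, h) /\ B (t, h))) as [t [Ut [[h1 [U1 A1]] [h2 [U2 B2]]]]].
  - apply copen_open, (proj1 (P A HA)).
  - apply copen_open, (proj1 (P B HB)).
  - intros t Ut. destruct (Hne t Ut) as [h Uh]. destruct (Hcov _ Uh) as [Q|Q]; [left|right]; exists h; auto.
  - exists ta. split; [apply (Hsub _ _ Ua)|exists ha; auto].
  - exists tb. split; [apply (Hsub _ _ Ub)|exists hb; auto].
  - destruct (Hfib t Ut (fun h => A (t, h)) (fun h => B (t, h))) as [h [Uh Hh]].
    + apply copen_open, (proj2 (P A HA)).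
    + apply copen_open, (proj2 (P B HB)).
    + intros h Uh. apply Hcov, Uh.
    + exists h1. auto.
    + exists h2. auto.
    + exists (t, h). auto.
Qed.

Lemma asymptotic_unique (q : nat -> C -> C) (f g : C -> C -> C) (U1 U2 : C -> Prop) (alpha c : R) (t : C) :
  0 < c -> U1 t -> U2 t -> holo_on (tdisc alpha c) (f t) -> holo_on (tdisc alpha c) (g t) ->
  factorial_bounds q f U1 (tdisc alpha c) -> factorial_bounds q g U2 (tdisc alpha c) ->
  forall h, tdisc alpha c h -> (f t h - g t h)%C = 0.
Proof.
  intros Hc H1 H2 Hf Hg [K1 [M1 [HK1 [HM1 B1]]]] [K2 [M2 [HK2 [HM2 B2]]]].
  pose proof (Rmax_l M1 M2) as L1. pose proof (Rmax_r M1 M2) as L2.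
  apply (watson alpha c (K1 + K2) (Rmax M1 M2) (fun h => f t h - g t h)%C); [exact Hc|lra|lra| |].
  - intros h Hh. destruct (Hf h Hh) as [l Hl]. destruct (Hg h Hh) as [m Hm]. eexists. apply cder_minus; [exact Hl|exact Hm].
  - intros n h Hh. specialize (B1 n t h H1 Hh). specialize (B2 n t h H2 Hh).
    set (s := partial_sum (fun k => q k t * h ^ k)%C n) in *.
    replace (f t h - g t h)%C with ((f t h - s) - (g t h - s))%C by ring.
    eapply Rle_trans; [apply Cmod_triangle_sub|].
    assert (P : forall K M, 0 < K -> 0 < M -> M <= Rmax M1 M2 ->
      K * M ^ n * INR (fact n) * Cmod h ^ n <= K * (Rmax M1 M2 ^ n * INR (fact n) * Cmod h ^ n)).
    { intros K M HK HM HL. rewrite !Rmult_assoc. apply Rmult_le_compat_l; [lra|]. apply Rmult_le_compat_r.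
      - apply Rmult_le_pos; [apply pos_INR|apply pow_le, Cmod_ge_0].
      - apply pow_incr. lra. }
    pose proof (P K1 M1 HK1 HM1 L1). pose proof (P K2 M2 HK2 HM2 L2).
    rewrite !(Rmult_assoc (K1 + K2)), Rmult_plus_distr_r. rewrite Rmult_assoc in *. lra.
Qed.

Section Resummation.
Variables (alpha : R) (U : C -> Prop) (q : nat -> C -> C) (v : C -> C) (N : C -> C -> Prop) (c : C -> R).
Hypothesis HU : copen U.
Hypothesis Uconv : convexC U.
Hypothesis Une : exists t, U t.
Hypothesis good : forall t, U t -> resum_good alpha U q v t (N t) (c t).

(** A union of products of local neighbourhoods with tangent discs. The value c varies with t0, so a
    fibre is a union of nested discs, and its point h may belong to a larger disc than the one
    attached to t. *)
Definition resum_domain (p : C * C) : Prop :=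
  exists t0, U t0 /\ N t0 (fst p) /\ tdisc alpha (c t0) (snd p).

Lemma resum_domain_sub (t h : C) : resum_domain (t, h) -> U t.
Proof. intros [t0 [U0 [Nt _]]]. destruct (good t0 U0) as [_ [_ [H _]]]. apply H, Nt. Qed.

Lemma resum_domain_open : open (T := prod_UniformSpace C_UniformSpace C_UniformSpace) resum_domain.
Proof.
  intros [t h] [t0 [U0 [Nt Dh]]]. destruct (good t0 U0) as [ON [_ [_ [Hc _]]]]. simpl in Nt, Dh.
  destruct (ON t Nt) as [r [Hr Hr']]. destruct (tdisc_open alpha (c t0) Hc h Dh) as [s [Hs Hs']].
  apply locally_CC. exists (Rmin r s). split; [apply Rmin_pos; assumption|]. intros x y Hx Hy.
  exists t0. split; [exact U0|]. split.
  - apply Hr'. eapply Rlt_le_trans; [exact Hx|apply Rmin_l].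
  - apply Hs'. eapply Rlt_le_trans; [exact Hy|apply Rmin_r].
Qed.

Lemma resum_domain_tdisc (t0 t h : C) : U t0 -> N t0 t -> tdisc alpha (c t0) h -> resum_domain (t, h).
Proof. intros U0 Nt Hh. exists t0. auto. Qed.

Lemma resum_domain_connected : connected (T := prod_UniformSpace C_UniformSpace C_UniformSpace) resum_domain.
Proof.
  apply (fibred_connected U); [exact HU|apply convex_connected, Uconv|apply resum_domain_open|apply resum_domain_sub| |].
  - intros t Ut. destruct (good t Ut) as [_ [Nt [_ [Hc _]]]]. destruct (tdisc_nonempty alpha (c t) Hc) as [h Hh].
    exists h. apply (resum_domain_tdisc t); assumption.
  - intros t Ut. apply connected_pairwise. intros h1 h2 [t1 [U1 [N1 D1]]] [t2 [U2 [N2 D2]]]. simpl in N1, D1, N2, D2.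
    destruct (good t1 U1) as [_ [_ [_ [Hc1 _]]]]. destruct (good t2 U2) as [_ [_ [_ [Hc2 _]]]].
    (* The tangent disc with the smaller c contains both points. *)
    destruct (Rle_lt_dec (c t1) (c t2)) as [L|L].
    + exists (tdisc alpha (c t1)). split; [apply convex_connected, tdisc_convex, Hc1|]. split; [|split].
      * intros z Hz. apply (resum_domain_tdisc t1); assumption.
      * exact D1.
      * apply (tdisc_mono alpha (c t1) (c t2)); assumption.
    + exists (tdisc alpha (c t2)). split; [apply convex_connected, tdisc_convex, Hc2|]. split; [|split].
      * intros z Hz. apply (resum_domain_tdisc t2); assumption.
      * apply (tdisc_mono alpha (c t2) (c t1)); [lra|assumption].
      * exact D2.
Qed.

Lemma resum_domain_domain : domain (T := prod_UniformSpace C_UniformSpace C_UniformSpace) resum_domain.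
Proof.
  split; [apply resum_domain_open|split; [|apply resum_domain_connected]].
  destruct Une as [t Ut]. destruct (good t Ut) as [_ [Nt [_ [Hc _]]]].
  destruct (tdisc_nonempty alpha (c t) Hc) as [h Hh]. exists (t, h). apply (resum_domain_tdisc t); assumption.
Qed.

Lemma resum_holomorphic : holomorphic2_on resum_domain (resum alpha q v).
Proof.
  intros [t h] [t0 [U0 [Nt Dh]]]. destruct (good t0 U0) as [_ [_ [_ [_ [H _]]]]].
  destruct (H t h Nt Dh) as [_ [a [b Hab]]]. exact (cder2_filterdiff _ t h a b Hab).
Qed.

(** The factorial bounds at t hold on the disc attached to t itself, where [watson] gives equality.
    For h in the disc of another t0 the identity is continued from the small segment that both discs
    share. *)
Lemma resum_unique (f : C -> C -> C) :
  holomorphic2_on resum_domain f ->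
  locally_uniformly_asymptotic q U resum_domain (fun t => tdisc alpha (c t)) f ->
  forall t h, resum_domain (t, h) -> f t h = resum alpha q v t h.
Proof.
  intros Hf Hasy t h Hth. pose proof (resum_domain_sub t h Hth) as Ut.
  assert (Hh : forall g, holomorphic2_on resum_domain g -> forall t0, U t0 -> N t0 t -> holo_on (tdisc alpha (c t0)) (g t)).
  { intros g Hg t0 U0 Nt0 w Hw. apply filterdiff_slice. apply Hg. apply (resum_domain_tdisc t0); assumption. }
  destruct (good t Ut) as [_ [Nt [_ [Hc [_ HB]]]]].
  destruct (Hasy t Ut) as [U0 [_ [U0t [_ [_ HB']]]]].
  destruct Hth as [t0 [Ut0 [Nt0 Dh]]]. simpl in Nt0, Dh. destruct (good t0 Ut0) as [_ [_ [_ [Hc0 _]]]].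
  assert (E : (f t h - resum alpha q v t h)%C = 0).
  { apply (tdisc_identity alpha (c t0) (/ c t) (fun h => f t h - resum alpha q v t h)%C Hc0 (Rinv_0_lt_compat _ Hc)); [| |exact Dh].
    - intros w Hw. destruct (Hh f Hf t0 Ut0 Nt0 w Hw) as [l Hl].
      destruct (Hh _ resum_holomorphic t0 Ut0 Nt0 w Hw) as [m Hm]. eexists. apply cder_minus; [exact Hl|exact Hm].
    - intros x Hx Hxc. apply (asymptotic_unique q f (resum alpha q v) U0 (N t) alpha (c t) t Hc U0t Nt); [| |exact HB'|exact HB|].
      + apply (Hh f Hf t Ut Nt).
      + apply (Hh _ resum_holomorphic t Ut Nt).
      + apply tdisc_real; [exact Hc|exact Hx|]. apply (Rmult_lt_compat_l _ _ _ Hc) in Hxc. rewrite Rinv_r in Hxc by lra. exact Hxc. }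
  replace (f t h) with ((f t h - resum alpha q v t h) + resum alpha q v t h)%C by ring. rewrite E. ring.
Qed.
End Resummation.

Theorem proposition2p14 :
  forall (alpha : R) (V : C -> Prop) (q : nat -> C -> C),
    stokes_sector alpha V ->
    distinguished_branch V q ->
    let U := t_projection V in
    stably_borel_summable_locally_uniformly q alpha U /\
    (exists (UU : C * C -> Prop) (q_alpha : C -> C -> C) (S : C -> C -> Prop),
        domain UU /\
        (forall t hbar, UU (t, hbar) -> U t) /\
        (forall t hbar, UU (t, hbar) ->
           is_borel_sum q alpha t hbar (q_alpha t hbar)) /\
        holomorphic2_on UU q_alpha /\
        (forall t0, U t0 ->
           sectorial_neighbourhood (Arc_pi alpha) (S t0) /\
           exists U0 : C -> Prop,
             open U0 /\ U0 t0 /\ (forall t, U0 t -> U t) /\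
             (forall t hbar, U0 t -> S t0 hbar -> UU (t, hbar))) /\
        locally_uniformly_asymptotic q U UU S q_alpha /\
        (forall f : C -> C -> C,
           holomorphic2_on UU f ->
           locally_uniformly_asymptotic q U UU S f ->
           forall t hbar, UU (t, hbar) -> f t hbar = q_alpha t hbar)) /\
    ~ (exists (U' : C -> Prop) (q' : nat -> C -> C),
         domain U' /\
         (forall t, U t -> U' t) /\ (exists t, U' t /\ ~ U t) /\
         formal_solution U' q' /\
         (forall n t, U t -> q' n t = q n t) /\
         stably_borel_summable_locally_uniformly q' alpha U').
Proof.
  intros alpha V q HV Hq U.
  destruct (stokes_sector_cone alpha V HV) as [th [H5 Hcone]].
  destruct HV as [Vne _].
  destruct (branch_exists alpha th V q Vne H5 Hcone Hq) as [v Hv]. fold U in Hv.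
  split; [exact (stable_summability alpha U q v Hv)|].
  split; [|exact (borel_maximality alpha th V q H5 Vne Hcone (proj2 Hq))].
  (* Membership in U stands below the existential, so that choice gives N and c as functions on all
     of C, with a default pair off U. *)
  assert (Hloc : forall t0, exists Nc : (C -> Prop) * R, U t0 -> resum_good alpha U q v t0 (fst Nc) (snd Nc)).
  { intros t0. destruct (classic (U t0)) as [U0|U0].
    - destruct (resum_local alpha U q v t0 Hv U0) as [N [c H]]. exists (N, c). intros _. exact H.
    - exists (U, 0). intros; contradiction. }
  set (Nc := fun t0 => proj1_sig (constructive_indefinite_description _ (Hloc t0))).
  assert (good : forall t0, U t0 -> resum_good alpha U q v t0 (fst (Nc t0)) (snd (Nc t0))).
  { intros t0. exact (proj2_sig (constructive_indefinite_description _ (Hloc t0))). }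
  set (N := fun t => fst (Nc t)). set (c := fun t => snd (Nc t)).
  change (forall t, U t -> resum_good alpha U q v t (N t) (c t)) in good.
  destruct Hv as [HU [Uconv [Une _]]].
  exists (resum_domain alpha U N c), (resum alpha q v), (fun t => tdisc alpha (c t)).
  split; [exact (resum_domain_domain alpha U q v N c HU Uconv Une good)|].
  split; [exact (resum_domain_sub alpha U q v N c good)|].
  assert (Hnb : forall t0, U t0 -> open (T := C_UniformSpace) (N t0) /\ N t0 t0 /\ (forall t, N t0 t -> U t) /\
    (forall t h, N t0 t -> tdisc alpha (c t0) h -> resum_domain alpha U N c (t, h))).
  { intros t0 U0. destruct (good t0 U0) as [ON [N0 [NU _]]]. split; [apply copen_open, ON|].
    split; [exact N0|]. split; [exact NU|]. intros t h Nt Dh. exists t0. auto. }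
  split; [|split; [|split; [|split]]].
  - intros t h [t0 [U0 [Nt Dh]]]. destruct (good t0 U0) as [_ [_ [_ [_ [H _]]]]]. apply (H t h Nt Dh).
  - exact (resum_holomorphic alpha U q v N c good).
  - intros t0 U0. split.
    + apply tdisc_sectorial. destruct (good t0 U0) as [_ [_ [_ [Hc _]]]]. exact Hc.
    + exists (N t0). exact (Hnb t0 U0).
  - intros t0 U0. exists (N t0). destruct (Hnb t0 U0) as [H1 [H2 [H3 H4]]]. repeat split; try assumption.
    destruct (good t0 U0) as [_ [_ [_ [_ [_ HB]]]]]. exact HB.
  - exact (resum_unique alpha U q v N c good).
Qed.
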